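(* Let $(\mathcal M^{(m)},\mathcal E^{(m)})_{m\in\mathbb N}$ be a sequence of MAC grids of $\Omega$ and $\delta t^{(m)}=T/N^{(m)}$ a sequence of time steps such that $\delta t^{(m)}\to0$ and $\delta_{\mathcal M^{(m)}}\to0$ as $m\to+\infty$. Assume that there exists $\eta>0$ such that $\eta_{\mathcal M^{(m)}}\le\eta$ for all $m\in\mathbb N$. Let $(h^{(m)},u^{(m)})_{m\in\mathbb N}$ be an associated sequence of solutions of the scheme described in the context, and assume that there are constants $C,C'>0$ such that, for all $m\in\mathbb N$ and $0\le n\le N^{(m)}$, $$\frac1C<(h^{(m)})^n_K\le C,\quad \frac1{C'}<\frac1{(h^{(m)})_K^n}\le C'\quad\forall K\in\mathcal M^{(m)},\qquad |(u^{(m)})^n_{i,\sigma}|\le C\quad\forall\sigma\in(\mathcal E^{(m)})^{(i)},\ i=1,2.$$ Assume that $(h^{(m)},u^{(m)})$ converges to $(\bar h,\bar u)$ in $L^1(\Omega\times(0,T))\times L^1(\Omega\times(0,T))^2$ as $m\to+\infty$. (i) Then $(\bar h,\bar u)$ satisfies the weak formulation of the shallow water equations: for all $\varphi\in C_c^\infty(\Omega\times[0,T))$, $$\int_0^T\!\!\int_\Omega\bigl[\bar h\,\partial_t\varphi+\bar h\,\bar u\cdot\nabla\varphi\bigr]\,dx\,dt+\int_\Omega h_0(x)\varphi(x,0)\,dx=0,$$ and for all $\boldsymbol\varphi\in C_c^\infty(\Omega\times[0,T))^2$, $$-\int_0^T\!\!\int_\Omega\Bigl[\bar h\,\bar u\cdot\partial_t\boldsymbol\varphi+(\bar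 h\,\bar u\otimes\bar u):\nabla\boldsymbol\varphi+\tfrac12g\,\bar h^2\,\mathrm{div}\,\boldsymbol\varphi-g\,\bar h\,\nabla z\cdot\boldsymbol\varphi\Bigr]dx\,dt-\int_\Omega h_0(x)\,u_0(x)\cdot\boldsymbol\varphi(x,0)\,dx=0.$$ (ii) If furthermore $\delta t^{(m)}/\delta_{\mathcal M^{(m)}}\to0$ as $m\to+\infty$ and there exists a constant $C''$ such that for all $m\in\mathbb N$ $$\sum_{n=0}^{N^{(m)}-1}\ \sum_{K\in\mathcal M^{(m)}}|K|\,\bigl|(h^{(m)})_K^{n+1}-(h^{(m)})_K^n\bigr|\le C'',$$ then $(\bar h,\bar u)$ satisfies the entropy inequality: for all $\varphi\in C_c^\infty(\Omega\times[0,T),\mathbb R_+)$, $$-\int_0^T\!\!\int_\Omega\bigl[\bar\eta\,\partial_t\varphi+\bar\Phi\cdot\nabla\varphi\bigr]\,dx\,dt-\int_\Omega\eta_0(x)\,\varphi(x,0)\,dx\le0,$$ where $\bar\eta=\frac12\bar h|\bar u|^2+\frac12g\bar h^2+g\bar hz$, $\bar\Phi=(\bar\eta+\frac12g\bar h^2)\bar u$ and $\eta_0=\frac12h_0|u_0|^2+\frac12gh_0^2+gh_0z$.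
   Context: $\Omega\subset\mathbb R^2$ is a bounded connected open set which is a union of rectangles with edges orthogonal to the canonical basis vectors $e^{(1)},e^{(2)}$; $T>0$; $g>0$ is the gravity constant; the topography $z$ is a given smooth function on $\overline\Omega$, independent of time; $h_0\in L^2(\Omega)$ and $u_0\in L^1(\Omega)^2$ are the initial height and velocity. $|\cdot|$ is the one- or two-dimensional measure. MAC grid $(\mathcal M,\mathcal E)$: $\mathcal M$ is a conforming structured (possibly non uniform) partition of $\Omega$ into rectangles $K$ (mass center $x_K$) with axis-parallel edges; $\mathcal E$ is the set of edges, $\mathcal E(K)$ the set of edges of $K$; $\mathcal E^{(i)}$ is the set of edges orthogonal to $e^{(i)}$ and $\mathcal E^{(i)}_{\rm int}$ the subset of internal ones, i.e. those of the form $\sigma=K|L=\partial K\cap\partial L$; the others lie on $\partial\Omega$. For $\sigma=K|L$ the dual cell is $D_\sigma=D_{K,\sigma}\cup D_{L,\sigma}$, where $D_{K,\sigma}$ is the half of $K$ adjacent to $\sigma$; for a boundary edge of $K$, $D_\sigma=D_{K,\sigma}$. $\widetilde{\mathcal E}^{(i)}(D_\sigma)$ is the set of edges of the rectangle $D_\sigma$, $\sigma\in\mathcal E^{(i)}$. Mesh size and regularity: $$\delta_{\mathcal M}=\max_{K\in\mathcal M}\mathrm{diam}(K),\qquad\eta_{\mathcal M}=\max\Bigl\{\frac{|\sigma|}{|\sigma'|}:\sigma\in\mathcal E^{(i)},\ \sigma'\in\mathcal E^{(j)},\ i,j\in\{1,2\},\ i\ne j\Bigr\}.$$ Time steps: $t_n=n\,\delta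 t$, $\delta t=T/N$. Scalar unknowns are one value per cell ($h_K$, $p_K$); the topography is represented by $z_K=\frac1{|K|}\int_Kz\,dx$. The $i$-th velocity component is given by one value $u_{i,\sigma}$ per $\sigma\in\mathcal E^{(i)}$, equal to $0$ on boundary edges. The associated functions are, for $t\in[t_n,t_{n+1})$, $0\le n\le N-1$: $h(x,t)=h_K^{n+1}$ for $x\in K$ and $u_i(x,t)=u_{i,\sigma}^{n+1}$ for $x\in D_\sigma$, $\sigma\in\mathcal E^{(i)}$. Primal mass flux: $F_{K,\sigma}=|\sigma|h_\sigma u_{K,\sigma}$, $u_{K,\sigma}=u_{i,\sigma}\,n_{K,\sigma}\cdot e^{(i)}$ for $\sigma\in\mathcal E^{(i)}$ ($n_{K,\sigma}$ unit normal outward $K$), with $h_\sigma=h_K$ if $u_{K,\sigma}\ge0$ and $h_\sigma=h_L$ otherwise for $\sigma=K|L$; $F_{K,\sigma}=0$ on boundary edges. Dual heights: $|D_\sigma|h_{D_\sigma}=|D_{K,\sigma}|h_K+|D_{L,\sigma}|h_L$ for $\sigma=K|L$. Centered heights: $h_{\sigma,c}=\frac12(h_K+h_L)$ for $\sigma=K|L$. Discrete gradient: for $\sigma=K|L\in\mathcal E^{(i)}_{\rm int}$ with $(x_L-x_K)\cdot e^{(i)}>0$, $(\eth_i q)_\sigma=\frac{|\sigma|}{|D_\sigma|}(q_L-q_K)$. Dual mass fluxes $F_{\sigma,\epsilon}$ (outward $D_\sigma$), for $\sigma=K|L\in\mathcal E^{(i)}_{\rm int}$: if $\epsilon$ is orthogonal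 to $e^{(i)}$ and contained in the cell $K$, with $\sigma,\sigma'$ the two edges of $K$ in $\mathcal E^{(i)}$, then $F_{\sigma,\epsilon}=\frac12(F_{K,\sigma'}-F_{K,\sigma})$ (and similarly in $L$). If $\epsilon$ is parallel to $e^{(i)}$, it is the union of halves of an edge $\tau$ of $K$ and an edge $\tau'$ of $L$, and $F_{\sigma,\epsilon}=\frac12(F_{K,\tau}+F_{L,\tau'})$. In particular dual edges contained in $\partial\Omega$ have zero flux. The value $u_{i,\epsilon}$ is the upwind one: $u_{i,\sigma}$ if $F_{\sigma,\epsilon}\ge0$, and otherwise $u_{i,\sigma'}$, where $D_{\sigma'}$, $\sigma'\in\mathcal E^{(i)}$, is the dual cell on the other side of $\epsilon$ (for $\epsilon$ parallel to $e^{(i)}$, $\sigma'$ is the edge collinear with $\sigma$ and sharing with it the endpoint that lies on $\epsilon$). The scheme. Initialisation: $h_K^0=\frac1{|K|}\int_Kh_0\,dx$, $p_K^0=\frac12g(h_K^0)^2$, $u^0_{i,\sigma}=\frac1{|D_\sigma|}\int_{D_\sigma}u_{0,i}\,dx$ for $\sigma\in\mathcal E^{(i)}_{\rm int}$ and $u^0_{i,\sigma}=0$ on boundary edges. For $0\le n\le N-1$, find $h^{n+1},p^{n+1}$ and $u^{n+1}$ (zero on boundary edges) such that $$\frac{1}{\delta t}(h_K^{n+1}-h_K^n)+\frac1{|K|}\sum_{\sigma\in\mathcal E(K)}F^n_{K,\sigma}=0,\qquad p_K^{n+1}=\tfrac12 g\,(h_K^{n+1})^2\qquad\forall K\in\mathcal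 M,$$ $$\frac1{\delta t}\bigl(h^{n+1}_{D_\sigma}u^{n+1}_{i,\sigma}-h^n_{D_\sigma}u^n_{i,\sigma}\bigr)+\frac1{|D_\sigma|}\sum_{\epsilon\in\widetilde{\mathcal E}^{(i)}(D_\sigma)}F^n_{\sigma,\epsilon}u^n_{i,\epsilon}+(\eth_i p^{n+1})_\sigma+g\,h^{n+1}_{\sigma,c}(\eth_i z)_\sigma=0\quad\forall\sigma\in\mathcal E^{(i)}_{\rm int},\ i=1,2 .$$ Superscripts $n$ denote time levels, and superscripts $(m)$ refer to the $m$-th mesh and time step. *)

(* Defs.v *)
From HB Require Import structures.
From mathcomp Require Import all_boot all_order all_algebra finmap.
From mathcomp Require Import all_classical all_reals all_analysis.

Set Implicit Arguments.
Unset Strict Implicit.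
Unset Printing Implicit Defensive.

Import Order.TTheory GRing.Theory Num.Theory.
Import numFieldNormedType.Exports.

Local Open Scope classical_set_scope.
Local Open Scope ring_scope.

(* The canonical directions e^(1), e^(2) are indexed by 'I_2; the direction
   other than i is rev_ord i. These two definitions are used both for points
   of the plane and for pairs of integer indices. *)
Definition evec {A : pzRingType} (i : 'I_2) : A * A :=
  if i == ord0 then (1, 0) else (0, 1).

Definition coord {A : Type} (i : 'I_2) (x : A * A) : A :=
  if i == ord0 then x.1 else x.2.

(* Sets and functions are typed over R * R and (R * R) * R below, and read on
   the domains of mu2 and mu3 by conversion. *)
Definition mu2 (R : realType) :
  {measure set (measurableTypeR R * measurableTypeR R) -> \bar R} :=
  (@lebesgue_measure R \x @lebesgue_measure R)%E.

Definition mu3 (R : realType) :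
  {measure set ((measurableTypeR R * measurableTypeR R) * measurableTypeR R) ->
    \bar R} :=
  (mu2 R \x @lebesgue_measure R)%E.

Definition square_integrable {R : realType} (Omega : set (R * R))
    (f : R * R -> R) : Prop :=
  measurable_fun (Omega : set (measurableTypeR R * measurableTypeR R)) f /\
  (mu2 R).-integrable Omega (fun x => (f x ^+ 2)%:E).

Definition area {R : realType} (A : set (R * R)) : R := fine (mu2 R A).

Definition mean {R : realType} (A : set (R * R)) (f : R * R -> R) : R :=
  (area A)^-1 * \int[mu2 R]_(x in A) f x.

Definition obox {R : realType} (a b : R * R) : set (R * R) :=
  [set x | forall i, coord i a < coord i x < coord i b].

Definition cbox {R : realType} (a b : R * R) : set (R * R) :=
  [set x | forall i, coord i a <= coord i x <= coord i b].

Definition union_of_rectangles {R : realType} (Omega : set (R * R)) : Prop :=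
  exists s : seq ((R * R) * (R * R)),
    Omega = \bigcup_(r in [set` s]) obox r.1 r.2.

Definition cylinder {R : realType} (Omega : set (R * R)) (T : R) :
  set ((R * R) * R) := Omega `*` `]0, T[.

Fixpoint Ck {R : realType} {V : normedModType R} (k : nat) (f : V -> R) : Prop :=
  continuous f /\
  match k with
  | 0%N => True
  | k'.+1 => forall v : V, (forall x, derivable f x v) /\ Ck k' ('D_v f)
  end.

Definition smooth {R : realType} {V : normedModType R} (f : V -> R) : Prop :=
  forall k, Ck k f.

Definition smooth_on_closure {R : realType} (Omega : set (R * R))
    (f : R * R -> R) : Prop :=
  exists2 f' : R * R -> R, smooth f' & forall x, closure Omega x -> f x = f' x.

(* C_c^oo(Omega x [0,T)): restrictions to t >= 0 of smooth functions, the
   support (relative to t >= 0) being a compact subset of Omega x [0,T); they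
   need not vanish at t = 0. *)
Definition test_function {R : realType} (Omega : set (R * R)) (T : R)
    (phi : (R * R) * R -> R) : Prop :=
  smooth phi /\
  exists K : set ((R * R) * R),
    [/\ compact K, K `<=` Omega `*` `[0, T[ &
        forall x t, 0 <= t -> ~ K (x, t) -> phi (x, t) = 0].

Definition dt_ {R : realType} (phi : (R * R) * R -> R) : (R * R) * R -> R :=
  'D_(((0, 0), 1) : (R * R) * R) phi.

Definition dx_ {R : realType} (i : 'I_2) (phi : (R * R) * R -> R) :
  (R * R) * R -> R := 'D_((evec i, 0) : (R * R) * R) phi.

(* A rectilinear grid: in direction i the grid lines are x_i = gline G i a,
   a : int, and cells G lists the cells of the mesh, the cell k = (k_1, k_2)
   lying between the lines k_i and k_i + 1 in each direction i. Only the lines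
   bounding some cell matter.

   For each i, edges orthogonal to e^(i) are indexed by pairs of integers too:
   edge k is the face of cell k lying on the line x_i = gline G i k_i. It
   separates the cells k - e^(i) and k. Hence the face of the cell k on its
   lower (b = false) or upper (b = true) side is the edge k or k + e^(i). *)
Record grid (R : realType) := Grid {
  gline : 'I_2 -> int -> R;
  cells : {fset int * int} }.

Definition low {R : realType} (G : grid R) (i : 'I_2) (k : int * int) : R :=
  gline G i (coord i k).
Definition upp {R : realType} (G : grid R) (i : 'I_2) (k : int * int) : R :=
  gline G i (coord i k + 1).
Definition mid {R : realType} (G : grid R) (i : 'I_2) (k : int * int) : R :=
  (low G i k + upp G i k) / 2.

(* Cells and dual cells are open: they are only used up to null sets. *)
Definition cell {R : realType} (G : grid R) (k : int * int) : set (R * R) :=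
  obox (low G ord0 k, low G ord_max k) (upp G ord0 k, upp G ord_max k).

Definition closed_cell {R : realType} (G : grid R) (k : int * int) :
  set (R * R) :=
  cbox (low G ord0 k, low G ord_max k) (upp G ord0 k, upp G ord_max k).

Definition mac_grid {R : realType} (Omega : set (R * R)) (G : grid R) : Prop :=
  [/\ forall i, {homo gline G i : a b / a < b},
      forall k, k \in cells G -> cell G k `<=` Omega
    & closure Omega = \bigcup_(k in [set` cells G]) closed_cell G k].

Definition edges {R : realType} (G : grid R) (i : 'I_2) : {fset int * int} :=
  (cells G `|` [fset (k + evec i)%R | k in cells G])%fset.

Definition int_edges {R : realType} (G : grid R) (i : 'I_2) :
  {fset int * int} :=
  [fset k in cells G | (k - evec i)%R \in cells G]%fset.

Definition face (i : 'I_2) (b : bool) (k : int * int) : int * int :=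
  if b then k + evec i else k.

Definition neighbor (i : 'I_2) (b : bool) (k : int * int) : int * int :=
  if b then k + evec i else k - evec i.

Definition normal_sign {R : realType} (b : bool) : R := if b then 1 else -1.

Definition edge_length {R : realType} (G : grid R) (i : 'I_2) (s : int * int) :
  R := upp G (rev_ord i) s - low G (rev_ord i) s.

Definition diam {R : realType} (G : grid R) (k : int * int) : R :=
  Num.sqrt (\sum_(i < 2) (upp G i k - low G i k) ^+ 2).

Definition mesh_size {R : realType} (G : grid R) : R :=
  \big[Num.max/0]_(k <- cells G) diam G k.

Definition mesh_regularity {R : realType} (G : grid R) : R :=
  \big[Num.max/0]_(i < 2) \big[Num.max/0]_(j < 2 | j != i)
    \big[Num.max/0]_(s <- edges G i) \big[Num.max/0]_(s' <- edges G j)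
      (edge_length G i s / edge_length G j s').

(* The half of the cell k adjacent to its face (i, b). *)
Definition half_cell {R : realType} (G : grid R) (i : 'I_2) (b : bool)
    (k : int * int) : set (R * R) :=
  [set x | cell G k x /\
           (if b then mid G i k < coord i x else coord i x < mid G i k)].

Definition dual_cell {R : realType} (G : grid R) (i : 'I_2) (s : int * int) :
  set (R * R) :=
  [set x | (s \in cells G /\ half_cell G i false s x) \/
           (s - evec i \in cells G /\ half_cell G i true (s - evec i) x)].

(* F_{K,sigma} for K = k and sigma the face (i, b) of K. *)
Definition primal_flux {R : realType} (G : grid R) (h : int * int -> R)
    (u : 'I_2 -> int * int -> R) (k : int * int) (i : 'I_2) (b : bool) : R :=
  let s := face i b k in
  let uK := u i s * normal_sign b in
  if s \in int_edges G i then
    edge_length G i s * (if 0 <= uK then h k else h (neighbor i b k)) * uK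
  else 0.

(* The cell containing the half of the dual cell of s (s in int_edges G i)
   lying on the lower (b = false) or upper (b = true) side of s. *)
Definition adj (i : 'I_2) (b : bool) (s : int * int) : int * int :=
  if b then s else s - evec i.

(* F_{sigma,epsilon} for sigma = s in int_edges G i, where epsilon is the edge
   of D_sigma orthogonal to e^(j) on the lower (b = false) or upper (b = true)
   side. *)
Definition dual_flux {R : realType} (G : grid R) (h : int * int -> R)
    (u : 'I_2 -> int * int -> R) (i : 'I_2) (s : int * int) (j : 'I_2)
    (b : bool) : R :=
  if j == i then
    2^-1 * (primal_flux G h u (adj i b s) i b
            - primal_flux G h u (adj i b s) i (~~ b))
  else
    2^-1 * (primal_flux G h u (adj i false s) j b
            + primal_flux G h u (adj i true s) j b).

Definition upwind_velocity {R : realType} (G : grid R) (h : int * int -> R)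
    (u : 'I_2 -> int * int -> R) (i : 'I_2) (s : int * int) (j : 'I_2)
    (b : bool) : R :=
  if 0 <= dual_flux G h u i s j b then u i s else u i (neighbor j b s).

Definition dual_height {R : realType} (G : grid R) (h : int * int -> R)
    (i : 'I_2) (s : int * int) : R :=
  (area (half_cell G i true (adj i false s)) * h (adj i false s)
   + area (half_cell G i false (adj i true s)) * h (adj i true s))
  / area (dual_cell G i s).

Definition centered_height {R : realType} (h : int * int -> R) (i : 'I_2)
    (s : int * int) : R :=
  2^-1 * (h (adj i false s) + h (adj i true s)).

Definition dgrad {R : realType} (G : grid R) (q : int * int -> R) (i : 'I_2)
    (s : int * int) : R :=
  edge_length G i s / area (dual_cell G i s)
  * (q (adj i true s) - q (adj i false s)).

(* h, p : time level -> cell -> value;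
   u : time level -> direction -> edge -> value;
   the values outside the mesh are irrelevant. *)
Record scheme_solution {R : realType} (g : R) (z h0 : R * R -> R)
    (u0 : 'I_2 -> R * R -> R) (T : R) (G : grid R) (N : nat)
    (h p : nat -> int * int -> R) (u : nat -> 'I_2 -> int * int -> R) : Prop :=
  SchemeSolution {
  init_height : forall k, k \in cells G -> h 0%N k = mean (cell G k) h0;
  init_pressure : forall k, k \in cells G -> p 0%N k = 2^-1 * g * h 0%N k ^+ 2;
  init_velocity : forall i s, s \in int_edges G i ->
    u 0%N i s = mean (dual_cell G i s) (u0 i);
  boundary_velocity : forall n i s, (n <= N)%N ->
    s \in edges G i -> s \notin int_edges G i -> u n i s = 0;
  mass_balance : forall n k, (n < N)%N -> k \in cells G ->
    (T / N%:R)^-1 * (h n.+1 k - h n k)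
    + (area (cell G k))^-1
      * \sum_(i < 2) \sum_(b : bool) primal_flux G (h n) (u n) k i b = 0;
  pressure_law : forall n k, (n < N)%N -> k \in cells G ->
    p n.+1 k = 2^-1 * g * h n.+1 k ^+ 2;
  momentum_balance : forall n i s, (n < N)%N -> s \in int_edges G i ->
    (T / N%:R)^-1 * (dual_height G (h n.+1) i s * u n.+1 i s
                     - dual_height G (h n) i s * u n i s)
    + (area (dual_cell G i s))^-1
      * (\sum_(j < 2) \sum_(b : bool)
          dual_flux G (h n) (u n) i s j b
          * upwind_velocity G (h n) (u n) i s j b)
    + dgrad G (p n.+1) i s
    + g * centered_height (h n.+1) i s
      * dgrad G (fun k => mean (cell G k) z) i s = 0 }.

Definition time_slab {R : realType} (T : R) (N n : nat) : set R :=
  `[n%:R * (T / N%:R), n.+1%:R * (T / N%:R)[.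

Definition height_function {R : realType} (T : R) (G : grid R) (N : nat)
    (h : nat -> int * int -> R) (y : (R * R) * R) : R :=
  \sum_(n < N) \sum_(k <- cells G)
    h n.+1 k * \1_(cell G k) y.1 * \1_(time_slab T N n) y.2.

Definition velocity_function {R : realType} (T : R) (G : grid R) (N : nat)
    (u : nat -> 'I_2 -> int * int -> R) (i : 'I_2) (y : (R * R) * R) : R :=
  \sum_(n < N) \sum_(s <- edges G i)
    u n.+1 i s * \1_(dual_cell G i s) y.1 * \1_(time_slab T N n) y.2.

Definition cvg_L1 {R : realType} (D : set ((R * R) * R))
    (f_ : nat -> (R * R) * R -> R) (f : (R * R) * R -> R) : Prop :=
  (mu3 R).-integrable D (EFin \o f) /\
  (\int[mu3 R]_(y in D) (`|f_ m y - f y|)%:E)%E @[m --> \oo] --> 0%E.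

Definition weak_mass {R : realType} (Omega : set (R * R)) (T : R)
    (h0 : R * R -> R) (h : (R * R) * R -> R) (u : 'I_2 -> (R * R) * R -> R) :
  Prop :=
  forall phi, test_function Omega T phi ->
    \int[mu3 R]_(y in cylinder Omega T)
      (h y * dt_ phi y + \sum_(i < 2) h y * u i y * dx_ i phi y)
    + \int[mu2 R]_(x in Omega) (h0 x * phi (x, 0)) = 0.

Definition weak_momentum {R : realType} (Omega : set (R * R)) (T g : R)
    (z h0 : R * R -> R) (u0 : 'I_2 -> R * R -> R)
    (h : (R * R) * R -> R) (u : 'I_2 -> (R * R) * R -> R) : Prop :=
  forall phi : 'I_2 -> (R * R) * R -> R,
    (forall i, test_function Omega T (phi i)) ->
    - (\int[mu3 R]_(y in cylinder Omega T)
        (\sum_(i < 2) h y * u i y * dt_ (phi i) y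
         + \sum_(i < 2) \sum_(j < 2) h y * u i y * u j y * dx_ j (phi i) y
         + 2^-1 * g * h y ^+ 2 * (\sum_(i < 2) dx_ i (phi i) y)
         - g * h y * (\sum_(i < 2) 'D_(evec i) z y.1 * phi i y)))
    - \int[mu2 R]_(x in Omega)
        (h0 x * \sum_(i < 2) u0 i x * phi i (x, 0)) = 0.

Definition entropy {R : realType} (g z h : R) (u : 'I_2 -> R) : R :=
  2^-1 * h * (\sum_(i < 2) u i ^+ 2) + 2^-1 * g * h ^+ 2 + g * h * z.

Definition entropy_flux {R : realType} (g z h : R) (u : 'I_2 -> R) (i : 'I_2) :
  R := (entropy g z h u + 2^-1 * g * h ^+ 2) * u i.

Definition entropy_inequality {R : realType} (Omega : set (R * R)) (T g : R)
    (z h0 : R * R -> R) (u0 : 'I_2 -> R * R -> R)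
    (h : (R * R) * R -> R) (u : 'I_2 -> (R * R) * R -> R) : Prop :=
  forall phi, test_function Omega T phi ->
    (forall x t, Omega x -> 0 <= t < T -> 0 <= phi (x, t)) ->
    - (\int[mu3 R]_(y in cylinder Omega T)
        (entropy g (z y.1) (h y) (u ^~ y) * dt_ phi y
         + \sum_(i < 2)
             entropy_flux g (z y.1) (h y) (u ^~ y) i * dx_ i phi y))
    - \int[mu2 R]_(x in Omega)
        (entropy g (z x) (h0 x) (u0 ^~ x) * phi (x, 0)) <= 0.

(* Main.v *)
(* This is the Lax-Wendroff argument. Cut every cell into four quarters and
   multiply by the time steps: the unknowns, their upwind values and the difference
   quotients of the test function are bounded arrays of numbers indexed by the
   resulting boxes. Strong L^1 convergence of such arrays is stable under sums,
   products and selection between arrays with a common limit. It is also stable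
   under passing to a neighbouring box, by density of the continuous functions and
   because neighbouring boxes of regular meshes have comparable measures.

   Testing the scheme with samples of the test function and summing by parts in
   time and space gives an identity between integrals of such arrays, which passes
   to the limit term by term: this proves (i).

   For (ii), multiply the momentum balance by u^{n+1}: the upwind choice and the
   condition dt = o(mesh size) give a kinetic energy inequality. Multiply the mass
   balance by g (h^n + z): the upwind choice gives a potential energy inequality up
   to (h^{n+1} - h^n)^2. Since |h^{n+1} - h^n| = O(dt / mesh size), the space-time
   sum of this residual is at most O(dt / mesh size) times the BV bound. The two
   pressure works differ by a discrete divergence and a shift of one time level,
   which costs O(dt / mesh size) as well. *)
Require Import Defs.
From HB Require Import structures.
From mathcomp Require Import all_boot all_order all_algebra finmap.
From mathcomp Require Import all_classical all_reals all_analysis.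
From mathcomp Require Import measurable_realfun ring lra.
Import Order.TTheory GRing.Theory Num.Theory.
Import numFieldNormedType.Exports.
Set Implicit Arguments.
Unset Strict Implicit.
Unset Printing Implicit Defensive.
Local Open Scope classical_set_scope.
Local Open Scope ring_scope.
(* vector.v also defines coord *)
Local Notation coord := Defs.coord.

(** * Integrals and density in L^1 *)

(** The limits [hbar] and [ubar] are merely integrable, while the equations contain products of up
    to four of them. Every argument is therefore run with their truncations at the uniform bound
    [C]: these are limits of the same arrays, and agree almost everywhere with [hbar] and [ubar], so
    they are removed only at the end. For [u0] this works only where the test function is nonzero,
    because the scheme puts 0 rather than an average on boundary edges. Nothing is extended across
    the boundary. A reflection fixes the quarters without neighbour; upwind arrays and quotients get
    convergent default values there, always multiplied by a vanishing velocity or test value.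
    Momentum is tested at edge midpoints, because the midpoint of a boundary edge lies outside the
    open set [Omega]. In the entropy estimate the kinetic energy is tested with phi^{n+1} and the
    potential energy with phi^n. Each pressure work then lives on a single time level and the two
    can be compared at equal level; the shift telescopes, since phi vanishes at T, and leaves one
    term at level 0. *)

Section real_integrals.
Context d {T : measurableType d} {R : realType}.
Variable mu : {measure set T -> \bar R}.
Variables (D : set T) (mD : measurable D).
Implicit Types f g : T -> R.
Local Notation itg f := (mu.-integrable D (EFin \o f)).

Lemma itgD f g : itg f -> itg g -> itg (fun x => f x + g x).
Proof. by move=> hf hg; exact: (integrableD mD hf hg). Qed.

Lemma itgN f : itg f -> itg (fun x => - f x).
Proof. by move=> hf; exact: (integrableN hf). Qed.

Lemma itgB f g : itg f -> itg g -> itg (fun x => f x - g x).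
Proof. by move=> hf hg; apply: itgD => //; exact: itgN. Qed.

Lemma itgZ a f : itg f -> itg (fun x => a * f x).
Proof. by move=> hf; exact: (integrableZl mD a hf). Qed.

Lemma itg_sum (J : Type) (s : seq J) (F : J -> T -> R) :
  (forall j, itg (F j)) -> itg (fun x => \sum_(j <- s) F j x).
Proof.
move=> hF; elim: s => [|j s ih].
  rewrite [X in itg X](_ : _ = cst 0); first exact: integrable0.
  by apply/funext => x; rewrite big_nil.
rewrite [X in itg X](_ : _ = fun x => F j x + \sum_(i <- s) F i x).
  exact: itgD.
by apply/funext => x; rewrite big_cons.
Qed.

Lemma itg_abs f : itg f -> itg (fun x => `|f x|).
Proof. exact: integrable_norm. Qed.

Lemma itg_meas f : itg f -> measurable_fun D f.
Proof. by move=> /measurable_int/measurable_EFinP. Qed.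

Lemma itg_bnd M f : (mu D < +oo)%E -> measurable_fun D f ->
  (forall x, D x -> `|f x| <= M) -> itg f.
Proof.
move=> muD mf fM; apply: measurable_bounded_integrable => //.
by exists M; split; [exact: num_real|move=> K MK x Dx /=; rewrite (le_trans (fM _ Dx))// ltW].
Qed.

Lemma itg_dom f g : measurable_fun D f -> itg g ->
  (forall x, D x -> `|f x| <= g x) -> itg f.
Proof.
move=> mf ig fg; apply: (le_integrable mD _ _ ig); first exact/measurable_EFinP.
move=> x Dx /=; rewrite lee_fin (le_trans (fg _ Dx))//; exact: ler_norm.
Qed.

Lemma itg_mulbnd M f g : itg f -> measurable_fun D g ->
  (forall x, D x -> `|g x| <= M) -> itg (fun x => f x * g x).
Proof.
move=> hf mg gM.
apply: (@itg_dom _ (fun x => M * `|f x|)).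
- by apply: measurable_funM => //; exact: itg_meas.
- by apply: itgZ; exact: itg_abs.
- by move=> x Dx; rewrite normrM mulrC ler_wpM2r// gM.
Qed.

Lemma rint_sum (J : Type) (s : seq J) (F : J -> T -> R) :
  (forall j, itg (F j)) ->
  \int[mu]_(x in D) (\sum_(j <- s) F j x) = \sum_(j <- s) \int[mu]_(x in D) F j x.
Proof.
move=> hF; elim: s => [|j s ih].
  rewrite big_nil; under eq_Rintegral do rewrite big_nil.
  by rewrite Rintegral_cst// mul0r.
rewrite big_cons; under eq_Rintegral do rewrite big_cons.
by rewrite RintegralD// ?ih//; exact: itg_sum.
Qed.

Lemma rint_cst (c : R) : \int[mu]_(x in D) c = c * fine (mu D).
Proof. exact: Rintegral_cst. Qed.

Lemma rint_triangle f g k : itg f -> itg g -> itg k ->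
  \int[mu]_(x in D) `|f x - k x| <=
  \int[mu]_(x in D) `|f x - g x| + \int[mu]_(x in D) `|g x - k x|.
Proof.
move=> hf hg hk.
have h1 : itg (fun x => `|f x - g x|) by apply: itg_abs; exact: itgB.
have h2 : itg (fun x => `|g x - k x|) by apply: itg_abs; exact: itgB.
rewrite -RintegralD//; apply: le_Rintegral => //.
- by apply: itg_abs; exact: itgB.
- exact: itgD.
- by move=> x _; exact: ler_distD.
Qed.

End real_integrals.

Section L1_closure.
Context d {T : measurableType d} {R : realType}.
Variable mu : {measure set T -> \bar R}.
Variables (D : set T) (mD : measurable D) (muD : (mu D < +oo)%E).
Implicit Types (C : (T -> R) -> Prop) (f g : T -> R).
Local Notation itg f := (mu.-integrable D (EFin \o f)).

Definition approximable C f := forall e : R, 0 < e ->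
  exists2 g, C g & itg g /\ \int[mu]_(x in D) `|f x - g x| < e.

Definition dense_in_L1 C := forall f, itg f -> approximable C f.

Lemma approximable_lim C f : itg f ->
  (forall e : R, 0 < e -> exists2 g, approximable C g &
     itg g /\ \int[mu]_(x in D) `|f x - g x| < e) -> approximable C f.
Proof.
move=> hf h e e0; have e20 : 0 < e / 2 by rewrite divr_gt0.
have [g Cg [hg fg]] := h _ e20; have [k Ck [hk gk]] := Cg _ e20.
exists k => //; split=> //.
by rewrite (le_lt_trans (rint_triangle mD hf hg hk))// (splitr e) ltrD.
Qed.

Lemma approximable_lin C a f1 f2 :
  (forall b g1 g2, C g1 -> C g2 -> C (fun x => b * g1 x + g2 x)) ->
  itg f1 -> itg f2 -> approximable C f1 -> approximable C f2 ->
  approximable C (fun x => a * f1 x + f2 x).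
Proof.
move=> Clin i1 i2 h1 h2 e e0.
(* Adding 1 keeps the denominator positive when [a] is 0. The same device recurs below with measures
   and bounds. *)
have e1 : 0 < e / 2 / (`|a| + 1) by rewrite !divr_gt0// ltr_wpDl.
have e2 : 0 < e / 2 by rewrite divr_gt0.
have [g1 C1 [ig1 fg1]] := h1 _ e1; have [g2 C2 [ig2 fg2]] := h2 _ e2.
exists (fun x => a * g1 x + g2 x); first exact: Clin.
split; first by apply: itgD => //; exact: itgZ.
have j1 : itg (fun x => `|f1 x - g1 x|) by apply: itg_abs; exact: itgB.
have j2 : itg (fun x => `|f2 x - g2 x|) by apply: itg_abs; exact: itgB.
apply: (@le_lt_trans _ _ (\int[mu]_(x in D)
   (`|a| * `|f1 x - g1 x| + `|f2 x - g2 x|))).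
  apply: le_Rintegral => //.
  - by apply: itg_abs; apply: itgB => //; apply: itgD => //; exact: itgZ.
  - by apply: itgD => //; exact: itgZ.
  - move=> x _; rewrite -normrM; apply: le_trans (ler_normD _ _).
    by rewrite le_eqVlt; apply/orP; left; apply/eqP; congr `|_|; ring.
rewrite RintegralD//; last exact: itgZ.
rewrite RintegralZl// [ltRHS]splitr ltrD//.
rewrite ltr_pdivlMr in fg1; last by rewrite ltr_wpDl.
apply: le_lt_trans fg1; rewrite mulrC ler_wpM2l//.
  by apply: Rintegral_ge0.
by rewrite lerDl.
Qed.

Lemma approximable_sum C (J : Type) (s : seq J) (a : J -> R) (F : J -> T -> R) :
  (forall b g1 g2, C g1 -> C g2 -> C (fun x => b * g1 x + g2 x)) ->
  C (cst 0) ->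
  (forall j, itg (F j)) -> (forall j, approximable C (F j)) ->
  approximable C (fun x => \sum_(j <- s) a j * F j x).
Proof.
move=> Clin C0 iF aF; elim: s => [|j s ih].
  move=> e e0; exists (cst 0) => //; split; first exact: integrable0.
  rewrite (_ : Rintegral _ _ _ = 0)//.
  under eq_Rintegral do rewrite big_nil subr0 normr0.
  by rewrite Rintegral_cst// mul0r.
rewrite [X in approximable _ X](_ : _ =
    fun x => a j * F j x + \sum_(i <- s) a i * F i x).
  apply: approximable_lin => //; apply: itg_sum => // i; exact: itgZ.
by apply/funext => x; rewrite big_cons.
Qed.

Lemma itg_indic A : measurable A -> itg (\1_A).
Proof.
move=> mA; apply: (itg_bnd mD (M := 1)) => //.
by move=> x _; rewrite indicE ger0_norm// lern1; case: (x \in A).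
Qed.

Import HBSimple.

(** The sets with approximable indicator form a Dynkin system: complements come from linearity and
    constants, disjoint unions from dominated convergence. Since the generator is stable under
    intersection, they are all the measurable sets; simple functions then give every integrable
    function. *)
Lemma dense_in_L1_generator C (G : set (set T)) :
  (forall b g1 g2, C g1 -> C g2 -> C (fun x => b * g1 x + g2 x)) ->
  (forall c, C (cst c)) ->
  @measurable _ T = <<s G >> -> setI_closed G ->
  (forall A, G A -> approximable C (\1_A)) -> dense_in_L1 C.
Proof.
move=> Clin Ccst GE GI GC.
have C1 A : measurable A -> approximable C (\1_A).
  move=> mA; have : <<s G >> A by rewrite -GE.
  have mG S : G S -> measurable S by move=> GS; rewrite GE; exact: sub_gen_smallest.
  have aT : approximable C (\1_(@setT T)).
    move=> e e0; exists (cst 1) => //; split.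
      by apply: (itg_bnd mD (M := 1)) => // x _ /=; rewrite normr1.
    under eq_Rintegral do rewrite indicT subrr normr0.
    by rewrite Rintegral_cst// mul0r.
  move: A {mA}; apply: (dynkin_induction GE GI) => //.
  - move=> S mS PS; rewrite [X in approximable _ X](_ : _ =
        fun x => -1 * \1_S x + \1_(@setT T) x); last first.
      apply/funext => x; rewrite !indicE in_setC in_setT.
      by case: (x \in S) => /=; rewrite ?mulr1 ?mulr0 ?addNr ?add0r.
    by apply: approximable_lin => //; exact: itg_indic.
  - move=> F mF tF aF.
    have mUF : measurable (\bigcup_k F k) by exact: bigcupT_measurable.
    apply: approximable_lim; first exact: itg_indic.
    move=> e e0.
    pose g n x : R := \sum_(i < n) 1 * \1_(F i) x.
    have gE n x : g n x = \1_(\big[setU/set0]_(i < n) F i) x.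
      rewrite /g; under eq_bigr do rewrite mul1r.
      elim: n => [|n ih]; first by rewrite !big_ord0 indic0.
      rewrite !big_ord_recr /= ih !indicE in_setU.
      have [xF|xF] := boolP (x \in F n); last by rewrite orbF addr0.
      rewrite orbT.
      case: (boolP (x \in \big[setU/set0]_(i < n) F i)) => [|_]; last by rewrite add0r.
      rewrite inE -bigcup_mkord => -[i /= ltin Fix].
      have := tF i n I I; move/(_ _)/eqP => h.
      have : (i = n) by apply/eqP; rewrite h//; exists x; split => //; exact/set_mem.
      by move=> ein; rewrite ein ltnn in ltin.
    have mU n : measurable (\big[setU/set0]_(i < n) F i).
      exact: bigsetU_measurable.
    have ig n : itg (g n).
      by rewrite (_ : g n = \1_(\big[setU/set0]_(i < n) F i));
        [exact: itg_indic|apply/funext => x; rewrite gE].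
    have h : (fun n => (\int[mu]_(x in D) `|(\1_(\bigcup_k F k) x - g n x)%:E|)%E)
       @ \oo --> 0%E.
      have := @dominated_convergence _ _ _ mu D mD (fun n => EFin \o g n)
        (EFin \o \1_(\bigcup_k F k)) (cst 1%E).
      case.
      - by move=> n; apply: measurable_int (ig n).
      - by apply: measurable_int (itg_indic mUF).
      - apply: aeW => x _.
        have [xF|xF] := boolP (x \in \bigcup_k F k).
          move: (xF); rewrite inE => -[k _ Fkx].
          apply: cvg_near_cst; exists k.+1 => // n /= kn.
          have xU : x \in \big[setU/set0]_(i < n) F i.
            by apply/mem_set; rewrite -bigcup_mkord; exists k.
          by rewrite gE !indicE xF xU.
        apply: cvg_near_cst; exists 0%N => // n _ /=.
        have xU : x \notin \big[setU/set0]_(i < n) F i.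
          apply: contra xF; rewrite !inE -bigcup_mkord => -[i _ Fi].
          by exists i.
        by rewrite gE !indicE (negbTE xF) (negbTE xU).
      - by apply: (itg_bnd mD (f := cst 1) (M := 1)) => // x _ /=; rewrite normr1.
      - apply: aeW => x n _ /=; rewrite gE lee_fin indicE ger0_norm// lern1.
        by case: (_ \in _).
      move=> _ + _; apply: cvg_trans; apply: near_eq_cvg; near=> n.
      by apply: eq_integral => x _ /=; rewrite distrC.
    have [N _ /(_ N (leqnn N)) /= hN] := (cvgrPdist_lt _ _).1 (fine_cvg h) e e0.
    exists (g N).
      rewrite /g; apply: approximable_sum => //.
      by move=> j; exact: itg_indic.
    split=> //; move: hN; rewrite sub0r normrN; apply: le_lt_trans.
    by rewrite -/(Rintegral mu D (fun x => `|\1_(\bigcup_k F k) x - g N x|)) ler_norm.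
move=> f hf; apply: approximable_lim => // e e0.
have [p_ [pi _ pf]] := approximation_sfun_integrable mD hf.
have [N _ /(_ N (leqnn N)) /= hN] := (cvgrPdist_lt _ _).1 (fine_cvg pf) e e0.
exists (p_ N); last first.
  split=> //; move: hN; rewrite sub0r normrN; apply: le_lt_trans.
  exact: ler_norm.
rewrite [X in approximable _ X](_ : _ =
   fun x => \sum_(y <- fset_set (range (p_ N))) y * \1_(p_ N @^-1` [set y]) x).
  apply: approximable_sum => //.
    by move=> y; exact: itg_indic.
  by move=> y; exact: C1.
apply/funext => x; rewrite fimfunE fsbig_finite//=.
Unshelve. all: by end_near.
Qed.

End L1_closure.

(** * Integrals and density on product spaces *)

Section product_integrals.
Context d1 d2 {T1 : measurableType d1} {T2 : measurableType d2} {R : realType}.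
Variable m1 : {sigma_finite_measure set T1 -> \bar R}.
Variable m2 : {sigma_finite_measure set T2 -> \bar R}.
Variables (D1 : set T1) (D2 : set T2).
Hypotheses (mD1 : measurable D1) (mD2 : measurable D2).

(** Both factors are extended by 0, so that Tonelli applies on the whole space and each factor comes
    out of the iterated integral. *)
Lemma ge0_integral_prod (f1 : T1 -> R) (f2 : T2 -> R) :
  measurable_fun D1 f1 -> measurable_fun D2 f2 ->
  (forall x, D1 x -> 0 <= f1 x) -> (forall x, D2 x -> 0 <= f2 x) ->
  (\int[m1 \x m2]_(x in D1 `*` D2) (f1 x.1 * f2 x.2)%:E =
   \int[m1]_(x in D1) (f1 x)%:E * \int[m2]_(x in D2) (f2 x)%:E)%E.
Proof.
move=> mf1 mf2 f10 f20.
have r10 x : 0 <= (f1 \_ D1) x.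
  by rewrite patchE; case: ifPn => // /set_mem /f10.
have r20 x : 0 <= (f2 \_ D2) x.
  by rewrite patchE; case: ifPn => // /set_mem /f20.
have mr1 : measurable_fun setT (f1 \_ D1).
  exact: (measurable_restrictT _ mD1).1.
have mr2 : measurable_fun setT (f2 \_ D2).
  exact: (measurable_restrictT _ mD2).1.
pose F (x : T1 * T2) : \bar R := ((f1 \_ D1) x.1 * (f2 \_ D2) x.2)%:E.
transitivity (\int[m1 \x m2]_x F x)%E.
  rewrite integral_mkcond; apply: eq_integral => -[x y] _ /=.
  rewrite /F /= !patchE in_setX /=.
  by case: (x \in D1); case: (y \in D2) => //=; rewrite ?mul0r ?mulr0.
rewrite fubini_tonelli1; last 2 first.
- apply/measurable_EFinP; apply: measurable_funM.
    exact: (measurableT_comp mr1 measurable_fst).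
  exact: (measurableT_comp mr2 measurable_snd).
- by move=> -[x y]; rewrite /F lee_fin mulr_ge0.
rewrite [X in (X * _)%E]integral_mkcond [X in (_ * X)%E]integral_mkcond.
rewrite !restrict_EFin /fubini_F /=.
rewrite -ge0_integralZr//; last 3 first.
- exact/measurable_EFinP.
- by move=> x _; rewrite lee_fin.
- by apply: integral_ge0 => x _; rewrite lee_fin.
apply: eq_integral => x _; rewrite -ge0_integralZl//; last 3 first.
- exact/measurable_EFinP.
- by move=> y _; rewrite lee_fin.
- by rewrite lee_fin.
Qed.

Lemma rint_prod (f1 : T1 -> R) (f2 : T2 -> R) :
  m1.-integrable D1 (EFin \o f1) -> m2.-integrable D2 (EFin \o f2) ->
  (forall x, D1 x -> 0 <= f1 x) -> (forall x, D2 x -> 0 <= f2 x) ->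
  \int[(m1 \x m2)%E]_(x in D1 `*` D2) (f1 x.1 * f2 x.2) =
  \int[m1]_(x in D1) f1 x * \int[m2]_(x in D2) f2 x.
Proof.
move=> i1 i2 f10 f20; rewrite /Rintegral ge0_integral_prod//.
- by rewrite fineM//; apply: integrable_fin_num.
- exact: itg_meas i1.
- exact: itg_meas i2.
Qed.

Hypotheses (fin1 : (m1 D1 < +oo)%E) (fin2 : (m2 D2 < +oo)%E).

Lemma prod_fin : ((m1 \x m2)%E (D1 `*` D2) < +oo)%E.
Proof.
by rewrite product_measure1E// lte_mul_pinfty// ge0_fin_numE.
Qed.

(** Measurable rectangles generate the product sigma-algebra and are stable under intersection, so
    only products of two indicators have to be approximated, by [g1] times [g2]. The error splits as
    [\1_B (\1_A - g1) + g1 (\1_B - g2)]. *)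
Lemma dense_in_L1_prod (C1 : (T1 -> R) -> Prop) (C2 : (T2 -> R) -> Prop)
    (C : (T1 * T2 -> R) -> Prop) :
  dense_in_L1 m1 D1 C1 -> dense_in_L1 m2 D2 C2 ->
  (forall g, C1 g -> measurable_fun D1 g /\ exists M : R, forall x, D1 x -> `|g x| <= M) ->
  (forall g, C2 g -> measurable_fun D2 g /\ exists M : R, forall x, D2 x -> `|g x| <= M) ->
  (forall b g1 g2, C g1 -> C g2 -> C (fun x => b * g1 x + g2 x)) ->
  (forall c, C (cst c)) ->
  (forall g1 g2, C1 g1 -> C2 g2 -> C (fun x => g1 x.1 * g2 x.2)) ->
  dense_in_L1 (m1 \x m2)%E (D1 `*` D2) C.
Proof.
move=> h1 h2 b1 b2 Clin Ccst C12.
have mD : measurable (D1 `*` D2) by exact: measurableX.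
apply: (dense_in_L1_generator mD prod_fin Clin Ccst
  (measurable_prod_measurableType T1 T2)).
  move=> _ _ [A1 mA1 [B1 mB1 <-]] [A2 mA2 [B2 mB2 <-]].
  exists (A1 `&` A2); first exact: measurableI.
  exists (B1 `&` B2); first exact: measurableI.
  by rewrite -setXI.
move=> _ [A mA [B mB <-]] e e0.
have iA := itg_indic mD1 fin1 mA; have iB := itg_indic mD2 fin2 mB.
pose e1 := e / 2 / (fine (m2 D2) + 1).
have e10 : 0 < e1 by rewrite !divr_gt0// ltr_wpDl// fine_ge0.
have [g1 Cg1 [ig1 hg1]] := h1 _ iA _ e10.
have [mg1 [M hM]] := b1 _ Cg1.
(* The first factor is chosen before the second, whose tolerance involves the bound [M] of [g1]. *)
pose e2 := e / 2 / ((`|M| + 1) * (fine (m1 D1) + 1)).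
have e20 : 0 < e2.
  by rewrite !divr_gt0// mulr_gt0// ltr_wpDl// fine_ge0.
have [g2 Cg2 [ig2 hg2]] := h2 _ iB _ e20.
have [mg2 [M2 hM2]] := b2 _ Cg2.
have ms1 : measurable_fun (D1 `*` D2) (g1 \o fst).
  apply: (@measurable_comp _ _ _ _ _ _ D1) => //; last exact: measurable_funTS.
  by move=> _ [x [Dx _]] <-.
have ms2 : measurable_fun (D1 `*` D2) (g2 \o snd).
  apply: (@measurable_comp _ _ _ _ _ _ D2) => //; last exact: measurable_funTS.
  by move=> _ [x [_ Dx]] <-.
have iG : (m1 \x m2)%E.-integrable (D1 `*` D2) (EFin \o (fun x => g1 x.1 * g2 x.2)).
  apply: (itg_bnd mD (M := `|M| * `|M2|)); first exact: prod_fin.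
    exact: measurable_funM.
  move=> x [D1x D2x]; rewrite normrM ler_pM//.
    by rewrite (le_trans (hM _ D1x))// ler_norm.
  by rewrite (le_trans (hM2 _ D2x))// ler_norm.
have i1 : m1.-integrable D1 (EFin \o (fun x => `|\1_A x - g1 x|)).
  by apply: itg_abs; exact: itgB.
have i2 : m2.-integrable D2 (EFin \o (fun x => `|\1_B x - g2 x|)).
  by apply: itg_abs; exact: itgB.
have c1 : m1.-integrable D1 (EFin \o (cst (`|M| + 1))).
  by apply: (itg_bnd mD1 (M := `| (`|M| + 1) |)).
have c2 : m2.-integrable D2 (EFin \o (cst 1)).
  by apply: (itg_bnd mD2 (M := `|1|)).
have P1 : (m1 \x m2)%E.-integrable (D1 `*` D2)
    (EFin \o (fun x => `|\1_A x.1 - g1 x.1| * (cst 1) x.2)).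
  apply: (itg_bnd mD (M := 1 + `|M|)); first exact: prod_fin.
    apply: measurable_funM => //; apply: measurableT_comp => //.
    apply: measurable_funB => //; apply: measurableT_comp => //.
    exact: measurable_funTS.
  move=> x [D1x D2x]; rewrite mulr1 normr_id (le_trans (ler_normB _ _))// lerD//.
    by rewrite indicE ger0_norm// lern1; case: (_ \in _).
  by rewrite (le_trans (hM _ D1x))// ler_norm.
have P2 : (m1 \x m2)%E.-integrable (D1 `*` D2)
    (EFin \o (fun x => (cst (`|M| + 1)) x.1 * `|\1_B x.2 - g2 x.2|)).
  apply: (itg_bnd mD (M := (`|M| + 1) * (1 + `|M2|))); first exact: prod_fin.
    apply: measurable_funM => //; apply: measurableT_comp => //.
    apply: measurable_funB => //; apply: measurableT_comp => //.
    exact: measurable_funTS.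
  move=> x [D1x D2x]; rewrite normrM normr_id ger0_norm ?addr_ge0//.
  rewrite ler_wpM2l ?addr_ge0// (le_trans (ler_normB _ _))// lerD//.
    by rewrite indicE ger0_norm// lern1; case: (_ \in _).
  by rewrite (le_trans (hM2 _ D2x))// ler_norm.
have iAB : (m1 \x m2)%E.-integrable (D1 `*` D2) (EFin \o \1_(A `*` B)).
  by apply: itg_indic => //; [exact: prod_fin|exact: measurableX].
exists (fun x => g1 x.1 * g2 x.2); first exact: C12.
split => //.
apply: (@le_lt_trans _ _ (\int[(m1 \x m2)%E]_(x in D1 `*` D2)
   (`|\1_A x.1 - g1 x.1| * (cst 1) x.2 + (cst (`|M| + 1)) x.1 * `|\1_B x.2 - g2 x.2|))).
  apply: le_Rintegral => //.
  - by apply: itg_abs; exact: itgB.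
  - exact: itgD.
  - move=> -[x y] [/= D1x D2x]; rewrite mulr1.
    rewrite (_ : \1_(A `*` B) (x, y) - g1 x * g2 y =
      \1_B y * (\1_A x - g1 x) + g1 x * (\1_B y - g2 y)); last first.
      rewrite (_ : \1_(A `*` B) (x, y) = \1_A x * \1_B y :> R); first by ring.
      by rewrite !indicE in_setX /=; case: (x \in A); case: (y \in B);
        rewrite ?mulr1 ?mulr0.
    rewrite (le_trans (ler_normD _ _))// !normrM lerD//.
      rewrite -[leRHS]mul1r ler_wpM2r// indicE ger0_norm// lern1.
      by case: (_ \in _).
    by rewrite ler_wpM2r// (le_trans (hM _ D1x))// (le_trans (ler_norm _))// lerDl.
rewrite RintegralD// (rint_prod i1 c2)// (rint_prod c1 i2)//; last first.
  by move=> x _ /=; rewrite addr_ge0.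
rewrite !rint_cst// mul1r [ltRHS]splitr.
have hh1 : \int[m1]_(x in D1) `|\1_A x - g1 x| * fine (m2 D2) < e / 2.
  rewrite ltr_pdivlMr in hg1; last by rewrite ltr_wpDl// fine_ge0.
  apply: le_lt_trans hg1; rewrite ler_wpM2l ?lerDl//.
  exact: Rintegral_ge0.
rewrite ltrD//.
rewrite ltr_pdivlMr in hg2; last by rewrite mulr_gt0// ltr_wpDl// fine_ge0.
apply: le_lt_trans hg2; rewrite mulrC ler_wpM2l//.
  exact: Rintegral_ge0.
by rewrite ler_wpM2l ?addr_ge0// lerDl.
Qed.

End product_integrals.

Section product_sigma_finite.
Context d1 d2 (T1 : measurableType d1) (T2 : measurableType d2) (R : realType).
Variable m1 : {sigma_finite_measure set T1 -> \bar R}.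
Variable m2 : {sigma_finite_measure set T2 -> \bar R}.

Lemma product_sigma_finite : sigma_finite setT (m1 \x m2)%E.
Proof.
have /sigma_finiteP[F [TF ndF Foo]] := sigma_finiteT m1.
have /sigma_finiteP[G [TG ndG Goo]] := sigma_finiteT m2.
exists (fun n => F n `*` G n); last first.
  move=> k; have [mF fF] := Foo k; have [mG fG] := Goo k.
  split; first exact: measurableX.
  by rewrite product_measure1E// lte_mul_pinfty// ge0_fin_numE.
apply/seteqP; split=> // -[x y] _.
have [n _ Fx] : (\bigcup_i F i) x by rewrite -TF.
have [k _ Gy] : (\bigcup_i G i) y by rewrite -TG.
exists (maxn n k) => //; split => /=.
  by move: x Fx; exact/subsetPset/ndF/leq_maxl.
by move: y Gy; exact/subsetPset/ndG/leq_maxr.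
Qed.

(* Canonical inference on a product measure finds the instance for products of
   subprobabilities instead. *)
Definition product_sfm : {sigma_finite_measure set (T1 * T2)%type -> \bar R} :=
  HB.pack_for {sigma_finite_measure set (T1 * T2)%type -> \bar R}
    (product_measure1 m1 m2)
    (Measure_isSigmaFinite.Build _ _ _ (product_measure1 m1 m2)
       product_sigma_finite).

End product_sigma_finite.

Lemma ler_sum_in {R : numDomainType} (J : eqType) (s : seq J) (F G : J -> R) :
  (forall i, i \in s -> F i <= G i) -> \sum_(i <- s) F i <= \sum_(i <- s) G i.
Proof. by move=> FG; rewrite big_seq [leRHS]big_seq; exact: ler_sum. Qed.

(** For 0 <= M, the projection of the line onto [-M, M]. *)
Definition clip {R : realType} (M x : R) : R := Num.max (- M) (Num.min x M).

Lemma clip_bnd {R : realType} (M x : R) : 0 <= M -> `|clip M x| <= M.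
Proof.
by move=> M0; rewrite /clip ler_norml le_max lexx /= ge_max ge_min lexx orbT andbT; lra.
Qed.

Lemma clip_id {R : realType} (M x : R) : `|x| <= M -> clip M x = x.
Proof.
rewrite ler_norml => /andP[h1 h2]; rewrite /clip.
by rewrite (min_idPl h2) (max_idPr h1).
Qed.

(** [clip M x] is the point of [-M, M] nearest to [x], and [a] lies in that interval. *)
Lemma clip_lip {R : realType} (M a x : R) : `|a| <= M -> `|x - clip M x| <= `|a - x|.
Proof.
move=> ha; have [h|h] := leP `|x| M; first by rewrite clip_id// subrr normr0.
move: ha; rewrite ler_norml /clip => /andP[h1 h2].
have [h'|h'] := leP x M; have [h''|h''] := leP (- M) _.
- by rewrite subrr normr0.
- rewrite ltr0_norm; last by lra.
  by have := ler_norm (a - x); lra.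
- rewrite gtr0_norm; last by lra.
  by have := ler_norm (x - a); rewrite distrC; lra.
- by lra.
Qed.

Lemma clip_contract (R : realType) (M x y : R) : `|clip M x - clip M y| <= `|x - y|.
Proof.
have h1 := ler_norm (x - y); have h2 := ler_norm (- (x - y)); rewrite normrN in h2.
rewrite /clip /Num.max /Num.min /Order.max /Order.min.
case: (boolP (x < M)); case: (boolP (y < M)); rewrite -?leNgt => ? ?;
repeat match goal with |- context [if ?b then _ else _] => case: (boolP b); rewrite -?leNgt => ? end;
  rewrite ler_norml; apply/andP; split; lra.
Qed.

(** * Strong convergence of piecewise constant arrays *)

Section partition_calculus.
Context d {X : measurableType d} {R : realType}.
Variable mu : {measure set X -> \bar R}.
Variables (D : set X) (I : eqType) (idx : nat -> seq I) (Q : nat -> I -> set X).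

Record partitions : Prop := Partitions {
  part_mD : measurable D;
  part_fin : (mu D < +oo)%E;
  part_uniq : forall m, uniq (idx m);
  part_meas : forall m i, measurable (Q m i);
  part_sub : forall m i, i \in idx m -> Q m i `<=` D;
  part_triv : forall m, trivIset [set` idx m] (Q m);
  part_cover : forall m, mu (D `\` \big[setU/set0]_(i <- idx m) Q m i) = 0%E }.

Definition wt m i : R := fine (mu (Q m i)).

(** L^1 convergence of the piecewise constant functions with values [a m i] on the boxes, written
    box by box so that these functions never have to be formed. *)
Definition cva (a : nat -> I -> R) (f : X -> R) :=
  \sum_(i <- idx m) \int[mu]_(x in Q m i) `|a m i - f x| @[m --> \oo] --> (0 : R).

Definition bda (a : nat -> I -> R) :=
  exists M : R, forall m i, i \in idx m -> `|a m i| <= M.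

Definition bdf (f : X -> R) :=
  measurable_fun D f /\ exists M : R, forall x, D x -> `|f x| <= M.

Definition cvb a f := [/\ bda a, bdf f & cva a f].

Hypothesis hP : partitions.
Let mD := part_mD hP.
Let mQ := part_meas hP.
Local Notation itg f := (mu.-integrable D (EFin \o f)).

Lemma wt_ge0 m i : 0 <= wt m i. Proof. by rewrite fine_ge0. Qed.

Lemma bdf_itg f : bdf f -> itg f.
Proof. by move=> [mf [M fM]]; apply: (itg_bnd mD (part_fin hP) mf fM). Qed.

Lemma itgQ m i f : i \in idx m -> itg f -> mu.-integrable (Q m i) (EFin \o f).
Proof. by move=> im; apply: integrableS => //; exact: (part_sub hP). Qed.

Lemma finQ m i : i \in idx m -> (mu (Q m i) < +oo)%E.
Proof.
move=> im; apply: le_lt_trans (part_fin hP).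
by apply: le_measure; rewrite ?inE//; exact: (part_sub hP).
Qed.

Lemma itgQ_cst m i (c : R) : i \in idx m ->
  mu.-integrable (Q m i) (EFin \o cst c).
Proof. by move=> im; apply: (itg_bnd (mQ m i) (finQ im) (M := `|c|)). Qed.

Lemma itgQ_dist m i (c : R) f : i \in idx m -> itg f ->
  mu.-integrable (Q m i) (EFin \o (fun x => `|c - f x|)).
Proof.
by move=> im hf; apply: itg_abs; apply: itgB => //; [exact: itgQ_cst|exact: itgQ].
Qed.

Lemma rint_part m f : itg f ->
  \int[mu]_(x in D) f x = \sum_(i <- idx m) \int[mu]_(x in Q m i) f x.
Proof.
move=> hf; set U := \big[setU/set0]_(i <- idx m) Q m i.
have mU : measurable U by exact: bigsetU_measurable.
have UD : U `<=` D.
  rewrite /U big_seq; elim/big_ind : _ => // [A B ? ?|i im]; first by rewrite subUset.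
  exact: (part_sub hP).
transitivity (\int[mu]_(x in U) f x).
  rewrite /Rintegral; congr fine.
  rewrite (@negligible_integral _ _ _ _ _ (D `\` U))//.
  - by rewrite setDD setIidr.
  - exact: measurableD.
  - exact: (part_cover hP).
rewrite /Rintegral /U integral_bigsetU_EFin//; last 3 first.
- exact: (part_uniq hP).
- exact: (part_triv hP).
- have/measurable_int := integrableS mD mU UD hf; exact.
rewrite [X in fine X](_ : _ = \sum_(i <- idx m) (\int[mu]_(x in Q m i) f x)%:E)%E.
  by rewrite sumEFin.
apply: eq_big_seq => i im; rewrite fineK//.
by apply: integrable_fin_num => //; exact: itgQ.
Qed.

Lemma cva_lim a f : itg f -> cva a f ->
  \sum_(i <- idx m) wt m i * a m i @[m --> \oo] --> \int[mu]_(x in D) f x.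
Proof.
move=> hf haf; apply/cvgrPdist_le => e e0.
have [N _ hN] := (cvgrPdist_le _ _).1 haf e e0.
exists N => // m /hN; rewrite sub0r normrN => /(le_trans (ler_norm _)); apply: le_trans.
rewrite (rint_part m hf) -sumrB big_seq [leRHS]big_seq.
apply: le_trans (ler_norm_sum _ _ _) _; apply: ler_sum => i im.
have -> : wt m i * a m i = \int[mu]_(x in Q m i) (cst (a m i)) x.
  by rewrite Rintegral_cst// mulrC.
rewrite -RintegralB//; [|exact: itgQ|exact: itgQ_cst].
under [leRHS]eq_Rintegral do rewrite distrC.
apply: le_normr_Rintegral => //.
by apply: itgB => //; [exact: itgQ|exact: itgQ_cst].
Qed.

Lemma cvb_lim a f : cvb a f ->
  \sum_(i <- idx m) wt m i * a m i @[m --> \oo] --> \int[mu]_(x in D) f x.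
Proof. by move=> [_ /bdf_itg hf]; exact: cva_lim. Qed.

Lemma cva_squeeze a f (b : nat -> R) : (b @ \oo --> (0 : R)) ->
  (\forall m \near \oo, \sum_(i <- idx m) \int[mu]_(x in Q m i) `|a m i - f x| <= b m) ->
  cva a f.
Proof.
move=> b0 h; apply: (@squeeze_cvgr _ _ _ _ (cst 0) b) => //; last exact: cvg_cst.
near=> m; apply/andP; split; last by near: m.
by apply: sumr_ge0 => i _; exact: Rintegral_ge0.
Unshelve. all: by end_near. Qed.

Lemma bdf_cst c : bdf (cst c).
Proof. by split => //; exists `|c|. Qed.

Lemma bdfD f g : bdf f -> bdf g -> bdf (fun x => f x + g x).
Proof.
move=> [mf [M hM]] [mg [N hN]]; split; first exact: measurable_funD.
by exists (M + N) => x Dx; rewrite (le_trans (ler_normD _ _))// lerD ?hM ?hN.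
Qed.

Lemma bdfM f g : bdf f -> bdf g -> bdf (fun x => f x * g x).
Proof.
move=> [mf [M hM]] [mg [N hN]]; split; first exact: measurable_funM.
by exists (M * N) => x Dx; rewrite normrM ler_pM ?hM ?hN.
Qed.

Lemma cva_cst c : cva (fun _ _ => c) (cst c).
Proof.
rewrite /cva [X in X @ _ --> _](_ : _ = cst 0); first exact: cvg_cst.
apply/funext => m; rewrite big1// => i _.
under eq_Rintegral do rewrite subrr normr0.
by rewrite Rintegral_cst// mul0r.
Qed.

Lemma cvb_cst c : cvb (fun _ _ => c) (cst c).
Proof. by split; [by exists `|c| |exact: bdf_cst|exact: cva_cst]. Qed.

Lemma cvbD a b f g : cvb a f -> cvb b g ->
  cvb (fun m i => a m i + b m i) (fun x => f x + g x).
Proof.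
move=> [[Ma ha] bf caf] [[Mb hb] bg cbg]; split.
- by exists (Ma + Mb) => m i im; rewrite (le_trans (ler_normD _ _))// lerD ?ha ?hb.
- exact: bdfD.
have hf := bdf_itg bf; have hg := bdf_itg bg.
apply: (cva_squeeze (b := fun m => \sum_(i <- idx m) \int[mu]_(x in Q m i) `|a m i - f x| +
   \sum_(i <- idx m) \int[mu]_(x in Q m i) `|b m i - g x|)).
  by rewrite -[X in _ --> X]addr0; exact: cvgD.
apply: nearW => m; rewrite -big_split; apply: ler_sum_in => i im /=.
rewrite -RintegralD//; [|exact: itgQ_dist|exact: itgQ_dist].
apply: le_Rintegral => //.
- by apply: itgQ_dist => //; exact: itgD.
- by apply: itgD => //; exact: itgQ_dist.
- move=> x _; apply: le_trans (ler_normD _ _).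
  by rewrite le_eqVlt; apply/orP; left; apply/eqP; congr `|_|; ring.
Qed.

(** Write [a b - f g] as [g (a - f) + a (b - g)]: the limit of one factor and the array of the other
    are bounded. *)
Lemma cvbM a b f g : cvb a f -> cvb b g ->
  cvb (fun m i => a m i * b m i) (fun x => f x * g x).
Proof.
move=> [[Ma ha] bf caf] [[Mb hb] bg cbg]; split.
- by exists (Ma * Mb) => m i im; rewrite normrM ler_pM ?ha ?hb.
- exact: bdfM.
have hf := bdf_itg bf; have hg := bdf_itg bg.
have hfg := bdf_itg (bdfM bf bg).
case: bg => mg [Mg hMg].
apply: (cva_squeeze (b := fun m => `|Mg| * (\sum_(i <- idx m) \int[mu]_(x in Q m i) `|a m i - f x|) +
   `|Ma| * \sum_(i <- idx m) \int[mu]_(x in Q m i) `|b m i - g x|)).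
  rewrite -[X in _ --> X]addr0 -[X in X + _](mulr0 `|Mg|) -[X in _ + X](mulr0 `|Ma|).
  by apply: cvgD; apply: cvgM => //; exact: cvg_cst.
apply: nearW => m; rewrite !big_distrr -big_split.
apply: ler_sum_in => i im /=.
rewrite -!RintegralZl//; [|exact: itgQ_dist|exact: itgQ_dist].
rewrite -RintegralD//; [|by apply: itgZ => //; exact: itgQ_dist|by apply: itgZ => //; exact: itgQ_dist].
apply: le_Rintegral => //.
- exact: itgQ_dist.
- by apply: itgD => //; apply: itgZ => //; exact: itgQ_dist.
- move=> x Qx; have Dx := part_sub hP im Qx.
  have -> : a m i * b m i - f x * g x = g x * (a m i - f x) + a m i * (b m i - g x) by ring.
  apply: le_trans (ler_normD _ _) _; rewrite !normrM lerD// ler_wpM2r//.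
    by rewrite (le_trans (hMg _ Dx))// ler_norm.
  by rewrite (le_trans (ha _ _ im))// ler_norm.
Qed.

Lemma cvbZ c a f : cvb a f -> cvb (fun m i => c * a m i) (fun x => c * f x).
Proof. by move=> h; exact: (cvbM (cvb_cst c) h). Qed.

Lemma cvbN a f : cvb a f -> cvb (fun m i => - a m i) (fun x => - f x).
Proof.
move=> /(cvbZ (-1)); congr cvb; [apply/funext => m; apply/funext => i|apply/funext => x];
  by rewrite mulN1r.
Qed.

Lemma cvbB a b f g : cvb a f -> cvb b g ->
  cvb (fun m i => a m i - b m i) (fun x => f x - g x).
Proof. by move=> h1 h2; apply: cvbD => //; exact: cvbN. Qed.

Lemma cvb_sum (J : Type) (s : seq J) (a : J -> nat -> I -> R) (f : J -> X -> R) :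
  (forall j, cvb (a j) (f j)) ->
  cvb (fun m i => \sum_(j <- s) a j m i) (fun x => \sum_(j <- s) f j x).
Proof.
move=> h; elim: s => [|j s ih].
  have := cvb_cst 0; congr cvb; [apply/funext => m; apply/funext => i|apply/funext => x];
    by rewrite big_nil.
have := cvbD (h j) ih; congr cvb; [apply/funext => m; apply/funext => i|apply/funext => x];
    by rewrite big_cons.
Qed.

Lemma cvb_ext a b f g : cvb a f -> (forall m i, i \in idx m -> a m i = b m i) ->
  (forall x, D x -> f x = g x) -> cvb b g.
Proof.
move=> [[M hM] [mf [N hN]] h] ab fg; split.
- by exists M => m i im; rewrite -ab// hM.
- split; last by exists N => x Dx; rewrite -fg// hN.
  by apply: eq_measurable_fun mf => x /set_mem Dx; rewrite fg.
- move: h; rewrite /cva; apply: cvg_trans; apply: near_eq_cvg; apply: nearW => m.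
  apply: eq_big_seq => i im; apply: eq_Rintegral => x /set_mem Qx.
  by rewrite ab// fg//; exact: (part_sub hP) Qx.
Qed.

Lemma sum_wt m : \sum_(i <- idx m) wt m i = fine (mu D).
Proof.
have := rint_part m (f := cst 1); rewrite Rintegral_cst// mul1r => ->.
  by apply: eq_bigr => i _; rewrite Rintegral_cst// mul1r.
by apply: bdf_itg; exact: bdf_cst.
Qed.

Lemma sum_cstQ m (c : R) : 0 <= c ->
  \sum_(i <- idx m) \int[mu]_(x in Q m i) c = c * fine (mu D).
Proof.
by move=> c0; rewrite -(sum_wt m) big_distrr; apply: eq_bigr => i _; rewrite Rintegral_cst.
Qed.

Lemma cva_near b f : itg f ->
  (forall e : R, 0 < e -> \forall m \near \oo, forall i x, i \in idx m ->
     Q m i x -> `|b m i - f x| <= e) -> cva b f.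
Proof.
move=> hf h; apply/cvgrPdist_le => e e0.
have e1 : 0 < e / (fine (mu D) + 1) by rewrite divr_gt0// ltr_wpDl// fine_ge0.
near=> m; rewrite sub0r normrN ger0_norm; last first.
  by apply: sumr_ge0 => i _; exact: Rintegral_ge0.
have hm : forall i x, i \in idx m -> Q m i x -> `|b m i - f x| <= e / (fine (mu D) + 1).
  by near: m; exact: h.
apply: (@le_trans _ _ (\sum_(i <- idx m) \int[mu]_(x in Q m i) (e / (fine (mu D) + 1)))).
  apply: ler_sum_in => i im; apply: le_Rintegral => //.
  - exact: itgQ_dist.
  - exact: itgQ_cst.
  - by move=> x; exact: hm.
rewrite sum_cstQ; last exact: ltW.
rewrite mulrAC ler_pdivrMr ?ltr_wpDl ?fine_ge0//.
by rewrite ler_wpM2l ?(ltW e0)// lerDl.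
Unshelve. all: by end_near. Qed.

Lemma cvb_near b f : bda b -> bdf f ->
  (forall e : R, 0 < e -> \forall m \near \oo, forall i x, i \in idx m ->
     Q m i x -> `|b m i - f x| <= e) -> cvb b f.
Proof. by move=> hb hf h; split => //; apply: cva_near => //; exact: bdf_itg. Qed.

Lemma cvb_dist a b f : cvb a f -> bda b ->
  \sum_(i <- idx m) wt m i * `|a m i - b m i| @[m --> \oo] --> (0 : R) -> cvb b f.
Proof.
move=> [ba bf caf] bb h; split => //.
have hf := bdf_itg bf.
apply: (cva_squeeze (b := fun m => \sum_(i <- idx m) wt m i * `|a m i - b m i| +
   \sum_(i <- idx m) \int[mu]_(x in Q m i) `|a m i - f x|)).
  by rewrite -[X in _ --> X]addr0; exact: cvgD.
apply: nearW => m; rewrite -big_split; apply: ler_sum_in => i im /=.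
have -> : wt m i * `|a m i - b m i| = \int[mu]_(x in Q m i) (cst `|a m i - b m i|) x.
  by rewrite Rintegral_cst// mulrC.
rewrite -RintegralD//; [|exact: itgQ_cst|exact: itgQ_dist].
apply: le_Rintegral => //; first exact: itgQ_dist.
  by apply: itgD => //; [exact: itgQ_cst|exact: itgQ_dist].
by move=> x _ /=; rewrite (distrC (a m i) (b m i)); exact: ler_distD.
Qed.

(** In each box the error of the selected array is at most the sum of the errors of the two
    candidates. Upwind values pass to the limit in this way, whatever the signs of the fluxes. *)
Lemma cvb_sel a b c f : cvb a f -> cvb b f ->
  (forall m i, i \in idx m -> c m i = a m i \/ c m i = b m i) -> cvb c f.
Proof.
move=> [[Ma ha] bf caf] [[Mb hb] _ cbf] hc; split => //.
  exists (`|Ma| + `|Mb|) => m i im.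
  have := ha _ _ im; have := hb _ _ im; have := ler_norm Ma; have := ler_norm Mb.
  have := normr_ge0 Ma; have := normr_ge0 Mb.
  by case: (hc _ _ im) => ->; lra.
have hf := bdf_itg bf.
apply: (cva_squeeze (b := fun m => \sum_(i <- idx m) \int[mu]_(x in Q m i) `|a m i - f x| +
   \sum_(i <- idx m) \int[mu]_(x in Q m i) `|b m i - f x|)).
  by rewrite -[X in _ --> X]addr0; exact: cvgD.
apply: nearW => m; rewrite -big_split; apply: ler_sum_in => i im /=.
by case: (hc _ _ im) => ->; rewrite ?lerDl ?lerDr; exact: Rintegral_ge0.
Qed.

(** * Stability under passing to neighbouring boxes *)

Section shifts.
Variable C : (X -> R) -> Prop.
Hypothesis dC : dense_in_L1 mu D C.
Variable pt : nat -> I -> X.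
Hypothesis ptQ : forall m i, i \in idx m -> Q m i (pt m i).

(* Reindexings s such that cva a f implies cva of a m (s m i) with the same limit:
   Q m (s m i) is close to Q m i and of comparable measure. *)
Record tame_shift (s : nat -> I -> I) : Prop := TameShift {
  shift_idx : forall m i, i \in idx m -> s m i \in idx m;
  shift_sum : exists2 K : R, 0 <= K & forall m (F : I -> R),
    (forall i, i \in idx m -> 0 <= F i) ->
    \sum_(i <- idx m) F (s m i) <= K * \sum_(i <- idx m) F i;
  shift_wt : exists2 K : R, 0 <= K & forall m i, i \in idx m -> wt m i <= K * wt m (s m i);
  shift_near : forall g, C g -> forall e : R, 0 < e -> \forall m \near \oo,
    forall i x y, i \in idx m -> Q m i x -> Q m (s m i) y -> `|g x - g y| <= e }.

(** A comparison with [f] over a box becomes a comparison of two numbers, [c] and the value of [g]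
    at the sample point. Unlike the integral, the latter can be reindexed by a shift. *)
Lemma dist_pt m i (c : R) f g (e : R) : i \in idx m -> itg f -> itg g ->
  (forall x, Q m i x -> `|g (pt m i) - g x| <= e) ->
  wt m i * `|c - g (pt m i)| <= \int[mu]_(x in Q m i) `|c - f x| +
    \int[mu]_(x in Q m i) `|f x - g x| + e * wt m i.
Proof.
move=> im hf hg hge.
have hfg : mu.-integrable (Q m i) (EFin \o (fun x => `|f x - g x|)).
  by apply: itg_abs; apply: itgB => //; exact: itgQ.
have -> : wt m i * `|c - g (pt m i)| = \int[mu]_(x in Q m i) (cst `|c - g (pt m i)|) x.
  by rewrite Rintegral_cst// mulrC.
have -> : e * wt m i = \int[mu]_(x in Q m i) (cst e) x by rewrite Rintegral_cst.
have i1 := itgQ_dist c im hf.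
rewrite -RintegralD// -RintegralD//; [|exact: itgD|exact: itgQ_cst].
apply: le_Rintegral => //; first exact: itgQ_cst.
  by apply: itgD => //; [exact: itgD|exact: itgQ_cst].
move=> x Qx /=; rewrite distrC (le_trans (ler_distD (g x) _ _))// addrC lerD ?hge//.
by rewrite distrC; exact: ler_distD.
Qed.

(** Replace [f] by a close [g] of the dense class. On [Q m i], [g] is nearly its value at the sample
    point of [Q m (s m i)], so the shifted error is, up to small terms, [wt m i] times the unshifted
    error at index [s m i]; [shift_wt] and [shift_sum] bring it back to the original sum. *)
Lemma cva_shift a f s : tame_shift s -> itg f -> cva a f ->
  cva (fun m i => a m (s m i)) f.
Proof.
move=> ts hf caf; apply/cvgrPdist_le => e e0.
have [K1 K10 hK1] := shift_sum ts; have [K2 K20 hK2] := shift_wt ts.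
have [K0 Kn0] : 0 <= K1 * K2 /\ K1 * K2 + 1 != 0.
  by split; [rewrite mulr_ge0|rewrite gt_eqF// ltr_wpDl// mulr_ge0].
set K := K1 * K2 in K0 Kn0.
pose V := fine (mu D) + 1.
have V0 : 0 < V by rewrite ltr_wpDl// fine_ge0.
(* The final bound is at most [(4 K + 2) e2], hence at most [e / 2]. As [V] exceeds the measure of
   [D], an error [e1] per unit of measure costs at most [e2]. *)
pose e1 := e / 8 / (K + 1) / V; pose e2 := e / 8 / (K + 1).
have Kp : 0 < K + 1 by rewrite ltr_wpDl.
have e10 : 0 < e1 by rewrite !divr_gt0.
have e20 : 0 < e2 by rewrite !divr_gt0.
have [g Cg [ig hfg]] := dC hf e20.
near=> m; rewrite sub0r normrN ger0_norm; last first.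
  by apply: sumr_ge0 => i _; exact: Rintegral_ge0.
have hnear : forall i x y, i \in idx m -> Q m i x -> Q m (s m i) y -> `|g x - g y| <= e1.
  by near: m; exact: (shift_near ts Cg).
(* The oscillation of [g] is controlled between a box and its image only, so two points of one box
   are compared through a point of the image. *)
have hnear0 i x : i \in idx m -> Q m i x -> `|g (pt m i) - g x| <= 2 * e1.
  move=> im Qx; have sm := shift_idx ts im.
  have h1 := hnear i x (pt m (s m i)) im Qx (ptQ sm).
  have h2 := hnear i (pt m i) (pt m (s m i)) im (ptQ im) (ptQ sm).
  apply: le_trans (ler_distD (g (pt m (s m i))) _ _) _.
  by rewrite (distrC (g (pt m (s m i)))); lra.
have hcaf : \sum_(i <- idx m) \int[mu]_(x in Q m i) `|a m i - f x| <= e2.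
  apply: le_trans (ler_norm _) _; rewrite -normrN -sub0r; near: m.
  exact: (cvgrPdist_le _ _).1 caf _ e20.
have hQfg : \sum_(i <- idx m) \int[mu]_(x in Q m i) `|f x - g x| <= e2.
  by rewrite -rint_part ?ltW//; apply: itg_abs; exact: itgB.
pose F i := wt m i * `|a m i - g (pt m i)|.
have hF : \sum_(i <- idx m) F i <= e2 + e2 + 2 * e1 * fine (mu D).
  apply: (@le_trans _ _ (\sum_(i <- idx m) (\int[mu]_(x in Q m i) `|a m i - f x| +
    \int[mu]_(x in Q m i) `|f x - g x| + 2 * e1 * wt m i))).
    apply: ler_sum_in => i im; apply: dist_pt => //.
    by move=> x; exact: hnear0.
  by rewrite !big_split -big_distrr /= sum_wt !lerD.
have hFs : \sum_(i <- idx m) wt m i * `|a m (s m i) - g (pt m (s m i))| <=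
    K * \sum_(i <- idx m) F i.
  apply: (@le_trans _ _ (\sum_(i <- idx m) K2 * F (s m i))).
    apply: ler_sum_in => i im.
    by rewrite mulrA ler_wpM2r// hK2.
  rewrite -big_distrr /= /K (mulrC K1) -mulrA ler_wpM2l//.
  by apply: hK1 => i _; rewrite mulr_ge0// wt_ge0.
apply: (@le_trans _ _ (\sum_(i <- idx m) (wt m i * `|a m (s m i) - g (pt m (s m i))| +
    (e1 * wt m i + \int[mu]_(x in Q m i) `|f x - g x|)))).
  apply: ler_sum_in => i im.
  have hfg' : mu.-integrable (Q m i) (EFin \o (fun x => `|f x - g x|)).
    by apply: itg_abs; apply: itgB => //; exact: itgQ.
  have -> : wt m i * `|a m (s m i) - g (pt m (s m i))| =
     \int[mu]_(x in Q m i) (cst `|a m (s m i) - g (pt m (s m i))|) x.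
    by rewrite Rintegral_cst// mulrC.
  have -> : e1 * wt m i = \int[mu]_(x in Q m i) (cst e1) x by rewrite Rintegral_cst.
  have c1 := itgQ_cst e1 im; have c2 := itgQ_cst `|a m (s m i) - g (pt m (s m i))| im.
  rewrite -RintegralD// -RintegralD//; last exact: itgD.
  apply: le_Rintegral => //; first exact: itgQ_dist.
    by apply: itgD => //; exact: itgD.
  move=> x Qx /=; apply: le_trans (ler_distD (g (pt m (s m i))) _ _) _.
  rewrite lerD2l; apply: le_trans (ler_distD (g x) _ _) _.
  rewrite [X in X + _]distrC [X in _ + X]distrC lerD2r.
  by apply: (hnear i) => //; apply: ptQ; exact: (shift_idx ts).
rewrite !big_split /= -big_distrr /= sum_wt.
have hV : e1 * fine (mu D) <= e2.
  rewrite /e1 -mulrA ger_pMr//.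
  by rewrite mulrC ler_pdivrMr// mul1r lerDl.
have hK : K * \sum_(i <- idx m) F i <= K * (4 * e2).
  by rewrite ler_wpM2l//; lra.
have he2 : e2 * (K + 1) = e / 8 by rewrite /e2 divfK.
have : K * (4 * e2) + e2 + e2 <= e by nra.
by lra.
Unshelve. all: by end_near. Qed.

Lemma cvb_shift a f s : tame_shift s -> cvb a f -> cvb (fun m i => a m (s m i)) f.
Proof.
move=> ts [[M ha] bf caf]; split => //.
  by exists M => m i im; apply: ha; exact: (shift_idx ts).
by apply: cva_shift => //; exact: bdf_itg.
Qed.

(** When [a m i] is the mean of [f] over the boxes [Q m (r j m i)], its distance to [g (pt m i)] is
    controlled by the errors of [g] on this group. No [r j] increases sums, so summing over [i]
    costs a factor [#|J|]. Averages over cells and over dual cells are the instances. *)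
Lemma cva_mean (J : finType) f (r : J -> nat -> I -> I) (a : nat -> I -> R) :
  itg f -> (forall j, tame_shift (r j)) ->
  (forall j m (F : I -> R), (forall i, i \in idx m -> 0 <= F i) ->
     \sum_(i <- idx m) F (r j m i) <= \sum_(i <- idx m) F i) ->
  (forall m i, i \in idx m -> 0 < wt m i) ->
  (forall m i, i \in idx m -> wt m i <= \sum_j wt m (r j m i)) ->
  (forall m i, i \in idx m ->
     a m i * (\sum_j wt m (r j m i)) =
     \sum_j \int[mu]_(x in Q m (r j m i)) f x) ->
  cva a f.
Proof.
move=> hf tr rinj w0 wle ha; apply/cvgrPdist_le => e e0.
pose V := fine (mu D) + 1; pose K : R := #|J|%:R.
have V0 : 0 < V by rewrite ltr_wpDl// fine_ge0.
have Kp : 0 < K + 1 by rewrite ltr_wpDl.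
pose e1 := e / 8 / (K + 1) / V; pose e2 := e / 8 / (K + 1).
have e10 : 0 < e1 by rewrite !divr_gt0.
have e20 : 0 < e2 by rewrite !divr_gt0.
have [g Cg [ig hfg]] := dC hf e20.
near=> m; rewrite sub0r normrN ger0_norm; last first.
  by apply: sumr_ge0 => i _; exact: Rintegral_ge0.
have hn : forall j i x y, i \in idx m -> Q m i x -> Q m (r j m i) y -> `|g x - g y| <= e1.
  by near: m; apply: filter_forall => j; exact: (shift_near (tr j) Cg).
have hfgQ i : i \in idx m -> mu.-integrable (Q m i) (EFin \o (fun x => `|f x - g x|)).
  by move=> im; apply: itg_abs; apply: itgB => //; exact: itgQ.
have hQfg : \sum_(i <- idx m) \int[mu]_(x in Q m i) `|f x - g x| <= e2.
  by rewrite -rint_part ?ltW//; apply: itg_abs; exact: itgB.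
have hV : e1 * fine (mu D) <= e2.
  rewrite /e1 -mulrA ger_pMr//.
  by rewrite mulrC ler_pdivrMr// mul1r lerDl.
pose F i := \int[mu]_(x in Q m i) `|f x - g x| + e1 * wt m i.
have F0 i : 0 <= F i.
  rewrite /F addr_ge0//; first by apply: Rintegral_ge0.
  by rewrite mulr_ge0 ?wt_ge0 ?(ltW e10).
have hF : \sum_(i <- idx m) F i <= e2 + e2.
  by rewrite /F big_split -big_distrr /= sum_wt lerD.
have key i : i \in idx m -> wt m i * `|a m i - g (pt m i)| <= \sum_j F (r j m i).
  move=> im; apply: (@le_trans _ _ ((\sum_j wt m (r j m i)) * `|a m i - g (pt m i)|)).
    by rewrite ler_wpM2r// wle.
  have W0 : 0 <= \sum_j wt m (r j m i) by apply: sumr_ge0 => j _; exact: wt_ge0.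
  rewrite -{1}(ger0_norm W0) -normrM mulrBr (mulrC _ (a m i)) ha// mulr_suml -sumrB.
  apply: le_trans (ler_norm_sum _ _ _) _; apply: ler_sum => j _.
  have rim := shift_idx (tr j) im.
  have -> : wt m (r j m i) * g (pt m i) = \int[mu]_(x in Q m (r j m i)) (cst (g (pt m i))) x.
    by rewrite Rintegral_cst// mulrC.
  have -> : F (r j m i) = \int[mu]_(x in Q m (r j m i)) (`|f x - g x| + cst e1 x).
    by rewrite RintegralD ?rint_cst//; [exact: hfgQ|exact: itgQ_cst].
  rewrite -RintegralB//; [|exact: itgQ|exact: itgQ_cst].
  have i1 : mu.-integrable (Q m (r j m i)) (EFin \o (fun x => f x - cst (g (pt m i)) x)).
    by apply: itgB => //; [exact: itgQ|exact: itgQ_cst].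
  apply: le_trans (le_normr_Rintegral _ i1) _ => //.
  apply: le_Rintegral => //; first exact: itg_abs.
    by apply: itgD => //; [exact: hfgQ|exact: itgQ_cst].
  move=> x Qx /=; apply: le_trans (ler_distD (g x) _ _) _; rewrite lerD2l distrC.
  by apply: (hn j i) => //; exact: ptQ.
apply: (@le_trans _ _ (\sum_(i <- idx m) (wt m i * `|a m i - g (pt m i)| +
    (2 * e1 * wt m i + \int[mu]_(x in Q m i) `|f x - g x|)))).
  apply: ler_sum_in => i im.
  have -> : wt m i * `|a m i - g (pt m i)| =
     \int[mu]_(x in Q m i) (cst `|a m i - g (pt m i)|) x.
    by rewrite Rintegral_cst// mulrC.
  have -> : 2 * e1 * wt m i = \int[mu]_(x in Q m i) (cst (2 * e1)) x by rewrite Rintegral_cst.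
  have c1 := itgQ_cst (2 * e1) im; have c2 := itgQ_cst `|a m i - g (pt m i)| im.
  have c3 := hfgQ _ im.
  rewrite -RintegralD// -RintegralD//; last exact: itgD.
  apply: le_Rintegral => //; first exact: itgQ_dist.
    by apply: itgD => //; exact: itgD.
  move=> x Qx /=; apply: le_trans (ler_distD (g (pt m i)) _ _) _.
  rewrite lerD2l; apply: le_trans (ler_distD (g x) _ _) _.
  rewrite [X in _ + X]distrC lerD2r.
  (* [J] is inhabited, since the positive weight of the box is bounded by a sum over [J]. An element
     of [J] then links two points of the same box. *)
  have [j _|J0] := pickP (@predT J); last first.
    by have := wle _ _ im; rewrite big_pred0// leNgt w0.
  have rim := shift_idx (tr j) im.
  have h1 := hn j i (pt m i) (pt m (r j m i)) im (ptQ im) (ptQ rim).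
  have h2 := hn j i x (pt m (r j m i)) im Qx (ptQ rim).
  apply: le_trans (ler_distD (g (pt m (r j m i))) _ _) _.
  by rewrite (distrC (g (pt m (r j m i)))); lra.
rewrite !big_split /= -big_distrr /= sum_wt.
have h1 : \sum_(i <- idx m) wt m i * `|a m i - g (pt m i)| <= K * (e2 + e2).
  apply: le_trans (ler_sum_in key) _; rewrite exchange_big /=.
  apply: (@le_trans _ _ (\sum_(j : J) (e2 + e2))).
    by apply: ler_sum => j _; apply: le_trans hF; apply: rinj.
  by rewrite sumr_const -mulr_natl.
have he2 : e2 * (K + 1) = e / 8 by rewrite /e2 divfK// gt_eqF.
have K0 : 0 <= K by [].
by nra.
Unshelve. all: by end_near. Qed.

End shifts.

End partition_calculus.

(** * Truncation at a uniform bound *)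

Section clipping.
Context d {X : measurableType d} {R : realType}.
Variable mu : {measure set X -> \bar R}.
Variables (D : set X) (I : eqType) (idx : nat -> seq I) (Q : nat -> I -> set X).
Hypothesis hP : partitions mu D idx Q.
Let mD := part_mD hP.
Let mQ := part_meas hP.
Local Notation itg f := (mu.-integrable D (EFin \o f)).

(** Integrate [|f - clip M f| |phi|]. In a box where the array is bounded by [M], clipping moves [f]
    by at most [|a - f|]; in the other boxes [phi] is small. Hence the integral is 0. The second
    kind of boxes is meant for the quarters next to the boundary, where no bound on the averages of
    [u0] is available. *)
Lemma cva_bound_ae M a f phi : 0 <= M -> itg f -> cva mu idx Q a f -> bdf D phi ->
  (forall e : R, 0 < e -> \forall m \near \oo, forall i x, i \in idx m -> Q m i x ->
     `|phi x| <= e \/ `|a m i| <= M) ->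
  {ae mu, forall x, D x -> phi x != 0 -> f x = clip M (f x)}.
Proof.
move=> M0 hf caf [mphi [B hB]] hn.
have mc : measurable_fun D (fun x => clip M (f x)).
  by apply: measurable_maxr => //; apply: measurable_minr => //; exact: itg_meas hf.
have bc : bdf D (fun x => clip M (f x)).
  by split => //; exists M => x _; exact: clip_bnd.
have hg : itg (fun x => `|f x - clip M (f x)|).
  by apply: itg_abs; apply: itgB => //; exact: (bdf_itg hP bc).
pose k x := (f x - clip M (f x)) * phi x.
have hk : itg k.
  by apply: (itg_mulbnd _ _ mphi hB) => //; apply: itgB => //; exact: (bdf_itg hP bc).
have hak : itg (fun x => `|k x|) by exact: itg_abs.
set J := \int[mu]_(x in D) `|f x - clip M (f x)|.
have J0 : 0 <= J by exact: Rintegral_ge0.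
have B0 x : D x -> 0 <= B by move=> Dx; apply: le_trans (hB x Dx).
have h0 : \int[mu]_(x in D) `|k x| = 0.
  apply/eqP; rewrite eq_le Rintegral_ge0// andbT.
  apply/ler_addgt0Pr => e e0; rewrite add0r.
  have e1 : 0 < e / (J + 1) by rewrite divr_gt0// ltr_wpDl.
  have cl : (`|B| * (\sum_(i <- idx m) \int[mu]_(x in Q m i) `|a m i - f x|) + e / (J + 1) * J)
      @[m --> \oo] --> (`|B| * 0 + e / (J + 1) * J).
    by apply: cvgD; [apply: cvgMr|exact: cvg_cst].
  have le1 : `|B| * 0 + e / (J + 1) * J <= e.
    by rewrite mulr0 add0r -mulrA ger_pMr// mulrC ler_pdivrMr ?ltr_wpDl// mul1r lerDl.
  apply: le_trans le1; apply: (ler_cvg_to (cvg_cst _) cl); near=> m.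
  have hm : forall i x, i \in idx m -> Q m i x -> `|phi x| <= e / (J + 1) \/ `|a m i| <= M.
    by near: m; exact: hn.
  set c := e / (J + 1) in hm *.
  rewrite (rint_part hP m hak) /J (rint_part hP m hg) !big_distrr /= -big_split /=.
  apply: ler_sum_in => i im.
  have i1 : mu.-integrable (Q m i) (EFin \o (fun x => `|a m i - f x|)) by exact: (itgQ_dist hP _ im).
  have i2 : mu.-integrable (Q m i) (EFin \o (fun x => `|f x - clip M (f x)|)) by exact: (itgQ hP im).
  have mQi : measurable (Q m i) by exact: mQ.
  rewrite -(RintegralZl _ mQi i1) -(RintegralZl _ mQi i2) -RintegralD//; last 2 first.
  - exact: itgZ.
  - exact: itgZ.
  apply: le_Rintegral => //; [exact: (itgQ hP im)|by apply: itgD => //; exact: itgZ|].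
  move=> x Qx; have Dx := part_sub hP im Qx.
  rewrite /k normrM; have [h|h] := hm i x im Qx.
    rewrite -[leLHS]add0r; apply: lerD; first by rewrite mulr_ge0.
    by rewrite mulrC ler_wpM2r.
  rewrite -[leLHS]addr0; apply: lerD; last by rewrite mulr_ge0// ltW.
  rewrite mulrC ler_pM//; last exact: clip_lip.
  by apply: le_trans (hB x Dx) _; exact: ler_norm.
have : (\int[mu]_(x in D) `|(k x)%:E| = 0)%E.
  have fi : (\int[mu]_(x in D) `|(k x)%:E|)%E \is a fin_num.
    exact: (integrable_fin_num mD hak).
  by rewrite -(fineK fi); congr (_%:E); rewrite -[RHS]h0.
move=> /(ae_eq_integral_abs mu mD _).1 => -[]; first exact: measurable_int hk.
move=> N [mN N0 sN]; exists N; split => // x /= hx; apply: sN => /= h; apply: hx => Dx px.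
have /= := h Dx; rewrite /k => -[/eqP]; rewrite mulf_eq0 (negbTE px) orbF subr_eq0.
by move=> /eqP.
Unshelve. all: by end_near. Qed.

(** Truncation is a contraction, so it does not increase the error. *)
Lemma cvb_clip M a f : 0 <= M -> itg f -> cva mu idx Q a f ->
  cvb mu D idx Q (fun m i => clip M (a m i)) (fun x => clip M (f x)).
Proof.
move=> M0 hf caf.
have bc : bdf D (fun x => clip M (f x)).
  split; last by exists M => x _; exact: clip_bnd.
  by apply: measurable_maxr => //; apply: measurable_minr => //; exact: itg_meas hf.
split => //; first by exists M => m i _; exact: clip_bnd.
apply: (cva_squeeze caf); apply: nearW => m.
apply: ler_sum_in => i im; apply: le_Rintegral => //.
- by apply: (itgQ_dist hP _ im); exact: (bdf_itg hP bc).
- exact: (itgQ_dist hP _ im).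
- by move=> x _; exact: clip_contract.
Qed.

Lemma cvb_clip_bounded M a f : 0 <= M -> (forall m i, i \in idx m -> `|a m i| <= M) ->
  itg f -> cva mu idx Q a f -> cvb mu D idx Q a (fun x => clip M (f x)).
Proof.
move=> M0 haM hf caf; apply: (cvb_ext hP (cvb_clip M0 hf caf)) => // m i im.
by rewrite clip_id// haM.
Qed.

Lemma cva_clip_ae M a f : 0 <= M -> (forall m i, i \in idx m -> `|a m i| <= M) ->
  itg f -> cva mu idx Q a f -> {ae mu, forall x, D x -> f x = clip M (f x)}.
Proof.
move=> M0 haM hf caf; have b1 : bdf D (cst 1 : X -> R).
  by split; [exact: measurable_cst|exists 1 => x _; rewrite normr1].
have h : {ae mu, forall x, D x -> (1 : R) != 0 -> f x = clip M (f x)}.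
  apply: (cva_bound_ae M0 hf caf b1) => e e0; apply: nearW => m i x im _.
  by right; exact: haM.
by apply: filterS h => x hx Dx; apply: hx => //; exact: oner_neq0.
Qed.

End clipping.

(** * Measure-theoretic tools *)

Section caratheodory.
Context d {T : measurableType d} {R : realType}.

(* Rounding the real variable down to a multiple of 1/(n+1) turns f into a
   countably glued family of measurable functions; let n go to infinity. *)
Lemma caratheodory_measurable (f : T * measurableTypeR R -> R) :
  (forall t, measurable_fun setT (fun x => f (x, t))) ->
  (forall x, continuous (fun t : R => f (x, t))) ->
  measurable_fun setT f.
Proof.
move=> mf cf.
pose r n (t : R) : R := (Num.floor (t * n.+1%:R))%:~R / n.+1%:R.
have rcvg t : r ^~ t @ \oo --> t.
  apply/cvgrPdist_lt => e e0; near=> n.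
  have n0 : (0 : R) < n.+1%:R by [].
  have /andP[h1 h2] := floor_itv (t * n.+1%:R).
  have -> : t - r n t = (t * n.+1%:R - (Num.floor (t * n.+1%:R))%:~R) / n.+1%:R.
    by rewrite mulrBl mulfK// gt_eqF.
  rewrite ger0_norm ?divr_ge0 ?subr_ge0// ltr_pdivrMr//.
  apply: (@lt_trans _ _ 1); first by move: h2; rewrite intrD; lra.
  rewrite mulrC -ltr_pdivrMr// mul1r.
  apply: le_lt_trans (ler_norm _) _.
  near: n; exists (Num.truncn `|e^-1|) => // n /= hn.
  rewrite (lt_le_trans (truncnS_gt _))//.
  by rewrite ler_nat ltnS.
apply: (@measurable_fun_cvg _ _ _ _ (fun n y => f (y.1, r n y.2))); last first.
  move=> -[x t] _ /=; exact: (cvg_comp (r ^~ t) (fun t => f (x, t)) (rcvg t) (cf x t)).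
move=> n _ B mB; rewrite setTI.
rewrite [X in measurable X](_ : _ = \bigcup_(q : int)
  (((fun x => f (x, q%:~R / n.+1%:R)) @^-1` B) `*`
   [set` `[q%:~R / n.+1%:R : R, (q + 1)%:~R / n.+1%:R[ ])); last first.
  have n0 : (0 : R) < n.+1%:R by [].
  apply/seteqP; split => -[x t] /=.
    move=> Bxt; exists (Num.floor (t * n.+1%:R)) => //=; split => //=.
    have /andP[h1 h2] := floor_itv (t * n.+1%:R).
    by rewrite in_itv /= ler_pdivrMr// ltr_pdivlMr// h1 h2.
  move=> [q _ [/= Bq]]; rewrite in_itv /= ler_pdivrMr// ltr_pdivlMr// => h.
  by rewrite /r; have /eqP -> : Num.floor (t * n.+1%:R) == q by rewrite floor_eq.
apply: countable_bigcupT_measurable => [|q]; first exact: countableP.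
apply: measurableX; last exact: measurable_itv.
by rewrite -[X in measurable X]setTI; exact: mf.
Unshelve. all: by end_near. Qed.

End caratheodory.

Lemma continuous_measurable2 {R : realType} (f : R * R -> R) : continuous f ->
  measurable_fun setT (f : measurableTypeR R * measurableTypeR R -> R).
Proof.
move=> cf; apply: caratheodory_measurable => [t|x].
  apply: continuous_measurable_fun => x.
  apply: (@continuous_comp _ _ _ (fun x => (x, t)) f); last exact: cf.
  exact: (cvg_pair cvg_id (cvg_cst t)).
move=> t; apply: (@continuous_comp _ _ _ (fun t => (x, t)) f); last exact: cf.
exact: (cvg_pair (cvg_cst x) cvg_id).
Qed.

Lemma continuous_measurable3 {R : realType} (f : (R * R) * R -> R) : continuous f ->
  measurable_fun setT
    (f : (measurableTypeR R * measurableTypeR R) * measurableTypeR R -> R).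
Proof.
move=> cf; apply: caratheodory_measurable => [t|x].
  apply: continuous_measurable2 => x.
  apply: (@continuous_comp _ _ _ (fun x => (x, t)) f); last exact: cf.
  exact: (cvg_pair cvg_id (cvg_cst t)).
move=> t; apply: (@continuous_comp _ _ _ (fun t => (x, t)) f); last exact: cf.
exact: (cvg_pair (cvg_cst x) cvg_id).
Qed.

(** Near-covering compactness, applied with radii tending to 0, turns the local radii of continuity
    into a single one. The second point ranges over the whole ball, which spares membership checks
    for sample points later. *)
Lemma heine_cantor {R : realType} {V : pseudoMetricType R} (K : set V) (f : V -> R) :
  compact K -> continuous f -> forall e : R, 0 < e ->
  exists2 d : R, 0 < d & forall x y, K x -> ball x d y -> `|f x - f y| < e.
Proof.
move=> /compact_near_coveringP cK cf e e0.
have e20 : 0 < e / 2 by rewrite divr_gt0.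
have := cK R (0^'+) (fun d x => forall y, ball x d y -> `|f x - f y| < e) _.
case.
  move=> x Kx; have hx : \forall t \near nbhs x, `|f x - f t| < e / 2.
    exact: (cvgrPdist_lt _ _).1 (cf x) _ e20.
  have [r /= r0 hr] := (nbhs_ballP _ _).1 hx.
  exists (ball x (r / 2), [set d | d < r / 2]); first split => /=.
  - by apply: nbhsx_ballx; rewrite divr_gt0.
  - by apply: nbhs_right_lt; rewrite divr_gt0.
  move=> [x' d] /= [bx hd] y hy.
  have b1 : ball x r x' by apply: le_ball bx; lra.
  have b2 : ball x r y.
    rewrite (splitr r); apply: ball_triangle bx _.
    by apply: le_ball hy; exact: ltW.
  have := hr _ b1; have := hr _ b2 => /= h1 h2.
  apply: le_lt_trans (ler_distD (f x) _ _) _.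
  by rewrite (distrC (f x')) (splitr e) ltrD.
move=> r /= r0 hr; exists (r / 2); first by rewrite divr_gt0.
move=> x y Kx; apply: (hr (r / 2)) => //=.
  rewrite sub0r normrN ger0_norm ?divr_ge0 ?ltW//; lra.
by rewrite divr_gt0.
Qed.

Lemma compact_bound {R : realType} {V : topologicalType} (K : set V) (f : V -> R) :
  compact K -> continuous f -> exists2 M : R, 0 <= M & forall x, K x -> `|f x| <= M.
Proof.
move=> cK cf.
have : compact (f @` K) by apply: continuous_compact => //; exact: continuous_subspaceT.
move=> /compact_bounded[M [_ hM]]; exists (`|M| + 1); first by rewrite addr_ge0.
move=> x Kx; apply: (hM (`|M| + 1)); last by exists x.
by rewrite ltr_pwDr// ler_norm.
Qed.

(** Derivatives are given along [v] only. The restriction to the line has literally the same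
    difference quotients ([eqg]), so the one-variable theorem applies without a chain rule. *)
Lemma dir_mvt {R : realType} {V : normedModType R} (f : V -> R) (v x : V) (s : R) :
  (forall y, derivable f y v) -> 0 < s ->
  exists2 t, 0 < t < s & f (x + s *: v) - f x = s * 'D_v f (x + t *: v).
Proof.
move=> df s0; pose g (t : R) := f (x + t *: v).
have eqg (t : R) : (fun h : R => h^-1 *: ((g \o shift t) (h *: (1 : R)) - g t)) =
   (fun h : R => h^-1 *: ((f \o shift (x + t *: v)) (h *: v) - f (x + t *: v))).
  apply/funext => h; rewrite /g /=; congr (_ *: (f _ - _)).
  by rewrite scalerDl [h *: 1]mulr1 addrCA.
have dg (t : R) : is_derive t (1 : R) g ('D_v f (x + t *: v)).
  split; first by rewrite /derivable eqg; exact: df.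
  by rewrite /derive eqg.
have [] := @MVT R g (fun t => 'D_v f (x + t *: v)) 0 s s0.
  apply: continuous_subspaceT => t; apply: differentiable_continuous.
  by apply/derivable1_diffP; exact: ex_derive.
move=> t; rewrite in_itv /= => ht; rewrite /g scale0r addr0 subr0 => ->.
by exists t => //; rewrite mulrC.
Qed.

Section intervals.
Context {R : realType}.
Local Notation leb := (@lebesgue_measure R).

Lemma leb_itvoo (a b : R) : a < b -> leb [set` `]a, b[ ] = (b - a)%:E.
Proof. by move=> ab; rewrite lebesgue_measure_itv /= lte_fin ab EFinB. Qed.

Lemma obox_setX (a b : R * R) :
  obox a b = [set` `]a.1, b.1[ ] `*` [set` `]a.2, b.2[ ].
Proof.
apply/seteqP; split => -[x y] /=.
  by move=> h; split => /=; rewrite in_itv /=; [exact: (h ord0)|exact: (h ord_max)].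
rewrite /= !in_itv /= => -[h1 h2] i; rewrite /Defs.coord.
by case: ifP.
Qed.

Lemma measurable_obox (a b : R * R) :
  measurable (obox a b : set (measurableTypeR R * measurableTypeR R)).
Proof. by rewrite obox_setX; apply: measurableX; exact: measurable_itv. Qed.

Lemma mu2_obox (a b : R * R) : a.1 < b.1 -> a.2 < b.2 ->
  mu2 R (obox a b) = ((b.1 - a.1) * (b.2 - a.2))%:E.
Proof.
move=> h1 h2; rewrite obox_setX /mu2 /=.
rewrite (@product_measure1E _ _ _ _ R leb leb); try exact: measurable_itv.
by rewrite EFinM; congr (_ * _)%E; exact: leb_itvoo.
Qed.

Lemma mu2_line0 (i : 'I_2) (c : R) :
  measurable ([set x | coord i x = c] : set (measurableTypeR R * measurableTypeR R)) /\
  mu2 R [set x | coord i x = c] = 0%E.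
Proof.
rewrite /Defs.coord; case: (i == ord0).
  rewrite [X in measurable X /\ mu2 R X = _](_ : _ = [set c] `*` setT); last first.
    by apply/seteqP; split => -[x y] //= [].
  split; first by apply: measurableX => //; exact: measurable_set1.
  rewrite /mu2 /= (@product_measure1E _ _ _ _ R leb leb)//.
  transitivity (0 * leb setT)%E; last by rewrite mul0e.
  by congr (_ * _)%E; exact: lebesgue_measure_set1.
rewrite [X in measurable X /\ mu2 R X = _](_ : _ = setT `*` [set c]); last first.
  by apply/seteqP; split => -[x y] //= [].
split; first by apply: measurableX => //; exact: measurable_set1.
rewrite /mu2 /= (@product_measure1E _ _ _ _ R leb leb)//.
transitivity (leb setT * 0)%E; last by rewrite mule0.
by congr (_ * _)%E; exact: lebesgue_measure_set1.
Qed.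

End intervals.

Lemma bigsetU_seqP (T : Type) (J : eqType) (s : seq J) (F : J -> set T) x :
  (\big[setU/set0]_(i <- s) F i) x <-> exists2 i, i \in s & F i x.
Proof.
elim: s => [|j s ih]; first by rewrite big_nil; split => // -[].
rewrite big_cons; split.
  move=> [Fj|/ih [i im Fi]]; first by exists j; rewrite ?mem_head.
  by exists i; rewrite // inE im orbT.
move=> [i]; rewrite inE => /predU1P[-> Fj|im Fi]; first by left.
by right; apply/ih; exists i.
Qed.

(** * Partitions of the time interval and of space-time *)

Section product_partitions.
Context d1 d2 {T1 : measurableType d1} {T2 : measurableType d2} {R : realType}.
Variable m1 : {measure set T1 -> \bar R}.
Variable m2 : {sigma_finite_measure set T2 -> \bar R}.
Variables (I1 I2 : eqType) (D1 : set T1) (D2 : set T2).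
Variables (idx1 : nat -> seq I1) (idx2 : nat -> seq I2).
Variables (Q1 : nat -> I1 -> set T1) (Q2 : nat -> I2 -> set T2).
Hypotheses (P1 : partitions m1 D1 idx1 Q1) (P2 : partitions m2 D2 idx2 Q2).

Let idx m : seq (I1 * I2) := [seq (i, j) | i <- idx1 m, j <- idx2 m].
Let Q m (p : I1 * I2) := Q1 m p.1 `*` Q2 m p.2.

Lemma mem_idx_prod m p : (p \in idx m) = (p.1 \in idx1 m) && (p.2 \in idx2 m).
Proof.
case: p => i j; apply/allpairsP/andP => [[[a b] [/= ? ? [-> ->]]]|[? ?]]; first by split.
by exists (i, j).
Qed.

Lemma prod_partitions : partitions (m1 \x m2)%E (D1 `*` D2) idx Q.
Proof.
have [mD1 f1 u1 mQ1 s1 t1 c1] := P1; have [mD2 f2 u2 mQ2 s2 t2 c2] := P2.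
split.
- exact: measurableX.
- rewrite [X in (X < _)%E](@product_measure1E _ _ _ _ R m1 m2)//.
  by rewrite lte_mul_pinfty// ge0_fin_numE.
- by move=> m; apply: allpairs_uniq => // -[? ?] [? ?] _ _ [-> ->].
- by move=> m [i j]; apply: measurableX.
- move=> m p; rewrite mem_idx_prod => /andP[h1 h2] x [/= q1 q2].
  by split => /=; [exact: s1 q1|exact: s2 q2].
- move=> m [i j] [i' j'] /=; rewrite !mem_idx_prod => /andP[/= h1 h2] /andP[/= h1' h2'].
  move=> [x [[/= q1 q2] [/= q1' q2']]].
  have -> : i = i' by apply: (t1 m i i' h1 h1'); exists x.1.
  by have -> : j = j' by apply: (t2 m j j' h2 h2'); exists x.2.
- move=> m; set U1 := \big[setU/set0]_(i <- idx1 m) Q1 m i in c1 *.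
  set U2 := \big[setU/set0]_(i <- idx2 m) Q2 m i in c2 *.
  pose U1' := \big[setU/set0]_(i <- idx1 m) Q1 m i.
  pose U2' := \big[setU/set0]_(i <- idx2 m) Q2 m i.
  have mU1 : measurable (D1 `\` U1') by apply: measurableD => //; exact: bigsetU_measurable.
  have mU2 : measurable (D2 `\` U2') by apply: measurableD => //; exact: bigsetU_measurable.
  apply: (@subset_measure0 _ _ _ _ _ ((D1 `\` U1') `*` D2 `|` D1 `*` (D2 `\` U2'))).
  + apply: measurableD; first exact: measurableX.
    by apply: bigsetU_measurable => -[i j] _; exact: measurableX.
  + by apply: measurableU; exact: measurableX.
  + move=> [x y] [[/= Dx Dy] nU].
    have [Ux|nUx] := pselect (U1' x); last by left.
    right; split => //=; split => // Uy; apply: nU.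
    move: Ux Uy => /bigsetU_seqP[i hi qi] /bigsetU_seqP[j hj qj].
    by apply/bigsetU_seqP; exists (i, j) => //; rewrite mem_idx_prod /= hi hj.
  + apply/eqP; rewrite eq_le measure_ge0 andbT.
    apply: (le_trans (measureU2 _ _ _)); [exact: measurableX|exact: measurableX|].
    rewrite [X in (X + _)%E](_ : _ = 0%E); last first.
      by rewrite [LHS](@product_measure1E _ _ _ _ R m1 m2)// c1 mul0e.
    rewrite [X in (_ + X)%E](_ : _ = 0%E); last first.
      by rewrite [LHS](@product_measure1E _ _ _ _ R m1 m2)// c2 mule0.
    by rewrite adde0.
Qed.

Lemma wt_prod m p : p \in idx m ->
  wt (m1 \x m2)%E Q m p = wt m1 Q1 m p.1 * wt m2 Q2 m p.2.
Proof.
rewrite mem_idx_prod => /andP[h1 h2].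
rewrite /wt [X in fine X](@product_measure1E _ _ _ _ R m1 m2)//;
  [|exact: (part_meas P1)|exact: (part_meas P2)].
rewrite fineM//.
  by rewrite ge0_fin_numE// (finQ P1).
by rewrite ge0_fin_numE// (finQ P2).
Qed.

End product_partitions.

Section time_partition.
Context {R : realType}.
Variables (T : R) (N : nat -> nat).
Hypotheses (T0 : 0 < T) (N0 : forall m, (0 < N m)%N).
Local Notation leb := (@lebesgue_measure R).

Definition tstep m : R := T / (N m)%:R.
Definition tidx m := iota 0 (N m).
(** Open, unlike [time_slab]: a half-open first slab would contain 0, which is outside ]0, T[. *)
Definition slab m n : set (measurableTypeR R) :=
  [set` `]n%:R * tstep m, n.+1%:R * tstep m[ ].

Lemma tstep_gt0 m : 0 < tstep m.
Proof. by rewrite divr_gt0// ltr0n. Qed.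

Lemma tstepN m : (N m)%:R * tstep m = T.
Proof. by rewrite mulrC divfK// pnatr_eq0 -lt0n. Qed.

Lemma mem_tidx m n : (n \in tidx m) = (n < N m)%N.
Proof. by rewrite mem_iota add0n. Qed.

Lemma slabP m n (t : R) : slab m n t <-> n%:R * tstep m < t < n.+1%:R * tstep m.
Proof. by rewrite /slab /= in_itv. Qed.

Lemma slab_sub m n t : (n < N m)%N -> slab m n t -> 0 < t < T.
Proof.
move=> nN /slabP /andP[h1 h2]; have := tstep_gt0 m => t0; apply/andP; split.
  by apply: le_lt_trans h1; rewrite mulr_ge0// ltW.
apply: (lt_le_trans h2); rewrite -(tstepN m) ler_wpM2r ?(ltW t0)//.
by rewrite ler_nat.
Qed.

Lemma leb_slab m n : leb (slab m n) = (tstep m)%:E.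
Proof.
have h : n%:R * tstep m < n.+1%:R * tstep m by rewrite ltr_pM2r ?tstep_gt0// ltr_nat.
have := leb_itvoo h; rewrite -mulrBl -natrB// subSnn mul1r; exact.
Qed.

Lemma time_partitions : partitions leb [set` `]0, T[ ] tidx slab.
Proof.
split.
- exact: measurable_itv.
- by have := leb_itvoo T0; rewrite /= => ->; rewrite ltry.
- by move=> m; exact: iota_uniq.
- by move=> m n; exact: measurable_itv.
- move=> m n; rewrite mem_tidx => nN t ht /=; rewrite in_itv /=; exact: slab_sub ht.
- move=> m n n' _ _ [t [/slabP/andP[h1 h2] /slabP/andP[h1' h2']]].
  have t0 := tstep_gt0 m.
  have := lt_trans h1 h2'; have := lt_trans h1' h2.
  by rewrite !ltr_pM2r// !ltr_nat !ltnS => ? ?; apply/eqP; rewrite eqn_leq; apply/andP.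
- move=> m.
  pose P := [set x : measurableTypeR R | exists2 n : nat, (n < (N m).+1)%N & x = n%:R * tstep m].
  have fP : finite_set P.
    have -> : P = (fun n : nat => n%:R * tstep m) @` `I_((N m).+1).
      by apply/seteqP; split => x [n /= h e]; exists n.
    exact/finite_image/finite_II.
  have mP : measurable P by apply: countable_measurable => //; exact: finite_set_countable.
  apply: (@subset_measure0 _ _ _ _ _ P) => //.
  + apply: measurableD; first exact: measurable_itv.
    by apply: bigsetU_measurable => n _; exact: measurable_itv.
  + move=> t [/=]; rewrite in_itv /= => /andP[t0 tT] nU.
    have ts := tstep_gt0 m.
    have tt : 0 <= t / tstep m by rewrite divr_ge0// ltW.
    (* The candidate index is the integer part of [t / tstep m]; a time missed by that open slab is
       its lower endpoint, hence in the finite set [P]. *)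
    have := truncn_itv tt; set n := Num.truncn _ => /andP[h1 h2].
    have nN : (n < N m)%N.
      rewrite -(ltr_nat R); apply: (le_lt_trans h1).
      by rewrite ltr_pdivrMr// tstepN.
    exists n; first by rewrite ltnW.
    apply: contrapT => ne; apply: nU; apply/bigsetU_seqP; exists n; first by rewrite mem_tidx.
    apply/slabP; move: h1 h2; rewrite ler_pdivlMr// ltr_pdivrMr// => h1 ->.
    by rewrite andbT lt_neqAle h1 andbT; apply/eqP => e; apply: ne.
  + by apply: countable_lebesgue_measure0; exact: finite_set_countable.
Qed.

End time_partition.

Lemma ord2P (i : 'I_2) : i = ord0 \/ i = ord_max.
Proof. by case: i => -[|[|//]] h; [left|right]; apply: val_inj. Qed.

Lemma eq_ord2 (i j : 'I_2) : j != i -> j = rev_ord i.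
Proof.
by case: (ord2P i) => ->; case: (ord2P j) => -> // _; apply: val_inj.
Qed.

Lemma rev_ord2_neq (i : 'I_2) : rev_ord i != i.
Proof. by case: (ord2P i) => ->. Qed.

Lemma sum_ord2 {V : nmodType} (F : 'I_2 -> V) : \sum_(i < 2) F i = F ord0 + F ord_max.
Proof. by rewrite big_ord_recr big_ord1 /=; congr (F _ + F _); apply: val_inj. Qed.

Lemma sum_ord2i {V : nmodType} (i : 'I_2) (F : 'I_2 -> V) :
  \sum_(j < 2) F j = F i + F (rev_ord i).
Proof.
rewrite sum_ord2; case: (ord2P i) => ->; [|rewrite addrC];
  by congr (F _ + F _); apply: val_inj.
Qed.

Lemma coord_pair {A : Type} (i : 'I_2) (f : 'I_2 -> A) :
  coord i (f ord0, f ord_max) = f i.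
Proof. by case: (ord2P i) => ->. Qed.

Lemma eq_coord {A : Type} (x y : A * A) : (forall i, coord i x = coord i y) -> x = y.
Proof.
case: x y => [a b] [a' b'] h.
have -> : a = a' by exact: (h ord0).
by have -> : b = b' by exact: (h ord_max).
Qed.

Lemma coordD {A : pzRingType} (i : 'I_2) (x y : A * A) :
  coord i (x + y) = coord i x + coord i y.
Proof. by rewrite /coord; case: ifP. Qed.

Lemma coordB {A : pzRingType} (i : 'I_2) (x y : A * A) :
  coord i (x - y) = coord i x - coord i y.
Proof. by rewrite /coord; case: ifP. Qed.

Lemma coord_evec {A : pzRingType} (i j : 'I_2) :
  coord i (evec j : A * A) = (i == j)%:R.
Proof. by rewrite /coord /evec; case: (ord2P i) => ->; case: (ord2P j) => ->. Qed.

(* Cell k is cut into four quarters, on which all the piecewise constant functions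
   of the scheme, primal and dual, are constant: the quarter (k, (b1, b2)) lies
   on the lower (false) or upper (true) side of the center in each direction. *)
Notation ind2 := ((int * int) * (bool * bool))%type.

Definition flip (i : 'I_2) (b : bool * bool) : bool * bool :=
  if i == ord0 then (~~ b.1, b.2) else (b.1, ~~ b.2).

Lemma coord_flip i j b : coord i (flip j b) = (i == j) (+) coord i b.
Proof. by case: b => ? ?; case: (ord2P i) => ->; case: (ord2P j) => ->. Qed.

Lemma flipK i : involutive (flip i).
Proof. by case=> a b; rewrite /flip; case: (i == ord0); rewrite /= negbK. Qed.

(** * Quarter cells of a MAC grid *)

Section one_grid.
Context {R : realType}.
Variables (Omega : set (R * R)) (G : grid R).
Implicit Types (i : 'I_2) (k s : int * int) (j : ind2).

Definition wd i k : R := upp G i k - low G i k.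
Definition qlo i j := if coord i j.2 then mid G i j.1 else low G i j.1.
Definition qup i j := if coord i j.2 then upp G i j.1 else mid G i j.1.
Definition quarter j : set (measurableTypeR R * measurableTypeR R) :=
  obox (qlo ord0 j, qlo ord_max j) (qup ord0 j, qup ord_max j).
Definition idx2 : seq ind2 := [seq (k, b) | k <- cells G, b <- index_enum (bool * bool)%type].

(** Mirror image across the face of the cell that touches the quarter. Without neighbour the quarter
    is fixed, which keeps the map an involution of [idx2]. *)
Definition reflect_face i j : ind2 :=
  let k := neighbor i (coord i j.2) j.1 in
  if k \in cells G then (k, flip i j.2) else j.
Definition reflect_mid i j : ind2 := (j.1, flip i j.2).

Lemma mem_idx2 j : (j \in idx2) = (j.1 \in cells G).
Proof.
case: j => k b; apply/allpairsP/idP => [[[k' b'] [/= h _ [-> _]]]//|/= h].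
by exists (k, b); split => //=; rewrite mem_index_enum.
Qed.

Lemma idx2_uniq : uniq idx2.
Proof.
apply: allpairs_uniq; [exact: fset_uniq|exact: index_enum_uniq|].
by move=> -[? ?] [? ?] _ _ [-> ->].
Qed.

Lemma sum_idx2 (F : ind2 -> R) :
  \sum_(j <- idx2) F j = \sum_(k <- cells G) \sum_(b : bool * bool) F (k, b).
Proof. by rewrite big_allpairs. Qed.

Lemma quarterP j x : quarter j x <-> forall i, qlo i j < coord i x < qup i j.
Proof. by split => h i; have := h i; rewrite !(coord_pair i (fun i => _ i j)). Qed.

Lemma cellP k x : cell G k x <-> forall i, low G i k < coord i x < upp G i k.
Proof. by split => h i; have := h i; rewrite !(coord_pair i (fun i => _ G i k)). Qed.

Lemma closed_cellP k x :
  closed_cell G k x <-> forall i, low G i k <= coord i x <= upp G i k.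
Proof. by split => h i; have := h i; rewrite !(coord_pair i (fun i => _ G i k)). Qed.

Hypothesis hG : mac_grid Omega G.

Lemma gline_lt i : {homo gline G i : a b / a < b}.
Proof. by case: hG => h _ _; exact: h. Qed.

Lemma gline_le i : {homo gline G i : a b / a <= b}.
Proof.
by move=> a b; rewrite le_eqVlt => /predU1P[->//|/(@gline_lt i)/ltW].
Qed.

Lemma wd_gt0 i k : 0 < wd i k.
Proof. by rewrite subr_gt0; apply: gline_lt; rewrite ltrDl. Qed.

Lemma midE i k : mid G i k = low G i k + wd i k / 2.
Proof. by rewrite /mid /wd; field. Qed.

Lemma uppE i k : upp G i k = low G i k + wd i k.
Proof. by rewrite /wd addrC subrK. Qed.

Lemma qE i j : qup i j - qlo i j = wd i j.1 / 2.
Proof. by rewrite /qup /qlo; case: ifP => _; rewrite !midE ?uppE; field. Qed.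

Lemma qlt i j : qlo i j < qup i j.
Proof. by rewrite -subr_gt0 qE divr_gt0// wd_gt0. Qed.

Lemma q_sub i j : low G i j.1 <= qlo i j /\ qup i j <= upp G i j.1.
Proof. by have := wd_gt0 i j.1; rewrite /qlo /qup; case: ifP => _; rewrite !midE ?uppE; lra. Qed.

Lemma quarter_cell j : quarter j `<=` cell G j.1.
Proof.
move=> x /quarterP h; apply/cellP => i; have /andP[h1 h2] := h i.
by have [h3 h4] := q_sub i j; rewrite (le_lt_trans h3)//= (lt_le_trans h2).
Qed.

Lemma upp_le_low i k k' : coord i k < coord i k' -> upp G i k <= low G i k'.
Proof. by move=> h; apply: gline_le; rewrite -lezD1 in h. Qed.

(** One cell is open, the other closed: a point strictly inside a grid cell determines it among all
    closed grid cells. [outer_cell] relies on this form. *)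
Lemma cell_disjoint k k' x : cell G k x -> closed_cell G k' x -> k = k'.
Proof.
move=> /cellP h /closed_cellP h'; apply: eq_coord => i.
have /andP[h1 h2] := h i; have /andP[h3 h4] := h' i.
apply/eqP; case: ltgtP => // hk; have := upp_le_low hk.
  by move=> hh; have := le_lt_trans (le_trans hh h3) h2; rewrite ltxx.
by move=> hh; have := lt_le_trans h1 (le_trans h4 hh); rewrite ltxx.
Qed.

Lemma cell_closed k : cell G k `<=` closed_cell G k.
Proof. by move=> x /cellP h; apply/closed_cellP => i; have /andP[h1 h2] := h i; rewrite !ltW. Qed.

Lemma quarter_disjoint j j' x : quarter j x -> quarter j' x -> j = j'.
Proof.
move=> q q'; have e : j.1 = j'.1.
  by apply: cell_disjoint (quarter_cell q) (cell_closed (quarter_cell q')).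
case: j j' q q' e => [k b] [k' b'] /quarterP h /quarterP h' /= e; subst k'.
congr (_, _); apply: eq_coord => i.
have := h i; have := h' i; rewrite /qlo /qup /=.
case: (coord i b); case: (coord i b') => // /andP[h1 h2] /andP[h3 h4].
  by have := lt_trans h2 h3; rewrite ltxx.
by have := lt_trans h4 h1; rewrite ltxx.
Qed.

Lemma mu2_quarter j : mu2 R (quarter j) = (wd ord0 j.1 / 2 * (wd ord_max j.1 / 2))%:E.
Proof. by rewrite mu2_obox /= ?qlt// !qE. Qed.

Lemma area_cell k : area (cell G k) = wd ord0 k * wd ord_max k.
Proof.
by rewrite /area mu2_obox /= ?(gline_lt _)// ?ltrDl//; have := wd_gt0 ord0 k; rewrite subr_gt0.
Qed.

Lemma cell_nonempty_pt k : cell G k (mid G ord0 k, mid G ord_max k).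
Proof.
apply/cellP => i; rewrite (coord_pair i (fun i => mid G i k)) midE uppE.
by have := wd_gt0 i k; lra.
Qed.

Lemma cell_sub k : k \in cells G -> cell G k `<=` Omega.
Proof. by case: hG => _ h _; exact: h. Qed.

Lemma Omega_closed_cell x : Omega x -> exists2 k, k \in cells G & closed_cell G k x.
Proof.
move=> Ox; have : closure Omega x by exact: subset_closure.
by case: hG => _ _ -> [k /= ? ?]; exists k.
Qed.

Lemma null_lines (L : seq ('I_2 * R)) (A : set (measurableTypeR R * measurableTypeR R)) :
  measurable A -> (forall x, A x -> exists2 p, p \in L & coord p.1 x = p.2) -> mu2 R A = 0%E.
Proof.
move=> mA AL; apply/negligibleP => //.
pose U := \big[setU/set0]_(p <- L) [set x : measurableTypeR R * measurableTypeR R | coord p.1 x = p.2].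
have AU : A `<=` U by move=> x /AL[p pL px]; apply/bigsetU_seqP; exists p.
apply: (negligibleS AU).
rewrite /U; apply: (big_ind (fun B => (mu2 R).-negligible B)); first exact: negligible_set0.
  by move=> ? ? ? ?; exact: negligibleU.
by move=> p _; apply/negligibleP; have [] := mu2_line0 p.1 p.2.
Qed.

Definition grid_lines : seq ('I_2 * R) :=
  flatten [seq [:: (i, low G i k); (i, mid G i k); (i, upp G i k)] | k <- cells G, i <- index_enum 'I_2].

Lemma mem_grid_lines i k c : k \in cells G ->
  c \in [:: low G i k; mid G i k; upp G i k] -> (i, c) \in grid_lines.
Proof.
move=> kG hc; apply/flattenP => /=.
exists [:: (i, low G i k); (i, mid G i k); (i, upp G i k)].
  by apply/allpairsP; exists (k, i); rewrite /= mem_index_enum.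
by move: hc; rewrite !inE !xpair_eqE !eqxx.
Qed.

Lemma off_lines_quarter k x : closed_cell G k x ->
  (forall i, coord i x != low G i k /\ coord i x != mid G i k /\ coord i x != upp G i k) ->
  exists b, quarter (k, b) x.
Proof.
move=> /closed_cellP h ne.
pose f i := mid G i k < coord i x.
exists (f ord0, f ord_max); apply/quarterP => i.
have [n1 [n2 n3]] := ne i; have /andP[h1 h2] := h i.
rewrite /qlo /qup /= (coord_pair i f) /f; case: (ltP (mid G i k) (coord i x)) => hm /=.
  by rewrite hm lt_neqAle n3.
by rewrite lt_neqAle eq_sym n1 h1 lt_neqAle n2.
Qed.

Lemma off_lines_dec k x : k \in cells G ->
  (forall i, coord i x != low G i k /\ coord i x != mid G i k /\ coord i x != upp G i k) \/
  exists2 p, p \in grid_lines & coord p.1 x = p.2.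
Proof.
move=> kG.
have [h|/existsNP[i h]] := pselect (forall i, coord i x \notin [:: low G i k; mid G i k; upp G i k]).
  by left => i; have := h i; rewrite !inE !negb_or => /and3P[].
right; exists (i, coord i x) => //; apply: mem_grid_lines kG _.
by move/negP : h; rewrite negbK.
Qed.

(** Each point of [Omega] is in a closed cell of the mesh; off finitely many lines it is interior to
    one of the quarters of that cell. *)
Lemma Omega_cover : measurable (Omega : set (measurableTypeR R * measurableTypeR R)) ->
  mu2 R (Omega `\` \big[setU/set0]_(j <- idx2) quarter j) = 0%E.
Proof.
move=> mO; apply: (null_lines (L := grid_lines)).
  by apply: measurableD => //; apply: bigsetU_measurable => j _; exact: measurable_obox.
move=> x [Ox nU]; have [k kG kx] := Omega_closed_cell Ox.
have [/(off_lines_quarter kx)[b qb]|//] := off_lines_dec x kG.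
by exfalso; apply: nU; apply/bigsetU_seqP; exists (k, b) => //; rewrite mem_idx2.
Qed.

Lemma reflect_mid_idx i j : j \in idx2 -> reflect_mid i j \in idx2.
Proof. by rewrite !mem_idx2. Qed.

Lemma reflect_face_idx i j : j \in idx2 -> reflect_face i j \in idx2.
Proof. by rewrite !mem_idx2 /reflect_face; case: ifP. Qed.

Lemma reflect_midK i : involutive (reflect_mid i).
Proof. by move=> [k b]; rewrite /reflect_mid /= flipK. Qed.

Lemma neighborK i b k : neighbor i (~~ b) (neighbor i b k) = k.
Proof. by case: b => /=; rewrite ?addrK ?subrK. Qed.

Lemma reflect_faceK i j : j \in idx2 -> reflect_face i (reflect_face i j) = j.
Proof.
case: j => k b; rewrite mem_idx2 /reflect_face /= => kG.
case h : (neighbor i (coord i b) k \in cells G) => /=; last by rewrite h.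
by rewrite coord_flip eqxx /= neighborK kG flipK.
Qed.

Lemma sum_involution (s : ind2 -> ind2) (F : ind2 -> R) :
  (forall j, j \in idx2 -> s j \in idx2) -> (forall j, j \in idx2 -> s (s j) = j) ->
  \sum_(j <- idx2) F (s j) = \sum_(j <- idx2) F j.
Proof.
move=> sI sK; rewrite -(big_map s xpredT F); apply: perm_big.
apply: uniq_perm; [|exact: idx2_uniq|].
  rewrite map_inj_in_uniq ?idx2_uniq// => a b ha hb e.
  by rewrite -(sK a)// e sK.
move=> j; apply/mapP/idP => [[a ha ->]|hj]; first exact: sI.
by exists (s j); [exact: sI|rewrite sK].
Qed.

End one_grid.

(** The summations by parts below reduce to this translation. Its two vanishing conditions carry the
    boundary values: a zero flux or a zero test value where the translate leaves the index set. *)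
Lemma sum_shift {V : nmodType} (S U : {fset int * int}) (v : int * int) (F : int * int -> V) :
  (forall s, s \in S -> s - v \notin U -> F s = 0) ->
  (forall t, t \in U -> t + v \notin S -> F (t + v) = 0) ->
  \sum_(s <- S) F s = \sum_(t <- U) F (t + v).
Proof.
move=> h1 h2.
rewrite (bigID (fun s => s - v \in U)) /= [X in _ + X]big_seq_cond [X in _ + X]big1 ?addr0; last first.
  by move=> s /andP[sS sU]; exact: h1.
rewrite [RHS](bigID (fun t => t + v \in S)) /= [X in _ = _ + X]big_seq_cond.
rewrite [X in _ = _ + X]big1 ?addr0; last by move=> s /andP[sS sU]; exact: h2.
rewrite -[LHS]big_filter -[RHS]big_filter.
rewrite -[RHS](big_map (fun t => t + v) xpredT); apply: perm_big; apply: uniq_perm.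
- by rewrite filter_uniq// fset_uniq.
- rewrite map_inj_in_uniq ?filter_uniq ?fset_uniq// => a b _ _ /=; exact: addIr.
move=> s; rewrite mem_filter; apply/andP/mapP => /=.
  by move=> [sU sS]; exists (s - v); rewrite ?mem_filter subrK// sS.
by move=> [t]; rewrite mem_filter => /andP[tS tU] ->; rewrite addrK.
Qed.

Lemma rev0 : rev_ord (ord0 : 'I_2) = ord_max. Proof. exact: val_inj. Qed.
Lemma revM : rev_ord (ord_max : 'I_2) = ord0. Proof. exact: val_inj. Qed.

(** * Sums over cells, edges and quarters *)

Section grid_sums.
Context {R : realType}.
Variables (Omega : set (R * R)) (G : grid R).
Hypothesis hG : mac_grid Omega G.
Implicit Types (i : 'I_2) (k s : int * int) (j : ind2).
Local Notation wd := (wd G).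

Lemma mem_int_edges i s : (s \in int_edges G i) = (s \in cells G) && (s - evec i \in cells G).
Proof. by rewrite !inE. Qed.

Lemma face_int i b k : k \in cells G ->
  (face i b k \in int_edges G i) = (neighbor i b k \in cells G).
Proof. by move=> kG; rewrite mem_int_edges; case: b => /=; rewrite ?addrK kG ?andbT. Qed.

Lemma face_edges i b k : k \in cells G -> face i b k \in edges G i.
Proof.
move=> kG; rewrite /edges in_fsetU; case: b => /=; last by rewrite kG.
by apply/orP; right; apply/imfsetP; exists k.
Qed.

Lemma sum_by_parts i (phi q : int * int -> R) :
  (forall s, s \in edges G i -> s \notin int_edges G i -> q s = 0) ->
  \sum_(k <- cells G) phi k * (q (k + evec i) - q k) =
  - \sum_(s <- int_edges G i) q s * (phi s - phi (s - evec i)).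
Proof.
move=> q0; under eq_bigr do rewrite mulrBr.
under [in RHS]eq_bigr do rewrite mulrBr.
rewrite !sumrB opprB; congr (_ - _).
  rewrite [RHS](@sum_shift _ _ (cells G) (evec i)); last 2 first.
  - by move=> s; rewrite mem_int_edges => /andP[_ ->].
  - move=> k kG kn; rewrite q0 ?mul0r//; exact: (face_edges i true kG).
  by apply: eq_bigr => k _; rewrite addrK mulrC.
rewrite [RHS](@sum_shift _ _ (cells G) 0); last 2 first.
- by move=> s; rewrite mem_int_edges subr0 => /andP[->].
- by move=> k kG; rewrite addr0 => kn; rewrite q0 ?mul0r//; exact: (face_edges i false kG).
by apply: eq_bigr => k _; rewrite addr0 mulrC.
Qed.

Lemma sum_edges i (A : int * int -> bool -> R) :
  \sum_(s <- int_edges G i) (A s false + A (s - evec i) true) =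
  \sum_(k <- cells G) \sum_(b : bool) (if neighbor i b k \in cells G then A k b else 0).
Proof.
rewrite big_split /=; under [RHS]eq_bigr do rewrite big_bool /=.
rewrite big_split /= addrC; congr (_ + _).
  pose F s := if s \in cells G then A (s - evec i) true else 0.
  transitivity (\sum_(s <- int_edges G i) F s).
    by apply: eq_big_seq => s; rewrite mem_int_edges /F => /andP[->].
  rewrite (@sum_shift _ _ (cells G) (evec i)).
  - by apply: eq_bigr => k _; rewrite /F addrK.
  - by move=> s; rewrite mem_int_edges => /andP[_ ->].
  - by move=> k kG; rewrite mem_int_edges addrK kG andbT /F => /negbTE ->.
pose F s := if s - evec i \in cells G then A s false else 0.
transitivity (\sum_(s <- int_edges G i) F s).
  by apply: eq_big_seq => s; rewrite mem_int_edges /F => /andP[_ ->].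
rewrite (@sum_shift _ _ (cells G) 0).
- by apply: eq_bigr => k _; rewrite /F addr0.
- by move=> s; rewrite mem_int_edges subr0 => /andP[->].
- by move=> k kG; rewrite addr0 mem_int_edges kG /= /F => /negbTE ->.
Qed.

Lemma sum_quarters i (B : bool -> bool -> R) :
  \sum_(b : bool * bool) B (coord i b) (coord (rev_ord i) b) =
  \sum_(c : bool) \sum_(c' : bool) B c c'.
Proof.
rewrite -(pair_bigA _ (fun b b' => B (coord i (b, b')) (coord (rev_ord i) (b, b')))) /=.
by rewrite !big_bool /=; case: (ord2P i) => -> //=; rewrite /coord /=; ring.
Qed.

Definition wq j : R := wd ord0 j.1 / 2 * (wd ord_max j.1 / 2).

Lemma wqE i j : wq j = wd i j.1 * wd (rev_ord i) j.1 / 4.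
Proof.
by rewrite /wq; case: (ord2P i) => ->; rewrite ?rev0 ?revM; field.
Qed.

Lemma wd_rev i s : wd (rev_ord i) (s - evec i) = wd (rev_ord i) s.
Proof. by rewrite /wd /upp /low coordB coord_evec (negbTE (rev_ord2_neq i)) subr0. Qed.

Lemma wd_rev' i s : wd (rev_ord i) (s + evec i) = wd (rev_ord i) s.
Proof. by rewrite -{2}(addrK (evec i) s) wd_rev. Qed.

Lemma edge_lengthE i s : edge_length G i s = wd (rev_ord i) s.
Proof. by []. Qed.

Definition dual_dist i s : R := (wd i s + wd i (s - evec i)) / 2.

Lemma dist_gt0 i s : 0 < dual_dist i s.
Proof. by rewrite divr_gt0// addr_gt0// (wd_gt0 hG). Qed.

Lemma upp_shift i s : upp G i (s - evec i) = low G i s.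
Proof. by rewrite /upp /low coordB coord_evec eqxx /= subrK. Qed.

Lemma low_shift i s : low G i (s + evec i) = upp G i s.
Proof. by rewrite -upp_shift addrK. Qed.

Lemma distE i s : dual_dist i s = mid G i s - mid G i (s - evec i).
Proof.
by rewrite /dual_dist !midE -(upp_shift i s) (uppE _ i); field.
Qed.

(** The dual cell of an internal edge is made of two quarters of each of its two cells, whence the
    factor 4. Quarters whose face is on the boundary belong to no such dual cell and get the value
    0. *)
Lemma sum_edges_quarters i (X : int * int -> bool -> bool -> R) :
  \sum_(s <- int_edges G i) edge_length G i s *
     (\sum_(c : bool) (wd i s * X s false c + wd i (s - evec i) * X (s - evec i) true c) / 4) =
  \sum_(j <- idx2 G) wq j *
     (if neighbor i (coord i j.2) j.1 \in cells G
      then X j.1 (coord i j.2) (coord (rev_ord i) j.2) else 0).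
Proof.
rewrite sum_idx2.
pose A k b := wd (rev_ord i) k * wd i k / 4 * \sum_(c : bool) X k b c.
transitivity (\sum_(s <- int_edges G i) (A s false + A (s - evec i) true)).
  by apply: eq_bigr => s _; rewrite edge_lengthE /A wd_rev !big_bool /=; field.
rewrite sum_edges; apply: eq_bigr => k _.
rewrite (sum_quarters i (fun c c' => wq (k, (c, c')) *
   (if neighbor i c k \in cells G then X k c c' else 0))) /=.
apply: eq_bigr => b _; case: ifP => _; last by rewrite big1// => c _; rewrite mulr0.
by rewrite /A big_distrr; apply: eq_bigr => c _; rewrite (wqE i) /=; field.
Qed.

Lemma sum_edges_dist i (X : int * int -> R) :
  \sum_(s <- int_edges G i) edge_length G i s * dual_dist i s * X s =
  \sum_(j <- idx2 G) wq j *
     (if neighbor i (coord i j.2) j.1 \in cells G then X (face i (coord i j.2) j.1) else 0).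
Proof.
rewrite -(sum_edges_quarters i (fun k b _ => X (face i b k))).
by apply: eq_bigr => s _; rewrite big_bool /= subrK /dual_dist; field.
Qed.

Lemma sum_cells_quarters i (X : int * int -> bool -> bool -> R) :
  \sum_(k <- cells G) wd i k * wd (rev_ord i) k *
     ((X k false false + X k false true + X k true false + X k true true) / 4) =
  \sum_(j <- idx2 G) wq j * X j.1 (coord i j.2) (coord (rev_ord i) j.2).
Proof.
rewrite sum_idx2; apply: eq_bigr => k _.
rewrite (sum_quarters i (fun c c' => wq (k, (c, c')) * X k c c')) /=.
by rewrite !big_bool /= !(wqE i) /=; field.
Qed.

Lemma sum_cells_cst (X : int * int -> R) :
  \sum_(k <- cells G) area (cell G k) * X k = \sum_(j <- idx2 G) wq j * X j.1.
Proof.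
rewrite -(sum_cells_quarters ord0 (fun k _ _ => X k)).
by apply: eq_bigr => k _; rewrite (area_cell hG) rev0; field.
Qed.

(* Transverse dual fluxes: the flux through a dual edge parallel to e^(i) is the
   half sum of the fluxes through two primal edges t, t - e^(i), so that summing
   against phi amounts to a sum over primal edges orthogonal to e^(j). *)
Lemma sum_transverse i i' (phi F U : int * int -> R) :
  (forall s, s \notin int_edges G i -> phi s = 0) ->
  (forall s, s \notin int_edges G i' -> F s = 0) ->
  \sum_(s <- int_edges G i) phi s *
     (2^-1 * (F (s + evec i') + F (s - evec i + evec i')) * U (s + evec i') -
      2^-1 * (F s + F (s - evec i)) * U s) =
  - \sum_(t <- int_edges G i') F t * (\sum_(c : bool) let s := face i c t in
       U s * (phi s - phi (s - evec i')) / 2).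
Proof.
move=> phi0 F0.
have E v w : \sum_(s <- int_edges G i) phi s * (F (s + v) * U (s + w)) =
    \sum_(t <- int_edges G i') F t * (phi (t - v) * U (t - v + w)).
  rewrite (@sum_shift _ _ (int_edges G i') (- v)).
  - by apply: eq_bigr => t _; rewrite subrK mulrCA.
  - by move=> s _ h; rewrite F0 ?mul0r ?mulr0//; move: h; rewrite opprK.
  - by move=> t _ h; rewrite phi0 ?mul0r.
transitivity (2^-1 * (\sum_(s <- int_edges G i) phi s * (F (s + evec i') * U (s + evec i')) +
   \sum_(s <- int_edges G i) phi s * (F (s + (evec i' - evec i)) * U (s + evec i')) -
   \sum_(s <- int_edges G i) phi s * (F (s + 0) * U (s + 0)) -
   \sum_(s <- int_edges G i) phi s * (F (s + - evec i) * U (s + 0)))).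
  rewrite -big_split -!sumrB big_distrr; apply: eq_bigr => s _ /=.
  by rewrite !addr0 (addrC (evec i')) addrA; ring.
rewrite !E -big_split -!sumrB big_distrr -sumrN; apply: eq_bigr => t _ /=.
have e1 : t - evec i' + evec i' = t by rewrite subrK.
have e2 : t - (evec i' - evec i) = t + evec i - evec i'.
  by rewrite opprB addrA.
have e3 : t - (evec i' - evec i) + evec i' = t + evec i by rewrite e2 subrK.
have e4 : t - 0 = t by rewrite subr0.
have e5 : t - 0 + 0 = t by rewrite addr0 subr0.
have e6 : t - - evec i = t + evec i by rewrite opprK.
have e7 : t - - evec i + 0 = t + evec i by rewrite addr0 opprK.
rewrite e1 e3 e2 e5 e4 e7 e6 big_bool /=.
by field.
Qed.

Lemma area_cellE i k : area (cell G k) = wd i k * wd (rev_ord i) k.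
Proof.
rewrite (area_cell hG); by case: (ord2P i) => ->; rewrite ?rev0 ?revM// mulrC.
Qed.

(** The midpoint of the edge [s]. Momentum is tested at these points, mass at the centers [cpt]. *)
Definition fpt i s : R * R :=
  if i == ord0 then (low G i s, mid G (rev_ord i) s) else (mid G (rev_ord i) s, low G i s).

Definition cpt k : R * R := (mid G ord0 k, mid G ord_max k).

Lemma coord_fpt i s : coord i (fpt i s) = low G i s.
Proof. by rewrite /fpt; case: (ord2P i) => ->. Qed.

Lemma coord_fpt' i s : coord (rev_ord i) (fpt i s) = mid G (rev_ord i) s.
Proof. by rewrite /fpt; case: (ord2P i) => ->. Qed.

Lemma coord_cpt i k : coord i (cpt k) = mid G i k.
Proof. exact: (coord_pair i (fun i => mid G i k)). Qed.

Lemma mid_rev i s : mid G (rev_ord i) (s - evec i) = mid G (rev_ord i) s.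
Proof. by rewrite /mid /upp /low coordB coord_evec (negbTE (rev_ord2_neq i)) subr0. Qed.

Lemma low_rev i s : low G (rev_ord i) (s - evec i) = low G (rev_ord i) s.
Proof. by rewrite /low coordB coord_evec (negbTE (rev_ord2_neq i)) subr0. Qed.

Lemma ord2i i (P : 'I_2 -> Prop) : P i -> P (rev_ord i) -> forall i', P i'.
Proof. by move=> h1 h2 i'; have [->//|/eq_ord2 ->] := eqVneq i' i. Qed.

Lemma fpt_closed i s : closed_cell G s (fpt i s) /\ closed_cell G (s - evec i) (fpt i s).
Proof.
split; apply/closed_cellP => i'; have [->|/eq_ord2 ->] := eqVneq i' i;
  rewrite ?coord_fpt ?coord_fpt' ?mid_rev.
- by rewrite lexx (uppE _ i) lerDl ltW// (wd_gt0 hG).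
- by rewrite (midE _ (rev_ord i)) (uppE _ (rev_ord i)); have := wd_gt0 hG (rev_ord i) s; lra.
- have := uppE G i (s - evec i); rewrite upp_shift => h.
  have := wd_gt0 hG i (s - evec i); lra.
- rewrite low_rev (midE _ (rev_ord i)) (uppE _ (rev_ord i)) low_rev wd_rev.
  by have := wd_gt0 hG (rev_ord i) s; lra.
Qed.

Lemma face_fpt i b k : closed_cell G k (fpt i (face i b k)).
Proof.
case: b => /=; last by have [] := fpt_closed i k.
by have [_] := fpt_closed i (k + evec i); rewrite addrK.
Qed.

(** From [x], move slightly towards the center of [k]. The new point is strictly inside [k] and
    still in the open set [Omega], so it lies in a closed cell of the mesh, which must be [k] by
    [cell_disjoint]: a contradiction. *)
Lemma outer_cell k x : open Omega -> k \notin cells G -> closed_cell G k x -> ~ Omega x.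
Proof.
move=> oO kG /closed_cellP kx Ox.
have /nbhs_ballP[r /= r0 hr] : nbhs x Omega by exact: open_nbhs_nbhs.
pose c i := mid G i k.
(* [0 < t < 1] puts the new point strictly inside the cell; the second bound keeps the displacement
   below the radius [r]. *)
pose t : R := Num.min (1/2) (r / (1 + `|c ord0 - coord ord0 x| + `|c ord_max - coord ord_max x|) / 2).
have S0 : 0 < 1 + `|c ord0 - coord ord0 x| + `|c ord_max - coord ord_max x|.
  by rewrite !ltr_wpDr.
have t0 : 0 < t by rewrite lt_min !divr_gt0.
have t1 : t < 1 by rewrite gt_min; apply/orP; left; lra.
pose y i := coord i x + t * (c i - coord i x).
have cy : cell G k (y ord0, y ord_max).
  apply/cellP => i; rewrite (coord_pair i y) /y /c.
  have /andP[h1 h2] := kx i; have := wd_gt0 hG i k.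
  rewrite (midE _ i); move: h2; rewrite (uppE _ i) => h2 w0.
  have := mulr_gt0 t0 w0; move: h1 h2; set a := low _ _ _; set w := wd _ _; nra.
have Oy : Omega (y ord0, y ord_max).
  apply: hr; rewrite /ball /= /prod_ball /=.
  have tr : t * (1 + `|c ord0 - coord ord0 x| + `|c ord_max - coord ord_max x|) < r.
    apply: (@le_lt_trans _ _ (r / 2)); last by lra.
    by rewrite -ler_pdivlMr// ge_min mulrAC lexx orbT.
  split; rewrite /ball /= /y opprD addrA subrr sub0r normrN normrM (gtr0_norm t0).
    apply: le_lt_trans tr; rewrite ler_wpM2l ?(ltW t0)//.
    by have := normr_ge0 (c ord_max - coord ord_max x); rewrite /coord /=; lra.
  apply: le_lt_trans tr; rewrite ler_wpM2l ?(ltW t0)//.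
  by have := normr_ge0 (c ord0 - coord ord0 x); rewrite /coord /=; lra.
have [k' k'G k'x] := Omega_closed_cell hG Oy.
by move: kG; rewrite (cell_disjoint hG cy k'x) k'G.
Qed.

End grid_sums.

Definition mkb (i : 'I_2) (c c' : bool) : bool * bool :=
  if i == ord0 then (c, c') else (c', c).

Lemma mkbE i b : mkb i (coord i b) (coord (rev_ord i) b) = b.
Proof. by case: b => ? ?; case: (ord2P i) => ->. Qed.

Lemma coord_mkb i c c' : coord i (mkb i c c') = c.
Proof. by case: (ord2P i) => ->. Qed.

Lemma flip_mkb i c c' : flip i (mkb i c c') = mkb i (~~ c) c'.
Proof. by case: (ord2P i) => ->. Qed.

Lemma flip_mkb' i c c' : flip (rev_ord i) (mkb i c c') = mkb i c (~~ c').
Proof. by case: (ord2P i) => ->; rewrite ?rev0 ?revM. Qed.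

Lemma sum_bool2 {V : nmodType} (F : bool * bool -> V) :
  \sum_(J : bool * bool) F J = F (true, true) + F (true, false) + (F (false, true) + F (false, false)).
Proof.
rewrite (eq_bigr (fun J => F (J.1, J.2))); last by move=> [].
by rewrite -(pair_bigA _ (fun b b' => F (b, b'))) /= !big_bool.
Qed.

(** * Averages over cells and dual cells *)

Section dual_cells.
Context {R : realType}.
Variables (Omega : set (R * R)) (G : grid R).
Hypothesis hG : mac_grid Omega G.
Hypothesis mOmega : measurable (Omega : set (measurableTypeR R * measurableTypeR R)).
Hypothesis finOmega : (mu2 R Omega < +oo)%E.
Implicit Types (i : 'I_2) (k s : int * int) (j : ind2).
Local Notation wd := (wd G).
Local Notation quarter := (quarter G).
Local Notation m2 := (mu2 R).
Local Notation itgO f := (m2.-integrable Omega (EFin \o f)).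

Definition off_lines (x : R * R) := forall p, p \in grid_lines G -> coord p.1 x != p.2.

(** A constant sequence of partitions, so that [rint_part] and [sum_wt] split integrals and areas of
    cells and dual cells into quarters. *)
Lemma quarter_partition (A : set (measurableTypeR R * measurableTypeR R)) (L : seq ind2) :
  measurable A -> A `<=` Omega -> uniq L ->
  (forall j, j \in L -> quarter j `<=` A) ->
  (forall x, A x -> off_lines x -> exists2 j, j \in L & quarter j x) ->
  partitions m2 A (fun=> L) (fun=> quarter).
Proof.
move=> mA AO uL LA cA; split => //.
- by apply: le_lt_trans finOmega; apply: le_measure; rewrite ?inE.
- by move=> _ j; exact: measurable_obox.
- by move=> _ j j' _ _ [x [q q']]; exact: (quarter_disjoint hG q q').
- move=> _; apply: (null_lines (L := grid_lines G)).
    by apply: measurableD => //; apply: bigsetU_measurable => j _; exact: measurable_obox.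
  move=> x [Ax nU]; apply: contrapT => h; apply: nU; apply/bigsetU_seqP.
  have ox : off_lines x.
    by move=> p pG; apply/eqP => e; apply: h; exists p.
  by have [j jL qj] := cA x Ax ox; exists j.
Qed.

Lemma off_lines_cell k x : k \in cells G -> off_lines x -> cell G k x ->
  exists b, quarter (k, b) x.
Proof.
move=> kG ox kx; have [h|[p pG px]] := off_lines_dec x kG.
  exact: (off_lines_quarter (cell_closed kx) h).
by have := ox p pG; rewrite px eqxx.
Qed.

Definition cell_quarters k : seq ind2 :=
  [:: (k, (true, true)); (k, (true, false)); (k, (false, true)); (k, (false, false))].

Lemma cell_partition k : k \in cells G ->
  partitions m2 (cell G k) (fun=> cell_quarters k) (fun=> quarter).
Proof.
move=> kG; apply: quarter_partition.
- exact: measurable_obox.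
- exact: (cell_sub hG kG).
- by rewrite /= !inE !xpair_eqE /= !andbF.
- move=> j; rewrite !inE => hj; have -> : k = j.1 by case/or4P : hj => /eqP ->.
  exact: (quarter_cell hG).
- move=> x kx ox; have [b qb] := off_lines_cell kG ox kx.
  by exists (k, b) => //; case: b {qb} => -[] []; rewrite !inE eqxx ?orbT.
Qed.

Definition half_lo i b k i' := if (i' == i) && b then mid G i' k else low G i' k.
Definition half_up i b k i' := if (i' == i) && ~~ b then mid G i' k else upp G i' k.

Lemma half_cellP i b k x : half_cell G i b k x <->
  forall i', half_lo i b k i' < coord i' x < half_up i b k i'.
Proof.
split.
  move=> [/cellP kx hb] i'; rewrite /half_lo /half_up; have /andP[h1 h2] := kx i'.
  have [->|] := eqVneq i' i; last by rewrite /= h1 h2.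
  have /andP[h3 h4] := kx i; move: hb.
  by case: b => /= ->; rewrite ?h3 ?h4.
move=> h; have := wd_gt0 hG i k => w0; split.
  apply/cellP => i'; have := h i'; rewrite /half_lo /half_up.
  have [->|] := eqVneq i' i; last by [].
  by case: b {h} => /= /andP[h1 h2]; move: h1 h2; rewrite !midE !uppE; lra.
have := h i; rewrite /half_lo /half_up eqxx /=.
by case: b {h} => /= /andP[h1 h2].
Qed.

Lemma half_cellE i b k : half_cell G i b k =
  obox (half_lo i b k ord0, half_lo i b k ord_max) (half_up i b k ord0, half_up i b k ord_max).
Proof.
apply/seteqP; split => x.
  move=> /half_cellP h i'; have := h i'.
  by rewrite !(coord_pair i' (fun i' => _ i b k i')).
move=> h; apply/half_cellP => i'; have := h i'.
by rewrite !(coord_pair i' (fun i' => _ i b k i')).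
Qed.

Lemma half_sub i b k : half_cell G i b k `<=` cell G k.
Proof. by move=> x []. Qed.

Lemma measurable_half i b k :
  measurable (half_cell G i b k : set (measurableTypeR R * measurableTypeR R)).
Proof. by rewrite half_cellE; exact: measurable_obox. Qed.

Lemma area_half i b k : area (half_cell G i b k) = wd i k * wd (rev_ord i) k / 2.
Proof.
have hw i' : half_up i b k i' - half_lo i b k i' = if i' == i then wd i' k / 2 else wd i' k.
  rewrite /half_lo /half_up; case: eqP => //= _.
  by case: (b); rewrite /= !midE ?uppE; field.
have hlt i' : half_lo i b k i' < half_up i b k i'.
  by rewrite -subr_gt0 hw; case: ifP => _; rewrite ?divr_gt0// (wd_gt0 hG).
rewrite /area half_cellE mu2_obox //= !hw.
by case: (ord2P i) => ->; rewrite ?rev0 ?revM /=; field.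
Qed.

Lemma dual_cellE i s : s \in int_edges G i ->
  dual_cell G i s = half_cell G i false s `|` half_cell G i true (s - evec i).
Proof.
rewrite mem_int_edges => /andP[sG eG]; apply/seteqP; split => x.
  by move=> [[_ h]|[_ h]]; [left|right].
by move=> [h|h]; [left|right].
Qed.

Definition dual_quarters i s : seq ind2 :=
  [:: (s, mkb i false true); (s, mkb i false false);
      (s - evec i, mkb i true true); (s - evec i, mkb i true false)].

Lemma quarter_half i b c k : quarter (k, mkb i b c) `<=` half_cell G i b k.
Proof.
move=> x qx; split; first exact: (quarter_cell hG qx).
have /quarterP/(_ i) := qx; rewrite /qlo /qup /= coord_mkb.
by case: b {qx} => /andP[].
Qed.

Lemma half_quarter i b k x : k \in cells G -> off_lines x -> half_cell G i b k x ->
  exists c, quarter (k, mkb i b c) x.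
Proof.
move=> kG ox [kx hb]; have [b' qb] := off_lines_cell kG ox kx.
exists (coord (rev_ord i) b'); rewrite (_ : mkb _ _ _ = b')//.
rewrite -[RHS](mkbE i); congr mkb.
have /quarterP/(_ i) := qb; rewrite /qlo /qup /=; move: hb.
case: b; case: (coord i b') => // h1 /andP[h2 h3].
  by have := lt_trans h1 h3; rewrite ltxx.
by have := lt_trans h1 h2; rewrite ltxx.
Qed.

Lemma neq_sub_evec i s : (s == s - evec i) = false.
Proof.
apply/negbTE/eqP => /(congr1 (coord i)); rewrite coordB coord_evec eqxx => /eqP.
by rewrite eq_sym subr_eq -subr_eq0 opprD addrA subrr sub0r oppr_eq0.
Qed.

Lemma dual_partition i s : s \in int_edges G i ->
  partitions m2 (dual_cell G i s) (fun=> dual_quarters i s) (fun=> quarter).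
Proof.
move=> sI; have := sI; rewrite mem_int_edges => /andP[sG eG].
rewrite dual_cellE//; apply: quarter_partition.
- by apply: measurableU; exact: measurable_half.
- by rewrite subUset; split => x /half_sub; exact: (cell_sub hG).
- rewrite /= !inE !xpair_eqE !(neq_sub_evec i s) /= !eqxx /=.
  by case: (ord2P i) => ->.
- move=> j; rewrite !inE => /or4P[] /eqP -> x /quarter_half; by [left|right].
- move=> x [h|h] ox.
    by have [c qc] := half_quarter sG ox h; exists (s, mkb i false c) => //;
      case: c {qc}; rewrite !inE eqxx ?orbT.
  by have [c qc] := half_quarter eG ox h; exists (s - evec i, mkb i true c) => //;
    case: c {qc}; rewrite !inE eqxx ?orbT.
Qed.

Lemma rint_cell k (f : R * R -> R) : k \in cells G -> itgO f ->
  \int[m2]_(x in cell G k) f x = \sum_(j <- cell_quarters k) \int[m2]_(x in quarter j) f x.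
Proof.
move=> kG hf; apply: (rint_part (cell_partition kG) 0).
by apply: integrableS hf => //; [exact: measurable_obox|exact: (cell_sub hG)].
Qed.

Lemma rint_dual i s (f : R * R -> R) : s \in int_edges G i -> itgO f ->
  \int[m2]_(x in dual_cell G i s) f x =
  \sum_(j <- dual_quarters i s) \int[m2]_(x in quarter j) f x.
Proof.
move=> sI hf; apply: (rint_part (dual_partition sI) 0).
have := sI; rewrite mem_int_edges => /andP[sG eG].
rewrite dual_cellE//; apply: integrableS hf => //.
  by apply: measurableU; exact: measurable_half.
by rewrite subUset; split => x /half_sub; exact: (cell_sub hG).
Qed.

Lemma wt_quarter (m : nat) j : wt m2 (fun=> quarter) m j = wq G j.
Proof. by rewrite /wt (mu2_quarter hG). Qed.

Lemma area_dual i s : s \in int_edges G i ->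
  area (dual_cell G i s) = edge_length G i s * dual_dist G i s.
Proof.
move=> sI; rewrite /area -(sum_wt (dual_partition sI) 0).
by rewrite !big_cons big_nil !wt_quarter !(wqE _ i) /= edge_lengthE wd_rev /dual_dist; field.
Qed.

(** The four quarters of a cell are reached by composing two reflections. Compositions of tame
    shifts are tame, so [cva_mean] applies. *)
Definition rcell (J : bool * bool) j : ind2 :=
  let j1 := if J.1 then reflect_mid ord0 j else j in
  if J.2 then reflect_mid ord_max j1 else j1.

(** Without neighbour across the face, the list repeats the two quarters of the half cell and
    represents no dual cell of an internal edge. *)
Definition rdual i (J : bool * bool) j : ind2 :=
  let j1 := if J.1 then reflect_face G i j else j in
  if J.2 then reflect_mid (rev_ord i) j1 else j1.

Lemma sum_rcell j (F : ind2 -> R) :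
  \sum_(J : bool * bool) F (rcell J j) = \sum_(j' <- cell_quarters j.1) F j'.
Proof.
rewrite sum_bool2 !big_cons big_nil; case: j => k [a b].
by rewrite /rcell /reflect_mid /=; case: a; case: b => /=; ring.
Qed.

Lemma sum_rdual i j (F : ind2 -> R) : neighbor i (coord i j.2) j.1 \in cells G ->
  \sum_(J : bool * bool) F (rdual i J j) =
  \sum_(j' <- dual_quarters i (face i (coord i j.2) j.1)) F j'.
Proof.
rewrite sum_bool2 !big_cons big_nil; case: j => k b /= nG.
rewrite -(mkbE i b); move: nG; rewrite -{1}(mkbE i b) coord_mkb => nG.
set a := coord i b in nG *; set c := coord _ b.
rewrite /rdual /reflect_face /reflect_mid /= !coord_mkb nG /= !flip_mkb !flip_mkb'.
by case: a nG => /=; case: c => /= _; rewrite ?addrK; ring.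
Qed.

End dual_cells.

Lemma dir_mvt_signed {R : realType} {V : normedModType R} (f : V -> R) (v x : V) (s : R) :
  (forall y, derivable f y v) ->
  exists2 t, `|t| <= `|s| & f (x + s *: v) - f x = s * 'D_v f (x + t *: v).
Proof.
move=> df; have [s0|s0|<-] := ltgtP 0 s; last first.
- by exists 0; rewrite // !scale0r addr0 subrr mul0r.
- have s0' : 0 < - s by rewrite oppr_gt0.
  have [t /andP[t0 ts] h] := dir_mvt (x + s *: v) df s0'.
  exists (s + t); first by rewrite !ler0_norm; lra.
  by rewrite scaleNr addrK in h; rewrite scalerDl addrA -[LHS]opprB h mulNr opprK.
- have [t /andP[t0 ts] h] := dir_mvt x df s0.
  by exists t => //; rewrite !ger0_norm; lra.
Qed.

(** * First moments of rectangles *)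

Section moments.
Context {R : realType}.
Local Notation leb := (@lebesgue_measure R).

Lemma rint_shift_itv (a b : R) : a < b ->
  \int[leb]_(x in [set` `]a, b[ ]) (x - a) = (b - a) ^+ 2 / 2.
Proof.
move=> ab; pose F (x : R) := 2^-1 * (x - a) ^+ 2.
have dF (x : R) : is_derive x (1 : R) F (x - a).
  by rewrite /F; apply: is_derive_eq; rewrite /GRing.scale /=; field.
have cF : continuous F.
  by move=> x; apply: differentiable_continuous; apply/derivable1_diffP; exact: ex_derive.
have cf : continuous (fun x : R => x - a).
  by move=> x; apply: cvgB; [exact: cvg_id|exact: cvg_cst].
have := @continuous_FTC2 R (fun x => x - a) F a b ab (continuous_subspaceT cf).
move=> /(_ _ _)/wrap[].
- split; first by move=> x _; exact: ex_derive.
    by apply: cvg_at_right_filter; exact: cF.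
  by apply: cvg_at_left_filter; exact: cF.
- by move=> x _; rewrite derive1E; exact: derive_val.
rewrite (@integral_itv_bndoo R a b) => [h|]; last first.
  by apply/measurable_EFinP; apply: measurable_funTS; exact: continuous_measurable_fun.
by rewrite /Rintegral h /= /F subrr expr0n /= mulr0 subr0 mulrC.
Qed.

Variables (a b : R * R).
Hypotheses (ab1 : a.1 < b.1) (ab2 : a.2 < b.2).

Lemma itg_oboxT (f : R * R -> R) : continuous f ->
  (mu2 R).-integrable (obox a b) (EFin \o f).
Proof.
move=> cf.
have cK : compact ([set` `[a.1, b.1] ] `*` [set` `[a.2, b.2] ] : set (R * R)).
  by apply: compact_setX; exact: segment_compact.
have [M M0 hM] := compact_bound cK cf.
apply: (itg_bnd (measurable_obox a b) (M := M)).
- by rewrite mu2_obox// ltry.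
- by apply: measurable_funTS; exact: continuous_measurable2.
- move=> x; rewrite obox_setX => -[/=]; rewrite !in_itv /= => /andP[h1 h2] /andP[h3 h4].
  by apply: hM; split; rewrite /= in_itv /= !ltW.
Qed.

(** [rint_prod] asks for nonnegative factors. The moment is therefore computed about the lower
    corner, where the coordinate difference is nonnegative, and recentred afterwards. *)
Lemma rint_moment (i : 'I_2) :
  \int[mu2 R]_(x in obox a b) (coord i x - (coord i a + coord i b) / 2) = 0.
Proof.
have c1 : continuous (fun x : R * R => x.1) by move=> x; exact: cvg_fst.
have c2 : continuous (fun x : R * R => x.2) by move=> x; exact: cvg_snd.
have L (f : R * R -> R) c : continuous f ->
    \int[mu2 R]_(x in obox a b) f x = c * fine (mu2 R (obox a b)) ->
    \int[mu2 R]_(x in obox a b) (f x - c) = 0.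
  move=> cf h; rewrite RintegralB//; first by rewrite h rint_cst ?subrr//; exact: measurable_obox.
  - exact: measurable_obox.
  - exact: itg_oboxT.
  - by apply: (itg_oboxT (f := cst c)) => x; exact: cvg_cst.
have mI (c d : R) : measurable ([set` `]c, d[ ] : set (measurableTypeR R)).
  exact: measurable_itv.
have I1 (c d : R) : c < d -> leb.-integrable [set` `]c, d[ ] (EFin \o (fun x : R => x - c)).
  move=> cd; apply: (itg_bnd (mI c d) (M := d - c)).
  - by have := leb_itvoo cd => /= ->; rewrite ltry.
  - by apply: measurable_funTS; apply: continuous_measurable_fun => x; apply: cvgB; [exact: cvg_id|exact: cvg_cst].
  - by move=> x /=; rewrite in_itv /= => /andP[? ?]; rewrite ger0_norm; lra.
have I2 (c d : R) : c < d -> leb.-integrable [set` `]c, d[ ] (EFin \o (cst 1)).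
  move=> cd; apply: (itg_bnd (mI c d) (M := 1)) => //.
    by have := leb_itvoo cd => /= ->; rewrite ltry.
  by move=> x _ /=; rewrite normr1.
have C2 (c d : R) : c < d -> \int[leb]_(x in [set` `]c, d[ ]) (cst 1 x) = d - c.
  move=> cd; rewrite rint_cst ?mul1r; last exact: measurable_itv.
  by have := leb_itvoo cd => /= ->.
have key (i0 : 'I_2) : \int[mu2 R]_(x in obox a b) (coord i0 x - coord i0 a) =
    (coord i0 b - coord i0 a) / 2 * fine (mu2 R (obox a b)).
  rewrite mu2_obox//= obox_setX; case: (ord2P i0) => ->; rewrite /coord /=.
    transitivity (\int[mu2 R]_(x in [set` `]a.1, b.1[ ] `*` [set` `]a.2, b.2[ ]) ((x.1 - a.1) * cst 1 x.2)).
      by apply: eq_Rintegral => x _; rewrite mulr1.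
    rewrite [LHS](@rint_prod _ _ _ _ R leb leb _ _ _ _ (fun x => x - a.1) (cst 1))//.
    - by rewrite (C2 _ _ ab2) rint_shift_itv//; field.
    - exact: I1.
    - exact: I2.
    - by move=> x /=; rewrite in_itv /= => /andP[/ltW]; rewrite subr_ge0.
  transitivity (\int[mu2 R]_(x in [set` `]a.1, b.1[ ] `*` [set` `]a.2, b.2[ ]) (cst 1 x.1 * (x.2 - a.2))).
    by apply: eq_Rintegral => x _; rewrite mul1r.
  rewrite [LHS](@rint_prod _ _ _ _ R leb leb _ _ _ _ (cst 1) (fun x => x - a.2))//.
  - by rewrite (C2 _ _ ab1) rint_shift_itv//; field.
  - exact: I2.
  - exact: I1.
  - by move=> x /=; rewrite in_itv /= => /andP[/ltW]; rewrite subr_ge0.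
have ci : continuous (fun x : R * R => coord i x).
  by rewrite /coord; case: (i == ord0).
rewrite (_ : (fun x => _) = (fun x => (coord i x - coord i a) - (coord i b - coord i a) / 2)); last first.
  by apply/funext => x; field.
apply: L; last exact: key.
by move=> x; apply: cvgB; [exact: ci|exact: cvg_cst].
Qed.

End moments.

(** * Sequences of meshes *)

Section dense_continuous.
Context {R : realType}.
Local Notation leb := (@lebesgue_measure R).

(** Extend [f] by 0, approximate it on the larger set and restrict. This reduces [Omega] to a
    square, where density comes from products. *)
Lemma dense_in_L1_subset d {X : measurableType d} (mu : {measure set X -> \bar R})
    (D B : set X) (C : (X -> R) -> Prop) : measurable D -> measurable B ->
  D `<=` B -> dense_in_L1 mu B C -> dense_in_L1 mu D C.
Proof.
move=> mD mB DB h f hf e e0.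
have hB : mu.-integrable B (EFin \o (f \_ D)).
  rewrite -restrict_EFin; apply/integrable_restrict => //.
  by rewrite (setIidr DB).
have [g Cg [ig hg]] := h _ hB _ e0.
have igD : mu.-integrable D (EFin \o g) by exact: integrableS ig.
exists g => //; split=> //; apply: le_lt_trans hg.
have hi : mu.-integrable B (EFin \o (fun x => `|(f \_ D) x - g x|)).
  by apply: itg_abs => //; exact: itgB.
rewrite (_ : \int[mu]_(x in D) `|f x - g x| = \int[mu]_(x in D) `|(f \_ D) x - g x|); last first.
  by apply: eq_Rintegral => x xD; rewrite patchE xD.
rewrite /Rintegral fine_le//.
- by apply: integrable_fin_num => //; exact: integrableS hi.
- by apply: integrable_fin_num.
- by apply: ge0_subset_integral => //; exact: measurable_int hi.
Qed.

Variable M : R.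
Hypothesis M0 : 0 < M.
Let J : set (measurableTypeR R) := [set` `]- M, M[ ].

Let mJ : measurable J. Proof. exact: measurable_itv. Qed.
Let finJ : (leb J < +oo)%E.
Proof.
have h : - M < M by rewrite gtrN.
by have := leb_itvoo h; rewrite /J => ->; rewrite ltry.
Qed.

Let cbd1 (g : R -> R) : continuous g ->
  measurable_fun J g /\ exists K : R, forall x, J x -> `|g x| <= K.
Proof.
move=> cg; split; first by apply: measurable_funTS; exact: continuous_measurable_fun.
have [K K0 hK] := compact_bound (@segment_compact R (- M) M) cg.
by exists K => x; rewrite /J /= in_itv /= => /andP[h1 h2]; apply: hK; rewrite /= in_itv /= !ltW.
Qed.

Lemma dense_continuous1 : dense_in_L1 leb J (fun g : R -> R => continuous g).
Proof.
move=> f hf e e0.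
have [g_ [cg ig hg]] := approximation_continuous_integrable mJ finJ hf.
have [n _ /(_ n (leqnn n)) /= hn] := (cvgrPdist_lt _ _).1 (fine_cvg hg) e e0.
exists (g_ n); first exact: cg.
split; first exact: ig.
by move: hn; rewrite sub0r normrN; apply: le_lt_trans; exact: ler_norm.
Qed.

Definition box2 : set (R * R) := J `*` J.
Definition box3 (T : R) : set ((R * R) * R) := box2 `*` [set` `]- T, T[ ].

Lemma lin_continuous {V : topologicalType} (b : R) (g1 g2 : V -> R) :
  continuous g1 -> continuous g2 -> continuous (fun x => b * g1 x + g2 x).
Proof.
move=> c1 c2 x; apply: cvgD; last exact: c2.
by apply: cvgM; [exact: cvg_cst|exact: c1].
Qed.

Lemma dense_continuous2 :
  dense_in_L1 (mu2 R) box2 (fun g : R * R -> R => continuous g).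
Proof.
apply: (@dense_in_L1_prod _ _ _ _ _ leb leb J J mJ mJ finJ finJ _ _ _
  dense_continuous1 dense_continuous1 cbd1 cbd1).
- by move=> b g1 g2; exact: lin_continuous.
- by move=> c x; exact: cvg_cst.
- move=> g1 g2 c1 c2 x; apply: cvgM.
    by apply: (cvg_comp fst g1); [exact: cvg_fst|exact: c1].
  by apply: (cvg_comp snd g2); [exact: cvg_snd|exact: c2].
Qed.

End dense_continuous.

Section dense_continuous3.
Context {R : realType}.
Local Notation leb := (@lebesgue_measure R).
Variables (M T : R).
Hypotheses (M0 : 0 < M) (T0 : 0 < T).

Let mI (c : R) : measurable ([set` `]- c, c[ ] : set (measurableTypeR R)).
Proof. exact: measurable_itv. Qed.
Let finI (c : R) : 0 < c -> (leb [set` `](- c)%R, c[ ] < +oo)%E.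
Proof.
move=> c0; have h : - c < c by rewrite gtrN.
by have := leb_itvoo h => ->; rewrite ltry.
Qed.

Lemma measurable_box2 : measurable (box2 M : set (measurableTypeR R * measurableTypeR R)).
Proof. by apply: measurableX; exact: mI. Qed.

Lemma fin_box2 : (mu2 R (box2 M) < +oo)%E.
Proof. exact: (@prod_fin _ _ _ _ R leb leb _ _ (mI M) (mI M) (finI M0) (finI M0)). Qed.

Lemma measurable_box3 :
  measurable (box3 M T : set ((measurableTypeR R * measurableTypeR R) * measurableTypeR R)).
Proof. by apply: measurableX; [exact: measurable_box2|exact: mI]. Qed.

Lemma box2_compact : exists2 K : set (R * R), compact K & box2 M `<=` K.
Proof.
exists ([set` `[- M, M] ] `*` [set` `[- M, M] ]).
  by apply: compact_setX; exact: segment_compact.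
have h x : [set` `]- M, M[ ] x -> [set` `[- M, M] ] x.
  by rewrite /= !in_itv /= => /andP[h1 h2]; rewrite !ltW.
by move=> x [h1 h2]; split; exact: h.
Qed.

Lemma box3_compact : exists2 K : set ((R * R) * R), compact K & box3 M T `<=` K.
Proof.
have [K cK hK] := box2_compact.
exists (K `*` [set` `[- T, T] ]); first by apply: compact_setX => //; exact: segment_compact.
move=> x [/= /hK h1]; rewrite in_itv /= => /andP[h2 h3]; split => //=.
by rewrite in_itv /= !ltW.
Qed.

Lemma dense_continuous3 :
  dense_in_L1 (mu3 R) (box3 M T) (fun g : (R * R) * R -> R => continuous g).
Proof.
have cb2 (g : R * R -> R) : continuous g ->
    measurable_fun (box2 M : set (measurableTypeR R * measurableTypeR R)) g /\
    exists K : R, forall x, box2 M x -> `|g x| <= K.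
  move=> cg; split; first by apply: measurable_funTS; exact: continuous_measurable2.
  have [K cK hK] := box2_compact; have [B B0 hB] := compact_bound cK cg.
  by exists B => x /hK /hB.
have cb1 (g : R -> R) : continuous g ->
    measurable_fun ([set` `]- T, T[ ] : set (measurableTypeR R)) g /\
    exists K : R, forall x, [set` `]- T, T[ ] x -> `|g x| <= K.
  move=> cg; split; first by apply: measurable_funTS; exact: continuous_measurable_fun.
  have [K K0 hK] := compact_bound (@segment_compact R (- T) T) cg.
  by exists K => x /=; rewrite in_itv /= => /andP[h1 h2]; apply: hK; rewrite /= in_itv /= !ltW.
apply: (@dense_in_L1_prod _ _ _ _ R (@product_sfm _ _ _ _ R leb leb) leb _ _ measurable_box2 (mI T)
  fin_box2 (finI T0) _ _ _ (dense_continuous2 M0) (dense_continuous1 T0) cb2 cb1).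
- by move=> b g1 g2; exact: lin_continuous.
- by move=> c x; exact: cvg_cst.
- move=> g1 g2 c1 c2 x; apply: cvgM.
    by apply: (cvg_comp fst g1); [exact: cvg_fst|exact: c1].
  by apply: (cvg_comp snd g2); [exact: cvg_snd|exact: c2].
Qed.

End dense_continuous3.

Lemma le_bigmax_fset {R : realDomainType} (J : choiceType) (A : {fset J}) (F : J -> R) j :
  j \in A -> F j <= \big[Num.max/0]_(i <- A) F i.
Proof. by move=> jA; apply: le_bigmax_seq. Qed.

(** * Mesh size and quasi-uniformity *)

Section grid_size.
Context {R : realType}.
Variables (Omega : set (R * R)) (G : grid R).
Hypothesis hG : mac_grid Omega G.
Implicit Types (i : 'I_2) (k s : int * int).

Lemma wd_le_mesh i k : k \in cells G -> wd G i k <= mesh_size G.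
Proof.
move=> kG; apply: (@le_trans _ _ (Defs.diam G k)); last first.
  exact: (le_bigmax_fset (Defs.diam G) kG).
rewrite /Defs.diam -[leLHS](ger0_norm (ltW (wd_gt0 hG i k))) -sqrtr_sqr ler_wsqrtr//.
by rewrite (sum_ord2i i) lerDl sqr_ge0.
Qed.

Lemma regularity_le eta i i' s s' : mesh_regularity G <= eta -> i' != i ->
  s \in edges G i -> s' \in edges G i' ->
  edge_length G i s <= eta * edge_length G i' s'.
Proof.
move=> h ii sE sE'; rewrite -ler_pdivrMr; last exact: (wd_gt0 hG).
apply: le_trans h; rewrite /mesh_regularity.
pose F2 j s := \big[Num.max/0]_(s' <- edges G j) (edge_length G i s / edge_length G j s').
pose F1 j := \big[Num.max/0]_(s <- edges G i) F2 j s.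
apply: le_trans; last by apply: (le_bigmax _ _ i).
apply: (@le_trans _ _ (F1 i')).
  apply: (@le_trans _ _ (F2 i' s)); last exact: (le_bigmax_fset (F2 i') sE).
  exact: (le_bigmax_fset (fun s' => edge_length G i s / edge_length G i' s') sE').
have := @le_bigmax_cond _ _ _ (0 : R) i' (fun j => j != i) F1 ii; exact.
Qed.

Variable eta : R.
Hypotheses (eta0 : 0 < eta) (heta : mesh_regularity G <= eta).
Let K := eta + eta ^+ 2.

(** The regularity compares edges of different directions only. Two widths in the same direction are
    compared through a perpendicular one, which costs [eta ^+ 2]. *)
Lemma quasi_uniform i i' k k' : k \in cells G -> k' \in cells G ->
  wd G i k <= K * wd G i' k'.
Proof.
move=> kG kG'.
have ne (i0 : 'I_2) l l' : l \in cells G -> l' \in cells G ->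
    wd G (rev_ord i0) l <= eta * wd G i0 l'.
  move=> lG lG'; have := @regularity_le eta i0 (rev_ord i0) l l' heta (rev_ord2_neq i0).
  rewrite !edge_lengthE rev_ordK; apply.
    exact: (face_edges i0 false lG).
  exact: (face_edges (rev_ord i0) false lG').
have w0 := wd_gt0 hG i' k'; have e2 : 0 <= eta ^+ 2 by exact: sqr_ge0.
have [->|ii] := eqVneq i i'.
  have := ne (rev_ord i') k k' kG kG'; rewrite rev_ordK => h1.
  have := ne i' k' k' kG' kG' => h2.
  apply: (le_trans h1); apply: (@le_trans _ _ (eta * (eta * wd G i' k'))).
    by rewrite ler_pM2l.
  by rewrite mulrA -expr2 /K ler_wpM2r ?(ltW w0)// lerDr ltW.
rewrite (eq_ord2 ii); apply: (le_trans (ne i' k k' kG kG')).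
by rewrite /K ler_wpM2r ?(ltW w0)// lerDl.
Qed.

(** A diameter is at most the sum of the two sides, each of which is at most [K] times any given
    width. *)
Lemma mesh_le_wd i k : k \in cells G -> mesh_size G <= 2 * K * wd G i k.
Proof.
move=> kG; have K0 : 0 < K by rewrite /K addr_gt0// exprn_gt0.
have w0 := wd_gt0 hG i k.
rewrite /mesh_size big_seq; apply: bigmax_le => [|l lG].
  by rewrite !mulr_ge0// ltW.
have q0 := quasi_uniform i i lG kG; have q1 := quasi_uniform (rev_ord i) i lG kG.
have l0 := wd_gt0 hG i l; have l1 := wd_gt0 hG (rev_ord i) l.
apply: (@le_trans _ _ (wd G i l + wd G (rev_ord i) l)); last by rewrite /wd in q0 q1 *; lra.
have s0 : 0 <= wd G i l + wd G (rev_ord i) l by rewrite addr_ge0// ltW.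
rewrite -[leRHS](ger0_norm s0) -sqrtr_sqr ler_wsqrtr//.
rewrite (_ : \sum_(_ < _) _ = wd G i l ^+ 2 + wd G (rev_ord i) l ^+ 2); last by rewrite (sum_ord2i i).
by have := mulr_gt0 l0 l1; nra.
Qed.

Lemma mesh_ge0 : 0 <= mesh_size G.
Proof. by rewrite /mesh_size; exact: bigmax_ge_id. Qed.

End grid_size.

Section shift_composition.
Context d {X : measurableType d} {R : realType}.
Variable mu : {measure set X -> \bar R}.
Variables (I : eqType) (idx : nat -> seq I) (Q : nat -> I -> set X).
Variable C : (X -> R) -> Prop.
Variable pt : nat -> I -> X.
Hypothesis ptQ : forall m i, i \in idx m -> Q m i (pt m i).

Lemma tame_shift_comp s1 s2 : tame_shift mu idx Q C s1 -> tame_shift mu idx Q C s2 ->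
  tame_shift mu idx Q C (fun m i => s2 m (s1 m i)).
Proof.
move=> t1 t2; split.
- by move=> m i im; apply: (shift_idx t2); exact: (shift_idx t1).
- have [K1 K10 h1] := shift_sum t1; have [K2 K20 h2] := shift_sum t2.
  exists (K1 * K2); first by rewrite mulr_ge0.
  move=> m F F0; apply: (le_trans (h1 m (F \o s2 m) _)).
    by move=> i im; apply: F0; exact: (shift_idx t2).
  by rewrite -mulrA ler_wpM2l// h2.
- have [K1 K10 h1] := shift_wt t1; have [K2 K20 h2] := shift_wt t2.
  exists (K1 * K2); first by rewrite mulr_ge0.
  move=> m i im; apply: (le_trans (h1 m i im)); rewrite -mulrA ler_wpM2l// h2//.
  exact: (shift_idx t1).
- move=> g Cg e e0; have e20 : 0 < e / 2 by rewrite divr_gt0.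
  near=> m => i x y im Qx Qy.
  have h1 : forall i x y, i \in idx m -> Q m i x -> Q m (s1 m i) y -> `|g x - g y| <= e / 2.
    by near: m; exact: (shift_near t1).
  have h2 : forall i x y, i \in idx m -> Q m i x -> Q m (s2 m i) y -> `|g x - g y| <= e / 2.
    by near: m; exact: (shift_near t2).
  have sim := shift_idx t1 im.
  apply: le_trans (ler_distD (g (pt m (s1 m i))) _ _) _.
  rewrite (splitr e) lerD//; first by apply: (h1 i) => //; exact: ptQ.
  by apply: (h2 (s1 m i)) => //; exact: ptQ.
Unshelve. all: by end_near. Qed.

End shift_composition.

Section mesh_sequences.
Context {R : realType}.
Variables (Omega : set (R * R)) (T : R) (G : nat -> grid R) (N : nat -> nat).

Record mesh_sequence : Prop := MeshSequence {
  ms_open : open Omega;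
  ms_bounded : bounded_set Omega;
  ms_rect : union_of_rectangles Omega;
  ms_T : 0 < T;
  ms_mac : forall m, mac_grid Omega (G m);
  ms_N : forall m, (0 < N m)%N;
  ms_dt : T / (N m)%:R @[m --> \oo] --> (0 : R);
  ms_mesh : mesh_size (G m) @[m --> \oo] --> (0 : R);
  ms_reg : exists2 eta : R, 0 < eta & forall m, mesh_regularity (G m) <= eta }.

Hypothesis S : mesh_sequence.
Local Notation dt := (tstep T N).

Lemma measurable_Omega : measurable (Omega : set (measurableTypeR R * measurableTypeR R)).
Proof.
have [s ->] := ms_rect S.
apply: fin_bigcup_measurable; first exact: finite_seq.
by move=> r _; exact: measurable_obox.
Qed.

Lemma closure_bound : exists2 M : R, 0 < M & closure Omega `<=` box2 M.
Proof.
have [M [_ hM]] := ms_bounded S.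
have h0 : `|M| + 1 > M by rewrite ltr_pwDr// ler_norm.
(* [|M| + 1] bounds [Omega], a point of the closure is within distance 1 of it, and one more unit
   gives the strict inequality of the open box. *)
exists (`|M| + 3); first by rewrite ltr_wpDl.
move=> x cx; have [y [Oy]] := cx _ (nbhsx_ballx x 1 ltr01).
have := hM _ h0 y Oy; rewrite /= prod_normE ge_max => /andP[n1 n2] [b1 b2].
move: n1 n2 b1 b2; rewrite /ball /= !ler_norml !ltr_norml => /andP[? ?] /andP[? ?] /andP[? ?] /andP[? ?].
by split => /=; rewrite in_itv /=; apply/andP; split; lra.
Qed.

Lemma Omega_bound : exists2 M : R, 0 < M & Omega `<=` box2 M.
Proof.
have [M M0 h] := closure_bound; exists M => // x Ox; apply: h; exact: subset_closure.
Qed.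

Lemma fin_Omega : (mu2 R Omega < +oo)%E.
Proof.
have [M M0 OM] := Omega_bound; apply: le_lt_trans (fin_box2 M0).
apply: le_measure; rewrite ?inE//; [exact: measurable_Omega|exact: measurable_box2].
Qed.

Lemma partitions2 : partitions (mu2 R) Omega (fun m => idx2 (G m)) (fun m => quarter (G m)).
Proof.
split.
- exact: measurable_Omega.
- exact: fin_Omega.
- by move=> m; exact: idx2_uniq.
- by move=> m j; exact: measurable_obox.
- move=> m j; rewrite mem_idx2 => jG x qx.
  by apply: (cell_sub (ms_mac S m) jG); exact: (quarter_cell (ms_mac S m)).
- by move=> m j j' _ _ [x [q q']]; exact: (quarter_disjoint (ms_mac S m) q q').
- by move=> m; apply: Omega_cover; [exact: ms_mac|exact: measurable_Omega].
Qed.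

Lemma wt2 m j : wt (mu2 R) (fun m => quarter (G m)) m j = wq (G m) j.
Proof. by rewrite /wt (mu2_quarter (ms_mac S m)). Qed.

Definition ind3 : eqType := (ind2 * nat)%type.
Definition idx3 m : seq ind3 := [seq (i, j) | i <- idx2 (G m), j <- tidx N m].
Definition Q3 m (p : ind3) : set ((measurableTypeR R * measurableTypeR R) * measurableTypeR R) :=
  quarter (G m) p.1 `*` slab T N m p.2.

Lemma partitions3 : partitions (mu3 R) (cylinder Omega T) idx3 Q3.
Proof. exact: (prod_partitions partitions2 (time_partitions (ms_T S) (ms_N S))). Qed.

Lemma mem_idx3 m (p : ind3) : (p \in idx3 m) = (p.1.1 \in cells (G m)) && (p.2 < N m)%N.
Proof. by rewrite -mem_idx2 -mem_tidx; exact: (@mem_idx_prod _ _ (fun m => idx2 (G m)) (tidx N)). Qed.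

Lemma wt3 m p : p \in idx3 m -> wt (mu3 R) Q3 m p = wq (G m) p.1 * dt m.
Proof.
move=> pm; rewrite [LHS](wt_prod partitions2 (time_partitions (ms_T S) (ms_N S)) pm) wt2.
by congr (_ * _); transitivity (fine (dt m)%:E) => //; congr fine; apply: leb_slab; [exact: ms_T S|exact: ms_N S].
Qed.

Lemma sum_idx3 m (F : ind3 -> R) :
  \sum_(p <- idx3 m) F p = \sum_(n < N m) \sum_(j <- idx2 (G m)) F (j, (n : nat)).
Proof.
rewrite /idx3 big_allpairs exchange_big /= /tidx -{1}(subn0 (N m)).
by rewrite -/(index_iota 0 (N m)) big_mkord.
Qed.

Lemma sum_wt3 m (F : ind3 -> R) :
  \sum_(p <- idx3 m) wt (mu3 R) Q3 m p * F p =
  \sum_(n < N m) dt m * \sum_(j <- idx2 (G m)) wq (G m) j * F (j, (n : nat)).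
Proof.
rewrite (eq_big_seq (fun p : ind3 => wq (G m) p.1 * dt m * F p)); last first.
  by move=> p pm; rewrite wt3.
rewrite sum_idx3; apply: eq_bigr => n _; rewrite big_distrr; apply: eq_bigr => j _ /=.
ring.
Qed.

Lemma quasi : exists2 K : R, 0 < K & forall m i i' k k',
  k \in cells (G m) -> k' \in cells (G m) -> wd (G m) i k <= K * wd (G m) i' k'.
Proof.
have [eta e0 he] := ms_reg S; exists (eta + eta ^+ 2); first by rewrite addr_gt0// exprn_gt0.
by move=> m i i' k k'; exact: (quasi_uniform (ms_mac S m) e0 (he m)).
Qed.

Lemma mesh_le : exists2 K : R, 0 < K & forall m i k,
  k \in cells (G m) -> mesh_size (G m) <= K * wd (G m) i k.
Proof.
have [eta e0 he] := ms_reg S; exists (2 * (eta + eta ^+ 2)).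
  by rewrite mulr_gt0// addr_gt0// exprn_gt0.
by move=> m i k; exact: (mesh_le_wd (ms_mac S m) e0 (he m)).
Qed.

Lemma mesh_small (e : R) : 0 < e -> \forall m \near \oo, mesh_size (G m) < e.
Proof.
move=> e0; have [n _ h] := (cvgrPdist_lt _ _).1 (ms_mesh S) _ e0.
by exists n => // m /h; rewrite sub0r normrN; apply: le_lt_trans; exact: ler_norm.
Qed.

Lemma dt_small (e : R) : 0 < e -> \forall m \near \oo, dt m < e.
Proof.
move=> e0; have [n _ h] := (cvgrPdist_lt _ _).1 (ms_dt S) _ e0.
by exists n => // m /h; rewrite sub0r normrN; apply: le_lt_trans; exact: ler_norm.
Qed.

Lemma dt_gt0 m : 0 < dt m. Proof. by apply: tstep_gt0; [exact: ms_T S|exact: ms_N S]. Qed.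

Lemma uniform2 (g : R * R -> R) : continuous g -> forall e : R, 0 < e ->
  exists2 r : R, 0 < r & forall x y, closure Omega x ->
    (forall i, `|coord i x - coord i y| < r) -> `|g x - g y| < e.
Proof.
move=> cg e e0; have [M M0 OM] := closure_bound.
have [K cK hK] := box2_compact M.
have [r r0 hr] := heine_cantor cK cg e0; exists r => // x y cx h.
apply: hr; first by apply: hK; exact: OM.
by split; [exact: (h ord0)|exact: (h ord_max)].
Qed.

Lemma uniform3 (g : (R * R) * R -> R) : continuous g -> forall e : R, 0 < e ->
  exists2 r : R, 0 < r & forall x y t t', closure Omega x -> 0 <= t <= T ->
    (forall i, `|coord i x - coord i y| < r) -> `|t - t'| < r -> `|g (x, t) - g (y, t')| < e.
Proof.
move=> cg e e0; have [M M0 OM] := closure_bound.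
have T1 : 0 < T + 1 by rewrite addr_gt0// (ms_T S).
have [K cK hK] := box3_compact M (T + 1).
have [r r0 hr] := heine_cantor cK cg e0; exists r => // x y t t' cx /andP[t0 tT] h ht.
apply: hr; last by split => //=; split; [exact: (h ord0)|exact: (h ord_max)].
by apply: hK; split => /=; [exact: OM|rewrite in_itv /=; apply/andP; split; lra].
Qed.

Lemma dense2 : dense_in_L1 (mu2 R) Omega (fun g : R * R -> R => continuous g).
Proof.
have [M M0 OM] := Omega_bound.
apply: dense_in_L1_subset (dense_continuous2 M0) => //; first exact: measurable_Omega.
exact: measurable_box2.
Qed.

Lemma cylinder_sub M : Omega `<=` box2 M -> cylinder Omega T `<=` box3 M T.
Proof.
move=> OM x [/= /OM h]; rewrite in_itv /= => /andP[h1 h2]; split => //=.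
by have := ms_T S => T0; rewrite in_itv /= h2 andbT; lra.
Qed.

Lemma dense3 : dense_in_L1 (mu3 R) (cylinder Omega T) (fun g : (R * R) * R -> R => continuous g).
Proof.
have [M M0 OM] := Omega_bound.
apply: dense_in_L1_subset (dense_continuous3 M0 (ms_T S)) => //.
- exact: (part_mD partitions3).
- exact: measurable_box3.
- exact: cylinder_sub.
Qed.

Lemma bdf2 (g : R * R -> R) : continuous g -> bdf Omega (g : measurableTypeR R * measurableTypeR R -> R).
Proof.
move=> cg; have [M M0 OM] := Omega_bound; have [K cK hK] := box2_compact M.
have [B B0 hB] := compact_bound cK cg.
split; first by apply: measurable_funTS; exact: continuous_measurable2.
by exists B => x Ox; apply: hB; apply: hK; exact: OM.
Qed.

Lemma bdf3 (g : (R * R) * R -> R) : continuous g ->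
  bdf (cylinder Omega T) (g : (measurableTypeR R * measurableTypeR R) * measurableTypeR R -> R).
Proof.
move=> cg; have [M M0 OM] := Omega_bound; have [K cK hK] := box3_compact M T.
have [B B0 hB] := compact_bound cK cg.
split; first by apply: measurable_funTS; exact: continuous_measurable3.
by exists B => x Ox; apply: hB; apply: hK; exact: cylinder_sub Ox.
Qed.

Lemma closed_cell_closure m k x : k \in cells (G m) -> closed_cell (G m) k x -> closure Omega x.
Proof. by move=> kG kx; have [_ _ ->] := ms_mac S m; exists k. Qed.

Lemma quarter_closed m j x : quarter (G m) j x -> closed_cell (G m) j.1 x.
Proof. by move=> /(quarter_cell (ms_mac S m)); exact: cell_closed. Qed.

Lemma closed_cell_dist m k x y i : k \in cells (G m) -> closed_cell (G m) k x ->
  closed_cell (G m) k y -> `|coord i x - coord i y| <= mesh_size (G m).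
Proof.
move=> kG /closed_cellP/(_ i)/andP[h1 h2] /closed_cellP/(_ i)/andP[h3 h4].
apply: le_trans (wd_le_mesh (ms_mac S m) i kG); rewrite ler_norml /wd.
by apply/andP; split; lra.
Qed.

Definition qpt m j : R * R :=
  ((qlo (G m) ord0 j + qup (G m) ord0 j) / 2, (qlo (G m) ord_max j + qup (G m) ord_max j) / 2).

Lemma qptQ m j : j \in idx2 (G m) -> quarter (G m) j (qpt m j).
Proof.
move=> _; apply/quarterP => i; rewrite /qpt (coord_pair i (fun i => (qlo (G m) i j + qup (G m) i j) / 2)).
by have := qlt (ms_mac S m) i j; lra.
Qed.

Definition qpt3 m (p : ind3) : (R * R) * R := (qpt m p.1, (p.2%:R + 2^-1) * dt m).

Lemma qpt3Q m p : p \in idx3 m -> Q3 m p (qpt3 m p).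
Proof.
rewrite mem_idx3 => /andP[h1 h2]; split => /=; first by apply: qptQ; rewrite mem_idx2.
apply/slabP; rewrite !ltr_pM2r ?dt_gt0// -(natr1 p.2); apply/andP; split; lra.
Qed.

Local Notation tame2 := (tame_shift (mu2 R) (fun m => idx2 (G m)) (fun m => quarter (G m))
  (fun g : R * R -> R => continuous g)).
Local Notation tame3 := (tame_shift (mu3 R) idx3 Q3 (fun g : (R * R) * R -> R => continuous g)).

(** Involutions preserve sums, and [wq_quasi] compares the weights; what remains to be known of each
    map is its displacement. The factor 2 accounts for crossing a face through its midpoint. *)
Record reflection (s : nat -> ind2 -> ind2) : Prop := Reflection {
  refl_idx : forall m j, j \in idx2 (G m) -> s m j \in idx2 (G m);
  refl_inv : forall m j, j \in idx2 (G m) -> s m (s m j) = j;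
  refl_dist : forall m j x y i, j \in idx2 (G m) -> quarter (G m) j x ->
    quarter (G m) (s m j) y -> `|coord i x - coord i y| <= 2 * mesh_size (G m) }.

Lemma refl_sum s m (F : ind2 -> R) : reflection s ->
  \sum_(j <- idx2 (G m)) F (s m j) = \sum_(j <- idx2 (G m)) F j.
Proof. by move=> [h1 h2 _]; apply: sum_involution; [exact: h1|exact: h2]. Qed.

Lemma wq_quasi : exists2 K : R, 0 < K & forall m j j', j \in idx2 (G m) ->
  j' \in idx2 (G m) -> wq (G m) j <= K * wq (G m) j'.
Proof.
have [K K0 hK] := quasi; exists (K ^+ 2); first by rewrite exprn_gt0.
move=> m j j'; rewrite !mem_idx2 => h h'.
have := hK m ord0 ord0 _ _ h h'; have := hK m ord_max ord_max _ _ h h'.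
have := wd_gt0 (ms_mac S m) ord0 j.1; have := wd_gt0 (ms_mac S m) ord_max j.1.
have := wd_gt0 (ms_mac S m) ord0 j'.1; have := wd_gt0 (ms_mac S m) ord_max j'.1.
rewrite /wq; set a := wd _ _ _; set b := wd _ _ _; set a' := wd _ _ _; set b' := wd _ _ _.
move=> p1 p2 p3 p4 h1 h2.
apply: (@le_trans _ _ ((K * b / 2) * (K * a / 2))); last by rewrite le_eqVlt; apply/orP; left; apply/eqP; field.
by rewrite ler_pM ?divr_ge0 ?(ltW p3) ?(ltW p4)// ler_wpM2r.
Qed.

Lemma refl_tame2 s : reflection s -> tame2 s.
Proof.
move=> rs; split.
- exact: refl_idx rs.
- exists 1 => // m F _; rewrite mul1r.
  by rewrite (refl_sum m F rs).
- have [K K0 hK] := wq_quasi; exists K; first exact: ltW.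
  by move=> m j jm; rewrite !wt2 hK//; exact: (refl_idx rs).
- move=> g cg e e0; have [r r0 hr] := uniform2 cg e0.
  have r20 : 0 < r / 2 by rewrite divr_gt0.
  near=> m => j x y jm qx qy; apply: ltW; apply: hr.
    by apply: (closed_cell_closure (m := m) (k := j.1)); [rewrite -mem_idx2|exact: quarter_closed].
  move=> i; apply: (le_lt_trans (refl_dist rs i jm qx qy)).
  have : mesh_size (G m) < r / 2 by near: m; exact: mesh_small.
  by lra.
Unshelve. all: by end_near. Qed.

Definition lift3 (s : nat -> ind2 -> ind2) m (p : ind3) : ind3 := (s m p.1, p.2).

Lemma slab_dist m n (t t' : R) : slab T N m n t -> slab T N m n t' -> `|t - t'| < dt m.
Proof.
move=> /slabP/andP[h1 h2] /slabP/andP[h3 h4]; move: h2 h4; rewrite -natr1 mulrDl mul1r => h2 h4.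
by rewrite ltr_norml; apply/andP; split; lra.
Qed.

Lemma slab_T m n (t : R) : (n < N m)%N -> slab T N m n t -> 0 <= t <= T.
Proof. by move=> h /(slab_sub (ms_T S) (ms_N S) h)/andP[h1 h2]; rewrite !ltW. Qed.

Lemma refl_tame3 s : reflection s -> tame3 (lift3 s).
Proof.
move=> rs; split.
- by move=> m p; rewrite !mem_idx3 -!mem_idx2 => /andP[h ->]; rewrite andbT; exact: (refl_idx rs).
- exists 1 => // m F _; rewrite mul1r !sum_idx3.
  by apply: ler_sum => n _; rewrite /lift3 /= (refl_sum m (fun j => F (j, (n : nat))) rs).
- have [K K0 hK] := wq_quasi; exists K; first exact: ltW.
  move=> m p pm; have := pm; rewrite mem_idx3 -mem_idx2 => /andP[h1 h2].
  have sm := refl_idx rs h1.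
  rewrite !wt3//; last by rewrite mem_idx3 -mem_idx2 /= sm.
  by rewrite mulrA ler_wpM2r ?(ltW (dt_gt0 m))// hK.
- move=> g cg e e0; have [r r0 hr] := uniform3 cg e0.
  have r20 : 0 < r / 2 by rewrite divr_gt0.
  near=> m => -[j n] [x t] [y t']; rewrite mem_idx3 => /andP[/= jm nm] [/= qx ht] [/= qy ht'].
  have jm2 : j \in idx2 (G m) by rewrite mem_idx2.
  apply: ltW; apply: hr.
  + by apply: (closed_cell_closure (m := m) (k := j.1)) => //; exact: quarter_closed.
  + exact: slab_T ht.
  + move=> i; apply: (le_lt_trans (refl_dist rs i jm2 qx qy)).
    have : mesh_size (G m) < r / 2 by near: m; exact: mesh_small.
    by lra.
  + apply: (lt_trans (slab_dist ht ht')); near: m; exact: dt_small.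
Unshelve. all: by end_near. Qed.

Lemma reflection_mid i : reflection (fun m => reflect_mid i).
Proof.
split.
- by move=> m j; exact: reflect_mid_idx.
- by move=> m j _; exact: reflect_midK.
- move=> m j x y i'; rewrite mem_idx2 => jm /quarter_closed qx /quarter_closed qy.
  have := closed_cell_dist i' jm qx qy; have := mesh_ge0 (G m); lra.
Qed.

Lemma reflection_face i : reflection (fun m => reflect_face (G m) i).
Proof.
split.
- by move=> m j; exact: reflect_face_idx.
- by move=> m j; exact: reflect_faceK.
- move=> m j x y i'; rewrite mem_idx2 => jm /quarter_closed qx /quarter_closed.
  rewrite /reflect_face; case: ifPn => [nG /= qy|_ qy]; last first.
    have := closed_cell_dist i' jm qx qy; have := mesh_ge0 (G m); lra.
  have f1 := face_fpt (ms_mac S m) i (coord i j.2) j.1.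
  have f2 : closed_cell (G m) (neighbor i (coord i j.2) j.1) (fpt (G m) i (face i (coord i j.2) j.1)).
    have := face_fpt (ms_mac S m) i (~~ coord i j.2) (neighbor i (coord i j.2) j.1).
    by case: (coord i j.2) => /=; rewrite ?subrK.
  have d1 := closed_cell_dist i' jm qx f1; have d2 := closed_cell_dist i' nG f2 qy.
  apply: le_trans (ler_distD (coord i' (fpt (G m) i (face i (coord i j.2) j.1))) _ _) _; lra.
Qed.

(** Level 0 is sent to itself and thus counted twice, whence the constant 2 in [shift_time_tame]. *)
Definition shift_time (m : nat) (p : ind3) : ind3 := (p.1, p.2.-1).

Lemma shift_time_tame : tame3 shift_time.
Proof.
split.
- move=> m p; rewrite !mem_idx3 => /andP[-> h] /=; exact: leq_ltn_trans (leq_pred _) h.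
- exists 2 => // m F F0; rewrite !sum_idx3.
  have N0 := ms_N S m.
  pose H n := \sum_(j <- idx2 (G m)) F (j, n).
  have H0 n : (n < N m)%N -> 0 <= H n.
    move=> nN; rewrite /H big_seq; apply: sumr_ge0 => j jm; apply: F0.
    by rewrite mem_idx3 -mem_idx2 jm.
  rewrite [leLHS](_ : _ = \sum_(n < N m) H n.-1)//.
  rewrite [X in _ <= 2 * X](_ : _ = \sum_(n < N m) H n)//.
  move: N0 H0; case: (N m) => // k _ H0.
  rewrite big_ord_recl /= [X in 2 * X]big_ord_recr /=.
  have e : \sum_(i < k) H (bump 0 i).-1 = \sum_(i < k) H i by apply: eq_bigr.
  rewrite e; have := H0 k (ltnSn k).
  have : H 0%N <= \sum_(i < k) H i + H k.
    have e1 : \sum_(i < k.+1) H i = \sum_(i < k) H i + H k by rewrite big_ord_recr.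
    rewrite -e1 big_ord_recl /= lerDl sumr_ge0// => i _.
    by apply: H0; rewrite /bump /= add1n ltnS.
  have : 0 <= \sum_(i < k) H i by apply: sumr_ge0 => i _; apply: H0; rewrite ltnW// ltnS.
  lra.
- exists 1 => // m p pm; rewrite mul1r !wt3//.
  move: pm; rewrite !mem_idx3 => /andP[-> h] /=; exact: leq_ltn_trans (leq_pred _) h.
- move=> g cg e e0; have [r r0 hr] := uniform3 cg e0.
  have r20 : 0 < r / 2 by rewrite divr_gt0.
  near=> m => -[j n] [x t] [y t']; rewrite mem_idx3 => /andP[/= jm nm] [/= qx ht] [/= qy ht'].
  apply: ltW; apply: hr.
  + by apply: (closed_cell_closure (m := m) (k := j.1)) => //; exact: quarter_closed.
  + exact: slab_T ht.
  + move=> i; apply: (le_lt_trans (closed_cell_dist i jm (quarter_closed qx) (quarter_closed qy))).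
    have : mesh_size (G m) < r / 2 by near: m; exact: mesh_small.
    by lra.
  + have hd : dt m < r / 2 by near: m; exact: dt_small.
    move: ht ht' => /slabP/andP[h1 h2] /slabP/andP[h3 h4].
    have d0 := dt_gt0 m.
    move: h1 h2 h3 h4; rewrite -!(natr1 n) -(natr1 n.-1) !mulrDl !mul1r.
    case: n nm => [|n] nm /=; rewrite ?mul0r -?(natr1 n) ?mulrDl ?mul1r => h1 h2 h3 h4;
      rewrite ltr_norml; apply/andP; split; lra.
Unshelve. all: by end_near. Qed.

Lemma cvb_shift3 a f s : tame3 s -> cvb (mu3 R) (cylinder Omega T) idx3 Q3 a f ->
  cvb (mu3 R) (cylinder Omega T) idx3 Q3 (fun m p => a m (s m p)) f.
Proof. exact: (cvb_shift partitions3 dense3 qpt3Q). Qed.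

End mesh_sequences.

Section smooth_facts.
Context {R : realType}.

Lemma smooth_continuous {V : normedModType R} (f : V -> R) : smooth f -> continuous f.
Proof. by move=> h; have [] := h 0%N. Qed.

Lemma smooth_derivable {V : normedModType R} (f : V -> R) (v : V) : smooth f -> forall x, derivable f x v.
Proof. by move=> h x; have [_ /(_ v)[]] := h 1%N. Qed.

Lemma smooth_derive_continuous {V : normedModType R} (f : V -> R) v :
  smooth f -> continuous ('D_v f).
Proof. by move=> h; have [_ /(_ v)[_ []]] := h 1%N. Qed.

Lemma evecE (i : 'I_2) (x y : R * R) : coord (rev_ord i) x = coord (rev_ord i) y ->
  y = x + (coord i y - coord i x) *: evec i.
Proof.
move=> h; apply: eq_coord => i'; have [->|/eq_ord2 ->] := eqVneq i' i.
  rewrite coordD (_ : coord i (_ *: _) = (coord i y - coord i x) * 1); first by ring.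
  by rewrite /coord /evec; case: (i == ord0).
rewrite coordD -h (_ : coord (rev_ord i) (_ *: _) = (coord i y - coord i x) * 0); first by ring.
by rewrite /coord /evec; case: (ord2P i) => ->.
Qed.

Lemma coord_line (i : 'I_2) (x : R * R) (t : R) :
  coord i (x + t *: evec i) = coord i x + t /\
  coord (rev_ord i) (x + t *: evec i) = coord (rev_ord i) x.
Proof.
rewrite !coordD; split.
  by congr (_ + _); rewrite /coord /evec; case: (ord2P i) => -> /=; rewrite /GRing.scale /= mulr1.
rewrite -[RHS]addr0; congr (_ + _).
by rewrite /coord /evec; case: (ord2P i) => -> /=; rewrite /GRing.scale /= mulr0.
Qed.

Lemma space_mvt (i : 'I_2) (phi : (R * R) * R -> R) (x y : R * R) (t : R) :
  smooth phi -> coord (rev_ord i) x = coord (rev_ord i) y -> coord i x < coord i y ->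
  exists xi : R * R, [/\ coord (rev_ord i) xi = coord (rev_ord i) x,
    coord i x < coord i xi < coord i y &
    phi (y, t) - phi (x, t) = (coord i y - coord i x) * dx_ i phi (xi, t)].
Proof.
move=> sp h hl; have s0 : 0 < coord i y - coord i x by rewrite subr_gt0.
have [r /andP[r0 rs] hr] := @dir_mvt R _ phi (evec i, 0) (x, t) _
  (@smooth_derivable _ phi _ sp) s0.
have [c1 c2] := coord_line i x r.
exists (x + r *: evec i); rewrite c1 c2; split => //; first by lra.
have e (a : R) : (x, t) + a *: (evec i, 0) = (x + a *: evec i, t) :> (R * R) * R.
  by congr (_, _); rewrite /= scaler0 addr0.
by move: hr; rewrite !e -(evecE h).
Qed.

Lemma time_mvt (phi : (R * R) * R -> R) (x : R * R) (t t' : R) :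
  smooth phi -> t < t' -> exists2 r, t < r < t' &
    phi (x, t') - phi (x, t) = (t' - t) * dt_ phi (x, r).
Proof.
move=> sp tt; have s0 : 0 < t' - t by rewrite subr_gt0.
have [r /andP[r0 rs] hr] := @dir_mvt R _ phi ((0, 0), 1) (x, t) _
  (@smooth_derivable _ phi _ sp) s0.
have e (a : R) : (x, t) + a *: ((0, 0), 1) = (x, t + a) :> (R * R) * R.
  congr (_, _); last by rewrite /= /GRing.scale /= mulr1.
  by case: x {hr} => x1 x2; congr (_, _); rewrite /= /GRing.scale /= mulr0 addr0.
exists (t + r); first by lra.
have e' : t + (t' - t) = t' by rewrite addrC subrK.
by move: hr; rewrite !e e'.
Qed.

Lemma plane_mvt (i : 'I_2) (z : R * R -> R) (x y : R * R) :
  smooth z -> coord (rev_ord i) x = coord (rev_ord i) y ->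
  exists xi : R * R, [/\ coord (rev_ord i) xi = coord (rev_ord i) x,
    `|coord i xi - coord i x| <= `|coord i y - coord i x| &
    z y - z x = (coord i y - coord i x) * 'D_(evec i) z xi].
Proof.
move=> sz h.
have [r rs hr] := @dir_mvt_signed R _ z (evec i) x (coord i y - coord i x)
  (@smooth_derivable _ z _ sz).
have [c1 c2] := coord_line i x r.
exists (x + r *: evec i); rewrite c1 c2 -hr -(evecE h); split => //.
by rewrite addrC addKr.
Qed.

End smooth_facts.

(** * Test functions *)

Section test_arrays.
Context {R : realType}.
Variables (Omega : set (R * R)) (T : R) (G : nat -> grid R) (N : nat -> nat).
Hypothesis S : mesh_sequence Omega T G N.
Local Notation dt := (tstep T N).
Local Notation idx3 := (idx3 G N).
Local Notation Q3 := (Q3 T G N).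
Local Notation cv3 a f := (cvb (mu3 R) (cylinder Omega T) idx3 Q3 a f).
Local Notation tn m n := (n%:R * dt m).
Local Notation side i p := (coord i p.1.2).
Local Notation fc i p := (face i (coord i p.1.2) p.1.1).

Lemma closure_compact3 (g : (R * R) * R -> R) : continuous g ->
  exists2 B : R, 0 <= B & forall x t, closure Omega x -> 0 <= t <= T -> `|g (x, t)| <= B.
Proof.
move=> cg; have [M M0 OM] := closure_bound S.
have [K cK hK] := box3_compact M (T + 1).
have [B B0 hB] := compact_bound cK cg; exists B => // x t cx /andP[t0 tT].
apply: hB; apply: hK; split => /=; first exact: OM.
by have := ms_T S; rewrite in_itv /=; lra.
Qed.

(** Uniform continuity of [g] on a compact box. Through the mean value theorem, the difference
    quotients of the test function reduce to this statement. *)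
Lemma cvb_points (psi : nat -> ind3 -> R) (g : (R * R) * R -> R) : continuous g ->
  (forall m p, p \in idx3 m -> exists y t, [/\ psi m p = g (y, t), closure Omega y,
     0 <= t <= T, (forall i x, cell (G m) p.1.1 x -> `|coord i y - coord i x| <= 2 * mesh_size (G m)) &
     forall t', slab T N m p.2 t' -> `|t - t'| <= 2 * dt m]) ->
  cv3 psi g.
Proof.
move=> cg h; have [B B0 hB] := closure_compact3 cg.
apply: cvb_near.
- exact: partitions3.
- by exists B => m p pm; have [y [t [-> cy ht _ _]]] := h m p pm; exact: hB.
- exact: bdf3 S _ cg.
move=> e e0; have [r r0 hr] := uniform3 S cg e0.
have r30 : 0 < r / 3 by rewrite divr_gt0.
near=> m => p [x t'] pm [/= qx ht'].
have [y [t [-> cy ht hy htt]]] := h m p pm.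
apply: ltW; apply: hr => //.
  move=> i; apply: (le_lt_trans (hy i x (quarter_cell (ms_mac S m) qx))).
  have : mesh_size (G m) < r / 3 by near: m; exact: mesh_small S _ r30.
  by lra.
apply: (le_lt_trans (htt t' ht')).
have : dt m < r / 3 by near: m; exact: dt_small S _ r30.
by lra.
Unshelve. all: by end_near. Qed.

Lemma tn_slab m n (t' : R) : slab T N m n t' -> `|tn m n - t'| <= 2 * dt m /\ `|tn m n.+1 - t'| <= 2 * dt m.
Proof.
move=> /slabP/andP[]; rewrite -natr1 mulrDl mul1r => h1 h2.
have := dt_gt0 S m => d0; rewrite !ler_norml; split; apply/andP; split; lra.
Qed.

Lemma tn_T m n : (n <= N m)%N -> 0 <= tn m n <= T.
Proof.
move=> h; have d0 := dt_gt0 S m; rewrite mulr_ge0 ?(ltW d0)//= -[leRHS](@tstepN R T N (ms_N S) m).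
by rewrite ler_wpM2r ?(ltW d0)// ler_nat.
Qed.

Lemma cell_near m k i x y : k \in cells (G m) -> closed_cell (G m) k y -> cell (G m) k x ->
  `|coord i y - coord i x| <= mesh_size (G m).
Proof. by move=> kG ky kx; apply: (closed_cell_dist S i kG ky); exact: cell_closed. Qed.

Lemma cpt_closed m k : closed_cell (G m) k (cpt (G m) k).
Proof. by apply: cell_closed; exact: (cell_nonempty_pt (ms_mac S m)). Qed.

Lemma face_fpt_nb m i c k : closed_cell (G m) (neighbor i c k) (fpt (G m) i (face i c k)).
Proof.
have := face_fpt (ms_mac S m) i (~~ c) (neighbor i c k).
by case: c => /=; rewrite ?subrK.
Qed.

Lemma nb_near m k i c i' x y : k \in cells (G m) -> neighbor i c k \in cells (G m) ->
  closed_cell (G m) (neighbor i c k) y -> cell (G m) k x ->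
  `|coord i' y - coord i' x| <= 2 * mesh_size (G m).
Proof.
move=> kG nG ny kx.
have h1 := closed_cell_dist S i' nG ny (face_fpt_nb m i c k).
have h2 := cell_near i' kG (face_fpt (ms_mac S m) i c k) kx.
apply: le_trans (ler_distD (coord i' (fpt (G m) i (face i c k))) _ _) _; lra.
Qed.

Variable phi : (R * R) * R -> R.
Hypothesis sphi : smooth phi.

Lemma mesh_pos m : 0 <= mesh_size (G m). Proof. exact: mesh_ge0. Qed.

Lemma cvb_cell_value : cv3 (fun m p => phi (cpt (G m) p.1.1, tn m p.2)) phi.
Proof.
apply: cvb_points; first exact: smooth_continuous.
move=> m p; rewrite mem_idx3 => /andP[kG nN].
exists (cpt (G m) p.1.1), (tn m p.2); split => //.
- exact: closed_cell_closure S _ _ _ kG (cpt_closed m _).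
- by apply: tn_T; exact: ltnW.
- by move=> i x kx; have := cell_near i kG (cpt_closed m _) kx; have := mesh_pos m; lra.
- by move=> t' /tn_slab[].
Qed.

Lemma cvb_face_value i (b : bool) :
  cv3 (fun m p => phi (fpt (G m) i (fc i p), tn m (p.2 + b)%N)) phi.
Proof.
apply: cvb_points; first exact: smooth_continuous.
move=> m p; rewrite mem_idx3 => /andP[kG nN].
have fcl := face_fpt (ms_mac S m) i (side i p) p.1.1.
exists (fpt (G m) i (fc i p)), (tn m (p.2 + b)%N); split => //.
- exact: closed_cell_closure S _ _ _ kG fcl.
- by apply: tn_T; case: b; rewrite ?addn1 ?addn0// ltnW.
- by move=> i' x kx; have := cell_near i' kG fcl kx; have := mesh_pos m; lra.
- by move=> t' /tn_slab[]; case: b; rewrite ?addn1 ?addn0.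
Qed.

Lemma cvb_dt_points (P : nat -> ind3 -> R * R) :
  (forall m p, p \in idx3 m -> closed_cell (G m) p.1.1 (P m p)) ->
  cv3 (fun m p => (phi (P m p, tn m p.2.+1) - phi (P m p, tn m p.2)) / dt m) (dt_ phi).
Proof.
move=> hP; apply: cvb_points; first exact: smooth_derive_continuous.
move=> m p pm; have := pm; rewrite mem_idx3 => /andP[kG nN].
have d0 := dt_gt0 S m.
have tt : tn m p.2 < tn m p.2.+1 by rewrite ltr_pM2r// ltr_nat.
have [r /andP[r1 r2] hr] := time_mvt (P m p) sphi tt.
have /andP[a1 a2] := tn_T (ltnW nN); have /andP[b1 b2] := tn_T nN.
exists (P m p), r; split => //.
- have e : tn m p.2.+1 - tn m p.2 = dt m.
    by rewrite -(natr1 p.2) mulrDl mul1r addrAC subrr add0r.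
  by rewrite hr e mulrC mulKf// gt_eqF.
- exact: closed_cell_closure S _ _ _ kG (hP _ _ pm).
- by rewrite (le_trans a1 (ltW r1)) (le_trans (ltW r2) b2).
- by move=> i' x kx; have := cell_near i' kG (hP _ _ pm) kx; have := mesh_pos m; lra.
- move=> t' /slabP/andP[h1 h2]; rewrite -(natr1 p.2) mulrDl mul1r in r2 h2.
  rewrite ler_norml; apply/andP; split; lra.
Qed.

(** The intermediate point of the mean value theorem may lie in a neighbouring cell. Asking that
    this cell belong to the mesh keeps the point in [closure Omega] and within two mesh sizes. *)
Lemma cvb_dx_points (i : 'I_2) (psi : nat -> ind3 -> R) :
  (forall m p, p \in idx3 m -> exists x y n, [/\ coord (rev_ord i) x = coord (rev_ord i) y,
     coord i x < coord i y,
     psi m p = (phi (y, tn m n) - phi (x, tn m n)) / (coord i y - coord i x),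
     (n == p.2) || (n == p.2.+1) &
     forall xi, coord (rev_ord i) xi = coord (rev_ord i) x -> coord i x <= coord i xi <= coord i y ->
       closed_cell (G m) p.1.1 xi \/
       exists i' c, neighbor i' c p.1.1 \in cells (G m) /\ closed_cell (G m) (neighbor i' c p.1.1) xi]) ->
  cv3 psi (dx_ i phi).
Proof.
move=> h; apply: cvb_points; first exact: smooth_derive_continuous.
move=> m p pm; have := pm; rewrite mem_idx3 => /andP[kG nN].
have [x [y [n [hr hl -> hn hc]]]] := h m p pm.
have [xi [x1 /andP[x2 x3] hxi]] := space_mvt (tn m n) sphi hr hl.
exists xi, (tn m n).
have hx : coord i x <= coord i xi <= coord i y by rewrite !ltW.
have cxi := hc xi x1 hx; split.
- by rewrite hxi mulrC mulKf// gt_eqF// subr_gt0.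
- case: cxi => [?|[i' [c [nG ?]]]]; first exact: closed_cell_closure S _ _ _ kG _.
  exact: closed_cell_closure S _ _ _ nG _.
- by apply: tn_T; case/orP : hn => /eqP ->; rewrite // ltnW.
- move=> i' x' kx; case: cxi => [kxi|[i0 [c [nG nxi]]]].
    by have := cell_near i' kG kxi kx; have := mesh_pos m; lra.
  exact: (nb_near i' kG nG nxi kx).
- by move=> t' /tn_slab[h1 h2]; case/orP : hn => /eqP ->.
Qed.

End test_arrays.

(** * Discrete summation by parts *)

Section scheme_algebra.
Context {R : realType}.
Variables (Omega : set (R * R)) (G : grid R).
Hypothesis hG : mac_grid Omega G.
Hypothesis mOmega : measurable (Omega : set (measurableTypeR R * measurableTypeR R)).
Hypothesis finOmega : (mu2 R Omega < +oo)%E.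
Implicit Types (i : 'I_2) (k s : int * int) (j : ind2).
Local Notation wd := (wd G).
Local Notation dist := (dual_dist G).
Local Notation wq := (wq G).
Local Notation fc i j := (face i (coord i j.2) j.1).
Local Notation nb i j := (neighbor i (coord i j.2) j.1).

Definition flux i (f : int * int -> R) s : R :=
  if s \in int_edges G i then edge_length G i s * f s else 0.

Lemma flux0 i f s : s \notin int_edges G i -> flux i f s = 0.
Proof. by rewrite /flux => /negbTE ->. Qed.

Lemma sum_flux i (f phi : int * int -> R) (d : ind2 -> R) :
  (forall s, s \in edges G i -> s \notin int_edges G i -> f s = 0) ->
  (forall j, j \in idx2 G -> nb i j \in cells G ->
     d j = (phi (fc i j) - phi (fc i j - evec i)) / dist i (fc i j)) ->
  \sum_(k <- cells G) phi k * (flux i f (k + evec i) - flux i f k) =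
  - \sum_(j <- idx2 G) wq j * (f (fc i j) * d j).
Proof.
move=> f0 hd; rewrite sum_by_parts; last by move=> s _; exact: flux0.
congr (- _).
transitivity (\sum_(s <- int_edges G i) edge_length G i s * dist i s *
   (f s * ((phi s - phi (s - evec i)) / dist i s))).
  apply: eq_big_seq => s sI; rewrite /flux sI; have := dist_gt0 hG i s => d0.
  by field; rewrite gt_eqF.
rewrite (sum_edges_dist G i (fun s => f s * ((phi s - phi (s - evec i)) / dist i s))); apply: eq_big_seq => j jG.
case: ifPn => [nG|nG]; first by rewrite hd.
rewrite f0 ?mul0r ?mulr0//; move: jG; rewrite mem_idx2 => jG.
  exact: face_edges.
by rewrite face_int.
Qed.

(** There is no boundary term, [psi] being 0 off the internal edges. The pressure gradient and the
    convection along e^(i) both take this form. *)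
Lemma sum_cells_by_parts i (P psi : int * int -> R) (d : ind2 -> R) :
  (forall s, s \notin int_edges G i -> psi s = 0) ->
  (forall j, j \in idx2 G -> d j = (psi (j.1 + evec i) - psi j.1) / wd i j.1) ->
  \sum_(s <- int_edges G i) psi s * (wd (rev_ord i) s * (P s - P (s - evec i))) =
  - \sum_(j <- idx2 G) wq j * (P j.1 * d j).
Proof.
move=> psi0 hd.
have h (F : int * int -> R) v : (forall s, s \in int_edges G i -> s - v \in cells G) ->
    (forall k, k \in cells G -> k + v \notin int_edges G i -> F (k + v) = 0) ->
    \sum_(s <- int_edges G i) F s = \sum_(k <- cells G) F (k + v).
  by move=> h1 h2; apply: sum_shift => // s sI; rewrite h1.
transitivity (\sum_(s <- int_edges G i) psi s * wd (rev_ord i) s * P s -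
  \sum_(s <- int_edges G i) psi s * wd (rev_ord i) s * P (s - evec i)).
  by rewrite -sumrB; apply: eq_bigr => s _; ring.
rewrite (h _ 0); first last.
- by move=> k _ kn; rewrite psi0// !mul0r.
- by move=> s; rewrite mem_int_edges subr0 => /andP[].
rewrite (h _ (evec i)); first last.
- by move=> k _ kn; rewrite psi0// !mul0r.
- by move=> s; rewrite mem_int_edges => /andP[].
transitivity (- \sum_(k <- cells G) area (cell G k) * (P k * ((psi (k + evec i) - psi k) / wd i k))).
  rewrite -sumrB -sumrN; apply: eq_bigr => k _; rewrite addr0 addrK wd_rev' (area_cellE hG i).
  by have := wd_gt0 hG i k => w0; field; rewrite gt_eqF.
rewrite (sum_cells_cst hG (fun k => P k * _)); congr (- _); apply: eq_big_seq => j jG.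
by rewrite hd.
Qed.

Variables (h : int * int -> R) (u : 'I_2 -> int * int -> R).
Hypothesis u0 : forall i s, s \in edges G i -> s \notin int_edges G i -> u i s = 0.

(** Edges are oriented along e^(i), so that the flux of an edge is a single number and the outward
    normal of a cell becomes a sign. *)
Definition hup i s : R := if 0 <= u i s then h (s - evec i) else h s.
Local Notation Fl i := (flux i (fun s => hup i s * u i s)).

Lemma primal_fluxE k i b : primal_flux G h u k i b = normal_sign b * Fl i (face i b k).
Proof.
rewrite /primal_flux /flux; case: ifP => _; last by rewrite mulr0.
rewrite /hup /normal_sign; case: b => /=.
  by rewrite mulr1 addrK; case: ifP => _; ring.
(* At zero velocity the outward convention may select the other height, but then the flux is 0. *)
rewrite mulrN1 oppr_ge0; case: (ltgtP (u i k) 0) => [_|_|->]; try ring.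
Qed.

Lemma primal_flux_div k : \sum_(i < 2) \sum_(b : bool) primal_flux G h u k i b =
  \sum_(i < 2) (Fl i (k + evec i) - Fl i k).
Proof.
by apply: eq_bigr => i _; rewrite big_bool !primal_fluxE /= /normal_sign mul1r mulN1r.
Qed.

(** Dual fluxes with fixed orientation: [flux_self] crosses the dual edge inside the cell [k], and
    [flux_trans] crosses the lower side, in the other direction, of the dual cell of [s]. *)
Definition flux_self i k : R := 2^-1 * (Fl i (k + evec i) + Fl i k).
Definition flux_trans i s : R := 2^-1 * (Fl (rev_ord i) s + Fl (rev_ord i) (s - evec i)).
Definition uself i k : R := if 0 <= flux_self i k then u i k else u i (k + evec i).
Definition utrans i s : R := if 0 <= flux_trans i s then u i (s - evec (rev_ord i)) else u i s.

Lemma dual_flux_self i s b : dual_flux G h u i s i b =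
  normal_sign b * flux_self i (adj i b s).
Proof.
rewrite /dual_flux eqxx !primal_fluxE /flux_self /normal_sign /adj.
by case: b => /=; rewrite ?subrK; ring.
Qed.

Lemma dual_flux_trans i s b : dual_flux G h u i s (rev_ord i) b =
  normal_sign b * flux_trans i (face (rev_ord i) b s).
Proof.
rewrite /dual_flux (negbTE (rev_ord2_neq i)) !primal_fluxE /flux_trans /adj.
case: b; rewrite /= /normal_sign; last by ring.
by rewrite addrAC; ring.
Qed.

Lemma upwind_self i s b (F : R -> R) :
  dual_flux G h u i s i b * F (upwind_velocity G h u i s i b) =
  normal_sign b * flux_self i (adj i b s) * F (uself i (adj i b s)).
Proof.
rewrite /upwind_velocity dual_flux_self /uself /normal_sign; case: b => /=; first by rewrite mul1r.
rewrite !mulN1r oppr_ge0 subrK; case: (ltgtP (flux_self i (s - evec i)) 0) => // ->.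
by rewrite oppr0 !mul0r.
Qed.

Lemma upwind_trans i s b (F : R -> R) :
  dual_flux G h u i s (rev_ord i) b * F (upwind_velocity G h u i s (rev_ord i) b) =
  normal_sign b * flux_trans i (face (rev_ord i) b s) * F (utrans i (face (rev_ord i) b s)).
Proof.
rewrite /upwind_velocity dual_flux_trans /utrans /normal_sign; case: b => /=.
  by rewrite mul1r addrK.
rewrite !mulN1r oppr_ge0; case: (ltgtP (flux_trans i s) 0) => // ->.
by rewrite oppr0 !mul0r.
Qed.

(** [F] is left general: the identity serves the transported velocity, its kinetic energy, and the
    constant 1 of the dual mass balance. *)
Lemma convection_sum i s (F : R -> R) :
  \sum_(i' < 2) \sum_(b : bool)
    dual_flux G h u i s i' b * F (upwind_velocity G h u i s i' b) =
  (flux_self i s * F (uself i s) - flux_self i (s - evec i) * F (uself i (s - evec i))) +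
  (flux_trans i (s + evec (rev_ord i)) * F (utrans i (s + evec (rev_ord i))) -
   flux_trans i s * F (utrans i s)).
Proof.
rewrite (sum_ord2i i) !big_bool !upwind_self !upwind_trans /= /normal_sign.
by rewrite !mul1r !mulN1r !mulNr.
Qed.

Definition hq j : R := h j.1.
Definition uq i j : R := u i (fc i j).
(** The default value keeps the array a selection between a height and its mirror image; it is
    multiplied by the velocity of a boundary edge, which is 0. *)
Definition qh i j : R := if nb i j \in cells G then hup i (fc i j) else h j.1.
Definition qus i j : R := uself i j.1.
Definition qut i j : R := if nb (rev_ord i) j \in cells G
  then utrans i (face (rev_ord i) (coord (rev_ord i) j.2) (fc i j)) else uq i j.

Lemma nb_in i j : j \in idx2 G -> uq i j != 0 -> nb i j \in cells G.
Proof.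
rewrite mem_idx2 => jG; apply: contraNT => nG; apply/eqP; apply: u0.
  exact: face_edges.
by rewrite face_int.
Qed.

Lemma qhu i j : j \in idx2 G -> qh i j * uq i j = hup i (fc i j) * u i (fc i j).
Proof.
move=> jG; rewrite -/(uq i j); have [->|/(nb_in jG) nG] := eqVneq (uq i j) 0.
  by rewrite !mulr0.
by rewrite /qh nG.
Qed.

Lemma sum_mass_flux (phi : int * int -> R) (d : 'I_2 -> ind2 -> R) :
  (forall i j, j \in idx2 G -> nb i j \in cells G ->
     d i j = (phi (fc i j) - phi (fc i j - evec i)) / dist i (fc i j)) ->
  \sum_(k <- cells G) phi k * (\sum_(i < 2) \sum_(b : bool) primal_flux G h u k i b) =
  - \sum_(i < 2) \sum_(j <- idx2 G) wq j * (qh i j * uq i j * d i j).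
Proof.
move=> hd; under eq_bigr do rewrite primal_flux_div big_distrr /=.
rewrite exchange_big -sumrN; apply: eq_bigr => i _.
rewrite (sum_flux _ (hd i)); last by move=> s se sn; rewrite u0// mulr0.
congr (- _); apply: eq_big_seq => j jG; by rewrite qhu.
Qed.

(** Dual edges orthogonal to e^(i) lie inside cells and are paired with the quotient of [psi] across
    a cell. Those parallel to e^(i) consist of halves of primal edges and are paired with the
    quotient [d'] between consecutive edges along the other direction. *)
Lemma sum_convection i (psi : int * int -> R) (F : R -> R) (d d' : ind2 -> R) :
  (forall s, s \notin int_edges G i -> psi s = 0) ->
  (forall j, j \in idx2 G -> d j = (psi (j.1 + evec i) - psi j.1) / wd i j.1) ->
  (forall j, j \in idx2 G -> nb (rev_ord i) j \in cells G ->
     let s := face (rev_ord i) (coord (rev_ord i) j.2) (fc i j) in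
     d' j = (psi s - psi (s - evec (rev_ord i))) / dist (rev_ord i) s) ->
  \sum_(s <- int_edges G i) psi s * (\sum_(i' < 2) \sum_(b : bool)
    dual_flux G h u i s i' b * F (upwind_velocity G h u i s i' b)) =
  - (\sum_(j <- idx2 G) wq j * (qh i j * uq i j * F (qus i j) * d j) +
     \sum_(j <- idx2 G) wq j *
       (qh (rev_ord i) j * uq (rev_ord i) j * F (qut i j) * d' j)).
Proof.
move=> psi0 hd hd'.
under eq_bigr do rewrite convection_sum mulrDr.
rewrite big_split opprD; congr (_ + _).
  (* The transverse width is the same on both sides of the edge; dividing by it puts the sum in the
     form of [sum_cells_by_parts]. *)
  transitivity (\sum_(s <- int_edges G i) psi s * (wd (rev_ord i) s *
     (flux_self i s * F (uself i s) / wd (rev_ord i) s -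
      flux_self i (s - evec i) * F (uself i (s - evec i)) / wd (rev_ord i) (s - evec i)))).
    apply: eq_bigr => s _; rewrite wd_rev; have := wd_gt0 hG (rev_ord i) s => w0.
    by field; rewrite gt_eqF.
  rewrite (sum_cells_by_parts (fun k => flux_self i k * F (uself i k) / wd (rev_ord i) k) psi0 hd).
  congr (- _).
  (* Each half of [flux_self] goes to the two quarters next to the corresponding face. *)
  pose X k b (c : bool) := (if face i b k \in int_edges G i then
    hup i (face i b k) * u i (face i b k) else 0) * F (uself i k) *
    ((psi (k + evec i) - psi k) / wd i k).
  transitivity (\sum_(j <- idx2 G) wq j * X j.1 (coord i j.2) (coord (rev_ord i) j.2)).
    rewrite -sum_cells_quarters.
    transitivity (\sum_(k <- cells G) area (cell G k) *
      (flux_self i k * F (uself i k) / wd (rev_ord i) k * ((psi (k + evec i) - psi k) / wd i k))).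
      by rewrite (sum_cells_cst hG (fun k => _ * _)); apply: eq_big_seq => j jG; rewrite hd.
    apply: eq_bigr => k _; rewrite (area_cellE hG i) /X /flux_self /flux /= !edge_lengthE wd_rev'.
    have := wd_gt0 hG i k; have := wd_gt0 hG (rev_ord i) k => w0 w1.
    by case: ifP => _; case: ifP => _; field; rewrite !gt_eqF.
  apply: eq_big_seq => j jG; rewrite /X hd// qhu//; congr (_ * (_ * _ * _)).
  case: ifPn => // sn; rewrite u0 ?mulr0//; apply: face_edges; by rewrite -mem_idx2.
pose i' := rev_ord i.
rewrite (eq_bigr (fun s => psi s * (2^-1 * (Fl i' (s + evec i') + Fl i' (s - evec i + evec i')) *
   F (utrans i (s + evec i')) - 2^-1 * (Fl i' s + Fl i' (s - evec i)) * F (utrans i s)))); last first.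
  by move=> s _; rewrite /flux_trans -/i' (addrAC s (evec i')).
rewrite (@sum_transverse _ G i i' psi (Fl i') (fun s => F (utrans i s)) psi0 (@flux0 i' _)).
congr (- _).
pose X k b (c : bool) := let t := face i' b k in let s := face i c t in
  hup i' t * u i' t * F (utrans i s) * ((psi s - psi (s - evec i')) / dist i' s).
transitivity (\sum_(t <- int_edges G i') edge_length G i' t *
     (\sum_(c : bool) (wd i' t * X t false c + wd i' (t - evec i') * X (t - evec i') true c) / 4)).
  apply: eq_big_seq => t tI; rewrite /flux tI /X !big_bool /= subrK.
  have e : dist i' (t + evec i) = dist i' t.
    by rewrite /dual_dist (addrAC t (evec i)) /i' !wd_rev'.
  rewrite e /dual_dist; have := wd_gt0 hG i' t; have := wd_gt0 hG i' (t - evec i') => w0 w1.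
  by field; rewrite gt_eqF// addr_gt0.
rewrite sum_edges_quarters; apply: eq_big_seq => j jG.
case: ifPn => nG; last first.
  have [->|/(nb_in jG) nG'] := eqVneq (uq (rev_ord i) j) 0; last by rewrite nG' in nG.
  by rewrite !(mulr0, mul0r).
have rr : rev_ord i' = i by rewrite /i' rev_ordK.
rewrite /X rr /qut nG qhu// hd'//= /i'.
have -> : face i (coord i j.2) (face (rev_ord i) (coord (rev_ord i) j.2) j.1) =
  face (rev_ord i) (coord (rev_ord i) j.2) (face i (coord i j.2) j.1).
  by rewrite /face; case: ifP => _; case: ifP => _ //; rewrite addrAC.
by [].
Qed.

(** This and the next two lemmas have the shape required by [cvb_sel]: the upwind value is found in
    the quarter itself or in a mirror image. *)
Lemma qh_sel i j : qh i j = hq j \/ qh i j = hq (reflect_face G i j).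
Proof.
rewrite /qh /hq /reflect_face; case: ifPn => nG; last by left.
rewrite /hup; case: (coord i j.2) => /=; case: ifP => _; rewrite ?addrK; tauto.
Qed.

Lemma qus_sel i j : qus i j = uq i j \/ qus i j = uq i (reflect_mid i j).
Proof.
rewrite /qus /uself /uq /reflect_mid /= coord_flip eqxx.
by case: (coord i j.2); case: ifP => _ /=; tauto.
Qed.

Lemma qut_sel i j : qut i j = uq i j \/ qut i j = uq i (reflect_face G (rev_ord i) j).
Proof.
rewrite /qut /reflect_face; case: ifPn => nG; last by left.
rewrite /utrans /uq /= coord_flip eq_sym (negbTE (rev_ord2_neq i)) /=.
rewrite /face /neighbor; case: (coord (rev_ord i) j.2); case: (coord i j.2); case: ifP => _ /=;
  rewrite ?addrK ?(addrAC j.1 (evec i)) ?addrK; tauto.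
Qed.

Definition dual_mass i s : R :=
  wd (rev_ord i) s * (wd i (s - evec i) * h (s - evec i) + wd i s * h s) / 2.

Lemma dual_massE i s : s \in int_edges G i ->
  area (dual_cell G i s) * dual_height G h i s = dual_mass i s.
Proof.
move=> sI; rewrite /dual_height !(area_half hG) /adj (area_dual hG mOmega finOmega sI) wd_rev.
have := dist_gt0 hG i s; have := wd_gt0 hG (rev_ord i) s => w0 d0.
rewrite /dual_mass edge_lengthE; field; by rewrite !gt_eqF.
Qed.

Lemma sum_dual_mass i (X psi : int * int -> R) : (forall s, s \notin int_edges G i -> psi s = 0) ->
  \sum_(s <- int_edges G i) psi s * (dual_mass i s * X s) =
  \sum_(j <- idx2 G) wq j * (hq j * X (fc i j) * psi (fc i j)).
Proof.
move=> psi0.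
pose Y k b (c : bool) := h k * X (face i b k) * psi (face i b k).
transitivity (\sum_(s <- int_edges G i) edge_length G i s *
     (\sum_(c : bool) (wd i s * Y s false c + wd i (s - evec i) * Y (s - evec i) true c) / 4)).
  apply: eq_bigr => s _; rewrite big_bool /Y /= subrK /dual_mass edge_lengthE; by field.
rewrite sum_edges_quarters; apply: eq_big_seq => j jG; case: ifPn => // nG.
by rewrite psi0 ?mulr0// face_int// -mem_idx2.
Qed.

Lemma sum_centered i (X psi : int * int -> R) (d : ind2 -> R) :
  (forall s, s \notin int_edges G i -> psi s = 0) ->
  (forall j, j \in idx2 G -> nb i j \in cells G ->
     d j = X (fc i j) / dist i (fc i j)) ->
  \sum_(s <- int_edges G i) psi s * (edge_length G i s * (centered_height h i s * X s)) =
  \sum_(j <- idx2 G) wq j * ((hq j + hq (reflect_face G i j)) / 2 * d j * psi (fc i j)).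
Proof.
move=> psi0 hd.
transitivity (\sum_(s <- int_edges G i) edge_length G i s * dist i s *
   (centered_height h i s * (X s / dist i s) * psi s)).
  apply: eq_bigr => s _; have := dist_gt0 hG i s => d0; field; by rewrite gt_eqF.
rewrite (sum_edges_dist G i (fun s => centered_height h i s * (X s / dist i s) * psi s)).
apply: eq_big_seq => j jG; case: ifPn => nG; last first.
  by rewrite psi0 ?mulr0// face_int// -mem_idx2.
rewrite hd//; congr (_ * (_ * _ * _)).
rewrite /centered_height /hq /reflect_face nG /adj.
by case: (coord i j.2); rewrite /= ?addrK mulrC // (addrC (h j.1)).
Qed.

End scheme_algebra.

(** * Difference quotients of test functions *)

Section test_quotients.
Context {R : realType}.
Variables (Omega : set (R * R)) (T : R) (G : nat -> grid R) (N : nat -> nat).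
Hypothesis S : mesh_sequence Omega T G N.
Local Notation dt := (tstep T N).
Local Notation idx3 := (idx3 G N).
Local Notation Q3 := (Q3 T G N).
Local Notation cv3 a f := (cvb (mu3 R) (cylinder Omega T) idx3 Q3 a f).
Local Notation tn m n := (n%:R * dt m).
Local Notation side i p := (coord i p.1.2).
Local Notation fc i p := (face i (coord i p.1.2) p.1.1).
Local Notation nb i p := (neighbor i (coord i p.1.2) p.1.1).

Lemma closed_cell_dir (g : grid R) i k x : low g i k <= coord i x <= upp g i k ->
  low g (rev_ord i) k <= coord (rev_ord i) x <= upp g (rev_ord i) k -> closed_cell g k x.
Proof. by move=> h1 h2; apply/closed_cellP; apply: (@ord2i i). Qed.

Lemma low_trans (g : grid R) i k : low g i (k + evec (rev_ord i)) = low g i k /\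
  low g i (k - evec (rev_ord i)) = low g i k.
Proof.
by split; [rewrite /low coordD|rewrite /low coordB];
  rewrite coord_evec eq_sym (negbTE (rev_ord2_neq i)) ?addr0 ?subr0.
Qed.

(** A segment between the centers of two adjacent cells crosses their common face only, so each of
    its points is in one of the two closed cells. *)
Lemma closed_cell_pair m i c k x : let t := face i c k in
  mid (G m) i (t - evec i) <= coord i x <= mid (G m) i t ->
  low (G m) (rev_ord i) k <= coord (rev_ord i) x <= upp (G m) (rev_ord i) k ->
  closed_cell (G m) k x \/ closed_cell (G m) (neighbor i c k) x.
Proof.
move=> /= h1 h2.
have lowr k' : low (G m) (rev_ord i) (k' + evec i) = low (G m) (rev_ord i) k'.
  by rewrite -[in RHS](addrK (evec i) k') low_rev.
have h3 : low (G m) (rev_ord i) (neighbor i c k) <= coord (rev_ord i) x <= upp (G m) (rev_ord i) (neighbor i c k).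
  rewrite !(uppE _ (rev_ord i)) in h2 *.
  by case: c {h1} => /=; rewrite ?lowr ?low_rev ?wd_rev ?wd_rev'.
have w1 := wd_gt0 (ms_mac S m) i k.
have w2 := wd_gt0 (ms_mac S m) i (k + evec i).
have w3 := wd_gt0 (ms_mac S m) i (k - evec i).
have e1 := uppE (G m) i k; have e2 := low_shift (G m) i k; have e3 := upp_shift (G m) i k.
have e4 := uppE (G m) i (k + evec i); have e5 := uppE (G m) i (k - evec i).
have m1 := midE (G m) i k; have m2 := midE (G m) i (k + evec i); have m3 := midE (G m) i (k - evec i).
case: c h1 h3 => /= h1 h3.
  rewrite addrK in h1; have [hx|hx] := lerP (coord i x) (upp (G m) i k).
    by left; apply: (closed_cell_dir (i := i)) => //; lra.
  by right; apply: (closed_cell_dir (i := i)) => //; lra.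
have [hx|hx] := lerP (low (G m) i k) (coord i x).
  by left; apply: (closed_cell_dir (i := i)) => //; lra.
by right; apply: (closed_cell_dir (i := i)) => //; lra.
Qed.

Variable phi : (R * R) * R -> R.
Hypothesis sphi : smooth phi.

(** It originates in [work_balance], where [phi] is taken at face midpoints in one pressure work and
    at centers in the other, and it is the default of other quotients next to the boundary. The flag
    [e] selects level n or n + 1; among these quotients, those testing the convection of kinetic
    energy use level n + 1. *)
Definition half_quotient i (e : bool) m (p : ind3) : R :=
  normal_sign (side i p) * (phi (fpt (G m) i (fc i p), tn m (p.2 + e)%N) -
    phi (cpt (G m) p.1.1, tn m (p.2 + e)%N)) / (wd (G m) i p.1.1 / 2).

Lemma level_cases (n : nat) (e : bool) : ((n + e)%N == n) || ((n + e)%N == n.+1).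
Proof. by case: e; rewrite ?addn1 ?addn0 eqxx ?orbT. Qed.

Lemma half_points i e m (p : ind3) : exists x y, [/\ coord (rev_ord i) x = coord (rev_ord i) y,
     coord i x < coord i y,
     half_quotient i e m p = (phi (y, tn m (p.2 + e)%N) - phi (x, tn m (p.2 + e)%N)) / (coord i y - coord i x) &
     forall xi, coord (rev_ord i) xi = coord (rev_ord i) x -> coord i x <= coord i xi <= coord i y ->
       closed_cell (G m) p.1.1 xi].
Proof.
set k := p.1.1.
have w1 := wd_gt0 (ms_mac S m) i k; have w2 := wd_gt0 (ms_mac S m) (rev_ord i) k.
have e1 := uppE (G m) i k; have e2 := low_shift (G m) i k; have e3 := midE (G m) i k.
have e4 := uppE (G m) (rev_ord i) k; have e5 := midE (G m) (rev_ord i) k.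
rewrite /half_quotient -/k; case: (side i p) => /=.
  have er : coord (rev_ord i) (fpt (G m) i (k + evec i)) = mid (G m) (rev_ord i) k.
    by rewrite coord_fpt' -[in RHS](addrK (evec i) k) mid_rev.
  exists (cpt (G m) k), (fpt (G m) i (k + evec i)).
  rewrite er coord_fpt !coord_cpt e2 e1 e3 mul1r; split => //; first by lra.
    by congr (_ / _); lra.
  by move=> xi h1 h2; apply: (closed_cell_dir (i := i)); rewrite ?h1; lra.
exists (fpt (G m) i k), (cpt (G m) k).
rewrite coord_fpt' coord_fpt !coord_cpt e3 mulN1r; split => //; first by lra.
  by congr (_ / _); lra.
by move=> xi h1 h2; apply: (closed_cell_dir (i := i)); rewrite ?h1; lra.
Qed.

Lemma cvb_half_quotient i e : cv3 (half_quotient i e) (dx_ i phi).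
Proof.
apply: cvb_dx_points => // m p pm; have [x [y [h1 h2 h3 h4]]] := half_points i e m p.
exists x, y, (p.2 + e)%N; split => //; first exact: level_cases.
by move=> xi hx hx'; left; exact: h4.
Qed.

Definition across_quotient i (e : bool) m (p : ind3) : R :=
  (phi (fpt (G m) i (p.1.1 + evec i), tn m (p.2 + e)%N) -
   phi (fpt (G m) i p.1.1, tn m (p.2 + e)%N)) / wd (G m) i p.1.1.

Lemma cvb_across_quotient i e : cv3 (across_quotient i e) (dx_ i phi).
Proof.
apply: cvb_dx_points => // m p pm; set k := p.1.1.
have w1 := wd_gt0 (ms_mac S m) i k; have w2 := wd_gt0 (ms_mac S m) (rev_ord i) k.
have e1 := uppE (G m) i k; have e2 := low_shift (G m) i k.
have e4 := uppE (G m) (rev_ord i) k; have e5 := midE (G m) (rev_ord i) k.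
have er : coord (rev_ord i) (fpt (G m) i (k + evec i)) = mid (G m) (rev_ord i) k.
  by rewrite coord_fpt' -[in RHS](addrK (evec i) k) mid_rev.
exists (fpt (G m) i k), (fpt (G m) i (k + evec i)), (p.2 + e)%N.
rewrite er coord_fpt' !coord_fpt e2 e1; split => //; first by lra.
- by rewrite /across_quotient -/k; congr (_ / _); ring.
- exact: level_cases.
- by move=> xi h1 h2; left; apply: (closed_cell_dir (i := i)); rewrite -/k ?h1; lra.
Qed.

(* Next to the boundary there is no neighbouring cell center; the quotient over
   half a cell keeps the array consistent there, and is multiplied by 0. *)
Definition center_quotient i (e : bool) m (p : ind3) : R :=
  if nb i p \in cells (G m) then
    (phi (cpt (G m) (fc i p), tn m (p.2 + e)%N) - phi (cpt (G m) (fc i p - evec i), tn m (p.2 + e)%N)) /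
      dual_dist (G m) i (fc i p)
  else half_quotient i e m p.

Lemma cvb_center_quotient i e : cv3 (center_quotient i e) (dx_ i phi).
Proof.
apply: cvb_dx_points => // m p pm; rewrite /center_quotient; case: ifPn => nG; last first.
  have [x [y [h1 h2 h3 h4]]] := half_points i e m p.
  exists x, y, (p.2 + e)%N; split => //; first exact: level_cases.
  by move=> xi hx hx'; left; exact: h4.
set s := fc i p; have d0 := dist_gt0 (ms_mac S m) i s; have dE := distE (G m) i s.
exists (cpt (G m) (s - evec i)), (cpt (G m) s), (p.2 + e)%N.
rewrite !coord_cpt mid_rev -dE; split => //; first by lra.
  exact: level_cases.
move=> xi h1 h2.
have h3 : low (G m) (rev_ord i) p.1.1 <= coord (rev_ord i) xi <= upp (G m) (rev_ord i) p.1.1.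
  have -> : coord (rev_ord i) xi = mid (G m) (rev_ord i) p.1.1.
    rewrite h1 /s /face; case: (side i p) => //.
    by rewrite -[in RHS](addrK (evec i) p.1.1) mid_rev.
  have := wd_gt0 (ms_mac S m) (rev_ord i) p.1.1.
  by have := uppE (G m) (rev_ord i) p.1.1; have := midE (G m) (rev_ord i) p.1.1; lra.
have [?|?] := closed_cell_pair (i := i) (c := side i p) h2 h3; first by left.
by right; exists i, (side i p).
Qed.

(** It compares two edges orthogonal to e^(i) that follow one another along the other direction, and
    is paired with the transverse dual fluxes. *)
Definition trans_quotient i (e : bool) m (p : ind3) : R :=
  let i' := rev_ord i in let s := face i' (side i' p) (fc i p) in
  if nb i' p \in cells (G m) then
    (phi (fpt (G m) i s, tn m (p.2 + e)%N) - phi (fpt (G m) i (s - evec i'), tn m (p.2 + e)%N)) /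
      dual_dist (G m) i' s
  else half_quotient i' e m p.

Lemma cvb_trans_quotient i e : cv3 (trans_quotient i e) (dx_ (rev_ord i) phi).
Proof.
set i' := rev_ord i; have ri : rev_ord i' = i by rewrite /i' rev_ordK.
apply: cvb_dx_points => // m p pm; rewrite /trans_quotient -/i'; case: ifPn => nG; last first.
  have [x [y [h1 h2 h3 h4]]] := half_points i' e m p.
  exists x, y, (p.2 + e)%N; split => //; first exact: level_cases.
  by move=> xi hx hx'; left; exact: h4.
set s := face i' _ (fc i p); have d0 := dist_gt0 (ms_mac S m) i' s; have dE := distE (G m) i' s.
have lows : low (G m) i s = low (G m) i (fc i p).
  by rewrite /s {1}/face; case: (side i' p) => //; have [] := low_trans (G m) i (fc i p).
exists (fpt (G m) i (s - evec i')), (fpt (G m) i s), (p.2 + e)%N.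
rewrite ri !coord_fpt !(coord_fpt' (G m) i) -dE; split => //; last 2 first.
- exact: level_cases.
- move=> xi h1 h2.
  have h3 : low (G m) (rev_ord i') p.1.1 <= coord (rev_ord i') xi <= upp (G m) (rev_ord i') p.1.1.
    rewrite ri h1 (low_trans _ i s).2 lows.
    have := wd_gt0 (ms_mac S m) i p.1.1.
    have := uppE (G m) i p.1.1; have := low_shift (G m) i p.1.1; rewrite /face.
    by case: (side i p) => /= f1 f2 f3; lra.
  have h2' : mid (G m) i' (face i' (side i' p) p.1.1 - evec i') <= coord i' xi <= mid (G m) i' (face i' (side i' p) p.1.1).
    move: h2; have hm k : mid (G m) i' (k + evec i) = mid (G m) i' k.
      by rewrite -[in RHS](addrK (evec i) k) /i' mid_rev.
    have [->|->] : s = fc i' p \/ s = fc i' p + evec i.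
    - by rewrite /s /face; case: (side i p); case: (side i' p); rewrite ?(addrAC _ (evec i')); tauto.
    - by [].
    - by rewrite -/i' (addrAC _ (evec i)) !hm.
  have [?|?] := closed_cell_pair (i := i') h2' h3; first by left.
  by right; exists i', (side i' p).
- by rewrite (low_trans _ i s).2.
- by lra.
Qed.

End test_quotients.

Section test_functions.
Context {R : realType}.
Variables (Omega : set (R * R)) (T : R) (G : nat -> grid R) (N : nat -> nat).
Hypothesis S : mesh_sequence Omega T G N.
Variable phi : (R * R) * R -> R.
Hypothesis tphi : test_function Omega T phi.

Lemma test_zero x t : 0 <= t -> ~ Omega x \/ T <= t -> phi (x, t) = 0.
Proof.
have [_ [K [_ KO K0]]] := tphi; move=> t0 h; apply: K0 => // /KO [/= Ox].
by rewrite in_itv /= => /andP[_ tT]; case: h => // hT; rewrite ltNge hT in tT.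
Qed.

(** The midpoint of an edge that is not internal lies in a closed grid cell outside the mesh, hence
    outside [Omega] by [outer_cell]. *)
Lemma test_face_zero m i s t : 0 <= t -> s \notin int_edges (G m) i ->
  phi (fpt (G m) i s, t) = 0.
Proof.
move=> t0; rewrite mem_int_edges negb_and => h; apply: test_zero => //; left.
have [c1 c2] := fpt_closed (ms_mac S m) i s.
by case/orP : h => h; apply: (outer_cell (ms_mac S m) (ms_open S) h).
Qed.

End test_functions.

(** * Cell averages of the topography *)

Section topography.
Context {R : realType}.
Variables (Omega : set (R * R)) (T : R) (G : nat -> grid R) (N : nat -> nat).
Hypothesis S : mesh_sequence Omega T G N.
Local Notation idx3 := (idx3 G N).
Local Notation Q3 := (Q3 T G N).
Local Notation cv3 a f := (cvb (mu3 R) (cylinder Omega T) idx3 Q3 a f).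
Local Notation side i p := (coord i p.1.2).
Local Notation fc i p := (face i (coord i p.1.2) p.1.1).
Local Notation nb i p := (neighbor i (coord i p.1.2) p.1.1).
Variables z zs : R * R -> R.
Hypothesis szs : smooth zs.
Hypothesis zE : forall x, closure Omega x -> z x = zs x.
Local Notation zc m k := (mean (cell (G m) k) z).

Lemma cell_itg m k (f : R * R -> R) : continuous f ->
  (mu2 R).-integrable (cell (G m) k) (EFin \o f).
Proof.
by move=> cf; apply: itg_oboxT => //=; rewrite -subr_gt0; exact: (wd_gt0 (ms_mac S m)).
Qed.

Lemma cell_moment m k i :
  \int[mu2 R]_(x in cell (G m) k) (coord i x - coord i (cpt (G m) k)) = 0.
Proof.
rewrite coord_cpt -[RHS](@rint_moment R (low (G m) ord0 k, low (G m) ord_max k)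
  (upp (G m) ord0 k, upp (G m) ord_max k) _ _ i) /=; last 2 first.
- by rewrite -subr_gt0; exact: (wd_gt0 (ms_mac S m)).
- by rewrite -subr_gt0; exact: (wd_gt0 (ms_mac S m)).
by rewrite /mid -!(coord_pair i (fun i => _ (G m) i k)).
Qed.

Lemma continuous_coord i : continuous (fun x : R * R => coord i x).
Proof. by rewrite /coord; case: (i == ord0) => x; [exact: cvg_fst|exact: cvg_snd]. Qed.

Lemma closed_cell_center m k x y : cell (G m) k x ->
  (forall i, `|coord i y - coord i (cpt (G m) k)| <= `|coord i x - coord i (cpt (G m) k)|) ->
  closed_cell (G m) k y.
Proof.
move=> /cellP hx h; apply/closed_cellP => i; have := h i; have := hx i.
rewrite coord_cpt (midE _ i) (uppE _ i) => /andP[h1 h2] h3.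
have h4 : `|coord i x - (low (G m) i k + wd (G m) i k / 2)| <= wd (G m) i k / 2.
  by rewrite ler_norml; apply/andP; split; lra.
by have := le_trans h3 h4; rewrite ler_norml => /andP[h5 h6]; apply/andP; split; lra.
Qed.

Lemma cell_facts m k : k \in cells (G m) -> [/\
  measurable (cell (G m) k : set (measurableTypeR R * measurableTypeR R)),
  0 < area (cell (G m) k) & (mu2 R (cell (G m) k) < +oo)%E].
Proof.
move=> kG; split; first exact: measurable_obox.
  by rewrite (area_cellE (ms_mac S m) ord0) mulr_gt0// (wd_gt0 (ms_mac S m)).
apply: le_lt_trans (fin_Omega S); apply: le_measure; rewrite ?inE//.
- exact: measurable_obox.
- exact: measurable_Omega S.
exact: (cell_sub (ms_mac S m) kG).
Qed.

(* The first-order Taylor term at the center of a cell has mean zero; hence the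
   error is o(mesh_size), and difference quotients of the means converge. *)
Lemma mean_dist m k (D : 'I_2 -> R) (e : R) : k \in cells (G m) ->
  (forall i y, closed_cell (G m) k y -> `|'D_(evec i) zs y - D i| <= e) ->
  `|zc m k - zs (cpt (G m) k)| <= 2 * e * mesh_size (G m).
Proof.
move=> kG hD; set c := cpt (G m) k; set A := cell (G m) k.
have [mA aA finA] := cell_facts kG; rewrite -/A in mA aA finA.
have cz : continuous zs by exact: smooth_continuous.
have cc : closed_cell (G m) k c := cpt_closed S m k.
have e0 : 0 <= e by apply: le_trans (hD ord0 c cc).
pose f x := zs x - zs c - ((coord ord0 x - coord ord0 c) * D ord0 + (coord ord_max x - coord ord_max c) * D ord_max).
have fb x : A x -> `|f x| <= 2 * e * mesh_size (G m).
  move=> Ax; have cx := cell_closed Ax.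
  have bx i : `|coord i x - coord i c| <= mesh_size (G m) by exact: (closed_cell_dist S i kG cx cc).
  (* Only directional derivatives are at hand, so the center is joined to [x] by two axis-parallel
     segments with corner [y]; both stay in the closed cell. *)
  pose y : R * R := (x.1, c.2).
  have [xi [k1 k2 k3]] : exists xi : R * R, [/\ coord (rev_ord ord0) xi = coord (rev_ord ord0) c,
    `|coord ord0 xi - coord ord0 c| <= `|coord ord0 y - coord ord0 c| &
    zs y - zs c = (coord ord0 y - coord ord0 c) * 'D_(evec ord0) zs xi].
    by apply: plane_mvt => //; rewrite rev0.
  have [xi' [l1 l2 l3]] : exists xi : R * R, [/\ coord (rev_ord ord_max) xi = coord (rev_ord ord_max) y,
    `|coord ord_max xi - coord ord_max y| <= `|coord ord_max x - coord ord_max y| &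
    zs x - zs y = (coord ord_max x - coord ord_max y) * 'D_(evec ord_max) zs xi].
    by apply: plane_mvt => //; rewrite revM.
  rewrite rev0 in k1; rewrite revM in l1.
  have cxi : closed_cell (G m) k xi.
    apply: closed_cell_center Ax _ => i; have [->|/eq_ord2 ->] := eqVneq i ord0; first exact: k2.
    by rewrite rev0 k1 subrr normr0.
  have cxi' : closed_cell (G m) k xi'.
    apply: closed_cell_center Ax _ => i; have [->|/eq_ord2 ->] := eqVneq i ord0; last by rewrite rev0.
    by rewrite l1.
  have -> : f x = (coord ord0 x - coord ord0 c) * ('D_(evec ord0) zs xi - D ord0) +
      (coord ord_max x - coord ord_max c) * ('D_(evec ord_max) zs xi' - D ord_max).
    rewrite /f -(subrK (zs y) (zs x)) -(addrA (zs x - zs y)) k3 l3.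
    have -> : coord ord0 y = coord ord0 x by [].
    have -> : coord ord_max y = coord ord_max c by [].
    by ring.
  apply: le_trans (ler_normD _ _) _; rewrite !normrM.
  have p1 := ler_pM (normr_ge0 _) (normr_ge0 _) (bx ord0) (hD ord0 xi cxi).
  have p2 := ler_pM (normr_ge0 _) (normr_ge0 _) (bx ord_max) (hD ord_max xi' cxi').
  lra.
have itc (c' : R) : (mu2 R).-integrable A (EFin \o (fun=> c')).
  by apply: (@cell_itg m k (cst c')) => x; exact: cvg_cst.
have itx i : (mu2 R).-integrable A (EFin \o (fun x => coord i x - coord i c)).
  by apply: itgB => //; apply: cell_itg; exact: continuous_coord.
have itz : (mu2 R).-integrable A (EFin \o (fun x => zs x - zs c)).
  by apply: itgB => //; exact: cell_itg.
have itx' i : (mu2 R).-integrable A (EFin \o (fun x => (coord i x - coord i c) * D i)).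
  have -> : (fun x => (coord i x - coord i c) * D i) = (fun x => D i * (coord i x - coord i c)).
    by apply/funext => x; rewrite mulrC.
  exact: itgZ.
have itf : (mu2 R).-integrable A (EFin \o f) by apply: itgB => //; exact: itgD.
have If : \int[mu2 R]_(x in A) f x = area A * (zc m k - zs c).
  rewrite /f RintegralB//; last by exact: itgD.
  have IZ i : \int[mu2 R]_(x in A) ((coord i x - coord i c) * D i) = 0.
    by rewrite (RintegralZr _ mA (itx i)) cell_moment mul0r.
  rewrite (RintegralD mA (itx' ord0) (itx' ord_max)) !IZ addr0 subr0.
  rewrite RintegralB//; last exact: cell_itg.
  rewrite rint_cst// mulrBr (mulrC _ (zs c)); congr (_ - _).
  rewrite /mean mulrA divff ?gt_eqF// mul1r; apply: eq_Rintegral => x; rewrite inE => Ax.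
  by rewrite zE//; apply: subset_closure; exact: (cell_sub (ms_mac S m) kG Ax).
rewrite -(ler_pM2l aA) -[X in X * _](gtr0_norm aA) -normrM -If.
apply: le_trans (le_normr_Rintegral mA itf) _.
rewrite [leRHS]mulrC -(rint_cst (mu2 R) mA); apply: le_Rintegral => //; exact: itg_abs.
Qed.

Lemma derive_bound : exists2 B : R, 0 <= B &
  forall i x, closure Omega x -> `|'D_(evec i) zs x| <= B.
Proof.
have [M M0 OM] := closure_bound S; have [K cK hK] := box2_compact M.
have b i : exists2 B : R, 0 <= B & forall x, K x -> `|'D_(evec i) zs x| <= B.
  by apply: compact_bound => //; exact: smooth_derive_continuous.
have [B B0 hB] := b ord0; have [B' B0' hB'] := b ord_max.
exists (B + B'); first exact: addr_ge0.
move=> i x /OM /hK Kx; case: (ord2P i) => ->.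
  by apply: le_trans (hB x Kx) _; rewrite lerDl.
by apply: le_trans (hB' x Kx) _; rewrite lerDr.
Qed.

(** Zero reference slopes give only [O(mesh_size)], but for every [m]: this bounds the arrays, while
    [mean_near], valid for large [m], gives their convergence. *)
Lemma mean_lip : exists2 B : R, 0 <= B & forall m k, k \in cells (G m) ->
  `|zc m k - zs (cpt (G m) k)| <= B * mesh_size (G m).
Proof.
have [B B0 hB] := derive_bound; exists (2 * B); first by rewrite mulr_ge0.
move=> m k kG; apply: (mean_dist (D := fun=> 0)) => // i y ky; rewrite subr0.
by apply: hB; exact: (closed_cell_closure S kG ky).
Qed.

Lemma mean_near (e : R) : 0 < e -> \forall m \near \oo, forall k, k \in cells (G m) ->
  `|zc m k - zs (cpt (G m) k)| <= e * mesh_size (G m).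
Proof.
move=> e0; have e20 : 0 < e / 2 by rewrite divr_gt0.
have hu i : \forall m \near \oo, forall k y, k \in cells (G m) -> closed_cell (G m) k y ->
    `|'D_(evec i) zs y - 'D_(evec i) zs (cpt (G m) k)| <= e / 2.
  have cD : continuous ('D_(evec i) zs) by exact: smooth_derive_continuous.
  have [r r0 hr] := uniform2 S cD e20.
  near=> m => k y kG ky; rewrite distrC; apply: ltW; apply: hr.
    exact: (closed_cell_closure S kG (cpt_closed S m k)).
  move=> i'; apply: le_lt_trans (closed_cell_dist S i' kG (cpt_closed S m k) ky) _.
  by near: m; exact: mesh_small S _ r0.
apply: filterS (filterI (hu ord0) (hu ord_max)) => m [h0 h1] k kG.
have -> : e = 2 * (e / 2) by field.
apply: (mean_dist (D := fun i => 'D_(evec i) zs (cpt (G m) k))) => // i y ky.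
by case: (ord2P i) => ->; [exact: h0|exact: h1].
Unshelve. all: by end_near. Qed.

Lemma near_plane (g : R * R -> R) : continuous g -> forall e : R, 0 < e ->
  \forall m \near \oo, forall (p : ind3) (x : R * R) y, p \in idx3 m -> cell (G m) p.1.1 x ->
    closure Omega y ->
    (forall i, `|coord i y - coord i x| <= 2 * mesh_size (G m)) -> `|g y - g x| <= e.
Proof.
move=> cg e e0; have [r r0 hr] := uniform2 S cg e0.
have r20 : 0 < r / 2 by rewrite divr_gt0.
near=> m => p x y pm kx cy h; apply: ltW; apply: hr => // i; apply: (le_lt_trans (h i)).
have : mesh_size (G m) < r / 2 by near: m; exact: mesh_small S _ r20.
by lra.
Unshelve. all: by end_near. Qed.

Lemma continuous_plane (g : R * R -> R) : continuous g ->
  continuous (fun y : (R * R) * R => g y.1).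
Proof. by move=> cg y; apply: (continuous_comp (f := fst)); [exact: cvg_fst|exact: cg]. Qed.

Lemma cvb_topography : cv3 (fun m p => zc m p.1.1) (fun y => zs y.1).
Proof.
have cz : continuous zs by exact: smooth_continuous.
have [B B0 hB] := mean_lip.
have [M M0 OM] := closure_bound S; have [K cK hK] := box2_compact M.
have [B' B0' hB'] := compact_bound cK cz.
have [Bm hm] : exists Bm : R, forall m, mesh_size (G m) <= Bm.
  have cv : cvgn (fun m => mesh_size (G m)) by apply/cvg_ex; exists 0; exact: ms_mesh S.
  have [Bm [_ h]] := cvg_seq_bounded cv.
  exists (Bm + 1) => m; apply: le_trans (ler_norm _) _; apply: h => //; by rewrite ltrDl.
apply: cvb_near.
- exact: partitions3 S.
- exists (B * Bm + B') => m p; rewrite (mem_idx3) => /andP[kG _].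
  rewrite -(subrK (zs (cpt (G m) p.1.1)) (zc m p.1.1)).
  apply: le_trans (ler_normD _ _) _; apply: lerD.
    by apply: le_trans (hB _ _ kG) _; rewrite ler_wpM2l.
  by apply: hB'; apply: hK; apply: OM; apply: (closed_cell_closure S kG (cpt_closed S m _)).
- by apply: bdf3 S _ _; exact: continuous_plane.
move=> e e0; have e20 : 0 < e / 2 by rewrite divr_gt0.
near=> m => p [x t'] pm [/= qx ht'].
have kx := quarter_cell (ms_mac S m) qx.
have kG : p.1.1 \in cells (G m) by move: pm; rewrite mem_idx3 => /andP[].
have h1 : forall k, k \in cells (G m) -> `|zc m k - zs (cpt (G m) k)| <= (e / 2) * mesh_size (G m).
  by near: m; exact: mean_near.
have h2 : forall (p : ind3) (x : R * R) y, p \in idx3 m -> cell (G m) p.1.1 x ->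
    closure Omega y ->
    (forall i, `|coord i y - coord i x| <= 2 * mesh_size (G m)) -> `|zs y - zs x| <= e / 2.
  by near: m; exact: near_plane.
have h3 : mesh_size (G m) < 1 by near: m; exact: mesh_small S _ ltr01.
have h4 := mesh_ge0 (G m).
apply: le_trans (ler_distD (zs (cpt (G m) p.1.1)) _ _) _; rewrite [leRHS]splitr; apply: lerD.
  by apply: le_trans (h1 _ kG) _; rewrite ler_piMr// ?ltW.
apply: (h2 p) => //; first exact: (closed_cell_closure S kG (cpt_closed S m _)).
by move=> i; have := cell_near S i kG (cpt_closed S m _) kx; lra.
Unshelve. all: by end_near. Qed.

(** The default keeps the array convergent at quarters without neighbour; there it is multiplied by
    a zero velocity or a zero test value. *)
Definition topo_quotient i m (p : ind3) : R :=
  if nb i p \in cells (G m) then (zc m (fc i p) - zc m (fc i p - evec i)) / dual_dist (G m) i (fc i p)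
  else 'D_(evec i) zs (cpt (G m) p.1.1).

Lemma plane_mvt_lt i x y : coord (rev_ord i) x = coord (rev_ord i) y -> coord i x < coord i y ->
  exists xi : R * R, [/\ coord (rev_ord i) xi = coord (rev_ord i) x,
    coord i x <= coord i xi <= coord i y &
    zs y - zs x = (coord i y - coord i x) * 'D_(evec i) zs xi].
Proof.
move=> h hl; have s0 : 0 < coord i y - coord i x by rewrite subr_gt0.
have [r /andP[r0 rs] hr] := @dir_mvt R _ zs (evec i) x _ (@smooth_derivable _ _ zs _ szs) s0.
have [c1 c2] := coord_line i x r.
by exists (x + r *: evec i); rewrite c1 c2 -hr -(evecE h); split => //; lra.
Qed.

(** The quotient of [zs] between the two centers is a derivative by the mean value theorem; [e1] and
    [e2] are the averaging errors divided by the distance of the centers. [B] and [K] are left free: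
    [mean_lip] then yields boundedness and [mean_near] convergence. *)
Lemma topo_quotientE i m (p : ind3) : p \in idx3 m -> exists y e1 e2,
  [/\ topo_quotient i m p = 'D_(evec i) zs y + e1 - e2, closure Omega y,
   forall i' x, cell (G m) p.1.1 x -> `|coord i' y - coord i' x| <= 2 * mesh_size (G m) &
   forall (B : R) K, 0 <= B -> (forall i k, k \in cells (G m) -> mesh_size (G m) <= K * wd (G m) i k) ->
   (forall k, k \in cells (G m) -> `|zc m k - zs (cpt (G m) k)| <= B * mesh_size (G m)) ->
   `|e1| <= B * K /\ `|e2| <= B * K].
Proof.
rewrite mem_idx3 => /andP[kG _]; rewrite /topo_quotient; case: ifPn => nG; last first.
  exists (cpt (G m) p.1.1), 0, 0; split.
  - by rewrite addr0 subr0.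
  - exact: (closed_cell_closure S kG (cpt_closed S m _)).
  - move=> i' x kx; have := cell_near S i' kG (cpt_closed S m _) kx; have := mesh_ge0 (G m); lra.
  - move=> B K B0 hK _; rewrite normr0; suff : 0 <= B * K by [].
    rewrite mulr_ge0//; have := hK i _ kG; have := mesh_ge0 (G m).
    have := wd_gt0 (ms_mac S m) i p.1.1 => w0 m0 h.
    by rewrite -(pmulr_lge0 _ w0) (le_trans m0 h).
set s := fc i p; have d0 := dist_gt0 (ms_mac S m) i s; have dE := distE (G m) i s.
have sG : s \in cells (G m) /\ s - evec i \in cells (G m).
  by move: nG; rewrite /s /face /neighbor; case: (side i p) => nG; rewrite ?addrK.
have [xi [h1 h2 h3]] : exists xi : R * R, [/\ coord (rev_ord i) xi = coord (rev_ord i) (cpt (G m) (s - evec i)),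
    coord i (cpt (G m) (s - evec i)) <= coord i xi <= coord i (cpt (G m) s) &
    zs (cpt (G m) s) - zs (cpt (G m) (s - evec i)) =
    (coord i (cpt (G m) s) - coord i (cpt (G m) (s - evec i))) * 'D_(evec i) zs xi].
  by apply: plane_mvt_lt; rewrite !coord_cpt ?mid_rev//; lra.
rewrite !coord_cpt mid_rev -dE in h1 h2 h3.
have hcl : closed_cell (G m) p.1.1 xi \/ closed_cell (G m) (nb i p) xi.
  apply: (closed_cell_pair S (i := i)) => //.
  have -> : coord (rev_ord i) xi = mid (G m) (rev_ord i) p.1.1.
    rewrite h1 /s /face; case: (side i p) => //.
    by rewrite -[in RHS](addrK (evec i) p.1.1) mid_rev.
  have := wd_gt0 (ms_mac S m) (rev_ord i) p.1.1.
  by have := uppE (G m) (rev_ord i) p.1.1; have := midE (G m) (rev_ord i) p.1.1; lra.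
exists xi, ((zc m s - zs (cpt (G m) s)) / dual_dist (G m) i s),
  ((zc m (s - evec i) - zs (cpt (G m) (s - evec i))) / dual_dist (G m) i s); split.
- have -> : 'D_(evec i) zs xi = (zs (cpt (G m) s) - zs (cpt (G m) (s - evec i))) / dual_dist (G m) i s.
    by rewrite h3 mulrC mulKf// gt_eqF.
  by field; rewrite gt_eqF.
- case: hcl => hcl; first exact: (closed_cell_closure S kG hcl).
  exact: (closed_cell_closure S nG hcl).
- move=> i' x kx; case: hcl => hcl.
    by have := cell_near S i' kG hcl kx; have := mesh_ge0 (G m); lra.
  exact: (nb_near S i' kG nG hcl kx).
move=> B K B0 hK hz.
have hd : mesh_size (G m) <= K * dual_dist (G m) i s.
  have := hK i _ sG.1; have := hK i _ sG.2; rewrite /dual_dist; lra.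
have hB k : k \in cells (G m) -> `|(zc m k - zs (cpt (G m) k)) / dual_dist (G m) i s| <= B * K.
  move=> kG'; rewrite normrM normfV (gtr0_norm d0) ler_pdivrMr//.
  by apply: le_trans (hz _ kG') _; rewrite -mulrA ler_wpM2l.
by split; apply: hB; case: sG.
Qed.

Lemma cvb_topo_quotient i : cv3 (topo_quotient i) (fun y => 'D_(evec i) zs y.1).
Proof.
have cD : continuous ('D_(evec i) zs) by exact: smooth_derive_continuous.
have [K K0 hK] := mesh_le S; have [B B0 hB] := mean_lip; have [B' B0' hB'] := derive_bound.
apply: cvb_near.
- exact: partitions3 S.
- exists (B' + B * K + B * K) => m p pm; have [y [e1 [e2 [-> cy _ he]]]] := topo_quotientE i pm.
  have [b1 b2] := he B K B0 (hK m) (hB m); have b3 := hB' i y cy.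
  apply: le_trans (ler_normB _ _) _; apply: lerD => //.
  by apply: le_trans (ler_normD _ _) _; apply: lerD.
- exact: (bdf3 S (continuous_plane cD)).
move=> e e0; have e30 : 0 < e / (3 * K) by rewrite divr_gt0// mulr_gt0.
have e40 : 0 < e / 3 by rewrite divr_gt0.
near=> m => p [x t'] pm [/= qx ht'].
have kx := quarter_cell (ms_mac S m) qx.
have [y [e1 [e2 [-> cy hy he]]]] := topo_quotientE i pm.
have h1 : forall k, k \in cells (G m) -> `|zc m k - zs (cpt (G m) k)| <= (e / (3 * K)) * mesh_size (G m).
  by near: m; exact: mean_near.
have h2 : forall (p : ind3) (x : R * R) y, p \in idx3 m -> cell (G m) p.1.1 x ->
    closure Omega y ->
    (forall i, `|coord i y - coord i x| <= 2 * mesh_size (G m)) -> `|'D_(evec i) zs y - 'D_(evec i) zs x| <= e / 3.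
  by near: m; exact: near_plane.
have [b1 b2] := he _ K (ltW e30) (hK m) h1.
have b3 := h2 p x y pm kx cy (fun i' => hy i' x kx).
have eK : e / (3 * K) * K = e / 3 by field; rewrite gt_eqF.
rewrite eK in b1 b2; move: b1 b2 b3; rewrite !ler_norml => /andP[? ?] /andP[? ?] /andP[? ?].
apply/andP; split; lra.
Unshelve. all: by end_near. Qed.

End topography.

(** * Arrays built from a solution *)

Section arrays.
Context {R : realType}.
Variables (Omega : set (R * R)) (T : R) (G : nat -> grid R) (N : nat -> nat).
Hypothesis S : mesh_sequence Omega T G N.
Local Notation dt := (tstep T N).
Local Notation idx3 := (idx3 G N).
Local Notation Q3 := (Q3 T G N).
Local Notation cv3 a f := (cvb (mu3 R) (cylinder Omega T) idx3 Q3 a f).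
Local Notation idx2 m := (idx2 (G m)).
Local Notation Q2 m := (quarter (G m)).
Local Notation tame2 := (tame_shift (mu2 R) (fun m => idx2 m) (fun m => Q2 m)
  (fun g : R * R -> R => continuous g)).
Local Notation cva2 a f := (cva (mu2 R) (fun m => idx2 m) (fun m => Q2 m) a f).
Local Notation plane := (measurableTypeR R * measurableTypeR R)%type.

Section piecewise.
Variables (A : nat -> int * int -> set (R * R)) (E : nat -> {fset int * int}).
Variables (c : ind2 -> int * int) (X : nat -> nat -> int * int -> R).
Hypothesis mA : forall m s, measurable (A m s : set plane).
Hypothesis cE : forall m j, j \in idx2 m -> c j \in E m.
Hypothesis AE : forall m j x s, j \in idx2 m -> s \in E m -> Q2 m j x -> A m s x <-> s = c j.
Let F m (y : (R * R) * R) := \sum_(n < N m) \sum_(s <- E m)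
  X m n.+1 s * \1_(A m s) y.1 * \1_(time_slab T (N m) n) y.2.

(** One argument for heights on cells and velocities on dual cells: [c j] is the piece that contains
    the quarter [j]. *)
Lemma piecewise_val m p y : p \in idx3 m -> Q3 m p y -> F m y = X m p.2.+1 (c p.1).
Proof.
rewrite mem_idx3 -mem_idx2 => /andP[jm nN] [/= qy sy].
rewrite /F (bigD1 (Ordinal nN))//= [X in _ + X]big1 ?addr0; last first.
  move=> n nn; rewrite big1// => s _; rewrite [X in _ * X]indicE.
  case: (boolP (y.2 \in _)); rewrite ?mulr0// inE /time_slab /= in_itv /= => /andP[h1 h2].
  exfalso; move/eqP: nn; apply; apply: val_inj => /=.
  have d0 := dt_gt0 S m; move/slabP : sy => /andP[h3 h4].
  apply/eqP; rewrite eqn_leq; apply/andP; split; rewrite -ltnS -(ltr_nat R) -(ltr_pM2r d0).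
    exact: le_lt_trans h1 h4.
  exact: lt_trans h3 h2.
rewrite (bigD1_seq (c p.1) (cE jm) (fset_uniq _))/= big1_seq ?addr0; last first.
  move=> s /andP[sc sE]; rewrite [X in _ * X * _]indicE.
  case: (boolP (y.1 \in _)); rewrite ?mulr0 ?mul0r// inE => /(AE jm sE qy) h.
  by rewrite h eqxx in sc.
rewrite !indicE !mem_set ?mulr1//.
  by rewrite /time_slab /= in_itv /=; move/slabP : sy => /andP[h1 ->]; rewrite andbT ltW.
by apply/(AE jm (cE jm) qy).
Qed.

Lemma piecewise_itg m : (mu3 R).-integrable (cylinder Omega T) (EFin \o F m).
Proof.
have mD := part_mD (partitions3 S).
apply: itg_sum => // n; apply: itg_sum => // s.
have -> : (fun y : plane * measurableTypeR R =>
    X m n.+1 s * \1_(A m s) y.1 * \1_(time_slab T (N m) n) y.2) =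
  (fun y => X m n.+1 s * \1_(A m s `*` time_slab T (N m) n) y).
  apply/funext => y; rewrite -mulrA; congr (_ * _); rewrite !indicE in_setX.
  by case: (_ \in _); rewrite ?mul1r ?mul0r.
apply: itgZ => //; apply: itg_indic => //; first exact: (part_fin (partitions3 S)).
apply: measurableX; first exact: mA.
exact: measurable_itv.
Qed.

Lemma piecewise_cva f : cvg_L1 (cylinder Omega T) F f ->
  cva (mu3 R) idx3 Q3 (fun m p => X m p.2.+1 (c p.1)) f.
Proof.
move=> [itf cv]; have mD := part_mD (partitions3 S).
have itd m : (mu3 R).-integrable (cylinder Omega T) (EFin \o (fun y => `|F m y - f y|)).
  by apply: itg_abs => //; apply: itgB => //; exact: piecewise_itg.
apply: (cvg_trans _ (fine_cvg cv)); apply: near_eq_cvg; apply: nearW => m /=.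
rewrite -[LHS]/(\int[mu3 R]_(y in cylinder Omega T) `|F m y - f y|).
rewrite (rint_part (partitions3 S) m (itd m)); apply: eq_big_seq => p pm.
by apply: eq_Rintegral => y; rewrite inE => Qy; rewrite (piecewise_val pm Qy).
Qed.

End piecewise.

(** [shift_time] already gives the values at level n for n >= 1. For n = 0 it gives level 1 instead
    of level 0, an error confined to one slab of length [dt m]. *)
Lemma cvb_level (X : nat -> nat -> ind2 -> R) (B : R) f :
  (forall m n j, (n <= N m)%N -> j \in idx2 m -> `|X m n j| <= B) ->
  cv3 (fun m p => X m p.2.+1 p.1) f -> cv3 (fun m p => X m p.2 p.1) f.
Proof.
move=> hB cX.
apply: (cvb_dist (partitions3 S) (cvb_shift3 S (shift_time_tame S) cX)).
  exists B => m p; rewrite mem_idx3 -mem_idx2 => /andP[jm nN]; apply: hB => //; exact: ltnW.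
have cl : dt m * (fine (mu2 R Omega) * (B + B)) @[m --> \oo] --> 0 * (fine (mu2 R Omega) * (B + B)).
  by apply: cvgMl; exact: (ms_dt S).
rewrite mul0r in cl; apply: (squeeze_cvgr _ (cvg_cst 0) cl); apply: nearW => m.
have N0 := ms_N S m; have d0 := dt_gt0 S m.
rewrite (sum_wt3 S) -(prednK N0) big_ord_recl /= [X in _ + X]big1 ?addr0; last first.
  by move=> n _; rewrite big1 ?mulr0// => j _; rewrite /bump /= add1n subrr normr0 mulr0.
apply/andP; split.
  apply: mulr_ge0; first exact: ltW.
  by apply: sumr_ge0 => j _; rewrite mulr_ge0// -(wt2 S) wt_ge0.
rewrite ler_pM2l// -(sum_wt (partitions2 S) m) big_distrl /= ; apply: ler_sum_in => j jm.
rewrite (wt2 S) ler_wpM2l//; first by rewrite -(wt2 S) wt_ge0.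
by apply: le_trans (ler_normB _ _) _; rewrite lerD// hB.
Qed.

Lemma reflection_id : reflection G (fun _ j => j).
Proof.
split=> // m j x y i; rewrite mem_idx2 => jm /(quarter_closed S) qx /(quarter_closed S) qy.
by have := closed_cell_dist S i jm qx qy; have := mesh_ge0 (G m); lra.
Qed.

Lemma reflection_if (b : bool) s : reflection G s ->
  reflection G (fun m j => if b then s m j else j).
Proof. by case: b => // _; exact: reflection_id. Qed.

Lemma cva_mean_reflections (s s' : nat -> ind2 -> ind2) f (a : nat -> ind2 -> R) :
  reflection G s -> reflection G s' -> (mu2 R).-integrable Omega (EFin \o f) ->
  let r (J : bool * bool) m j :=
    let j1 := if J.1 then s m j else j in if J.2 then s' m j1 else j1 in
  (forall m j, j \in idx2 m -> a m j * (\sum_J wq (G m) (r J m j)) =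
     \sum_J \int[mu2 R]_(x in Q2 m (r J m j)) f x) ->
  cva2 a f.
Proof.
move=> rs rs' itf r ha.
have t1 (b : bool) : tame2 (fun m j => if b then s m j else j).
  by apply: (refl_tame2 S); exact: reflection_if.
have t2 (b : bool) : tame2 (fun m j => if b then s' m j else j).
  by apply: (refl_tame2 S); exact: reflection_if.
apply: (cva_mean (partitions2 S) (dense2 S) (@qptQ R Omega T G N S) (J := (bool * bool)%type) (r := r) itf).
- by move=> J; exact: (tame_shift_comp (@qptQ R Omega T G N S) (t1 J.1) (t2 J.2)).
- move=> J m F _; rewrite /r.
  by rewrite (refl_sum m (fun j => F (if J.2 then s' m j else j)) (reflection_if J.1 rs))
    (refl_sum m F (reflection_if J.2 rs')).
- by move=> m j jm; rewrite (wt2 S) mulr_gt0// divr_gt0// (wd_gt0 (ms_mac S m)).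
- move=> m j jm; rewrite (bigD1 (false, false))//= lerDl sumr_ge0// => J _; exact: wt_ge0.
move=> m j jm; rewrite -ha//; congr (_ * _); by apply: eq_bigr => J _; exact: (wt2 S).
Qed.

Lemma init_height_cva (h0 : R * R -> R) : (mu2 R).-integrable Omega (EFin \o h0) ->
  cva2 (fun m j => mean (cell (G m) j.1) h0) h0.
Proof.
move=> ith; apply: (cva_mean_reflections (reflection_mid S ord0) (reflection_mid S ord_max) ith).
move=> m j; rewrite mem_idx2 => kG.
transitivity (mean (cell (G m) j.1) h0 * \sum_J wq (G m) (rcell J j)); first by [].
transitivity (\sum_J (fun j' => \int[mu2 R]_(x in Q2 m j') h0 x) (rcell J j)); last by [].
rewrite sum_rcell (sum_rcell j (fun j' => \int[mu2 R]_(x in Q2 m j') h0 x)).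
rewrite -(rint_cell (ms_mac S m) (measurable_Omega S) (fin_Omega S) kG ith).
have [_ aA _] := cell_facts S kG.
have -> : \sum_(j' <- cell_quarters j.1) wq (G m) j' = area (cell (G m) j.1).
  by rewrite !big_cons big_nil (area_cell (ms_mac S m)) /wq /=; field.
by rewrite /mean mulrAC mulVf ?mul1r// gt_eqF.
Qed.

(** The mean over the reflected group is defined at every quarter and converges to [v0]. At internal
    edges it is the dual-cell average; next to the boundary, where the scheme imposes 0, it stands
    in for the missing average. *)
Lemma init_velocity_cva i (v0 : R * R -> R) : (mu2 R).-integrable Omega (EFin \o v0) ->
  exists2 a, cva2 a v0 & forall m j, j \in idx2 m ->
    neighbor i (coord i j.2) j.1 \in cells (G m) ->
    a m j = mean (dual_cell (G m) i (face i (coord i j.2) j.1)) v0.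
Proof.
move=> itv.
pose I m J j := \int[mu2 R]_(x in Q2 m (rdual (G m) i J j)) v0 x.
pose W m J j := wq (G m) (rdual (G m) i J j).
have w0 m j : 0 < wq (G m) j by rewrite mulr_gt0// divr_gt0// (wd_gt0 (ms_mac S m)).
have W0 m j : 0 < \sum_J W m J j.
  by rewrite (bigD1 (false, false))//= ltr_wpDr ?w0//; apply: sumr_ge0 => J _; apply: ltW; exact: w0.
exists (fun m j => (\sum_J I m J j) / (\sum_J W m J j)).
  apply: (cva_mean_reflections (reflection_face S i) (reflection_mid S (rev_ord i)) itv) => m j jm.
  by rewrite divfK// gt_eqF.
move=> m j; rewrite mem_idx2 => kG nG.
have sI : face i (coord i j.2) j.1 \in int_edges (G m) i by rewrite face_int.
rewrite /I /W (sum_rdual (fun j' => \int[mu2 R]_(x in Q2 m j') v0 x) nG) (sum_rdual (wq (G m)) nG).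
have hm := ms_mac S m; have mO := measurable_Omega S; have fO := fin_Omega S.
rewrite -(rint_dual hm mO fO sI itv) /mean mulrC; congr (_^-1 * _).
rewrite (area_dual hm mO fO sI) !big_cons big_nil !(wqE (G m) i) /= wd_rev edge_lengthE /dual_dist.
by field.
Qed.

End arrays.

Section initial_test.
Context {R : realType}.

Lemma continuous_slice (phi : (R * R) * R -> R) (t : R) : continuous phi ->
  continuous (fun x : R * R => phi (x, t)).
Proof.
move=> cphi x; apply: (@cvg_comp _ _ _ (fun x0 : R * R => (x0, t)) phi _ (nbhs (x, t))); last exact: cphi.
move=> A [[/= B1 B2] [h1 h2] sub]; apply: filterS h1 => y By; apply: sub.
by split => //; exact: nbhs_singleton h2.
Qed.

Variables (Omega : set (R * R)) (T : R) (G : nat -> grid R) (N : nat -> nat).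
Hypothesis S : mesh_sequence Omega T G N.
Local Notation cv2 a f := (cvb (mu2 R) Omega (fun m => idx2 (G m)) (fun m => quarter (G m)) a f).

Lemma cvb_init_points (phi : (R * R) * R -> R) (P : nat -> ind2 -> R * R) : continuous phi ->
  (forall m j, j \in idx2 (G m) -> closed_cell (G m) j.1 (P m j)) ->
  cv2 (fun m j => phi (P m j, 0)) (fun x => phi (x, 0)).
Proof.
move=> cphi hP; have c0 := @continuous_slice phi 0 cphi.
have [M M0 OM] := closure_bound S; have [K cK hK] := box2_compact M.
have [B B0 hB] := compact_bound cK c0.
have hcl m j : j \in idx2 (G m) -> closure Omega (P m j).
  by move=> jm; apply: (closed_cell_closure S (k := j.1) _ (hP m j jm)); rewrite -mem_idx2.
apply: cvb_near.
- exact: partitions2 S.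
- by exists B => m j jm; apply: hB; apply: hK; apply: OM; exact: hcl.
- exact: (bdf2 S c0).
move=> e e0; have [r r0 hr] := uniform2 S c0 e0.
near=> m => j x jm qx; apply: ltW; apply: hr; first exact: hcl.
move=> i; have jG : j.1 \in cells (G m) by rewrite -mem_idx2.
apply: le_lt_trans (closed_cell_dist S i jG (hP m j jm) (quarter_closed S qx)) _.
by near: m; exact: mesh_small S _ r0.
Unshelve. all: by end_near. Qed.

End initial_test.

(** * Limits of the unknowns and of the initial data *)

Section solutions.
Context {R : realType}.
Variables (Omega : set (R * R)) (T : R) (G : nat -> grid R) (N : nat -> nat).
Hypothesis S : mesh_sequence Omega T G N.
Local Notation idx3 := (idx3 G N).
Local Notation Q3 := (Q3 T G N).
Local Notation cv3 a f := (cvb (mu3 R) (cylinder Omega T) idx3 Q3 a f).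
Local Notation cv2 a f := (cvb (mu2 R) Omega (fun m => idx2 (G m)) (fun m => quarter (G m)) a f).
Local Notation nb i j := (neighbor i (coord i j.2) j.1).
Variables (h : nat -> nat -> int * int -> R) (u : nat -> nat -> 'I_2 -> int * int -> R).
Variables (C : R) (hbar : (R * R) * R -> R) (ubar : 'I_2 -> (R * R) * R -> R).
Hypothesis C0 : 0 <= C.
Hypothesis hC : forall m n k, (n <= N m)%N -> k \in cells (G m) -> `|h m n k| <= C.
Hypothesis uC : forall m n i s, (n <= N m)%N -> s \in edges (G m) i -> `|u m n i s| <= C.

Definition limit_height y := clip C (hbar y).
Definition limit_velocity i y := clip C (ubar i y).
Local Notation H := limit_height.
Local Notation U := limit_velocity.

Lemma measurable_dual_cell m i s :
  measurable (dual_cell (G m) i s : set (measurableTypeR R * measurableTypeR R)).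
Proof.
have mh b k : measurable (half_cell (G m) i b k : set (measurableTypeR R * measurableTypeR R)).
  exact: (measurable_half (ms_mac S m)).

apply: measurableU.
  rewrite (_ : (fun x => _) = (if s \in cells (G m) then half_cell (G m) i false s else set0)).
    by case: ifP.
  by apply/seteqP; split => x /=; case: ifP => // _ [].
rewrite (_ : (fun x => _) = (if s - evec i \in cells (G m) then half_cell (G m) i true (s - evec i) else set0)).
  by case: ifP.
by apply/seteqP; split => x /=; case: ifP => // _ [].
Qed.

Lemma quarter_dual_cell m i j x s : j \in idx2 (G m) -> quarter (G m) j x ->
  dual_cell (G m) i s x <-> s = face i (coord i j.2) j.1.
Proof.
rewrite mem_idx2 => jG qx; have kx := quarter_cell (ms_mac S m) qx.
have hx : half_cell (G m) i (coord i j.2) j.1 x.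
  by apply: (@quarter_half _ _ _ (ms_mac S m) i _ (coord (rev_ord i) j.2)); rewrite mkbE; case: j {jG kx} qx.
have ex b k : half_cell (G m) i b k x -> k = j.1 /\ b = coord i j.2.
  move=> [kx' hb]; have e := cell_disjoint (ms_mac S m) kx' (cell_closed kx); split => //.
  move: hx hb => [_]; rewrite e; case: b; case: (coord i j.2) => //= h1 h2;
    by have := lt_trans h1 h2; rewrite ltxx.
split.
  case=> -[sG /ex[]].
    by move=> -> <-.
  by move=> <- <-; rewrite /face subrK.
move=> ->; rewrite /dual_cell /=; case E : (coord i j.2) hx => hx; rewrite /face.
  by right; rewrite addrK.
by left.
Qed.

Section limits.
Hypothesis h_cvg : cvg_L1 (cylinder Omega T)
  (fun m => height_function T (G m) (N m) (h m)) hbar.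
Hypothesis u_cvg : forall i, cvg_L1 (cylinder Omega T)
  (fun m => velocity_function T (G m) (N m) (u m) i) (ubar i).

Lemma height_cva : cva (mu3 R) idx3 Q3 (fun m p => h m p.2.+1 p.1.1) hbar.
Proof.
apply: (piecewise_cva S (A := fun m k => cell (G m) k) (E := fun m => cells (G m)) (c := fun j => j.1)) => //.
- by move=> m k; exact: measurable_obox.
- by move=> m j; rewrite mem_idx2.
- move=> m j x k jm kG qx; have kx := quarter_cell (ms_mac S m) qx; split => [kx'|-> //].
  exact: (cell_disjoint (ms_mac S m) kx' (cell_closed kx)).
Qed.

Lemma velocity_cva i : cva (mu3 R) idx3 Q3
  (fun m p => u m p.2.+1 i (face i (coord i p.1.2) p.1.1)) (ubar i).
Proof.
apply: (piecewise_cva S (A := fun m s => dual_cell (G m) i s) (E := fun m => edges (G m) i)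
  (c := fun j => face i (coord i j.2) j.1) (X := fun m n s => u m n i s)); last exact: u_cvg.
- by move=> m s; exact: measurable_dual_cell.
- by move=> m j; rewrite mem_idx2; exact: face_edges.
- by move=> m j x s jm _; exact: quarter_dual_cell.
Qed.

Lemma height_bound m n j : (n <= N m)%N -> j \in idx2 (G m) -> `|hq (h m n) j| <= C.
Proof. by rewrite mem_idx2 => nN jG; exact: hC. Qed.

Lemma velocity_bound m n i j : (n <= N m)%N -> j \in idx2 (G m) -> `|uq (u m n) i j| <= C.
Proof. by rewrite mem_idx2 => nN jG; apply: uC => //; exact: face_edges. Qed.

Lemma idx3P m (p : ind3) : p \in idx3 m -> p.1 \in idx2 (G m) /\ (p.2 < N m)%N.
Proof. by rewrite mem_idx3 -mem_idx2 => /andP. Qed.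

Lemma cvb_height : cv3 (fun m p => hq (h m p.2.+1) p.1) H.
Proof.
have hB m p : p \in idx3 m -> `|h m p.2.+1 p.1.1| <= C.
  by move=> /idx3P[? ?]; exact: height_bound.
exact: (cvb_clip_bounded (partitions3 S) C0 hB (proj1 h_cvg) height_cva).
Qed.

Lemma cvb_velocity i : cv3 (fun m p => uq (u m p.2.+1) i p.1) (U i).
Proof.
have hB m p : p \in idx3 m -> `|u m p.2.+1 i (face i (coord i p.1.2) p.1.1)| <= C.
  by move=> /idx3P[? ?]; exact: velocity_bound.
exact: (cvb_clip_bounded (partitions3 S) C0 hB (proj1 (u_cvg i)) (velocity_cva i)).
Qed.

Lemma cvb_height0 : cv3 (fun m p => hq (h m p.2) p.1) H.
Proof. by apply: (cvb_level S (X := fun m n j => hq (h m n) j) height_bound); exact: cvb_height. Qed.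

Lemma cvb_velocity0 i : cv3 (fun m p => uq (u m p.2) i p.1) (U i).
Proof.
apply: (cvb_level S (X := fun m n j => uq (u m n) i j)); last exact: cvb_velocity.
by move=> m n j; exact: velocity_bound.
Qed.

Lemma cvb_height_face i : cv3 (fun m p => hq (h m p.2.+1) (reflect_face (G m) i p.1)) H.
Proof. exact: (cvb_shift3 S (refl_tame3 S (reflection_face S i)) cvb_height). Qed.

Lemma cvb_upwind_height i : cv3 (fun m p => qh (G m) (h m p.2) (u m p.2) i p.1) H.
Proof.
apply: (cvb_sel (partitions3 S) cvb_height0
  (cvb_shift3 S (refl_tame3 S (reflection_face S i)) cvb_height0)) => m p pm.
exact: qh_sel.
Qed.

Lemma cvb_upwind_self i : cv3 (fun m p => qus (G m) (h m p.2) (u m p.2) i p.1) (U i).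
Proof.
apply: (cvb_sel (partitions3 S) (cvb_velocity0 i)
  (cvb_shift3 S (refl_tame3 S (reflection_mid S i)) (cvb_velocity0 i))) => m p pm.
exact: qus_sel.
Qed.

Lemma cvb_upwind_trans i : cv3 (fun m p => qut (G m) (h m p.2) (u m p.2) i p.1) (U i).
Proof.
apply: (cvb_sel (partitions3 S) (cvb_velocity0 i)
  (cvb_shift3 S (refl_tame3 S (reflection_face S (rev_ord i))) (cvb_velocity0 i))) => m p pm.
exact: qut_sel.
Qed.

Lemma height_ae : {ae mu3 R, forall y, cylinder Omega T y -> hbar y = H y}.
Proof.
have hB m p : p \in idx3 m -> `|h m p.2.+1 p.1.1| <= C.
  by move=> /idx3P[? ?]; exact: height_bound.
exact: (cva_clip_ae (partitions3 S) C0 hB (proj1 h_cvg) height_cva).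
Qed.

Lemma velocity_ae i : {ae mu3 R, forall y, cylinder Omega T y -> ubar i y = U i y}.
Proof.
have hB m p : p \in idx3 m -> `|u m p.2.+1 i (face i (coord i p.1.2) p.1.1)| <= C.
  by move=> /idx3P[? ?]; exact: velocity_bound.
exact: (cva_clip_ae (partitions3 S) C0 hB (proj1 (u_cvg i)) (velocity_cva i)).
Qed.

End limits.

Section initial.
Variables (h0 : R * R -> R) (u0 : 'I_2 -> R * R -> R).
Hypothesis h0_itg : (mu2 R).-integrable Omega (EFin \o h0).
Hypothesis u0_itg : forall i, (mu2 R).-integrable Omega (EFin \o u0 i).
Hypothesis h0E : forall m k, k \in cells (G m) -> h m 0 k = mean (cell (G m) k) h0.
Hypothesis u0E : forall m i s, s \in int_edges (G m) i ->
  u m 0 i s = mean (dual_cell (G m) i s) (u0 i).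

Lemma init_cva : cva (mu2 R) (fun m => idx2 (G m)) (fun m => quarter (G m))
  (fun m j => hq (h m 0%N) j) h0.
Proof.
apply: cvg_trans (init_height_cva S h0_itg); apply: near_eq_cvg; apply: nearW => m.
by apply: eq_big_seq => j; rewrite mem_idx2 => jG; rewrite /hq h0E.
Qed.

Lemma cvb_init_height : cv2 (fun m j => hq (h m 0%N) j) (fun x => clip C (h0 x)).
Proof.
have hB m j : j \in idx2 (G m) -> `|hq (h m 0%N) j| <= C by move=> jm; exact: height_bound.
exact: (cvb_clip_bounded (partitions2 S) C0 hB h0_itg init_cva).
Qed.

Lemma init_height_ae : {ae mu2 R, forall x, Omega x -> h0 x = clip C (h0 x)}.
Proof.
have hB m j : j \in idx2 (G m) -> `|hq (h m 0%N) j| <= C by move=> jm; exact: height_bound.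
exact: (cva_clip_ae (partitions2 S) C0 hB h0_itg init_cva).
Qed.

(** Clipping changes nothing where the array is the discrete initial velocity, already bounded by
    [C]; next to the boundary it supplies the bound that [cvb] requires. *)
Lemma cvb_init_velocity i : exists2 a, cv2 a (fun x => clip C (u0 i x)) &
  forall m j, j \in idx2 (G m) -> nb i j \in cells (G m) -> a m j = uq (u m 0%N) i j.
Proof.
have [a ca aE] := init_velocity_cva S i (u0_itg i).
exists (fun m j => clip C (a m j)); first exact: (cvb_clip (partitions2 S)).
move=> m j jm nG; have jG : j.1 \in cells (G m) by rewrite -mem_idx2.
by rewrite aE// -u0E ?face_int// clip_id//; exact: velocity_bound.
Qed.

(* Near the boundary of Omega the velocity is set to zero, so that nothing is
   known on u0 there: hence the restriction to the support of phi. *)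
Lemma init_velocity_ae i (phi : (R * R) * R -> R) : test_function Omega T phi ->
  {ae mu2 R, forall x, Omega x -> phi (x, 0) != 0 -> u0 i x = clip C (u0 i x)}.
Proof.
move=> tphi; have cphi : continuous phi by case: tphi => + _; exact: smooth_continuous.
have c0 := @continuous_slice _ phi 0 cphi.
have [a ca aE] := init_velocity_cva S i (u0_itg i).
apply: (cva_bound_ae (partitions2 S) C0 (u0_itg i) ca (phi := fun x => phi (x, 0))).
  exact: (bdf2 S c0).
move=> e e0; have [r r0 hr] := uniform2 S c0 e0.
near=> m => j x jm qx; have jG : j.1 \in cells (G m) by rewrite -mem_idx2.
have [nG|nG] := boolP (nb i j \in cells (G m)); [right|left].
  rewrite aE// -u0E ?face_int//; exact: velocity_bound.
have kx := quarter_cell (ms_mac S m) qx; have ckx := cell_closed kx.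
have z0 := @test_face_zero _ _ _ _ _ S _ tphi m i (face i (coord i j.2) j.1) 0 (lexx 0).
have := hr x (fpt (G m) i (face i (coord i j.2) j.1)) (closed_cell_closure S jG ckx).
rewrite z0 ?face_int// subr0 => h1; apply: ltW; apply: h1.
move=> i'; apply: le_lt_trans (closed_cell_dist S i' jG ckx (face_fpt (ms_mac S m) i _ _)) _.
by near: m; exact: mesh_small S _ r0.
Unshelve. all: by end_near. Qed.

End initial.

End solutions.

Lemma abel_sum {R : comPzRingType} (n : nat) (a b : nat -> R) :
  \sum_(i < n) b i * (a i.+1 - a i) =
  b n * a n - b 0%N * a 0%N - \sum_(i < n) a i.+1 * (b i.+1 - b i).
Proof.
elim: n => [|n IH]; first by rewrite !big_ord0 subrr subr0.
by rewrite !big_ord_recr /= IH; ring.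
Qed.

(** * Mass and momentum *)

Section weak_forms.
Context {R : realType}.
Variables (Omega : set (R * R)) (T g : R) (G : nat -> grid R) (N : nat -> nat).
Hypothesis S : mesh_sequence Omega T G N.
Local Notation dt := (tstep T N).
Local Notation idx3 := (idx3 G N).
Local Notation Q3 := (Q3 T G N).
Local Notation cv3 a f := (cvb (mu3 R) (cylinder Omega T) idx3 Q3 a f).
Local Notation cv2 a f := (cvb (mu2 R) Omega (fun m => idx2 (G m)) (fun m => quarter (G m)) a f).
Local Notation nb i j := (neighbor i (coord i j.2) j.1).
Local Notation fc i j := (face i (coord i j.2) j.1).
Local Notation tn m n := (n%:R * dt m).
Variables (z zs h0 : R * R -> R) (u0 : 'I_2 -> R * R -> R).
Variables (h p : nat -> nat -> int * int -> R) (u : nat -> nat -> 'I_2 -> int * int -> R).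
Variables (C : R) (hbar : (R * R) * R -> R) (ubar : 'I_2 -> (R * R) * R -> R).
Hypothesis szs : smooth zs.
Hypothesis zE : forall x, closure Omega x -> z x = zs x.
Hypothesis sol : forall m, scheme_solution g z h0 u0 T (G m) (N m) (h m) (p m) (u m).
Hypothesis C0 : 0 <= C.
Hypothesis hC : forall m n k, (n <= N m)%N -> k \in cells (G m) -> `|h m n k| <= C.
Hypothesis uC : forall m n i s, (n <= N m)%N -> s \in edges (G m) i -> `|u m n i s| <= C.
Hypothesis h_cvg : cvg_L1 (cylinder Omega T)
  (fun m => height_function T (G m) (N m) (h m)) hbar.
Hypothesis u_cvg : forall i, cvg_L1 (cylinder Omega T)
  (fun m => velocity_function T (G m) (N m) (u m) i) (ubar i).
Hypothesis h0_itg : (mu2 R).-integrable Omega (EFin \o h0).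
Hypothesis u0_itg : forall i, (mu2 R).-integrable Omega (EFin \o u0 i).
Local Notation H := (limit_height C hbar).
Local Notation U := (limit_velocity C ubar).
Local Notation h0c x := (clip C (h0 x)).
Local Notation u0c i x := (clip C (u0 i x)).

Lemma pair_lim A f B f0 : cv3 A f -> cv2 B f0 ->
  \sum_(n < N m) dt m * (\sum_(j <- idx2 (G m)) wq (G m) j * A m (j, (n : nat))) +
    \sum_(j <- idx2 (G m)) wq (G m) j * B m j @[m --> \oo] -->
  \int[mu3 R]_(y in cylinder Omega T) f y + \int[mu2 R]_(x in Omega) f0 x.
Proof.
move=> cA cB; apply: cvgD.
  have := cvb_lim (partitions3 S) cA; apply: cvg_trans; apply: near_eq_cvg; apply: nearW => m.
  by rewrite (sum_wt3 S).
have := cvb_lim (partitions2 S) cB; apply: cvg_trans; apply: near_eq_cvg; apply: nearW => m.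
by apply: eq_bigr => j _; rewrite (wt2 S).
Qed.

Lemma pair_eq0 A f B f0 : cv3 A f -> cv2 B f0 ->
  (forall m, \sum_(n < N m) dt m * (\sum_(j <- idx2 (G m)) wq (G m) j * A m (j, (n : nat))) +
    \sum_(j <- idx2 (G m)) wq (G m) j * B m j = 0) ->
  \int[mu3 R]_(y in cylinder Omega T) f y + \int[mu2 R]_(x in Omega) f0 x = 0.
Proof.
move=> cA cB e; have := pair_lim cA cB.
have -> : (fun m => \sum_(n < N m) dt m * (\sum_(j <- idx2 (G m)) wq (G m) j * A m (j, (n : nat))) +
    \sum_(j <- idx2 (G m)) wq (G m) j * B m j) = cst 0 by apply/funext => m; exact: e.
by move=> h1; apply: (cvg_unique _ h1 (cvg_cst _)).
Qed.

(** Abel summation; the upper boundary term drops because the weight vanishes at the last level. A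
    weight at level n leaves [X] at level n + 1. *)
Lemma sum_levels m (X : nat -> ind2 -> R) (phi : nat -> ind2 -> R) :
  (forall j, j \in idx2 (G m) -> phi (N m) j = 0) ->
  \sum_(n < N m) \sum_(j <- idx2 (G m)) wq (G m) j * (phi n j * (X n.+1 j - X n j)) =
  - (\sum_(n < N m) dt m * (\sum_(j <- idx2 (G m)) wq (G m) j *
       (X n.+1 j * ((phi n.+1 j - phi n j) / dt m))) +
     \sum_(j <- idx2 (G m)) wq (G m) j * (X 0%N j * phi 0%N j)).
Proof.
move=> phiN.
have d0 : dt m != 0 by rewrite gt_eqF// (dt_gt0 S).
under [in RHS]eq_bigr do rewrite big_distrr /=.
rewrite exchange_big [in RHS]exchange_big /= -big_split /= -sumrN.
apply: eq_big_seq => j jm; rewrite -big_distrr /= (abel_sum (N m) (X ^~ j) (phi ^~ j)) phiN//.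
have -> : \sum_(i < N m) dt m * (wq (G m) j * (X i.+1 j * ((phi i.+1 j - phi i j) / dt m))) =
    wq (G m) j * \sum_(i < N m) X i.+1 j * (phi i.+1 j - phi i j).
  by rewrite big_distrr; apply: eq_bigr => i _ /=; field.
by ring.
Qed.

Lemma mass_step m n k : (n < N m)%N -> k \in cells (G m) ->
  area (cell (G m) k) * (h m n.+1 k - h m n k) =
  - (dt m * \sum_(i < 2) \sum_(b : bool) primal_flux (G m) (h m n) (u m n) k i b).
Proof.
move=> nN kG; have := mass_balance (sol m) nN kG; rewrite -/(dt m).
have [_ aA _] := cell_facts S kG; have d0 := dt_gt0 S m.
set F := \sum_(i < 2) _; set a := area _ => e.
have : a * (dt m * ((dt m)^-1 * (h m n.+1 k - h m n k) + a^-1 * F)) = 0 by rewrite e !mulr0.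
have -> : a * (dt m * ((dt m)^-1 * (h m n.+1 k - h m n k) + a^-1 * F)) =
    a * (h m n.+1 k - h m n k) + dt m * F by field; rewrite !gt_eqF.
by move=> /eqP; rewrite addr_eq0 => /eqP.
Qed.

Lemma level_last m (phi : (R * R) * R -> R) x : test_function Omega T phi -> phi (x, tn m (N m)) = 0.
Proof.
move=> tphi; have -> : tn m (N m) = T by exact: (@tstepN R T N (ms_N S) m).
by apply: (test_zero tphi); [exact: ltW (ms_T S)|right].
Qed.

Lemma level_ge0 m n : 0 <= tn m n.
Proof. by rewrite mulr_ge0// ltW// (dt_gt0 S). Qed.

Lemma boundary0 m n : (n <= N m)%N -> forall i s, s \in edges (G m) i ->
  s \notin int_edges (G m) i -> u m n i s = 0.
Proof. by move=> nN i s; exact: (boundary_velocity (sol m)). Qed.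

Definition cell_dt (phi : (R * R) * R -> R) m (q : ind3) : R :=
  (phi (cpt (G m) q.1.1, tn m q.2.+1) - phi (cpt (G m) q.1.1, tn m q.2)) / dt m.
Definition face_dt (phi : (R * R) * R -> R) i m (q : ind3) : R :=
  (phi (fpt (G m) i (fc i q.1), tn m q.2.+1) - phi (fpt (G m) i (fc i q.1), tn m q.2)) / dt m.

Definition mass_array phi m (q : ind3) : R :=
  hq (h m q.2.+1) q.1 * cell_dt phi m q +
  \sum_(i < 2) qh (G m) (h m q.2) (u m q.2) i q.1 * uq (u m q.2) i q.1 *
    center_quotient T G N phi i false m q.

Lemma mass_flux_level m n (phi : (R * R) * R -> R) : (n < N m)%N ->
  \sum_(j <- idx2 (G m)) wq (G m) j * (phi (cpt (G m) j.1, tn m n) *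
     (hq (h m n.+1) j - hq (h m n) j)) =
  dt m * \sum_(j <- idx2 (G m)) wq (G m) j *
    (\sum_(i < 2) qh (G m) (h m n) (u m n) i j * uq (u m n) i j *
      center_quotient T G N phi i false m (j, n)).
Proof.
move=> nN.
rewrite -(sum_cells_cst (ms_mac S m) (fun k => phi (cpt (G m) k, tn m n) * (h m n.+1 k - h m n k))).
transitivity (- (dt m * \sum_(k <- cells (G m)) phi (cpt (G m) k, tn m n) *
   \sum_(i < 2) \sum_(b : bool) primal_flux (G m) (h m n) (u m n) k i b)).
  rewrite big_distrr -sumrN; apply: eq_big_seq => k kG.
  by rewrite mulrCA (mass_step nN kG) mulrN mulrCA.
rewrite (sum_mass_flux (ms_mac S m) (h m n) (boundary0 (ltnW nN))
  (phi := fun k => phi (cpt (G m) k, tn m n)) (d := fun i j => center_quotient T G N phi i false m (j, n))).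
  rewrite mulrN opprK exchange_big; congr (_ * _); apply: eq_bigr => j _.
  by rewrite big_distrr.
by move=> i j jm nG; rewrite /center_quotient nG /= addn0.
Qed.

Lemma mass_identity m phi : test_function Omega T phi ->
  \sum_(n < N m) dt m * (\sum_(j <- idx2 (G m)) wq (G m) j * mass_array phi m (j, (n : nat))) +
  \sum_(j <- idx2 (G m)) wq (G m) j * (hq (h m 0%N) j * phi (cpt (G m) j.1, 0)) = 0.
Proof.
move=> tphi.
have := @sum_levels m (fun n j => hq (h m n) j) (fun n j => phi (cpt (G m) j.1, tn m n)).
rewrite mul0r => /(_ _)/eqP; rewrite -addr_eq0 => e; apply/eqP; move: (e (fun j _ => level_last _ _ tphi)).
congr (_ == _); rewrite addrA; congr (_ + _); rewrite -big_split; apply: eq_bigr => n _ /=.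
rewrite mass_flux_level// -mulrDr -big_split; congr (_ * _); apply: eq_bigr => j _ /=.
by rewrite -mulrDr; congr (_ * _); rewrite addrC.
Qed.

Lemma mass_limit phi : test_function Omega T phi ->
  \int[mu3 R]_(y in cylinder Omega T)
    (H y * dt_ phi y + \sum_(i < 2) H y * U i y * dx_ i phi y) +
  \int[mu2 R]_(x in Omega) (h0c x * phi (x, 0)) = 0.
Proof.
move=> tphi; have sphi : smooth phi by case: tphi.
have P3 := partitions3 S; have P2 := partitions2 S.
have cA : cv3 (mass_array phi) (fun y => H y * dt_ phi y + \sum_(i < 2) H y * U i y * dx_ i phi y).
  apply: (cvbD P3).
    apply: (cvbM P3); first exact: (cvb_height S C0 hC h_cvg).
    by apply: (cvb_dt_points S sphi) => m q _; exact: (cpt_closed S).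
  apply: (cvb_sum P3) => i; apply: (cvbM P3); last exact: (cvb_center_quotient S sphi).
  apply: (cvbM P3); first exact: (cvb_upwind_height S u C0 hC h_cvg).
  exact: (cvb_velocity0 S C0 uC u_cvg).
have cB : cv2 (fun m j => hq (h m 0%N) j * phi (cpt (G m) j.1, 0)) (fun x => h0c x * phi (x, 0)).
  apply: (cvbM P2); first exact: (cvb_init_height S C0 hC h0_itg (fun m => init_height (sol m))).
  apply: (cvb_init_points S (P := fun m j => cpt (G m) j.1)); first exact: smooth_continuous.
  by move=> m j _; exact: (cpt_closed S).
by apply: (pair_eq0 cA cB) => m; exact: mass_identity.
Qed.

Definition convection_array phi i (F : R -> R) (e : bool) m (q : ind3) : R :=
  let hm := h m q.2 in let um := u m q.2 in let i' := rev_ord i in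
  qh (G m) hm um i q.1 * uq um i q.1 * F (qus (G m) hm um i q.1) *
    across_quotient T G N phi i e m q +
  qh (G m) hm um i' q.1 * uq um i' q.1 * F (qut (G m) hm um i q.1) *
    trans_quotient T G N phi i e m q.

Definition topo_work phi i (e : bool) m (q : ind3) : R :=
  g * ((hq (h m q.2.+1) q.1 + hq (h m q.2.+1) (reflect_face (G m) i q.1)) / 2 *
    topo_quotient G z zs i m q * phi (fpt (G m) i (fc i q.1), tn m (q.2 + e)%N)).

Definition momentum_array phi i m (q : ind3) : R :=
  hq (h m q.2.+1) q.1 * uq (u m q.2.+1) i q.1 * face_dt phi i m q +
  convection_array phi i id false m q +
  2^-1 * g * (hq (h m q.2.+1) q.1 * hq (h m q.2.+1) q.1) * across_quotient T G N phi i false m q -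
  topo_work phi i false m q.

Definition edge_convection (F : R -> R) m n i s : R := \sum_(j < 2) \sum_(b : bool)
  dual_flux (G m) (h m n) (u m n) i s j b * F (upwind_velocity (G m) (h m n) (u m n) i s j b).

Lemma momentum_step m n i s : (n < N m)%N -> s \in int_edges (G m) i ->
  dual_mass (G m) (h m n.+1) i s * u m n.+1 i s - dual_mass (G m) (h m n) i s * u m n i s =
  - (dt m * edge_convection id m n i s)
  - dt m * (wd (G m) (rev_ord i) s * (p m n.+1 s - p m n.+1 (s - evec i)))
  - dt m * (g * (edge_length (G m) i s * (centered_height (h m n.+1) i s *
      (mean (cell (G m) s) z - mean (cell (G m) (s - evec i)) z)))).
Proof.
move=> nN sI; have := momentum_balance (sol m) nN sI; rewrite -/(dt m).
have hm := ms_mac S m; have d0 := dt_gt0 S m.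
rewrite -!(dual_massE hm (measurable_Omega S) (fin_Omega S) _ sI) /dgrad /=.
have aD : area (dual_cell (G m) i s) = edge_length (G m) i s * dual_dist (G m) i s.
  exact: (area_dual hm (measurable_Omega S) (fin_Omega S) sI).
have a0 : 0 < area (dual_cell (G m) i s).
  by rewrite aD mulr_gt0 ?(dist_gt0 hm)// edge_lengthE (wd_gt0 hm).
rewrite -/(edge_convection id m n i s) -[wd _ (rev_ord i) s]edge_lengthE.
move: (area (dual_cell (G m) i s)) a0 {aD} => a a0.
set X := edge_convection _ _ _ _ _; set l := edge_length _ _ _; set zd := _ - mean _ z.
set D' := dual_height _ (h m n.+1) _ _; set D := dual_height _ (h m n) _ _.
set hc := centered_height _ _ _; move=> e.
have : a * dt m * ((dt m)^-1 * (D' * u m n.+1 i s - D * u m n i s) + a^-1 * X +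
  l / a * (p m n.+1 s - p m n.+1 (s - evec i)) + g * hc * (l / a * zd)) = 0 by rewrite e mulr0.
have -> : a * dt m * ((dt m)^-1 * (D' * u m n.+1 i s - D * u m n i s) + a^-1 * X +
  l / a * (p m n.+1 s - p m n.+1 (s - evec i)) + g * hc * (l / a * zd)) =
  (a * D' * u m n.+1 i s - a * D * u m n i s) + dt m * X + dt m * (l * (p m n.+1 s - p m n.+1 (s - evec i)))
  + dt m * (g * (l * (hc * zd))) by field; rewrite !gt_eqF.
by move=> e'; lra.
Qed.

Lemma convection_level m n i phi F (e : bool) : test_function Omega T phi -> (n < N m)%N ->
  \sum_(s <- int_edges (G m) i) phi (fpt (G m) i s, tn m (n + e)%N) * edge_convection F m n i s =
  - \sum_(j <- idx2 (G m)) wq (G m) j * convection_array phi i F e m (j, n).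
Proof.
move=> tphi nN.
rewrite (sum_convection (ms_mac S m) (h m n) (boundary0 (ltnW nN)) F
  (psi := fun s => phi (fpt (G m) i s, tn m (n + e)%N))
  (d := fun j => across_quotient T G N phi i e m (j, n))
  (d' := fun j => trans_quotient T G N phi i e m (j, n))).
- by rewrite -big_split; congr (- _); apply: eq_bigr => j _; rewrite /= -mulrDr.
- by move=> s sI; apply: (test_face_zero S tphi) => //; exact: level_ge0.
- by [].
- by move=> j jm nG; rewrite /trans_quotient /= nG.
Qed.

Lemma pressure_level m n i phi (e : bool) : test_function Omega T phi -> (n < N m)%N ->
  \sum_(s <- int_edges (G m) i) phi (fpt (G m) i s, tn m (n + e)%N) *
    (wd (G m) (rev_ord i) s * (p m n.+1 s - p m n.+1 (s - evec i))) =
  - \sum_(j <- idx2 (G m)) wq (G m) j * (2^-1 * g * (hq (h m n.+1) j * hq (h m n.+1) j) *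
      across_quotient T G N phi i e m (j, n)).
Proof.
move=> tphi nN.
rewrite (sum_cells_by_parts (ms_mac S m) (p m n.+1)
  (psi := fun s => phi (fpt (G m) i s, tn m (n + e)%N))
  (d := fun j => across_quotient T G N phi i e m (j, n))) //; last first.
  by move=> s sI; apply: (test_face_zero S tphi) => //; exact: level_ge0.
congr (- _); apply: eq_big_seq => j; rewrite mem_idx2 => jG.
by rewrite (pressure_law (sol m) nN jG) /hq; ring.
Qed.

Lemma topo_level m n i phi (e : bool) : test_function Omega T phi -> (n < N m)%N ->
  \sum_(s <- int_edges (G m) i) phi (fpt (G m) i s, tn m (n + e)%N) *
    (g * (edge_length (G m) i s * (centered_height (h m n.+1) i s *
      (mean (cell (G m) s) z - mean (cell (G m) (s - evec i)) z)))) =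
  \sum_(j <- idx2 (G m)) wq (G m) j * topo_work phi i e m (j, n).
Proof.
move=> tphi nN.
under eq_bigr do rewrite mulrCA; rewrite -big_distrr /=.
rewrite (sum_centered (ms_mac S m) (h m n.+1)
  (X := fun s => mean (cell (G m) s) z - mean (cell (G m) (s - evec i)) z)
  (psi := fun s => phi (fpt (G m) i s, tn m (n + e)%N))
  (d := fun j => topo_quotient G z zs i m (j, n))).
- by rewrite big_distrr; apply: eq_bigr => j _; rewrite /= mulrCA.
- by move=> s sI; apply: (test_face_zero S tphi) => //; exact: level_ge0.
- by move=> j jm nG; rewrite /topo_quotient /= nG.
Qed.

Lemma momentum_identity m i phi : test_function Omega T phi ->
  \sum_(n < N m) dt m * (\sum_(j <- idx2 (G m)) wq (G m) j * momentum_array phi i m (j, (n : nat))) +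
  \sum_(j <- idx2 (G m)) wq (G m) j *
    (hq (h m 0%N) j * uq (u m 0%N) i j * phi (fpt (G m) i (fc i j), 0)) = 0.
Proof.
move=> tphi.
have := @sum_levels m (fun n j => hq (h m n) j * uq (u m n) i j) (fun n j => phi (fpt (G m) i (fc i j), tn m n)).
rewrite mul0r => /(_ _)/eqP; rewrite -addr_eq0 => e; apply/eqP; move: (e (fun j _ => level_last _ _ tphi)).
congr (_ == _); rewrite addrA; congr (_ + _); rewrite -big_split; apply: eq_bigr => n _ /=.
have phi0 s : s \notin int_edges (G m) i -> phi (fpt (G m) i s, tn m n) = 0.
  by move=> sI; apply: (test_face_zero S tphi) => //; exact: level_ge0.
transitivity (\sum_(s <- int_edges (G m) i) phi (fpt (G m) i s, tn m (n + false)%N) *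
  (dual_mass (G m) (h m n.+1) i s * u m n.+1 i s - dual_mass (G m) (h m n) i s * u m n i s) +
  dt m * \sum_(j <- idx2 (G m)) wq (G m) j * (hq (h m n.+1) j * uq (u m n.+1) i j * face_dt phi i m (j, (n : nat)))).
  congr (_ + _); rewrite addn0; under [RHS]eq_bigr do rewrite mulrBr; rewrite sumrB.
  rewrite !(sum_dual_mass (G := G m) _ _ (psi := fun s => phi (fpt (G m) i s, tn m n)) phi0).
  by rewrite -sumrB; apply: eq_bigr => j _; rewrite /uq; ring.
rewrite (eq_big_seq _ (fun s sI => congr1 _ (momentum_step (ltn_ord n) sI))).
have dist3 (c c' X Y Z : R) :
  c * (- (c' * X) - c' * Y - c' * Z) = - (c' * (c * X)) - c' * (c * Y) - c' * (c * Z) by ring.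
under eq_bigr do rewrite dist3.
rewrite 2!sumrB sumrN -3!big_distrr /= (convection_level i id false tphi (ltn_ord n))
  (pressure_level i false tphi (ltn_ord n)) (topo_level i false tphi (ltn_ord n)).
rewrite -!mulrN opprK -!mulrDr -!sumrN -!big_split; congr (_ * _); apply: eq_bigr => j _ /=.
by rewrite /momentum_array /=; ring.
Qed.

Lemma cvb_convection_array phi i F e (f : (R * R) * R -> R) : smooth phi ->
  cv3 (fun m q => F (qus (G m) (h m q.2) (u m q.2) i q.1)) f ->
  cv3 (fun m q => F (qut (G m) (h m q.2) (u m q.2) i q.1)) f ->
  cv3 (convection_array phi i F e) (fun y => H y * U i y * f y * dx_ i phi y +
    H y * U (rev_ord i) y * f y * dx_ (rev_ord i) phi y).
Proof.
move=> sphi f1 f2; have P3 := partitions3 S.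
apply: (cvbD P3); apply: (cvbM P3).
- apply: (cvbM P3) => //; apply: (cvbM P3); first exact: (cvb_upwind_height S u C0 hC h_cvg).
  exact: (cvb_velocity0 S C0 uC u_cvg).
- exact: (cvb_across_quotient S sphi).
- apply: (cvbM P3) => //; apply: (cvbM P3); first exact: (cvb_upwind_height S u C0 hC h_cvg).
  exact: (cvb_velocity0 S C0 uC u_cvg).
- exact: (cvb_trans_quotient S sphi).
Qed.

Lemma cvb_mean_height i :
  cv3 (fun m q => (hq (h m q.2.+1) q.1 + hq (h m q.2.+1) (reflect_face (G m) i q.1)) / 2) H.
Proof.
have P3 := partitions3 S.
have h1 := cvb_height S C0 hC h_cvg; have h2 := cvb_height_face S C0 hC h_cvg i.
apply: (cvb_ext P3 (cvbZ P3 2^-1 (cvbD P3 h1 h2))) => [m q _|y _]; first by rewrite mulrC.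
by field.
Qed.

Lemma cvb_topo_work phi i e : smooth phi ->
  cv3 (topo_work phi i e) (fun y => g * (H y * 'D_(evec i) zs y.1 * phi y)).
Proof.
move=> sphi; have P3 := partitions3 S.
apply: (cvbZ P3); apply: (cvbM P3); last exact: (cvb_face_value S sphi).
by apply: (cvbM P3); [exact: cvb_mean_height|exact: (cvb_topo_quotient S szs zE)].
Qed.

Lemma momentum_limit i phi : test_function Omega T phi ->
  \int[mu3 R]_(y in cylinder Omega T)
    (H y * U i y * dt_ phi y +
     (H y * U i y * U i y * dx_ i phi y + H y * U (rev_ord i) y * U i y * dx_ (rev_ord i) phi y) +
     2^-1 * g * (H y * H y) * dx_ i phi y - g * (H y * 'D_(evec i) zs y.1 * phi y)) +
  \int[mu2 R]_(x in Omega) (h0c x * u0c i x * phi (x, 0)) = 0.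
Proof.
move=> tphi; have sphi : smooth phi by case: tphi.
have P3 := partitions3 S; have P2 := partitions2 S.
have c1 := cvb_height S C0 hC h_cvg.
have cA : cv3 (momentum_array phi i) (fun y => H y * U i y * dt_ phi y +
     (H y * U i y * U i y * dx_ i phi y + H y * U (rev_ord i) y * U i y * dx_ (rev_ord i) phi y) +
     2^-1 * g * (H y * H y) * dx_ i phi y - g * (H y * 'D_(evec i) zs y.1 * phi y)).
  apply: (cvbB P3); last exact: cvb_topo_work.
  apply: (cvbD P3); first apply: (cvbD P3).
  - apply: (cvbM P3); first by apply: (cvbM P3) => //; exact: (cvb_velocity S C0 uC u_cvg).
    apply: (cvb_dt_points S sphi (P := fun m q => fpt (G m) i (fc i q.1))) => m q _.
    exact: (face_fpt (ms_mac S m)).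
  - apply: cvb_convection_array => //; first exact: (cvb_upwind_self S h C0 uC u_cvg).
    exact: (cvb_upwind_trans S h C0 uC u_cvg).
  - apply: (cvbM P3); last exact: (cvb_across_quotient S sphi).
    by apply: (cvbZ P3); exact: (cvbM P3).
have [a ca aE] := cvb_init_velocity S C0 uC u0_itg (fun m => init_velocity (sol m)) i.
have cB : cv2 (fun m j => hq (h m 0%N) j * a m j * phi (fpt (G m) i (fc i j), 0))
    (fun x => h0c x * u0c i x * phi (x, 0)).
  apply: (cvbM P2).
    by apply: (cvbM P2) => //; exact: (cvb_init_height S C0 hC h0_itg (fun m => init_height (sol m))).
  apply: (cvb_init_points S (P := fun m j => fpt (G m) i (fc i j))); first exact: smooth_continuous.
  by move=> m j _; exact: (face_fpt (ms_mac S m)).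
(* The array [a] and the discrete initial velocity can differ only next to the boundary, where the
   test value is 0. *)
apply: (pair_eq0 cA cB) => m; rewrite -[RHS](momentum_identity m i tphi); congr (_ + _).
apply: eq_big_seq => j jm; have [nG|nG] := boolP (nb i j \in cells (G m)); first by rewrite aE.
by rewrite (test_face_zero S tphi) ?mulr0// face_int// -mem_idx2.
Qed.

End weak_forms.

(** * Entropy *)

Section entropy.
Context {R : realType}.
Variables (Omega : set (R * R)) (T g : R) (G : nat -> grid R) (N : nat -> nat).
Hypothesis S : mesh_sequence Omega T G N.
Local Notation dt := (tstep T N).
Local Notation idx3 := (idx3 G N).
Local Notation Q3 := (Q3 T G N).
Local Notation cv3 a f := (cvb (mu3 R) (cylinder Omega T) idx3 Q3 a f).
Local Notation cv2 a f := (cvb (mu2 R) Omega (fun m => idx2 (G m)) (fun m => quarter (G m)) a f).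
Local Notation nb i j := (neighbor i (coord i j.2) j.1).
Local Notation fc i j := (face i (coord i j.2) j.1).
Local Notation tn m n := (n%:R * dt m).
Variables (z zs h0 : R * R -> R) (u0 : 'I_2 -> R * R -> R).
Variables (h p : nat -> nat -> int * int -> R) (u : nat -> nat -> 'I_2 -> int * int -> R).
Variables (C c0 : R) (hbar : (R * R) * R -> R) (ubar : 'I_2 -> (R * R) * R -> R).
Hypothesis g0 : 0 <= g.
Hypothesis szs : smooth zs.
Hypothesis zE : forall x, closure Omega x -> z x = zs x.
Hypothesis sol : forall m, scheme_solution g z h0 u0 T (G m) (N m) (h m) (p m) (u m).
Hypothesis C0 : 0 <= C.
Hypothesis c0_gt0 : 0 < c0.
Hypothesis hc0 : forall m n k, (n <= N m)%N -> k \in cells (G m) -> c0 <= h m n k.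
Hypothesis hC : forall m n k, (n <= N m)%N -> k \in cells (G m) -> `|h m n k| <= C.
Hypothesis uC : forall m n i s, (n <= N m)%N -> s \in edges (G m) i -> `|u m n i s| <= C.
Hypothesis h_cvg : cvg_L1 (cylinder Omega T)
  (fun m => height_function T (G m) (N m) (h m)) hbar.
Hypothesis u_cvg : forall i, cvg_L1 (cylinder Omega T)
  (fun m => velocity_function T (G m) (N m) (u m) i) (ubar i).
Hypothesis h0_itg : (mu2 R).-integrable Omega (EFin \o h0).
Hypothesis u0_itg : forall i, (mu2 R).-integrable Omega (EFin \o u0 i).
Hypothesis dt_mesh : dt m / mesh_size (G m) @[m --> \oo] --> (0 : R).
Local Notation H := (limit_height C hbar).
Local Notation U := (limit_velocity C ubar).
Local Notation h0c x := (clip C (h0 x)).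
Local Notation u0c i x := (clip C (u0 i x)).
Local Notation econv F m n i s := (edge_convection G h u F m n i s).
Local Notation Mass m n i s := (dual_mass (G m) (h m n) i s).

Lemma dt_mesh_small (e : R) : 0 < e -> \forall m \near \oo, dt m / mesh_size (G m) < e.
Proof.
move=> e0; have [n _ hn] := (cvgrPdist_lt _ _).1 dt_mesh _ e0.
by exists n => // m /hn; rewrite sub0r normrN; apply: le_lt_trans; exact: ler_norm.
Qed.

Lemma pair_le A f B f0 (e : nat -> R) : cv3 A f -> cv2 B f0 -> e @ \oo --> (0 : R) ->
  (\forall m \near \oo,
    - (\sum_(n < N m) dt m * (\sum_(j <- idx2 (G m)) wq (G m) j * A m (j, (n : nat))) +
       \sum_(j <- idx2 (G m)) wq (G m) j * B m j) <= e m) ->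
  - (\int[mu3 R]_(y in cylinder Omega T) f y + \int[mu2 R]_(x in Omega) f0 x) <= 0.
Proof.
move=> cA cB ce he; rewrite oppr_le0 -[leRHS]addr0.
have c : (\sum_(n < N m) dt m * (\sum_(j <- idx2 (G m)) wq (G m) j * A m (j, (n : nat))) +
    \sum_(j <- idx2 (G m)) wq (G m) j * B m j) + e m @[m --> \oo] -->
    \int[mu3 R]_(y in cylinder Omega T) f y + \int[mu2 R]_(x in Omega) f0 x + 0.
  by apply: cvgD => //; exact: (pair_lim S cA cB).
by apply: (ler_cvg_to (cvg_cst _) c); apply: filterS he => m; rewrite lerNl -subr_ge0 opprK.
Qed.

Lemma flux_bound m n i s : (n <= N m)%N ->
  `|flux (G m) i (fun s => hup (h m n) (u m n) i s * u m n i s) s| <= mesh_size (G m) * C ^+ 2.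
Proof.
move=> nN; rewrite /flux; case: ifPn => sI; last first.
  by rewrite normr0 mulr_ge0 ?mesh_ge0 ?exprn_ge0.
have := sI; rewrite mem_int_edges => /andP[sG seG].
have a1 : `|edge_length (G m) i s| <= mesh_size (G m).
  rewrite edge_lengthE gtr0_norm ?(wd_gt0 (ms_mac S m))//.
  exact: (wd_le_mesh (ms_mac S m)).
have a2 : `|hup (h m n) (u m n) i s * u m n i s| <= C ^+ 2.
  rewrite normrM expr2; apply: ler_pM => //; first by rewrite /hup; case: ifP => _; exact: hC.
  by apply: uC => //; exact: (face_edges i false sG).
by rewrite normrM; exact: ler_pM.
Qed.

Lemma primal_flux_bound m n k i b : (n <= N m)%N ->
  `|primal_flux (G m) (h m n) (u m n) k i b| <= mesh_size (G m) * C ^+ 2.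
Proof.
move=> nN; rewrite primal_fluxE normrM; case: b; rewrite /normal_sign ?normrN normr1 mul1r;
  exact: flux_bound.
Qed.

Lemma dual_flux_bound m n i s i' b : (n <= N m)%N ->
  `|dual_flux (G m) (h m n) (u m n) i s i' b| <= mesh_size (G m) * C ^+ 2.
Proof.
move=> nN; rewrite /dual_flux; case: ifP => _; rewrite normrM ger0_norm ?invr_ge0//.
  have b1 := primal_flux_bound (adj i b s) i b nN.
  have b2 := primal_flux_bound (adj i b s) i (~~ b) nN.
  rewrite ler_pdivrMl//; apply: le_trans (ler_normB _ _) _; lra.
have b1 := primal_flux_bound (adj i false s) i' b nN.
have b2 := primal_flux_bound (adj i true s) i' b nN.
rewrite ler_pdivrMl//; apply: le_trans (ler_normD _ _) _; lra.
Qed.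

Lemma econv_quad m n i s (w : R) : econv (fun x => (w - x) ^+ 2) m n i s =
  w ^+ 2 * econv (fun=> 1) m n i s - 2 * w * econv id m n i s + 2 * econv (fun x => x ^+ 2 / 2) m n i s.
Proof. by rewrite /edge_convection !(sum_ord2 _) !big_bool /=; field. Qed.

(** Half the sum of the mass balances of the two adjacent cells. The dual fluxes are half sums and
    half differences of primal fluxes precisely so that the flux through the common edge cancels and
    this balance is inherited. *)
Lemma dual_mass_step m n i s : (n < N m)%N -> s \in int_edges (G m) i ->
  Mass m n.+1 i s - Mass m n i s = - (dt m * econv (fun=> 1) m n i s).
Proof.
move=> nN; rewrite mem_int_edges => /andP[sG seG]; have hm := ms_mac S m.
have e1 := mass_step S sol nN sG; have e2 := mass_step S sol nN seG.
rewrite primal_flux_div (sum_ord2i i) (area_cellE hm i) in e1.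
rewrite primal_flux_div (sum_ord2i i) (area_cellE hm i) wd_rev in e2.
rewrite /edge_convection (convection_sum _ _ _ _ _ (fun=> 1)) /flux_self /flux_trans !mulr1 subrK.
rewrite subrK in e2; rewrite (addrAC s (evec (rev_ord i))) /dual_mass.
set w1 := wd (G m) i s in e1 *; set w2 := wd (G m) i _ in e2 *; set w3 := wd (G m) _ s in e1 e2 *.
have -> : w3 * (w2 * h m n.+1 (s - evec i) + w1 * h m n.+1 s) / 2 -
    w3 * (w2 * h m n (s - evec i) + w1 * h m n s) / 2 =
  (w1 * w3 * (h m n.+1 s - h m n s) + w2 * w3 * (h m n.+1 (s - evec i) - h m n (s - evec i))) / 2 by field.
by rewrite e1 e2; field.
Qed.

Lemma dual_mass_ge m n i s (K : R) : 0 < K -> (n <= N m)%N -> s \in int_edges (G m) i ->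
  (forall i k, k \in cells (G m) -> mesh_size (G m) <= K * wd (G m) i k) ->
  (mesh_size (G m) / K) ^+ 2 * c0 <= 2 * Mass m n i s.
Proof.
move=> K0 nN; rewrite mem_int_edges => /andP[sG seG] hK; have hm := ms_mac S m.
have hw i' : mesh_size (G m) / K <= wd (G m) i' s by rewrite ler_pdivrMr// mulrC hK.
have m0 : 0 <= mesh_size (G m) / K by rewrite divr_ge0 ?mesh_ge0// ltW.
have w0 := wd_gt0 hm (rev_ord i) s; have w1 := wd_gt0 hm i s; have w2 := wd_gt0 hm i (s - evec i).
have h1 := hc0 nN sG; have h2 := hc0 nN seG.
have q1 : (mesh_size (G m) / K) ^+ 2 * c0 <= wd (G m) (rev_ord i) s * (wd (G m) i s * h m n s).
  rewrite expr2 -mulrA; apply: ler_pM => //; first by rewrite mulr_ge0// ltW.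
  by apply: ler_pM => //; exact: ltW.
have q2 : 0 <= wd (G m) (rev_ord i) s * (wd (G m) i (s - evec i) * h m n (s - evec i)).
  by rewrite !mulr_ge0 ?ltW//; exact: lt_le_trans h2.
by rewrite /dual_mass; lra.
Qed.

(* Under a CFL condition, the dissipation due to upwinding absorbs the error of
   the explicit time discretization in the kinetic energy balance. *)
Lemma upwind_dissipation m n i s (w : R) : (n <= N m)%N ->
  dt m * (4 * (mesh_size (G m) * C ^+ 2)) <= Mass m n i s ->
  dt m * econv (fun x => (w - x) ^+ 2) m n i s <= Mass m n i s * (w - u m n i s) ^+ 2.
Proof.
move=> nN cfl; have d0 := dt_gt0 S m.
(* An outgoing flux carries [u m n i s] itself and is bounded by [dual_flux_bound]; an incoming one
   makes the product nonpositive. The factor 4 counts the sides of the dual cell. *)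
have hb i' b : dual_flux (G m) (h m n) (u m n) i s i' b *
    (w - upwind_velocity (G m) (h m n) (u m n) i s i' b) ^+ 2 <=
    mesh_size (G m) * C ^+ 2 * (w - u m n i s) ^+ 2.
  have B := dual_flux_bound i s i' b nN; rewrite /upwind_velocity; case: ifPn => hd.
    by rewrite ler_wpM2r ?sqr_ge0//; apply: le_trans B; exact: ler_norm.
  apply: (@le_trans _ _ 0); last first.
    by apply: mulr_ge0; [apply: mulr_ge0; [exact: mesh_ge0|exact: sqr_ge0]|exact: sqr_ge0].
  by rewrite mulr_le0_ge0 ?sqr_ge0// ltW// ltNge.
apply: le_trans (_ : dt m * (4 * (mesh_size (G m) * C ^+ 2)) * (w - u m n i s) ^+ 2 <= _).
  rewrite -mulrA ler_pM2l// /edge_convection (sum_ord2 _) !big_bool /=.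
  by have := hb ord0 true; have := hb ord0 false; have := hb ord_max true; have := hb ord_max false; lra.
by rewrite ler_wpM2r ?sqr_ge0.
Qed.

(** With [M], [M'] the dual masses and [v], [w] the velocities at levels n and n + 1, [M' w^2/2 - M
    v^2/2 = w (M' w - M v) - w^2/2 (M' - M) - M/2 (w - v)^2]. Besides the works of pressure and
    topography, the first two terms give by [econv_quad] the kinetic flux and [dt/2] times the flux
    of [(w - x)^2], which [upwind_dissipation] absorbs into the last term. *)
Lemma kinetic_step m n i s : (n < N m)%N -> s \in int_edges (G m) i ->
  dt m * (4 * (mesh_size (G m) * C ^+ 2)) <= Mass m n i s ->
  Mass m n.+1 i s * (u m n.+1 i s ^+ 2 / 2) - Mass m n i s * (u m n i s ^+ 2 / 2) <=
  - (dt m * econv (fun x => x ^+ 2 / 2) m n i s)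
  - dt m * (u m n.+1 i s * (wd (G m) (rev_ord i) s * (p m n.+1 s - p m n.+1 (s - evec i))))
  - dt m * (u m n.+1 i s * (g * (edge_length (G m) i s * (centered_height (h m n.+1) i s *
      (mean (cell (G m) s) z - mean (cell (G m) (s - evec i)) z))))).
Proof.
move=> nN sI cfl; set w := u m n.+1 i s.
have e1 := momentum_step S sol nN sI; have e2 := dual_mass_step nN sI.
have e3 := upwind_dissipation w (ltnW nN) cfl; have e4 := econv_quad m n i s w.
rewrite e4 in e3; rewrite -/w in e1.
move: e1 e2 e3; set M' := Mass m n.+1 i s; set M := Mass m n i s.
set X0 := econv (fun=> 1) _ _ _ _; set X1 := econv id _ _ _ _; set X2 := econv _ _ _ _ _.
set P := wd _ _ _ * _; set Z := g * _; set v := u m n i s => e1 e2 e3.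
have e5 : w * (M' * w - M * v) = w * (- (dt m * X1) - dt m * P - dt m * Z) by rewrite e1.
have e6 : w ^+ 2 * (M' - M) = w ^+ 2 * (- (dt m * X0)) by rewrite e2.
nra.
Qed.

(** Testing at level n + 1 leaves [X] at level n. The kinetic energy is tested in this way, so that
    pressure, velocity and test function in its pressure work are all at level n + 1. *)
Lemma sum_levels_next m (X phi : nat -> ind2 -> R) :
  (forall j, j \in idx2 (G m) -> phi (N m) j = 0) ->
  \sum_(n < N m) \sum_(j <- idx2 (G m)) wq (G m) j * (phi n.+1 j * (X n.+1 j - X n j)) =
  - (\sum_(n < N m) dt m * (\sum_(j <- idx2 (G m)) wq (G m) j *
       (X n j * ((phi n.+1 j - phi n j) / dt m))) +
     \sum_(j <- idx2 (G m)) wq (G m) j * (X 0%N j * phi 0%N j)).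
Proof.
move=> phiN; have d0 : dt m != 0 by rewrite gt_eqF// (dt_gt0 S).
have -> : \sum_(n < N m) \sum_(j <- idx2 (G m)) wq (G m) j * (phi n.+1 j * (X n.+1 j - X n j)) =
  \sum_(n < N m) \sum_(j <- idx2 (G m)) wq (G m) j * (phi n j * (X n.+1 j - X n j)) +
  \sum_(n < N m) dt m * (\sum_(j <- idx2 (G m)) wq (G m) j *
       ((X n.+1 j - X n j) * ((phi n.+1 j - phi n j) / dt m))).
  rewrite -big_split; apply: eq_bigr => n _; rewrite big_distrr -big_split.
  by apply: eq_bigr => j _ /=; field.
rewrite (sum_levels S X phiN) !opprD addrAC -!sumrN -big_split; congr (_ + _).
apply: eq_bigr => n _ /=; rewrite -mulrN -mulrDr -mulrN; congr (_ * _).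
by rewrite -!sumrN -big_split; apply: eq_bigr => j _ /=; ring.
Qed.

Variable phi : (R * R) * R -> R.
Hypothesis tphi : test_function Omega T phi.
Hypothesis phi_ge0 : forall x t, Omega x -> 0 <= t < T -> 0 <= phi (x, t).
Local Notation zc m k := (mean (cell (G m) k) z).
Local Notation phc m n k := (phi (cpt (G m) k, tn m n)).
Local Notation phf m n i s := (phi (fpt (G m) i s, tn m n)).
Local Notation press m n k := (2^-1 * g * h m n k ^+ 2).

Lemma test_ge0 x t : 0 <= t -> 0 <= phi (x, t).
Proof.
move=> t0; have [Ox|nO] := pselect (Omega x); last by rewrite (test_zero tphi) //; left.
have [tT|Tt] := ltP t T; first by apply: phi_ge0 => //; rewrite t0.
by rewrite (test_zero tphi) //; right.
Qed.

Lemma phf0 m n i s : s \notin int_edges (G m) i -> phf m n i s = 0.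
Proof. by move=> sI; apply: (test_face_zero S tphi) => //; exact: (level_ge0 S). Qed.

(** The expression equals [(w g / 2) (hu - hk)^2] times the inward velocity: it vanishes for
    outflow, where [hu = hk], and is nonnegative for inflow. The upwinding of the height enters the
    potential energy here. *)
Lemma upwind_pressure m n k i b : (n < N m)%N -> k \in cells (G m) ->
  0 <= normal_sign b * (g * h m n k *
      flux (G m) i (fun s => hup (h m n) (u m n) i s * u m n i s) (face i b k) -
    flux (G m) i (fun s => 2^-1 * g * hup (h m n) (u m n) i s ^+ 2 * u m n i s) (face i b k) -
    press m n k * (wd (G m) (rev_ord i) k * u m n i (face i b k))).
Proof.
move=> nN kG; rewrite /flux; case: ifPn => sI; last first.
  rewrite (boundary0 sol (ltnW nN) (face_edges i b kG) sI); lra.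
have -> : edge_length (G m) i (face i b k) = wd (G m) (rev_ord i) k.
  by rewrite edge_lengthE /face; case: b {sI}; rewrite ?wd_rev'.
set w := wd _ _ _; set hu := hup _ _ _ _; set v := u m n i _; set hk := h m n k.
have w0 : 0 < w by exact: (wd_gt0 (ms_mac S m)).
have -> : normal_sign b * (g * hk * (w * (hu * v)) - w * (2^-1 * g * hu ^+ 2 * v) -
    2^-1 * g * hk ^+ 2 * (w * v)) = (w * 2^-1 * g * (hu - hk) ^+ 2) * - (normal_sign b * v) by field.
have q0 : 0 <= w * 2^-1 * g * (hu - hk) ^+ 2.
  by apply: mulr_ge0; [rewrite !mulr_ge0// ltW|exact: sqr_ge0].
have hE : 0 < normal_sign b * v -> hu = hk.
  rewrite /hu /hup /hk /v; case: b {sI hu v q0} => /=.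
    by rewrite /normal_sign mul1r => /ltW ->; rewrite addrK.
  by rewrite /normal_sign mulN1r oppr_gt0 ltNge => /negbTE ->.
have [h1|h1] := ltP 0 (normal_sign b * v); last by rewrite mulr_ge0// oppr_ge0.
by rewrite hE// subrr expr0n mulr0 mul0r.
Qed.

Definition potential m n k : R := press m n k + g * zc m k * h m n k.

Lemma potential_step m n k : (n < N m)%N -> k \in cells (G m) ->
  area (cell (G m) k) * (potential m n.+1 k - potential m n k) <=
  - (dt m * \sum_(i < 2) (flux (G m) i (fun s => 2^-1 * g * hup (h m n) (u m n) i s ^+ 2 * u m n i s) (k + evec i) -
       flux (G m) i (fun s => 2^-1 * g * hup (h m n) (u m n) i s ^+ 2 * u m n i s) k)) -
  dt m * (\sum_(i < 2) wd (G m) (rev_ord i) k * (press m n k * (u m n i (k + evec i) - u m n i k))) -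
  dt m * (g * zc m k * \sum_(i < 2) \sum_(b : bool) primal_flux (G m) (h m n) (u m n) k i b) +
  2^-1 * g * (area (cell (G m) k) * (h m n.+1 k - h m n k) ^+ 2).
Proof.
move=> nN kG; have d0 := dt_gt0 S m; have e := mass_step S sol nN kG.
have f i b := upwind_pressure i b nN kG.
set a := area _ in e *.
(* [h'^2 - h^2 = 2 h (h' - h) + (h' - h)^2]: freezing the multiplier at level n leaves the last
   square, of unfavourable sign, as a residual. *)
have -> : a * (potential m n.+1 k - potential m n k) =
    (g * h m n k + g * zc m k) * (a * (h m n.+1 k - h m n k)) +
    2^-1 * g * (a * (h m n.+1 k - h m n k) ^+ 2) by rewrite /potential; field.
rewrite e; apply: lerD => //.
rewrite mulrDl -[leLHS]addrC; rewrite primal_flux_div !sum_ord2.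
have f1 := f ord0 true; have f2 := f ord0 false; have f3 := f ord_max true; have f4 := f ord_max false.
rewrite /= /normal_sign ?mul1r ?mulN1r in f1 f2 f3 f4.
move: f1 f2 f3 f4.
set F1 := flux _ ord0 _ (k + _); set F2 := flux _ ord0 _ k.
set F3 := flux _ ord_max _ (k + _); set F4 := flux _ ord_max _ k.
set Q1 := flux _ ord0 _ (k + _); set Q2 := flux _ ord0 _ k.
set Q3 := flux _ ord_max _ (k + _); set Q4 := flux _ ord_max _ k.
set w1 := wd _ _ _; set w2 := wd _ _ _; move=> f1 f2 f3 f4.
have f5 : 0 <= dt m * (g * h m n k * (F1 - F2 + (F3 - F4)) - (Q1 - Q2 + (Q3 - Q4)) -
  (w1 * (press m n k * (u m n ord0 (k + evec ord0) - u m n ord0 k)) +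
   w2 * (press m n k * (u m n ord_max (k + evec ord_max) - u m n ord_max k)))).
  by rewrite mulr_ge0 ?(ltW d0)//; lra.
lra.
Qed.

(** The difference quotient of the product [phi z] between two centers, by the discrete product
    rule: [phi] is taken in the cell of the quarter and [z] in its neighbour. *)
Definition topo_test i m (q : ind3) : R :=
  phi (cpt (G m) q.1.1, tn m q.2) * topo_quotient G z zs i m q +
  zc m (reflect_face (G m) i q.1).1 * center_quotient T G N phi i false m q.

Definition potential_flux m (q : ind3) : R :=
  let hm := h m q.2 in let um := u m q.2 in
  \sum_(i < 2) (2^-1 * g * (qh (G m) hm um i q.1 * qh (G m) hm um i q.1) * uq um i q.1 *
       center_quotient T G N phi i false m q +
     g * (qh (G m) hm um i q.1 * uq um i q.1 * topo_test i m q)).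

(* The pressure gradient of the momentum balance is implicit, hence the work in
   the kinetic balance of step n is work_kinetic at level n + 1, whereas that of
   the potential balance is work_potential at level n. *)
Definition work_potential i m n : R := \sum_(k <- cells (G m))
  wd (G m) (rev_ord i) k * (press m n k * (phc m n k * (u m n i (k + evec i) - u m n i k))).
Definition work_kinetic i m n : R := \sum_(k <- cells (G m))
  wd (G m) (rev_ord i) k * (press m n k *
    (phf m n i (k + evec i) * u m n i (k + evec i) - phf m n i k * u m n i k)).

(** Nonnegativity of [phi] preserves the local inequality. Fluxes become sums over quarters, while
    the pressure work stays a sum over cells, to be compared with the kinetic one. *)
Lemma potential_level m n : (n < N m)%N ->
  \sum_(j <- idx2 (G m)) wq (G m) j * (phc m n j.1 * (potential m n.+1 j.1 - potential m n j.1)) <=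
  dt m * (\sum_(j <- idx2 (G m)) wq (G m) j * potential_flux m (j, n)) -
  dt m * (\sum_(i < 2) work_potential i m n) +
  \sum_(k <- cells (G m)) phc m n k * (2^-1 * g * (area (cell (G m) k) * (h m n.+1 k - h m n k) ^+ 2)).
Proof.
move=> nN; have hm := ms_mac S m.
rewrite -(sum_cells_cst hm (fun k => phc m n k * (potential m n.+1 k - potential m n k))).
pose hu i s := hup (h m n) (u m n) i s.
pose Fq i s := flux (G m) i (fun s => 2^-1 * g * hu i s ^+ 2 * u m n i s) s.
pose pf k := \sum_(i < 2) \sum_(b : bool) primal_flux (G m) (h m n) (u m n) k i b.
have bd i s : s \in edges (G m) i -> s \notin int_edges (G m) i -> u m n i s = 0.
  exact: (boundary0 sol (ltnW nN)).
apply: le_trans (_ : \sum_(k <- cells (G m)) phc m n k *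
  (- (dt m * \sum_(i < 2) (Fq i (k + evec i) - Fq i k)) -
   dt m * (\sum_(i < 2) wd (G m) (rev_ord i) k * (press m n k * (u m n i (k + evec i) - u m n i k))) -
   dt m * (g * zc m k * pf k) +
   2^-1 * g * (area (cell (G m) k) * (h m n.+1 k - h m n k) ^+ 2)) <= _).
  apply: ler_sum_in => k kG; rewrite mulrCA; apply: ler_wpM2l.
    by apply: test_ge0; exact: (level_ge0 S).
  exact: potential_step.
under eq_bigr do rewrite mulrDr; rewrite big_split lerD2r /=.
have dist3 (c c' X Y Z : R) :
  c * (- (c' * X) - c' * Y - c' * Z) = - (c' * (c * X)) - c' * (c * Y) - c' * (c * Z) by ring.
under eq_bigr do rewrite dist3.
rewrite 2!sumrB sumrN -3!big_distrr /=.
have e1 : \sum_(k <- cells (G m)) phc m n k * (\sum_(i < 2) (Fq i (k + evec i) - Fq i k)) =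
    - \sum_(j <- idx2 (G m)) wq (G m) j * \sum_(i < 2) (2^-1 * g *
       (qh (G m) (h m n) (u m n) i j * qh (G m) (h m n) (u m n) i j) * uq (u m n) i j *
       center_quotient T G N phi i false m (j, n)).
  under eq_bigr do rewrite big_distrr /=.
  under [in RHS]eq_bigr do rewrite big_distrr /=.
  rewrite exchange_big [in RHS]exchange_big -sumrN; apply: eq_bigr => i _.
  rewrite (sum_flux hm (i := i) (phi := fun k => phc m n k)
    (d := fun j => center_quotient T G N phi i false m (j, n))).
  - congr (- _); apply: eq_big_seq => j jG; congr (_ * _); congr (_ * _).
    rewrite -/(uq (u m n) i j); have [->|un] := eqVneq (uq (u m n) i j) 0; first by rewrite !mulr0.
    by rewrite /qh (nb_in bd jG un) -expr2.
  - by move=> s se sn; rewrite bd// mulr0.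
  - by move=> j jG nG; rewrite /center_quotient /= nG addn0.
have e2 : \sum_(k <- cells (G m)) phc m n k * (\sum_(i < 2) wd (G m) (rev_ord i) k *
     (press m n k * (u m n i (k + evec i) - u m n i k))) = \sum_(i < 2) work_potential i m n.
  rewrite /work_potential exchange_big; apply: eq_bigr => k _; rewrite big_distrr.
  by apply: eq_bigr => i _; rewrite /=; ring.
have e3 : \sum_(k <- cells (G m)) phc m n k * (g * zc m k * pf k) =
    - \sum_(j <- idx2 (G m)) wq (G m) j * \sum_(i < 2) (g *
      (qh (G m) (h m n) (u m n) i j * uq (u m n) i j * topo_test i m (j, n))).
  transitivity (g * \sum_(k <- cells (G m)) (phc m n k * zc m k) * pf k).
    by rewrite big_distrr; apply: eq_bigr => k _; rewrite /=; ring.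
  rewrite (sum_mass_flux hm (h m n) bd (phi := fun k => phc m n k * zc m k)
    (d := fun i j => topo_test i m (j, n))).
    rewrite mulrN exchange_big big_distrr; congr (- _); apply: eq_bigr => j _ /=.
    by rewrite -big_distrr /= mulrCA; congr (_ * _); rewrite big_distrr.
  move=> i j jG nG; rewrite /topo_test /topo_quotient /center_quotient /reflect_face /= nG addn0.
  have := dist_gt0 hm i (fc i j) => d0.
  case E : (coord i j.2) nG d0 => nG d0; rewrite /= ?addrK; field; by rewrite gt_eqF.
rewrite e1 e2 e3 !mulrN !opprK le_eqVlt; apply/orP; left; apply/eqP.
rewrite addrAC -mulrDr -big_split; congr (_ * _ - _); apply: eq_bigr => j _.
by rewrite /= -mulrDr -big_split.
Qed.

Definition topo_power i m (q : ind3) : R :=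
  g * ((hq (h m q.2.+1) q.1 + hq (h m q.2.+1) (reflect_face (G m) i q.1)) / 2 *
    topo_quotient G z zs i m q * (phf m q.2.+1 i (fc i q.1) * uq (u m q.2.+1) i q.1)).

Local Notation kin m n i j := (hq (h m n) j * (uq (u m n) i j ^+ 2 / 2)).

(** The product of [phi] and [u], both at level n + 1, plays the part of the test function: it is 0
    off the internal edges, so the pressure gradient sums by parts into [work_kinetic]. *)
Lemma kinetic_level m n i : (n < N m)%N ->
  (forall s, s \in int_edges (G m) i -> dt m * (4 * (mesh_size (G m) * C ^+ 2)) <= Mass m n i s) ->
  \sum_(j <- idx2 (G m)) wq (G m) j * (phf m n.+1 i (fc i j) * (kin m n.+1 i j - kin m n i j)) <=
  dt m * (\sum_(j <- idx2 (G m)) wq (G m) j *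
    (convection_array T G N h u phi i (fun x => x ^+ 2 / 2) true m (j, n) - topo_power i m (j, n))) +
  dt m * work_kinetic i m n.+1.
Proof.
move=> nN cfl; have hm := ms_mac S m.
pose ps s := phf m n.+1 i s; pose w s := u m n.+1 i s.
have ps0 s : s \notin int_edges (G m) i -> ps s = 0 by exact: phf0.
have psw0 s : s \notin int_edges (G m) i -> ps s * w s = 0 by move=> sI; rewrite ps0// mul0r.
have -> : \sum_(j <- idx2 (G m)) wq (G m) j * (phf m n.+1 i (fc i j) * (kin m n.+1 i j - kin m n i j)) =
  \sum_(s <- int_edges (G m) i) ps s * (Mass m n.+1 i s * (w s ^+ 2 / 2) - Mass m n i s * (u m n i s ^+ 2 / 2)).
  under [RHS]eq_bigr do rewrite mulrBr; rewrite sumrB.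
  rewrite (sum_dual_mass (h m n.+1) (fun s => w s ^+ 2 / 2) ps0).
  rewrite (sum_dual_mass (h m n) (fun s => u m n i s ^+ 2 / 2) ps0).
  by rewrite -sumrB; apply: eq_bigr => j _; rewrite /uq /ps /w; ring.
apply: le_trans (_ : \sum_(s <- int_edges (G m) i) ps s *
  (- (dt m * econv (fun x => x ^+ 2 / 2) m n i s)
  - dt m * (w s * (wd (G m) (rev_ord i) s * (p m n.+1 s - p m n.+1 (s - evec i))))
  - dt m * (w s * (g * (edge_length (G m) i s * (centered_height (h m n.+1) i s *
      (zc m s - zc m (s - evec i))))))) <= _).
  apply: ler_sum_in => s sI; apply: ler_wpM2l; first by apply: test_ge0; exact: (level_ge0 S).
  by apply: kinetic_step => //; exact: cfl.
have dist3 (c c' X Y Z : R) :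
  c * (- (c' * X) - c' * Y - c' * Z) = - (c' * (c * X)) - c' * (c * Y) - c' * (c * Z) by ring.
under eq_bigr do rewrite dist3.
rewrite 2!sumrB sumrN -3!big_distrr /=.
have e1 : \sum_(s <- int_edges (G m) i) ps s * econv (fun x => x ^+ 2 / 2) m n i s =
    - \sum_(j <- idx2 (G m)) wq (G m) j *
      convection_array T G N h u phi i (fun x => x ^+ 2 / 2) true m (j, n).
  rewrite -(convection_level S sol i _ true tphi nN); apply: eq_bigr => s _; by rewrite addn1.
have e2 : \sum_(s <- int_edges (G m) i) ps s *
    (w s * (wd (G m) (rev_ord i) s * (p m n.+1 s - p m n.+1 (s - evec i)))) = - work_kinetic i m n.+1.
  under eq_bigr do rewrite mulrA.
  rewrite (sum_cells_by_parts hm (p m n.+1) (psi := fun s => ps s * w s)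
    (d := fun j => (ps (j.1 + evec i) * w (j.1 + evec i) - ps j.1 * w j.1) / wd (G m) i j.1))//.
  congr (- _); rewrite -(sum_cells_cst hm (fun k => p m n.+1 k *
    ((ps (k + evec i) * w (k + evec i) - ps k * w k) / wd (G m) i k))).
  apply: eq_big_seq => k kG; rewrite (area_cellE hm i) (pressure_law (sol m) nN kG).
  have w0 := wd_gt0 hm i k; rewrite /ps /w; field; by rewrite gt_eqF.
have e3 : \sum_(s <- int_edges (G m) i) ps s *
    (w s * (g * (edge_length (G m) i s * (centered_height (h m n.+1) i s *
      (zc m s - zc m (s - evec i)))))) =
    \sum_(j <- idx2 (G m)) wq (G m) j * topo_power i m (j, n).
  transitivity (g * \sum_(s <- int_edges (G m) i) ps s * w s *
    (edge_length (G m) i s * (centered_height (h m n.+1) i s * (zc m s - zc m (s - evec i))))).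
    by rewrite big_distrr; apply: eq_bigr => s _; rewrite /=; ring.
  rewrite (sum_centered hm (h m n.+1) (X := fun s => zc m s - zc m (s - evec i))
    (psi := fun s => ps s * w s) (d := fun j => topo_quotient G z zs i m (j, n)))//.
    by rewrite big_distrr; apply: eq_bigr => j _; rewrite /= mulrCA.
  by move=> j jm nG; rewrite /topo_quotient /= nG.
rewrite e1 e2 e3 !mulrN !opprK le_eqVlt; apply/orP; left; apply/eqP.
rewrite addrAC -mulrBr -sumrB; congr (_ * _ + _); apply: eq_bigr => j _.
by rewrite -mulrBr.
Qed.

(** At equal level both works involve the velocities on the faces of a cell, with [phi] at the face
    in one and at the center in the other. The difference is a quotient over half a cell, which
    produces a pressure flux in the limit. *)
Lemma work_balance i m n : work_kinetic i m n - work_potential i m n =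
  \sum_(j <- idx2 (G m)) wq (G m) j * (2^-1 * g * (hq (h m n) j * hq (h m n) j) * uq (u m n) i j *
    half_quotient T G N phi i false m (j, n)).
Proof.
have hm := ms_mac S m.
rewrite /work_kinetic /work_potential -sumrB.
pose X k b (c : bool) := press m n k * u m n i (face i b k) *
  (normal_sign b * (phf m n i (face i b k) - phc m n k) / (wd (G m) i k / 2)).
transitivity (\sum_(j <- idx2 (G m)) wq (G m) j * X j.1 (coord i j.2) (coord (rev_ord i) j.2)).
  rewrite -sum_cells_quarters; apply: eq_bigr => k _; have := wd_gt0 hm i k => w0.
  rewrite /X /normal_sign /=; field; by rewrite gt_eqF.
by apply: eq_bigr => j _; rewrite /X /half_quotient /= addn0 /hq /uq expr2.
Qed.

Lemma work_last i m : work_kinetic i m (N m) = 0.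
Proof.
rewrite /work_kinetic big1// => k _; rewrite !(level_last S _ _ tphi); ring.
Qed.

(** The shift of level telescopes, and the last kinetic work is 0 because [phi] vanishes at time
    T. *)
Lemma work_shift i m :
  \sum_(n < N m) (work_kinetic i m n.+1 - work_potential i m n) =
  \sum_(n < N m) (work_kinetic i m n - work_potential i m n) - work_kinetic i m 0.
Proof.
rewrite !sumrB addrAC; congr (_ - _).
have e : \sum_(n < N m) (work_kinetic i m n.+1 - work_kinetic i m n) = - work_kinetic i m 0.
  by rewrite -(big_mkord xpredT (fun n => work_kinetic i m n.+1 - work_kinetic i m n)) telescope_sumr// work_last sub0r.
by rewrite -e sumrB addrC subrK.
Qed.

Definition spacetime_sum m (A : ind3 -> R) : R :=
  \sum_(n < N m) dt m * (\sum_(j <- idx2 (G m)) wq (G m) j * A (j, (n : nat))).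
Local Notation II := spacetime_sum.

Lemma spacetime_sumD m A B : II m (fun q => A q + B q) = II m A + II m B.
Proof.
rewrite /II -big_split; apply: eq_bigr => n _ /=; rewrite -mulrDr -big_split; congr (_ * _).
by apply: eq_bigr => j _ /=; rewrite mulrDr.
Qed.

Lemma spacetime_sumB m A B : II m (fun q => A q - B q) = II m A - II m B.
Proof.
rewrite /II -sumrB; apply: eq_bigr => n _ /=; rewrite -mulrBr -sumrB; congr (_ * _).
by apply: eq_bigr => j _ /=; rewrite mulrBr.
Qed.

Definition work_array i m (q : ind3) : R :=
  2^-1 * g * (hq (h m q.2) q.1 * hq (h m q.2) q.1) * uq (u m q.2) i q.1 *
    half_quotient T G N phi i false m q.
Definition kinetic_array i m (q : ind3) : R := kin m q.2 i q.1 * face_dt T G N phi i m q +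
    convection_array T G N h u phi i (fun x => x ^+ 2 / 2) true m q - topo_power i m q +
    work_array i m q.
Definition potential_array m (q : ind3) : R :=
  potential_flux m q + potential m q.2.+1 q.1.1 * cell_dt T G N phi m q.
Definition entropy_array m (q : ind3) : R :=
  \sum_(i < 2) kinetic_array i m q + potential_array m q.

Definition entropy_init m (j : ind2) : R :=
  \sum_(i < 2) kin m 0 i j * phi (fpt (G m) i (fc i j), 0) + potential m 0 j.1 * phi (cpt (G m) j.1, 0).

Definition entropy_error m : R :=
  \sum_(n < N m) \sum_(k <- cells (G m)) phc m n k *
    (2^-1 * g * (area (cell (G m) k) * (h m n.+1 k - h m n k) ^+ 2)) -
  dt m * \sum_(i < 2) work_kinetic i m 0.

Lemma kinetic_balance m i :
  (forall n s, (n < N m)%N -> s \in int_edges (G m) i ->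
     dt m * (4 * (mesh_size (G m) * C ^+ 2)) <= Mass m n i s) ->
  - (II m (kinetic_array i m) +
     \sum_(j <- idx2 (G m)) wq (G m) j * (kin m 0 i j * phi (fpt (G m) i (fc i j), 0))) <=
  \sum_(n < N m) dt m * work_potential i m n - dt m * work_kinetic i m 0.
Proof.
move=> cfl.
have k1 : \sum_(n < N m) \sum_(j <- idx2 (G m)) wq (G m) j *
    (phf m n.+1 i (fc i j) * (kin m n.+1 i j - kin m n i j)) <=
    \sum_(n < N m) (dt m * (\sum_(j <- idx2 (G m)) wq (G m) j *
    (convection_array T G N h u phi i (fun x => x ^+ 2 / 2) true m (j, (n : nat)) - topo_power i m (j, (n : nat)))) +
  dt m * work_kinetic i m n.+1).
  by apply: ler_sum => n _; apply: kinetic_level => // s sI; exact: cfl.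
rewrite (@sum_levels_next m (fun n j => kin m n i j) (fun n j => phf m n i (fc i j))) in k1; last first.
  by move=> j _; exact: (level_last S _ _ tphi).
have w1 : \sum_(n < N m) dt m * work_kinetic i m n.+1 =
    \sum_(n < N m) dt m * work_potential i m n + II m (work_array i m) - dt m * work_kinetic i m 0.
  have := congr1 (fun x => dt m * x) (work_shift i m); rewrite mulrBr !big_distrr /=.
  under eq_bigr do rewrite mulrBr; under [in RHS]eq_bigr do rewrite work_balance.
  by rewrite sumrB /II /work_array /= => /eqP; rewrite subr_eq => /eqP ->; ring.
rewrite big_split /= w1 mul0r -/(II m (fun q => kin m q.2 i q.1 * face_dt T G N phi i m q))
  -/(II m (fun q => convection_array T G N h u phi i (fun x => x ^+ 2 / 2) true m q - topo_power i m q)) in k1.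
rewrite /kinetic_array spacetime_sumD spacetime_sumB spacetime_sumD.
by rewrite spacetime_sumB in k1; lra.
Qed.

(** [work_potential] has opposite signs in the potential balance and in the two kinetic balances,
    and cancels. What remains is the residual of the heights and the kinetic work at level 0. *)
Lemma entropy_balance m :
  (forall n i s, (n < N m)%N -> s \in int_edges (G m) i ->
     dt m * (4 * (mesh_size (G m) * C ^+ 2)) <= Mass m n i s) ->
  - (II m (entropy_array m) + \sum_(j <- idx2 (G m)) wq (G m) j * entropy_init m j) <= entropy_error m.
Proof.
move=> cfl.
have k1 : \sum_(n < N m) \sum_(j <- idx2 (G m)) wq (G m) j *
    (phc m n j.1 * (potential m n.+1 j.1 - potential m n j.1)) <=
  \sum_(n < N m) (dt m * (\sum_(j <- idx2 (G m)) wq (G m) j * potential_flux m (j, (n : nat))) -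
  dt m * (\sum_(i < 2) work_potential i m n) +
  \sum_(k <- cells (G m)) phc m n k * (2^-1 * g * (area (cell (G m) k) * (h m n.+1 k - h m n k) ^+ 2))).
  by apply: ler_sum => n _; exact: potential_level.
rewrite (sum_levels S (fun n j => potential m n j.1) (phi := fun n j => phc m n j.1)) in k1; last first.
  by move=> j _; exact: (level_last S _ _ tphi).
rewrite big_split sumrB /= mul0r -/(II m (fun q => potential_flux m q))
  -/(II m (fun q => potential m q.2.+1 q.1.1 * cell_dt T G N phi m q)) in k1.
have k2 := @kinetic_balance m ord0 (fun n s => cfl n ord0 s).
have k3 := @kinetic_balance m ord_max (fun n s => cfl n ord_max s).
have w : \sum_(n < N m) dt m * (\sum_(i < 2) work_potential i m n) =
    \sum_(n < N m) dt m * work_potential ord0 m n + \sum_(n < N m) dt m * work_potential ord_max m n.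
  by rewrite -big_split; apply: eq_bigr => n _; rewrite sum_ord2 mulrDr.
rewrite w in k1.
have e1 : II m (entropy_array m) = II m (kinetic_array ord0 m) + II m (kinetic_array ord_max m) + II m (potential_array m).
  rewrite -2!spacetime_sumD; apply: eq_bigr => n _; congr (_ * _); apply: eq_bigr => j _.
  by rewrite /entropy_array sum_ord2.
have e2 : \sum_(j <- idx2 (G m)) wq (G m) j * entropy_init m j =
    \sum_(j <- idx2 (G m)) wq (G m) j * (kin m 0 ord0 j * phi (fpt (G m) ord0 (fc ord0 j), 0)) +
    \sum_(j <- idx2 (G m)) wq (G m) j * (kin m 0 ord_max j * phi (fpt (G m) ord_max (fc ord_max j), 0)) +
    \sum_(j <- idx2 (G m)) wq (G m) j * (potential m 0 j.1 * phi (cpt (G m) j.1, 0)).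
  by rewrite -!big_split; apply: eq_bigr => j _; rewrite /entropy_init sum_ord2 /= !mulrDr.
rewrite e1 e2 /entropy_error sum_ord2 /potential_array spacetime_sumD; lra.
Qed.

Lemma mesh_gt0 m k : k \in cells (G m) -> 0 < mesh_size (G m).
Proof.
by move=> kG; apply: lt_le_trans (wd_le_mesh (ms_mac S m) ord0 kG); exact: (wd_gt0 (ms_mac S m)).
Qed.

Lemma cfl : \forall m \near \oo, forall n i s, (n < N m)%N -> s \in int_edges (G m) i ->
  dt m * (4 * (mesh_size (G m) * C ^+ 2)) <= Mass m n i s.
Proof.
have [K K0 hK] := mesh_le S.
(* [dual_mass_ge] bounds the mass below by [(mesh / K)^2 c0 / 2], so that
   [dt / mesh <= c0 / (8 K^2 C^2)] is the condition to reach; adding 1 to [C^2] keeps the quotient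
   defined. *)
have e0 : 0 < c0 / (8 * K ^+ 2 * (C ^+ 2 + 1)).
  by rewrite divr_gt0// !mulr_gt0 ?exprn_gt0// ltr_wpDl ?sqr_ge0.
near=> m => n i s nN sI.
have hd : dt m / mesh_size (G m) < c0 / (8 * K ^+ 2 * (C ^+ 2 + 1)) by near: m; exact: dt_mesh_small.
have := dual_mass_ge K0 (ltnW nN) sI (hK m).
have m0 : 0 < mesh_size (G m) by apply: (@mesh_gt0 m s); move: sI; rewrite mem_int_edges => /andP[].
set d := mesh_size (G m) in hd m0 * => h1.
have C1 : 0 < C ^+ 2 + 1 by rewrite ltr_wpDl ?sqr_ge0.
have K2 : 0 < K ^+ 2 by rewrite exprn_gt0.
move: hd; rewrite ltr_pdivrMr// => hd.
have h2 : dt m * (8 * K ^+ 2 * (C ^+ 2 + 1)) <= c0 * d.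
  rewrite -ler_pdivlMr ?mulr_gt0//; apply: (le_trans (ltW hd)).
  by rewrite le_eqVlt; apply/orP; left; apply/eqP; field; rewrite !gt_eqF.
have h3 : (d / K) ^+ 2 * c0 = d * (c0 * d) / K ^+ 2 by field; rewrite gt_eqF.
have h4 : dt m * (8 * (C ^+ 2 + 1)) * d <= (d / K) ^+ 2 * c0.
  rewrite h3 ler_pdivlMr//.
  have := ler_wpM2l (ltW m0) h2; lra.
have h5 : 0 <= dt m * d by rewrite mulr_ge0 ?ltW// (dt_gt0 S).
by move: h1 h4 h5; nra.
Unshelve. all: by end_near. Qed.

(** Each of the four face fluxes is at most [mesh_size] times [C^2], whereas the area of the cell is
    at least [(mesh_size / K)^2]. *)
Lemma height_variation m n k (K : R) : 0 < K -> (n < N m)%N -> k \in cells (G m) ->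
  (forall i k, k \in cells (G m) -> mesh_size (G m) <= K * wd (G m) i k) ->
  `|h m n.+1 k - h m n k| <= 4 * K ^+ 2 * C ^+ 2 * (dt m / mesh_size (G m)).
Proof.
move=> K0 nN kG hK; have [_ aA _] := cell_facts S kG; have d0 := dt_gt0 S m.
have m0 := mesh_gt0 kG.
have b i c := primal_flux_bound k i c (ltnW nN).
have e : `|area (cell (G m) k) * (h m n.+1 k - h m n k)| <= dt m * (4 * (mesh_size (G m) * C ^+ 2)).
  rewrite (mass_step S sol nN kG) normrN normrM (gtr0_norm d0) ler_pM2l// sum_ord2 !big_bool /=.
  have b1 := b ord0 true; have b2 := b ord0 false; have b3 := b ord_max true; have b4 := b ord_max false.
  apply: le_trans (ler_normD _ _) _.
  have := ler_normD (primal_flux (G m) (h m n) (u m n) k ord0 true) (primal_flux (G m) (h m n) (u m n) k ord0 false).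
  have := ler_normD (primal_flux (G m) (h m n) (u m n) k ord_max true) (primal_flux (G m) (h m n) (u m n) k ord_max false).
  lra.
rewrite normrM (gtr0_norm aA) in e.
have hA : mesh_size (G m) ^+ 2 <= K ^+ 2 * area (cell (G m) k).
  rewrite (area_cellE (ms_mac S m) ord0) expr2.
  have -> : K ^+ 2 * (wd (G m) ord0 k * wd (G m) (rev_ord ord0) k) =
    (K * wd (G m) ord0 k) * (K * wd (G m) (rev_ord ord0) k) by ring.
  by apply: ler_pM; [exact: ltW|exact: ltW|exact: hK|exact: hK].
set d := mesh_size (G m) in m0 e hA *; set V := `|_| in e *.
have V0 : 0 <= V by exact: normr_ge0.
rewrite -(ler_pM2l (exprn_gt0 2 m0)).
have -> : d ^+ 2 * (4 * K ^+ 2 * C ^+ 2 * (dt m / d)) = K ^+ 2 * (dt m * (4 * (d * C ^+ 2))).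
  by field; rewrite gt_eqF.
apply: (le_trans (ler_wpM2r V0 hA)); rewrite -mulrA ler_pM2l ?exprn_gt0//.
Qed.

Variable C2 : R.
Hypothesis BV : forall m, \sum_(n < N m) \sum_(k <- cells (G m))
  area (cell (G m) k) * `|h m n.+1 k - h m n k| <= C2.

(** The residual is covered by [height_variation] and [BV]. The kinetic work at level 0 sums face
    lengths instead of areas, hence is [O(1 / mesh_size)], and it comes multiplied by [dt m]. *)
Lemma entropy_error_le : exists D : R, forall m, entropy_error m <= D * (dt m / mesh_size (G m)).
Proof.
have [K K0 hK] := mesh_le S.
have [B B0 hB] := closure_compact3 S (smooth_continuous (proj1 tphi)).
have hcl m k n : k \in cells (G m) -> (n <= N m)%N -> `|phc m n k| <= B.
  move=> kG nN; apply: hB; last exact: (tn_T S nN).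
  exact: (closed_cell_closure S kG (cpt_closed S m k)).
have hcf m k n i b : k \in cells (G m) -> (n <= N m)%N -> `|phf m n i (face i b k)| <= B.
  move=> kG nN; apply: hB; last exact: (tn_T S nN).
  exact: (closed_cell_closure S kG (face_fpt (ms_mac S m) i b k)).
pose D1 := B * (2^-1 * g * (4 * K ^+ 2 * C ^+ 2)) * C2.
(* Three bounds are collected: the pressure by [g C^2 / 2], a difference of two values of [phi u] by
   [2 B C], and a face length by [K / mesh_size] times the area. There is one [D2] for each
   direction. *)
pose D2 := g * C ^+ 3 * B * K * fine (mu2 R Omega).
exists (D1 + (D2 + D2)) => m; rewrite /entropy_error mulrDl; apply: lerD.
  have d0 := dt_gt0 S m; have m0 := mesh_ge0 (G m).
  have q0 : 0 <= B * (2^-1 * g * (4 * K ^+ 2 * C ^+ 2)) * (dt m / mesh_size (G m)).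
    have Kg := ltW K0; have dg := ltW d0.
    by apply: mulr_ge0; [rewrite !mulr_ge0 ?invr_ge0 ?exprn_ge0|exact: divr_ge0].
  apply: le_trans (_ : B * (2^-1 * g * (4 * K ^+ 2 * C ^+ 2)) * (dt m / mesh_size (G m)) *
    (\sum_(n < N m) \sum_(k <- cells (G m)) area (cell (G m) k) * `|h m n.+1 k - h m n k|) <= _).
    rewrite big_distrr; apply: ler_sum => n _; rewrite big_distrr; apply: ler_sum_in => k kG /=.
    have [_ aA _] := cell_facts S kG; have hv := height_variation K0 (ltn_ord n) kG (hK m).
    have hp := hcl m k n kG (ltnW (ltn_ord n)).
    set V := `|_| in hv *; have V0 : 0 <= V by exact: normr_ge0.
    have -> : (h m n.+1 k - h m n k) ^+ 2 = V ^+ 2 by rewrite /V real_normK ?num_real.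
    set q := 4 * _ * _ * _ in hv.
    have -> : B * (2^-1 * g * (4 * K ^+ 2 * C ^+ 2)) * (dt m / mesh_size (G m)) * (area (cell (G m) k) * V) =
      B * (2^-1 * g * (area (cell (G m) k) * (q * V))) by rewrite /q; ring.
    apply: ler_pM; first by apply: test_ge0; exact: (level_ge0 S).
    - by have aG := ltW aA; rewrite !mulr_ge0 ?invr_ge0 ?exprn_ge0.
    - by apply: le_trans hp; exact: ler_norm.
    - by rewrite ler_wpM2l ?mulr_ge0 ?invr_ge0// ler_pM2l// expr2 ler_wpM2r.
  apply: (le_trans (ler_wpM2l q0 (BV m))).
  by rewrite /D1 le_eqVlt; apply/orP; left; apply/eqP; ring.
have hw i : - (dt m * work_kinetic i m 0) <= D2 * (dt m / mesh_size (G m)).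
  have d0 := dt_gt0 S m; have hm := ms_mac S m.
  rewrite -mulrN -sumrN.
  apply: le_trans (_ : dt m * \sum_(k <- cells (G m)) area (cell (G m) k) *
    (g * C ^+ 3 * B * K / mesh_size (G m)) <= _).
    rewrite ler_pM2l//; apply: ler_sum_in => k kG.
    have [_ aA _] := cell_facts S kG; have m0 := mesh_gt0 kG.
    rewrite (area_cellE hm i); have w1 := wd_gt0 hm i k; have w2 := wd_gt0 hm (rev_ord i) k.
    apply: le_trans (ler_norm _) _; rewrite normrN normrM (gtr0_norm w2).
    have -> : wd (G m) i k * wd (G m) (rev_ord i) k * (g * C ^+ 3 * B * K / mesh_size (G m)) =
      wd (G m) (rev_ord i) k * ((wd (G m) i k * K / mesh_size (G m)) * (g * C ^+ 3 * B)) by ring.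
    rewrite ler_pM2l//; apply: (@le_trans _ _ (1 * (g * C ^+ 3 * B))); last first.
      apply: ler_wpM2r; first by rewrite !mulr_ge0 ?exprn_ge0.
      by rewrite ler_pdivlMr// mul1r mulrC hK.
    have h1 : `|press m 0 k| <= 2^-1 * g * C ^+ 2.
      rewrite normrM ger0_norm ?mulr_ge0 ?invr_ge0// ler_wpM2l ?mulr_ge0 ?invr_ge0//.
      by rewrite normrX lerXn2r ?nnegrE// hC.
    have h2 b : `|phf m 0 i (face i b k) * u m 0 i (face i b k)| <= B * C.
      rewrite normrM; apply: ler_pM => //; first exact: hcf.
      by apply: uC => //; exact: face_edges.
    rewrite mul1r normrM.
    have h3 : `|phf m 0 i (k + evec i) * u m 0 i (k + evec i) - phf m 0 i k * u m 0 i k| <= 2 * (B * C).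
      apply: le_trans (ler_normB _ _) _; have := h2 true; have := h2 false; rewrite /=; lra.
    apply: le_trans (ler_pM _ _ h1 h3) _ => //.
    by rewrite le_eqVlt; apply/orP; left; apply/eqP; field.
  rewrite (sum_cells_cst hm (fun=> _)) -big_distrl /=.
  have -> : \sum_(j <- idx2 (G m)) wq (G m) j = fine (mu2 R Omega).
    by rewrite -(sum_wt (partitions2 S) m); apply: eq_bigr => j _; rewrite (wt2 S).
  by rewrite /D2 le_eqVlt; apply/orP; left; apply/eqP; ring.
by rewrite mulrDl sum_ord2 mulrDr opprD; apply: lerD; exact: hw.
Qed.

Let P3 := partitions3 S.
Let P2 := partitions2 S.
Let sphi : smooth phi := proj1 tphi.

Lemma cvb_half_sqr (a : nat -> ind3 -> R) f : cv3 a f ->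
  cv3 (fun m q => a m q ^+ 2 / 2) (fun y => f y ^+ 2 / 2).
Proof.
by move=> ca; apply: (cvb_ext P3 (cvbZ P3 2^-1 (cvbM P3 ca ca))) => [m q _|y _]; rewrite mulrC expr2.
Qed.

Lemma cvb_kinetic_array i : cv3 (kinetic_array i) (fun y => H y * (U i y ^+ 2 / 2) * dt_ phi y +
  (H y * U i y * (U i y ^+ 2 / 2) * dx_ i phi y +
   H y * U (rev_ord i) y * (U i y ^+ 2 / 2) * dx_ (rev_ord i) phi y) -
  g * (H y * 'D_(evec i) zs y.1 * (phi y * U i y)) +
  2^-1 * g * (H y * H y) * U i y * dx_ i phi y).
Proof.
have h1 := cvb_height0 S C0 hC h_cvg; have u1 := cvb_velocity0 S C0 uC u_cvg i.
apply: (cvbD P3); first apply: (cvbB P3); first apply: (cvbD P3).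
- apply: (cvbM P3); first by apply: (cvbM P3) => //; exact: cvb_half_sqr.
  apply: (cvb_dt_points S sphi (P := fun m q => fpt (G m) i (fc i q.1))) => m q _.
  exact: (face_fpt (ms_mac S m)).
- apply: (cvb_convection_array S C0 hC uC h_cvg u_cvg true sphi (F := fun x => x ^+ 2 / 2)).
    by apply: cvb_half_sqr; exact: (cvb_upwind_self S h C0 uC u_cvg).
  by apply: cvb_half_sqr; exact: (cvb_upwind_trans S h C0 uC u_cvg).
- apply: (cvbZ P3); apply: (cvbM P3); last first.
    apply: (cvbM P3); last exact: (cvb_velocity S C0 uC u_cvg).
    apply: (cvb_ext P3 (cvb_face_value S sphi i true)) => // m q _; by rewrite addn1.
  by apply: (cvbM P3); [exact: (cvb_mean_height S C0 hC h_cvg)|exact: (cvb_topo_quotient S szs zE)].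
- apply: (cvbM P3); last exact: (cvb_half_quotient S sphi).
  by apply: (cvbM P3) => //; apply: (cvbZ P3); exact: (cvbM P3).
Qed.

Lemma cvb_potential_array : cv3 potential_array (fun y =>
  \sum_(i < 2) (2^-1 * g * (H y * H y) * U i y * dx_ i phi y +
     g * (H y * U i y * (phi y * 'D_(evec i) zs y.1 + zs y.1 * dx_ i phi y))) +
  (2^-1 * g * H y ^+ 2 + g * zs y.1 * H y) * dt_ phi y).
Proof.
have h1 := cvb_height S C0 hC h_cvg; have z1 := cvb_topography S szs zE.
apply: (cvbD P3).
  apply: (cvb_sum P3) => i.
  have q1 := cvb_upwind_height S u C0 hC h_cvg i; have u1 := cvb_velocity0 S C0 uC u_cvg i.
  apply: (cvbD P3).
    apply: (cvbM P3); last exact: (cvb_center_quotient S sphi).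
    by apply: (cvbM P3) => //; apply: (cvbZ P3); exact: (cvbM P3).
  apply: (cvbZ P3); apply: (cvbM P3); first exact: (cvbM P3).
  apply: (cvbD P3); apply: (cvbM P3).
  - exact: (cvb_cell_value S sphi).
  - exact: (cvb_topo_quotient S szs zE).
  - exact: (cvb_shift3 S (refl_tame3 S (reflection_face S i)) z1).
  - exact: (cvb_center_quotient S sphi).
apply: (cvbM P3); last by apply: (cvb_dt_points S sphi) => m q _; exact: (cpt_closed S).
apply: (cvbD P3).
  by apply: (cvb_ext P3 (cvbZ P3 (2^-1 * g) (cvbM P3 h1 h1))) => [m q _|y _]; rewrite expr2.
by apply: (cvbM P3) => //; exact: (cvbZ P3).
Qed.

(** Convergence is that of cell averages of an integrable function; the bound is read off the
    space-time array at level 0. *)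
Lemma cvb_topography2 : cv2 (fun m j => zc m j.1) zs.
Proof.
have cz : continuous zs by exact: smooth_continuous.
have bz := bdf2 S cz; have [[B hB] _ _] := cvb_topography S szs zE.
have ca := init_height_cva S (bdf_itg P2 bz).
have ca' : cva (mu2 R) (fun m => idx2 (G m)) (fun m => quarter (G m)) (fun m j => zc m j.1) zs.
  apply: cvg_trans ca; apply: near_eq_cvg; apply: nearW => m; apply: eq_big_seq => j.
  rewrite mem_idx2 => jG; congr (Rintegral _ _ _); apply/funext => x; congr (`|_ - _|).
  rewrite /mean; congr (_ * _); apply: eq_Rintegral => y; rewrite inE => cy; apply/esym/zE.
  by apply: subset_closure; exact: (cell_sub (ms_mac S m) jG).
split => //; exists B => m j jm; apply: (hB m (j, 0%N)).
by rewrite mem_idx3 -mem_idx2 jm /=; exact: (ms_N S).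
Qed.

Lemma cvb_entropy_init : exists2 a, cv2 a (fun x =>
    \sum_(i < 2) h0c x * (u0c i x ^+ 2 / 2) * phi (x, 0) +
    (2^-1 * g * h0c x ^+ 2 + g * zs x * h0c x) * phi (x, 0)) &
  forall m j, j \in idx2 (G m) -> a m j = entropy_init m j.
Proof.
have hi := cvb_init_height S C0 hC h0_itg (fun m => init_height (sol m)).
have cphi : continuous phi by exact: smooth_continuous.
have ai i := cvb_init_velocity S C0 uC u0_itg (fun m => init_velocity (sol m)) i.
pose a i := s2val (cid2 (ai i)).
have ca i : cv2 (a i) (fun x => u0c i x) by exact: (s2valP (cid2 (ai i))).
have aE i := s2valP' (cid2 (ai i)).
exists (fun m j => \sum_(i < 2) hq (h m 0%N) j * (a i m j ^+ 2 / 2) * phi (fpt (G m) i (fc i j), 0) +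
   potential m 0 j.1 * phi (cpt (G m) j.1, 0)).
  apply: (cvbD P2).
    apply: (cvb_sum P2) => i; apply: (cvbM P2).
      apply: (cvbM P2) => //; apply: (cvb_ext P2 (cvbZ P2 2^-1 (cvbM P2 (ca i) (ca i)))) => [m q _|y _];
        by rewrite mulrC expr2.
    apply: (cvb_init_points S (P := fun m j => fpt (G m) i (fc i j))) => // m j _.
    exact: (face_fpt (ms_mac S m)).
  apply: (cvbM P2); last first.
    by apply: (cvb_init_points S (P := fun m j => cpt (G m) j.1)) => // m j _; exact: (cpt_closed S).
  apply: (cvbD P2).
    by apply: (cvb_ext P2 (cvbZ P2 (2^-1 * g) (cvbM P2 hi hi))) => [m q _|y _]; rewrite expr2.
  by apply: (cvbM P2) => //; apply: (cvbZ P2); exact: cvb_topography2.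
move=> m j jm; rewrite /entropy_init; congr (_ + _); apply: eq_bigr => i _.
have [nG|nG] := boolP (nb i j \in cells (G m)); first by rewrite /a aE.
by rewrite (test_face_zero S tphi) ?mulr0// face_int// -mem_idx2.
Qed.

Lemma entropy_limit :
  - (\int[mu3 R]_(y in cylinder Omega T)
      (\sum_(i < 2) (H y * (U i y ^+ 2 / 2) * dt_ phi y +
        (H y * U i y * (U i y ^+ 2 / 2) * dx_ i phi y +
         H y * U (rev_ord i) y * (U i y ^+ 2 / 2) * dx_ (rev_ord i) phi y) -
        g * (H y * 'D_(evec i) zs y.1 * (phi y * U i y)) +
        2^-1 * g * (H y * H y) * U i y * dx_ i phi y) +
       (\sum_(i < 2) (2^-1 * g * (H y * H y) * U i y * dx_ i phi y +
          g * (H y * U i y * (phi y * 'D_(evec i) zs y.1 + zs y.1 * dx_ i phi y))) +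
        (2^-1 * g * H y ^+ 2 + g * zs y.1 * H y) * dt_ phi y)) +
     \int[mu2 R]_(x in Omega) (\sum_(i < 2) h0c x * (u0c i x ^+ 2 / 2) * phi (x, 0) +
       (2^-1 * g * h0c x ^+ 2 + g * zs x * h0c x) * phi (x, 0))) <= 0.
Proof.
have [a ca aE] := cvb_entropy_init.
have cA := cvbD P3 (cvb_sum P3 (index_enum 'I_2) cvb_kinetic_array) cvb_potential_array.
have [D hD] := entropy_error_le.
have cD : D * (dt m / mesh_size (G m)) @[m --> \oo] --> (0 : R).
  by rewrite -[X in _ --> X](mulr0 D); apply: cvgMr; exact: dt_mesh.
(* The discrete inequality is available once the CFL condition of [cfl] holds, that is for large
   [m]. *)
apply: (pair_le cA ca cD); near=> m.
have hc : forall n i s, (n < N m)%N -> s \in int_edges (G m) i ->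
  dt m * (4 * (mesh_size (G m) * C ^+ 2)) <= Mass m n i s by near: m; exact: cfl.
apply: le_trans (hD m); apply: le_trans (entropy_balance hc).
rewrite le_eqVlt; apply/orP; left; apply/eqP; congr (- (_ + _)).
by apply: eq_big_seq => j jm; rewrite aE.
Unshelve. all: by end_near. Qed.

End entropy.

(** * Removal of the truncations *)

Section ae_equality.
Context d {X : measurableType d} {R : realType}.
Variable mu : {measure set X -> \bar R}.
Variables (D : set X) (mD : measurable D).
Local Notation mf f := (measurable_fun D f).

Lemma rint_ae (f f' : X -> R) : mf f -> mf f' -> {ae mu, forall x, D x -> f x = f' x} ->
  \int[mu]_(x in D) f x = \int[mu]_(x in D) f' x.
Proof.
move=> mf1 mf2 h; rewrite /Rintegral; congr fine; apply: ae_eq_integral => //.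
- exact/measurable_EFinP.
- exact/measurable_EFinP.
- by apply: filterS h => x hx Dx; rewrite hx.
Qed.

(** These combinators let the measurability of the long integrands below be given by explicit terms
    that follow their syntax. *)
Lemma mfun_add (f f' : X -> R) : mf f -> mf f' -> mf (fun x => f x + f' x).
Proof. exact: measurable_funD. Qed.

Lemma mfun_mul (f f' : X -> R) : mf f -> mf f' -> mf (fun x => f x * f' x).
Proof. exact: measurable_funM. Qed.

Lemma mfun_scale (c : R) (f : X -> R) : mf f -> mf (fun x => c * f x).
Proof. by move=> h; apply: mfun_mul. Qed.

Lemma mfun_opp (f : X -> R) : mf f -> mf (fun x => - f x).
Proof. by move=> h; apply: measurableT_comp h. Qed.

Lemma mfun_sum (F : 'I_2 -> X -> R) : (forall i, mf (F i)) -> mf (fun x => \sum_(i < 2) F i x).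
Proof.
move=> h; have -> : (fun x => \sum_(i < 2) F i x) = (fun x => F ord0 x + F ord_max x).
  by apply/funext => x; rewrite sum_ord2.
exact: mfun_add.
Qed.

Lemma mfun_sqr (f : X -> R) : mf f -> mf (fun x => f x ^+ 2).
Proof. by move=> h; have := mfun_mul h h. Qed.

End ae_equality.

Section conclusion.
Context {R : realType}.
Variables (Omega : set (R * R)) (T g : R) (G : nat -> grid R) (N : nat -> nat).
Hypothesis S : mesh_sequence Omega T G N.
Local Notation sp2 := (measurableTypeR R * measurableTypeR R)%type.
Local Notation sp3 := (sp2 * measurableTypeR R)%type.
Variables (z zs h0 : R * R -> R) (u0 : 'I_2 -> R * R -> R).
Variables (h p : nat -> nat -> int * int -> R) (u : nat -> nat -> 'I_2 -> int * int -> R).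
Variables (C c0 : R) (hbar : (R * R) * R -> R) (ubar : 'I_2 -> (R * R) * R -> R).
Hypothesis g0 : 0 <= g.
Hypothesis szs : smooth zs.
Hypothesis zE : forall x, closure Omega x -> z x = zs x.
Hypothesis sol : forall m, scheme_solution g z h0 u0 T (G m) (N m) (h m) (p m) (u m).
Hypothesis C0 : 0 <= C.
Hypothesis c0_gt0 : 0 < c0.
Hypothesis hc0 : forall m n k, (n <= N m)%N -> k \in cells (G m) -> c0 <= h m n k.
Hypothesis hC : forall m n k, (n <= N m)%N -> k \in cells (G m) -> `|h m n k| <= C.
Hypothesis uC : forall m n i s, (n <= N m)%N -> s \in edges (G m) i -> `|u m n i s| <= C.
Hypothesis h_cvg : cvg_L1 (cylinder Omega T)
  (fun m => height_function T (G m) (N m) (h m)) hbar.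
Hypothesis u_cvg : forall i, cvg_L1 (cylinder Omega T)
  (fun m => velocity_function T (G m) (N m) (u m) i) (ubar i).
Hypothesis h0_itg : (mu2 R).-integrable Omega (EFin \o h0).
Hypothesis u0_itg : forall i, (mu2 R).-integrable Omega (EFin \o u0 i).
Local Notation H := (limit_height C hbar).
Local Notation U := (limit_velocity C ubar).
Local Notation h0c x := (clip C (h0 x)).
Local Notation u0c i x := (clip C (u0 i x)).
Let O : set sp2 := Omega.
Let D : set sp3 := cylinder Omega T.
Local Notation mf2 f := (measurable_fun O (f : sp2 -> R)).
Local Notation mf3 f := (measurable_fun D (f : sp3 -> R)).

Let mO : measurable O. Proof. exact: measurable_Omega S. Qed.
Let mD : measurable D. Proof. exact: (part_mD (partitions3 S)). Qed.

Let mh : mf3 hbar. Proof. exact: itg_meas (proj1 h_cvg). Qed.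
Let mu i : mf3 (ubar i). Proof. exact: itg_meas (proj1 (u_cvg i)). Qed.
Let mh0 : mf2 h0. Proof. exact: itg_meas h0_itg. Qed.
Let mu0 i : mf2 (u0 i). Proof. exact: itg_meas (u0_itg i). Qed.

Let mclip d (X : measurableType d) (A : set X) (f : X -> R) : measurable A -> measurable_fun A f ->
  measurable_fun A (fun x => clip C (f x)).
Proof. by move=> mA mf; apply: measurable_maxr => //; apply: measurable_minr. Qed.

Let mH : mf3 H. Proof. exact: mclip. Qed.
Let mU i : mf3 (U i). Proof. exact: mclip. Qed.
Let mh0c : mf2 (fun x => h0c x). Proof. exact: mclip. Qed.
Let mu0c i : mf2 (fun x => u0c i x). Proof. exact: mclip. Qed.

Let mc3 (f : (R * R) * R -> R) : continuous f -> mf3 f.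
Proof. by move=> cf; apply: measurable_funTS; exact: continuous_measurable3. Qed.
Let mc2 (f : R * R -> R) : continuous f -> mf2 f.
Proof. by move=> cf; apply: measurable_funTS; exact: continuous_measurable2. Qed.

Let heq : {ae mu3 R, forall y, D y -> hbar y = H y}. Proof. exact: (height_ae S C0 hC h_cvg). Qed.
Let ueq i : {ae mu3 R, forall y, D y -> ubar i y = U i y}. Proof. exact: (velocity_ae S C0 uC u_cvg). Qed.
Let h0eq : {ae mu2 R, forall x, O x -> h0 x = h0c x}.
Proof. exact: (init_height_ae S C0 hC h0_itg (fun m => init_height (sol m))). Qed.

Let limits_ae : {ae mu3 R, forall y, D y -> hbar y = H y /\ forall i, ubar i y = U i y}.
Proof.
apply: filterS3 heq (ueq ord0) (ueq ord_max) => y e e0 e1 Dy; split; first exact: e.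
by move=> i; case: (ord2P i) => ->; [exact: e0|exact: e1].
Qed.

Let mt (phi : (R * R) * R -> R) : smooth phi -> mf3 (dt_ phi).
Proof. by move=> sphi; apply: mc3; exact: smooth_derive_continuous. Qed.
Let mx i (phi : (R * R) * R -> R) : smooth phi -> mf3 (dx_ i phi).
Proof. by move=> sphi; apply: mc3; exact: smooth_derive_continuous. Qed.
Let mphi (phi : (R * R) * R -> R) : smooth phi -> mf3 phi.
Proof. by move=> sphi; apply: mc3; exact: smooth_continuous. Qed.
Let mphi0 (phi : (R * R) * R -> R) : smooth phi -> mf2 (fun x => phi (x, 0)).
Proof. by move=> sphi; apply: mc2; apply: continuous_slice; exact: smooth_continuous. Qed.
Let mz : mf3 (fun y => zs y.1).
Proof. by apply: mc3; apply: continuous_plane; exact: smooth_continuous. Qed.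
Let mz2 : mf2 zs.
Proof. by apply: mc2; exact: smooth_continuous. Qed.
Let mdz i : mf3 (fun y => 'D_(evec i) zs y.1).
Proof.
have cD : continuous ('D_(evec i) zs) by exact: smooth_derive_continuous.
exact: mc3 (continuous_plane cD).
Qed.

Let zO x : Omega x -> z x = zs x.
Proof. by move=> Ox; apply: zE; exact: subset_closure. Qed.

(** As [Omega] is open, [z] and [zs] agree on a neighbourhood of [x], hence so do their difference
    quotients. *)
Let dzO i x : Omega x -> 'D_(evec i) z x = 'D_(evec i) zs x.
Proof.
move=> Ox; apply: near_eq_derive; near=> y; apply: zO.
by near: y; exact: (open_nbhs_nbhs (conj (ms_open S) Ox)).
Unshelve. all: by end_near. Qed.

Lemma weak_mass_limit : weak_mass Omega T h0 hbar ubar.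
Proof.
move=> phi tphi; have sphi : smooth phi by case: tphi.
rewrite -[RHS](mass_limit S sol C0 hC uC h_cvg u_cvg h0_itg tphi).
congr (_ + _); apply: rint_ae => //.
- exact: (mfun_add (mfun_mul mh (mt sphi)) (mfun_sum (fun i => mfun_mul (mfun_mul mh (mu i)) (mx i sphi)))).
- exact: (mfun_add (mfun_mul mH (mt sphi)) (mfun_sum (fun i => mfun_mul (mfun_mul mH (mU i)) (mx i sphi)))).
- by apply: filterS limits_ae => y e Dy; have [-> e'] := e Dy; under eq_bigr do rewrite e'.
- by apply: mfun_mul => //; exact: mphi0.
- by apply: mfun_mul => //; exact: mphi0.
- by apply: filterS h0eq => x e Ox; rewrite -e.
Qed.

Let momentum_integrand i (phi : (R * R) * R -> R) y : R := H y * U i y * dt_ phi y +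
     (H y * U i y * U i y * dx_ i phi y + H y * U (rev_ord i) y * U i y * dx_ (rev_ord i) phi y) +
     2^-1 * g * (H y * H y) * dx_ i phi y - g * (H y * 'D_(evec i) zs y.1 * phi y).

Let bH : bdf D (H : sp3 -> R).
Proof. by split => //; exists C => y _; exact: clip_bnd. Qed.
Let bU i : bdf D (U i : sp3 -> R).
Proof. by split => //; exists C => y _; exact: clip_bnd. Qed.
Let bc (f : (R * R) * R -> R) : continuous f -> bdf D (f : sp3 -> R).
Proof. by move=> cf; exact: (bdf3 S cf). Qed.

Let momentum_itg i (phi : (R * R) * R -> R) : smooth phi -> (mu3 R).-integrable D (EFin \o momentum_integrand i phi).
Proof.
move=> sphi; have P3 := partitions3 S; apply: (bdf_itg P3).
have bt : bdf D (dt_ phi : sp3 -> R) by apply: bc; exact: smooth_derive_continuous.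
have bx j : bdf D (dx_ j phi : sp3 -> R) by apply: bc; exact: smooth_derive_continuous.
have bp : bdf D (phi : sp3 -> R) by apply: bc; exact: smooth_continuous.
have bz : bdf D ((fun y => 'D_(evec i) zs y.1) : sp3 -> R).
  have cD : continuous ('D_(evec i) zs) by exact: smooth_derive_continuous.
  exact: bc (continuous_plane cD).
have bs c (f : sp3 -> R) : bdf D f -> bdf D (fun y => c * f y).
  by move=> bf; apply: bdfM => //; split; [exact: measurable_cst|exists `|c|].
have bn (f : sp3 -> R) : bdf D f -> bdf D (fun y => - f y).
  move=> bf; have -> : (fun y => - f y) = (fun y => -1 * f y) by apply/funext => y; rewrite mulN1r.
  exact: bs.
exact: (bdfD (bdfD (bdfD (bdfM (bdfM bH (bU i)) bt)
  (bdfD (bdfM (bdfM (bdfM bH (bU i)) (bU i)) (bx i))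
        (bdfM (bdfM (bdfM bH (bU (rev_ord i))) (bU i)) (bx (rev_ord i)))))
  (bdfM (bs (2^-1 * g) _ (bdfM bH bH)) (bx i))) (bn _ (bs g _ (bdfM (bdfM bH bz) bp)))).
Qed.

Lemma weak_momentum_limit : weak_momentum Omega T g z h0 u0 hbar ubar.
Proof.
move=> phi tphi; have sphi i : smooth (phi i) by case: (tphi i).
have lim i := momentum_limit S szs zE sol C0 hC uC h_cvg u_cvg h0_itg u0_itg i (tphi i).
have e1 : \int[mu3 R]_(y in cylinder Omega T)
        (\sum_(i < 2) hbar y * ubar i y * dt_ (phi i) y
         + \sum_(i < 2) \sum_(j < 2) hbar y * ubar i y * ubar j y * dx_ j (phi i) y
         + 2^-1 * g * hbar y ^+ 2 * (\sum_(i < 2) dx_ i (phi i) y)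
         - g * hbar y * (\sum_(i < 2) 'D_(evec i) z y.1 * phi i y)) =
    \sum_(i < 2) \int[mu3 R]_(y in cylinder Omega T) momentum_integrand i (phi i) y.
  rewrite -rint_sum//; last by move=> i; exact: momentum_itg.
  transitivity (\int[mu3 R]_(y in cylinder Omega T)
        (\sum_(i < 2) hbar y * ubar i y * dt_ (phi i) y
         + \sum_(i < 2) \sum_(j < 2) hbar y * ubar i y * ubar j y * dx_ j (phi i) y
         + 2^-1 * g * hbar y ^+ 2 * (\sum_(i < 2) dx_ i (phi i) y)
         - g * hbar y * (\sum_(i < 2) 'D_(evec i) zs y.1 * phi i y))).
    apply: eq_Rintegral => y; rewrite inE => -[Oy _].
    by congr (_ - _ * _); apply: eq_bigr => i _; rewrite dzO.
  apply: rint_ae => //.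
  - exact: (mfun_add (mfun_add (mfun_add
      (mfun_sum (fun i => mfun_mul (mfun_mul mh (mu i)) (mt (sphi i))))
      (mfun_sum (fun i => mfun_sum (fun j => mfun_mul (mfun_mul (mfun_mul mh (mu i)) (mu j)) (mx j (sphi i))))))
      (mfun_mul (mfun_scale (2^-1 * g) (mfun_sqr mh)) (mfun_sum (fun i => mx i (sphi i)))))
      (mfun_opp (mfun_mul (mfun_scale g mh) (mfun_sum (fun i => mfun_mul (mdz i) (mphi (sphi i))))))).
  - apply: mfun_sum => i; exact: itg_meas (momentum_itg i (sphi i)).
  apply: filterS limits_ae => y e Dy; have [-> e'] := e Dy.
  rewrite !sum_ord2 !e' /momentum_integrand rev0 revM.
  move: (dx_ ord0 (phi ord0) y) (dx_ ord_max (phi ord0) y) (dx_ ord0 (phi ord_max) y)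
    (dx_ ord_max (phi ord_max) y) (dt_ (phi ord0) y) (dt_ (phi ord_max) y)
    ('D_(evec ord0) zs y.1) ('D_(evec ord_max) zs y.1) (H y) (U ord0 y) (U ord_max y).
  by move=> *; ring.
have e2 : \int[mu2 R]_(x in Omega) (h0 x * \sum_(i < 2) u0 i x * phi i (x, 0)) =
    \sum_(i < 2) \int[mu2 R]_(x in Omega) (h0c x * u0c i x * phi i (x, 0)).
  rewrite -rint_sum//; last first.
    move=> i; have P2 := partitions2 S; apply: (bdf_itg P2).
    have bcl (f : sp2 -> R) : mf2 f -> bdf O (fun x => clip C (f x)).
      by move=> mf; split; [exact: mclip|exists C => x _; exact: clip_bnd].
    apply: bdfM; first by apply: bdfM; exact: bcl.
    by apply: (bdf2 S); apply: continuous_slice; exact: smooth_continuous.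
  apply: rint_ae => //.
  - exact: (mfun_mul mh0 (mfun_sum (fun i => mfun_mul (mu0 i) (mphi0 (sphi i))))).
  - exact: (mfun_sum (fun i => mfun_mul (mfun_mul mh0c (mu0c i)) (mphi0 (sphi i)))).
  have v i := init_velocity_ae S C0 uC u0_itg (fun m => init_velocity (sol m)) i (tphi i).
  apply: filterS3 h0eq (v ord0) (v ord_max) => x e v0 v1 Ox.
  rewrite -e// big_distrr; apply: eq_bigr => i _ /=; rewrite -mulrA; congr (_ * _).
  (* [init_velocity_ae] gives information on [u0] only where the test function is nonzero; elsewhere
     both sides are 0. *)
  have [->|p0] := eqVneq (phi i (x, 0)) 0; first by rewrite !mulr0.
  by congr (_ * _); move: p0; case: (ord2P i) => -> p0; [exact: v0|exact: v1].
rewrite e1 e2 -opprD -big_split big1 ?oppr0// => i _; exact: lim.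
Qed.

Section entropy_conclusion.
Hypothesis dt_mesh : T / (N m)%:R / mesh_size (G m) @[m --> \oo] --> (0 : R).
Variable C2 : R.
Hypothesis BV : forall m, \sum_(n < N m) \sum_(k <- cells (G m))
  area (cell (G m) k) * `|h m n.+1 k - h m n k| <= C2.

Lemma entropy_inequality_limit : entropy_inequality Omega T g z h0 u0 hbar ubar.
Proof.
move=> phi tphi phi_ge0; have sphi : smooth phi by case: tphi.
apply: le_trans (entropy_limit S g0 szs zE sol C0 c0_gt0 hc0 hC uC h_cvg u_cvg h0_itg u0_itg
  dt_mesh tphi phi_ge0 BV).
rewrite le_eqVlt; apply/orP; left; apply/eqP; rewrite -opprD; congr (- (_ + _)).
  transitivity (\int[mu3 R]_(y in cylinder Omega T)
      (entropy g (zs y.1) (hbar y) (ubar ^~ y) * dt_ phi y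
         + \sum_(i < 2)
             entropy_flux g (zs y.1) (hbar y) (ubar ^~ y) i * dx_ i phi y)).
    by apply: eq_Rintegral => y; rewrite inE => -[Oy _]; rewrite zO.
  apply: rint_ae => //.
  - have mE := mfun_add (mfun_add (mfun_mul (mfun_scale 2^-1 mh) (mfun_sum (fun i => mfun_sqr (mu i))))
      (mfun_scale (2^-1 * g) (mfun_sqr mh))) (mfun_mul (mfun_scale g mh) mz).
    exact: (mfun_add (mfun_mul mE (mt sphi)) (mfun_sum (fun i => mfun_mul (mfun_mul
      (mfun_add mE (mfun_scale (2^-1 * g) (mfun_sqr mh))) (mu i)) (mx i sphi)))).
  - have mh2 i := mfun_mul (mfun_sqr (mU i)) (measurable_cst (2^-1 : R)).
    have mp := mfun_scale (2^-1 * g) (mfun_mul mH mH).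
    have mK i := mfun_add (mfun_add (mfun_add (mfun_mul (mfun_mul mH (mh2 i)) (mt sphi))
      (mfun_add (mfun_mul (mfun_mul (mfun_mul mH (mU i)) (mh2 i)) (mx i sphi))
        (mfun_mul (mfun_mul (mfun_mul mH (mU (rev_ord i))) (mh2 i)) (mx (rev_ord i) sphi))))
      (mfun_opp (mfun_scale g (mfun_mul (mfun_mul mH (mdz i)) (mfun_mul (mphi sphi) (mU i))))))
      (mfun_mul (mfun_mul mp (mU i)) (mx i sphi)).
    have mP i := mfun_add (mfun_mul (mfun_mul mp (mU i)) (mx i sphi)) (mfun_scale g
      (mfun_mul (mfun_mul mH (mU i)) (mfun_add (mfun_mul (mphi sphi) (mdz i)) (mfun_mul mz (mx i sphi))))).
    exact: (mfun_add (mfun_sum mK) (mfun_add (mfun_sum mP)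
      (mfun_mul (mfun_add (mfun_scale (2^-1 * g) (mfun_sqr mH)) (mfun_mul (mfun_scale g mz) mH)) (mt sphi)))).
  apply: filterS limits_ae => y e Dy; have [-> e'] := e Dy.
  (* The work of the topography cancels between the two balances. The pressure flux occurs once in
     each, and the two occurrences give the [g h^2] of the entropy flux. *)
  rewrite /entropy_flux /entropy !sum_ord2 !e' rev0 revM.
  move: (dx_ ord0 phi y) (dx_ ord_max phi y) (dt_ phi y) ('D_(evec ord0) zs y.1)
    ('D_(evec ord_max) zs y.1) (H y) (U ord0 y) (U ord_max y).
  by move=> *; field.
transitivity (\int[mu2 R]_(x in Omega) (entropy g (zs x) (h0 x) (u0 ^~ x) * phi (x, 0))).
  by apply: eq_Rintegral => x; rewrite inE => Ox; rewrite zO.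
apply: rint_ae => //.
- exact: (mfun_mul (mfun_add (mfun_add (mfun_mul (mfun_scale 2^-1 mh0) (mfun_sum (fun i => mfun_sqr (mu0 i))))
    (mfun_scale (2^-1 * g) (mfun_sqr mh0))) (mfun_mul (mfun_scale g mh0) mz2)) (mphi0 sphi)).
- have mh2 i := mfun_mul (mfun_sqr (mu0c i)) (measurable_cst (2^-1 : R)).
  exact: (mfun_add (mfun_sum (fun i => mfun_mul (mfun_mul mh0c (mh2 i)) (mphi0 sphi)))
    (mfun_mul (mfun_add (mfun_scale (2^-1 * g) (mfun_sqr mh0c)) (mfun_mul (mfun_scale g mz2) mh0c)) (mphi0 sphi))).
have v i := init_velocity_ae S C0 uC u0_itg (fun m => init_velocity (sol m)) i tphi.
apply: filterS3 h0eq (v ord0) (v ord_max) => x e e0 e1 Ox.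
rewrite -e// /entropy !sum_ord2.
have [->|p0] := eqVneq (phi (x, 0)) 0; first by rewrite !mulr0 !addr0.
by rewrite -e0// -e1//; field.
Qed.

End entropy_conclusion.

End conclusion.

Unset Implicit Arguments.
Set Strict Implicit.
Set Printing Implicit Defensive.

Theorem theorem1 (R : realType) (Omega : set (R * R)) (T g : R)
    (z h0 : R * R -> R) (u0 : 'I_2 -> R * R -> R)
    (Omega_open : open Omega) (Omega_bounded : bounded_set Omega)
    (Omega_connected : connected Omega)
    (Omega_rect : union_of_rectangles Omega)
    (T_gt0 : 0 < T) (g_gt0 : 0 < g)
    (z_smooth : smooth_on_closure Omega z)
    (h0_L2 : square_integrable Omega h0)
    (u0_L1 : forall i, (mu2 R).-integrable Omega (EFin \o u0 i))
    (G : nat -> grid R) (N : nat -> nat)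
    (h p : nat -> nat -> int * int -> R)
    (u : nat -> nat -> 'I_2 -> int * int -> R)
    (G_mac : forall m, mac_grid Omega (G m))
    (N_gt0 : forall m, (0 < N m)%N)
    (dt_cvg0 : T / (N m)%:R @[m --> \oo] --> (0 : R))
    (mesh_cvg0 : mesh_size (G m) @[m --> \oo] --> (0 : R))
    (mesh_regular : exists2 eta : R, 0 < eta &
      forall m, mesh_regularity (G m) <= eta)
    (sol : forall m,
      scheme_solution g z h0 u0 T (G m) (N m) (h m) (p m) (u m))
    (bounds : exists C C' : R, [/\ 0 < C, 0 < C' &
      forall m n, (n <= N m)%N ->
        (forall k, k \in cells (G m) ->
          (C^-1 < h m n k <= C) /\ (C'^-1 < (h m n k)^-1 <= C')) /\
        (forall i s, s \in edges (G m) i -> `|u m n i s| <= C)])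
    (hbar : (R * R) * R -> R) (ubar : 'I_2 -> (R * R) * R -> R)
    (h_cvg : cvg_L1 (cylinder Omega T)
      (fun m => height_function T (G m) (N m) (h m)) hbar)
    (u_cvg : forall i, cvg_L1 (cylinder Omega T)
      (fun m => velocity_function T (G m) (N m) (u m) i) (ubar i)) :
  (weak_mass Omega T h0 hbar ubar /\
   weak_momentum Omega T g z h0 u0 hbar ubar) /\
  ((T / (N m)%:R) / mesh_size (G m) @[m --> \oo] --> (0 : R) ->
   (exists C'' : R, forall m,
     \sum_(n < N m) \sum_(k <- cells (G m))
       area (cell (G m) k) * `|h m n.+1 k - h m n k| <= C'') ->
   entropy_inequality Omega T g z h0 u0 hbar ubar).
Proof.
have S : mesh_sequence Omega T G N by split.
have [zs szs zE] := z_smooth; have [C [C' [Cpos _ hb]]] := bounds.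
have C0 := ltW Cpos; have c0 : 0 < C^-1 by rewrite invr_gt0.
have hlow m n k : (n <= N m)%N -> k \in cells (G m) -> C^-1 <= h m n k.
  by move=> nN kG; have [/(_ k kG)[/andP[/ltW]]] := hb m n nN.
have hC m n k : (n <= N m)%N -> k \in cells (G m) -> `|h m n k| <= C.
  move=> nN kG; have h1 := hlow m n k nN kG; have [/(_ k kG)[/andP[_ h2] _] _] := hb m n nN.
  by rewrite ger0_norm// (le_trans _ h1)// ltW.
have uC m n i s : (n <= N m)%N -> s \in edges (G m) i -> `|u m n i s| <= C.
  by move=> nN; have [_] := hb m n nN; exact.
(* [|x| <= 1 + x^2], and constants are integrable on [Omega], which has finite measure. *)
have h0_L1 : (mu2 R).-integrable Omega (EFin \o h0).
  have [mh0 ih0] := h0_L2; have mO := measurable_Omega S.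
  apply: (itg_dom mO (g := fun x => 1 + h0 x ^+ 2)) => //.
    apply: itgD => //; apply: (itg_bnd mO (M := 1)) => //; first exact: fin_Omega S.
    by move=> x _; rewrite normr1.
  by move=> x _; rewrite -real_normK ?num_real//; have := sqr_ge0 (`|h0 x| - 1); nra.
split; first split.
- move=> phi; exact: (weak_mass_limit S sol C0 hC uC h_cvg u_cvg h0_L1).
- move=> phi; exact: (weak_momentum_limit S szs zE sol C0 hC uC h_cvg u_cvg h0_L1 u0_L1).
- move=> dt_mesh [C2 BV].
  move=> phi; exact: (entropy_inequality_limit S (ltW g_gt0) szs zE sol C0 c0 hlow hC uC h_cvg u_cvg h0_L1 u0_L1 dt_mesh BV).
Qed.
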